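(* Define $\mu:(\tfrac12,\infty)\to\mathbb{R}$ by $$\mu(\lambda)=\frac{1}{4\lambda^2}\sum_{r=1}^{\infty}\frac{r^{r-2}}{r!}\left(2\lambda e^{-2\lambda}\right)^r+\frac12\left(1-\frac1\lambda\right).$$ Then $\mu$ is strictly positive, monotonically increasing and continuous, and satisfies $\mu(\lambda)\to 0$ as $\lambda\to\frac12$ and $\mu(\lambda)\to\frac12$ as $\lambda\to\infty$. Moreover, if $\lambda>\frac12$ is a fixed constant and $m=m(n)\sim\lambda n$, then with high probability $$g(n,m)=(1+o(1))\,\mu(\lambda)\,m.$$
   Context: $G(n,m)$ denotes a graph chosen uniformly at random from all labelled graphs on vertex set $[n]$ with exactly $m$ edges ($m=m(n)\ge0$ an integer), and $g(n,m)$ is its genus (minimum number of handles attached to a sphere needed to embed the graph without crossings). ''With high probability'' (whp) means with probability tending to $1$ as $n\to\infty$. $a(n)\sim b(n)$ means $a(n)/b(n)\to1$. The statement $X=(1+o(1))b$ whp means: for every constant $\epsilon>0$, $|X-b|\le \epsilon b$ whp. *)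

(* Defs.v *)
From HB Require Import structures.
From mathcomp Require Import all_boot all_order all_algebra.
From mathcomp Require Import all_classical all_reals all_analysis.
Set Implicit Arguments.
Unset Strict Implicit.
Unset Printing Implicit Defensive.
Import Order.TTheory GRing.Theory Num.Theory.
Import numFieldNormedType.Exports.
Local Open Scope classical_set_scope.
Local Open Scope ring_scope.

(** A sphere with [g] handles, as a polyhedral surface in R^3.

    The sphere is the surface of the box [0, 2g+1] x [0, 3] x [0, 1]. The i-th
    handle (i < g) is attached by removing from the sphere the two open squares
    ]2i+1, 2i+2[ x ]1, 2[ in the planes z = 0 and z = 1, and joining their two
    boundaries by a tube, the product of the boundary of the square with
    [0, 1]. The tubes are pairwise disjoint and run through the inside of the
    box, so the result is a closed connected orientable surface. *)
Definition box_sphere (R : realType) (g : nat) : set (R * R * R) :=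
  [set p | let: (x, y, z) := p in
     [/\ 0 <= x <= (2 * g + 1)%:R, 0 <= y <= 3, 0 <= z <= 1 &
         [\/ x = 0 \/ x = (2 * g + 1)%:R, y = 0 \/ y = 3 | z = 0 \/ z = 1]]].

Definition handle_mouths (R : realType) (i : nat) : set (R * R * R) :=
  [set p | let: (x, y, z) := p in
     [/\ (2 * i + 1)%:R < x < (2 * i + 2)%:R, 1 < y < 2 & z = 0 \/ z = 1]].

Definition handle_tube (R : realType) (i : nat) : set (R * R * R) :=
  [set p | let: (x, y, z) := p in
     [/\ (2 * i + 1)%:R <= x <= (2 * i + 2)%:R, 1 <= y <= 2, 0 <= z <= 1 &
         (x = (2 * i + 1)%:R \/ x = (2 * i + 2)%:R) \/ (y = 1 \/ y = 2)]].

Definition sphere_with_handles (R : realType) (g : nat) : set (R * R * R) :=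
  (box_sphere g `\` \bigcup_(i in `I_g) handle_mouths i)
    `|` \bigcup_(i in `I_g) handle_tube i.

(** A graph on the vertex set ['I_n] is given by its set of edges, which are
    two-element sets of vertices. *)
Definition graphs (n m : nat) : {set {set {set 'I_n}}} :=
  [set E : {set {set 'I_n}} | [forall e in E, #|e| == 2%N] && (#|E| == m)]%SET.

(** A drawing without crossings of the graph [E] on [S]: distinct vertices are
    distinct points, each edge is a simple arc joining its two ends, and the
    interior of the arc meets no vertex and no other edge. *)
Definition drawing (R : realType) (n : nat) (E : {set {set 'I_n}})
    (S : set (R * R * R))
    (pos : 'I_n -> R * R * R) (arc : {set 'I_n} -> R -> R * R * R) : Prop :=
  [/\ injective pos /\ (forall v, S (pos v)),
      forall e, e \in E ->
        [/\ {within `[0, 1], continuous (arc e)},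
            {in `[0, 1] &, injective (arc e)},
            forall t : R, t \in `[0, 1] -> S (arc e t) &
            exists u v, [/\ e = [set u; v]%SET, arc e 0 = pos u
                          & arc e 1 = pos v]],
      forall e v (t : R), e \in E -> t \in `]0, 1[ -> arc e t <> pos v &
      forall e f (s t : R), e \in E -> f \in E -> e <> f ->
        s \in `]0, 1[ -> t \in `]0, 1[ -> arc e s <> arc f t].

Definition embeddable (R : realType) (n : nat) (E : {set {set 'I_n}})
    (S : set (R * R * R)) : Prop :=
  exists pos arc, drawing E S pos arc.

(** The default value 0 is never used: every finite graph is embeddable in a
    sphere with sufficiently many handles. *)
Definition genus (R : realType) (n : nat) (E : {set {set 'I_n}}) : nat :=
  xget 0%N [set g : nat | embeddable E (@sphere_with_handles R g) /\
    forall h : nat, embeddable E (@sphere_with_handles R h) -> (g <= h)%N].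

(** Probability of the property [P] of G(n, m). It is 0 by convention when
    [m > 'C(n, 2)], in which case there is no graph to choose from. *)
Definition prob_gnm (R : realType) (n m : nat) (P : {set {set 'I_n}} -> Prop)
    : R :=
  #|[set E in graphs n m | `[< P E >]]%SET|%:R / #|graphs n m|%:R.

Definition whp_gnm (R : realType) (m : nat -> nat)
    (P : forall n : nat, {set {set 'I_n}} -> Prop) : Prop :=
  (fun n => prob_gnm R (m n) (P n)) @ \oo --> (1 : R).

Definition asymp_equiv (R : realType) (a b : nat -> R) : Prop :=
  (fun n => a n / b n) @ \oo --> (1 : R).

(** For r = 1 the truncated exponent [r - 2] is 0 instead of -1, which is
    harmless since the base is 1. *)
Definition mu (R : realType) (l : R) : R :=
  (4 * l ^+ 2)^-1 *
    limn (fun N : nat => \sum_(1 <= r < N)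
            (r ^ (r - 2))%N%:R / (r`!)%N%:R * (2 * l * expR (- (2 * l))) ^+ r)
  + 2^-1 * (1 - l^-1).

(* Main.v *)
(** For a graph with n vertices, m edges and kappa components, let
    beta = m - n + kappa be the dimension of its cycle space. The genus is at
    most about beta / 2: sweeping the surface from left to right one draws a
    spanning forest and closes the remaining edges by chords, each handle taking
    care of two interleaved chords. Conversely, a drawing on a sphere with g
    handles makes the graph a minor of a fine cubical subdivision of the surface;
    over F_2 the faces generate the cycle space up to codimension 2g, so beta is
    at most 2g plus the number of faces that are nonzero cycles of the graph, and
    no edge lies on more than two of them. In G(n, m) with m ~ lambda n there are
    O(1) short cycles on average, so nearly all these cycles are long, their
    number is o(n), and the genus is beta / 2 + o(n).

    Up to o(n), kappa counts the tree components of bounded size. By Cayley's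
    formula and a second moment computation, kappa / n tends to f(x) / c with
    c = 2 lambda, x = c e^(-c) and f(x) = sum_r r^(r-2) x^r / r!, which gives
    mu. For the analytic properties, the tree function T = x f' satisfies
    f = T - T^2 / 2 (a convolution identity for forests), hence T e^(-T) = x with
    T < 1 < c, mu = ((c - 1)^2 - (1 - T)^2) / (2 c^2), and
    d mu / d lambda = (c - T) (1 - T) / (4 lambda^3). *)

(* The genus is defined through continuous arcs on a polyhedron, so both bounds have to be reduced
   to finite data. For the lower bound, neither the complement of the drawing nor Euler's formula
   for it is used. The only homology is that of the cubical surface: connectedness of its vertices
   and of its faces, with one alternating count, controls two ranks over ['F_2]. A minor inherits
   the estimate, because deleting mesh edges merges faces and contracting branch sets sends cycles
   to cycles. Branch sets come from cutting each arc into thirds: thirds that must not meet are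
   disjoint compact sets, so a fine mesh tells them apart. For the upper bound, a section of the box
   is cut open to an interval, and only the order of the strands on it matters. Heights can thus be
   normalised before each handle, and a single explicit picture with fixed rational heights serves
   for all handles. One chord may be left over at the end, which is why a cycle rank of 2g + 1 is
   still allowed. *)
Require Import Defs.
From HB Require Import structures.
From mathcomp Require Import all_boot all_order all_algebra.
From mathcomp Require Import zify.
Set Implicit Arguments.
Unset Strict Implicit.
Unset Printing Implicit Defensive.
Import Order.TTheory GRing.Theory Num.Theory.

Local Open Scope ring_scope.

(** * The cycle space of a minor *)

Section Components.
Variable T : finType.
Implicit Types (E : {set {set T}}) (u v : T).

Definition adj E : rel T := [rel u v | [set u; v] \in E].

Lemma adj_sym E : symmetric (adj E).
Proof. by move=> u v; rewrite /adj /= setUC. Qed.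

Lemma adj_connect_sym E : connect_sym (adj E).
Proof. by apply: sym_connect_sym; exact: adj_sym. Qed.

Definition kappa E := #|[set r | roots (adj E) r]|.

End Components.

(** * Linear algebra over the field with two elements *)

Section BinaryVectors.
Local Notation F2 := 'F_2.

Lemma addF2 (x : F2) : x + x = 0.
Proof. by case: x => [[|[|]]] // i; apply: val_inj. Qed.

Lemma natF2 k : (k%:R : F2) = (odd k)%:R.
Proof.
elim: k => // k IH; rewrite mulrS IH /=.
by case: (odd k); [exact: addF2|exact: addr0].
Qed.

Lemma boolF2_inj (b c : bool) : (b%:R : F2) = c%:R -> b = c.
Proof. by case: b; case: c => // /eqP; rewrite ?oner_eq0 // eq_sym oner_eq0. Qed.

Lemma F2E (x : F2) : x = (x != 0)%:R.
Proof. by case: x => [[|[|]]] // i; apply: val_inj. Qed.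

(** Chains are plain functions on finite types; [frow] and [fmx] pass to matrices over ordinals only
    where a rank is needed. *)
Definition frow (A : finType) (f : A -> F2) : 'rV[F2]_#|A| := \row_j f (enum_val j).
Definition fmx (A B : finType) (M : A -> B -> F2) : 'M[F2]_(#|A|, #|B|) :=
  \matrix_(i, j) M (enum_val i) (enum_val j).

Lemma frow_mul (A B : finType) (f : A -> F2) (M : A -> B -> F2) :
  frow f *m fmx M = frow (fun b => \sum_a f a * M a b).
Proof.
apply/rowP => j; rewrite !mxE (reindex (@enum_rank A)) /=; last first.
  by apply: onW_bij; exact: enum_rank_bij.
by apply: eq_bigr => a _; rewrite !mxE enum_rankK.
Qed.

Lemma frowK (A : finType) (v : 'rV[F2]_#|A|) : v = frow (fun a => v 0 (enum_rank a)).
Proof. by apply/rowP => j; rewrite mxE enum_valK. Qed.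

Lemma frow_eq (A : finType) (f h : A -> F2) : frow f = frow h <-> f =1 h.
Proof.
split=> [/rowP E a|E]; last by apply/rowP => j; rewrite !mxE E.
by have := E (enum_rank a); rewrite !mxE enum_rankK.
Qed.

Lemma frow0 (A : finType) (f : A -> F2) : frow f = 0 <-> forall a, f a = 0.
Proof.
have -> : (0 : 'rV[F2]_#|A|) = frow (fun _ : A => 0 : F2) by apply/rowP => j; rewrite !mxE.
exact: frow_eq.
Qed.

Lemma fmxM (A B C : finType) (M : A -> B -> F2) (M' : B -> C -> F2) :
  fmx M *m fmx M' = fmx (fun a c => \sum_b M a b * M' b c).
Proof.
apply/matrixP => i j; rewrite !mxE (reindex (@enum_rank B)) /=; last first.
  by apply: onW_bij; exact: enum_rank_bij.
by apply: eq_bigr => a _; rewrite !mxE enum_rankK.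
Qed.

Lemma row_sub_all (A : finType) m (M : 'M[F2]_(m, #|A|)) k (N : 'M[F2]_(k, #|A|)) :
  (forall f : A -> F2, (frow f <= M)%MS -> (frow f <= N)%MS) -> (M <= N)%MS.
Proof. by move=> H; apply/row_subP => i; rewrite (frowK (row i M)) H // -frowK row_sub. Qed.

(** By hypothesis the left kernel of [fmx M] contains only constant vectors, so its dimension is at
    most 1. It is applied to the vertices and to the faces of the surface. *)
Lemma rank_kermx_connected (A B : finType) (M : A -> B -> F2) :
  (forall f : A -> F2, (forall b, \sum_a f a * M a b = 0) -> forall a a', f a = f a') ->
  (#|A| <= (\rank (fmx M)).+1)%N.
Proof.
move=> H; have : (\rank (kermx (fmx M)) <= 1)%N.
  apply: leq_trans (rank_leq_row (frow (fun _ : A => 1 : F2))).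
  apply: mxrankS; apply: row_sub_all => f /sub_kermxP; rewrite frow_mul => /frow0 f0.
  have c := H f f0; case: (pickP A) => [a0 _|A0].
    rewrite (_ : frow f = f a0 *: frow (fun=> 1)); last first.
      by apply/rowP => j; rewrite !mxE mulr1; exact: c.
    exact: scalemx_sub.
  rewrite (_ : frow f = 0) ?sub0mx //; apply/frow0 => a.
  by have := A0 a.
by rewrite mxrank_ker leq_subLR addn1.
Qed.

Lemma sum_pair (A : finType) (a b : A) (P : pred A) : a != b ->
  \sum_(c | P c) (c \in [set a; b])%:R = (P a)%:R + (P b)%:R :> F2.
Proof.
move=> ab; under eq_bigr => c _ do rewrite !inE.
rewrite (eq_bigr (fun c => (c == a)%:R + (c == b)%:R)); last first.
  by move=> c _; have [->|] := eqVneq c a; rewrite ?(negbTE ab) ?addr0 // add0r.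
have one (d : A) : \sum_(c | P c) (c == d)%:R = (P d)%:R :> F2.
  rewrite big_mkcond /= (bigD1 d) //= eqxx big1 => [|c /negbTE->]; last by case: (P c).
  by rewrite addr0; case: (P d).
by rewrite big_split /= !one.
Qed.

End BinaryVectors.

Local Notation F2 := 'F_2.

Section CycleSpace.
Variables (T : finType) (E : {set {set T}}).
Hypothesis E2 : forall e, e \in E -> #|e| = 2%N.
Local Notation GE := {e : {set T} | e \in E}.

Definition graph_inc (e : GE) (v : T) : F2 := (v \in val e)%:R.

(** The indicator vectors of the components are independent, and they annihilate the vertex-edge
    incidence matrix because both ends of an edge lie in one component. *)
Lemma rank_graph_inc : (\rank (fmx graph_inc) + kappa E <= #|T|)%N.
Proof.
pose M (v : T) (e : GE) : F2 := (v \in val e)%:R.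
have -> : fmx graph_inc = (fmx M)^T by apply/matrixP => i j; rewrite !mxE.
rewrite mxrank_tr.
pose rt := {r : T | roots (adj E) r}.
pose K (r : rt) (v : T) : F2 := (fingraph.root (adj E) v == val r)%:R.
have KM : fmx K *m fmx M = 0.
  rewrite fmxM; apply/matrixP => i j; rewrite !mxE.
  move: (enum_val i) (enum_val j) => r [e eE] /=.
  have /eqP/cards2P[u [v [uv eUV]]] := E2 eE.
  rewrite (eq_bigr (fun w => if fingraph.root (adj E) w == val r then (w \in [set u; v])%:R else 0 : F2)).
    rewrite -big_mkcond /= sum_pair //.
    have -> : fingraph.root (adj E) u = fingraph.root (adj E) v.
      by apply/(fingraph.rootP (adj_connect_sym E))/connect1; rewrite /adj /= -eUV.
    exact: addF2.
  by move=> w _; rewrite /K /M /= eUV; case: (_ == _); rewrite ?mul1r ?mul0r.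
have Kfree : row_free (fmx K).
  apply/row_freeP; exists (fmx (fun v (r : rt) => (v == val r)%:R)).
  rewrite fmxM; apply/matrixP => i j; rewrite !mxE.
  rewrite (bigD1 (val (enum_val j))) //= eqxx mulr1 big1 => [|v /negbTE->]; last by rewrite mulr0.
  rewrite addr0 -(inj_eq enum_val_inj) -val_eqE /= /K.
  by rewrite (eqP (valP (enum_val j))) eq_sym.
have : (\rank (fmx K) <= \rank (kermx (fmx M)))%N by apply: mxrankS; apply/sub_kermxP.
rewrite (eqP Kfree) mxrank_ker card_sig => h.
have -> : kappa E = #|[pred r | roots (adj E) r]| by rewrite /kappa cardsE.
by move: h (rank_leq_row (fmx M)); lia.
Qed.

End CycleSpace.

(** * Minors of the 1-skeleton of a closed surface *)

Section MinorBound.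
(** The types are the vertices, edges and faces of a cellulation of the surface; [iv] gives the ends
    of an edge and [bd] the boundary of a face. Further on, [U] and [x] exhibit [E] as a minor, by
    branch sets and by one host edge for each edge of [E]. *)
Variables (HV HE HF : finType) (iv : HE -> {set HV}) (bd : HF -> {set HE}) (g : nat).
Hypothesis iv2 : forall e, #|iv e| = 2%N.
Hypothesis bd2 : forall e, #|[set f | e \in bd f]| = 2%N.
Hypothesis bdiv : forall f v, \sum_e (e \in bd f)%:R * (v \in iv e)%:R = 0 :> F2.
Hypothesis connV : forall h : HV -> F2,
  (forall e u v, u \in iv e -> v \in iv e -> h u = h v) -> forall u v, h u = h v.
Hypothesis connF : forall h : HF -> F2,
  (forall e f f', e \in bd f -> e \in bd f' -> h f = h f') -> forall f f', h f = h f'.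
Hypothesis euler : (#|HE| + 2 <= #|HV| + #|HF| + 2 * g)%N.

Variables (T : finType) (E : {set {set T}}).
Hypothesis E2 : forall e, e \in E -> #|e| = 2%N.
Variables (U : T -> {set HV}) (x : {set T} -> HE).

Definition inside v : rel HV :=
  [rel a b | [exists h, [&& iv h == [set a; b], a \in U v & b \in U v]]].

Hypothesis Udisj : forall u v a, a \in U u -> a \in U v -> u = v.
Hypothesis Uconn : forall v a b, a \in U v -> b \in U v -> connect (inside v) a b.
Hypothesis xP : forall e, e \in E -> exists u v a b,
  [/\ e = [set u; v], iv (x e) = [set a; b], a \in U u & b \in U v].

Local Notation GE := {e : {set T} | e \in E}.

(** The host edges that survive: those contracted inside a branch set and those representing an edge
    of [E]. The others count as deleted. *)
Definition kept e := [exists v, iv e \subset U v] || [exists f in E, x f == e].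
Definition boundary (w : HE -> F2) v : F2 := \sum_e w e * (v \in iv e)%:R.

Lemma sum_ends h (P : pred HV) a b : iv h = [set a; b] ->
  \sum_(c | P c) (c \in iv h)%:R = (P a)%:R + (P b)%:R :> F2.
Proof.
move=> ih; rewrite ih sum_pair //; have := iv2 h; rewrite ih cards2.
by case: eqP.
Qed.

Lemma ends_count e v : e \in E ->
  \sum_(c in U v) (c \in iv (x e))%:R = (v \in e)%:R :> F2.
Proof.
move=> eE; have [u [w [a [b [eUV ivx aU bU]]]]] := xP eE.
have uw : u != w by have := E2 eE; rewrite eUV cards2; case: eqP.
rewrite (sum_ends _ ivx) eUV !inE.
have H c t : c \in U t -> (c \in U v) = (v == t).
  move=> ct; apply/idP/eqP => [cv|->//]; exact: Udisj cv ct.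
rewrite (H _ _ aU) (H _ _ bU).
by have [->|] := eqVneq v u; rewrite ?(negbTE uw) ?addr0 ?add0r.
Qed.

Lemma x_outside e v : e \in E -> ~~ (iv (x e) \subset U v).
Proof.
move=> eE; have [u [w [a [b [eUV ivx aU bU]]]]] := xP eE.
apply/negP => /subsetP s.
have au : u = v by apply: Udisj aU _; apply: s; rewrite ivx !inE eqxx.
have bw : w = v by apply: Udisj bU _; apply: s; rewrite ivx !inE eqxx orbT.
by have := E2 eE; rewrite eUV au bw cards2 eqxx.
Qed.

Lemma x_inj : {in E &, injective x}.
Proof.
move=> e f eE fE exf; apply/setP => v; apply: boolF2_inj.
by rewrite -!ends_count // exf.
Qed.

(** Sum the boundary of [w] over a branch set: an edge inside the set counts twice and vanishes, so
    only the edges representing edges at [v] remain. *)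
Lemma projection_cycle (w : HE -> F2) : (forall v, boundary w v = 0) ->
  (forall e, ~~ kept e -> w e = 0) ->
  forall v, \sum_(e in E) w (x e) * (v \in e)%:R = 0.
Proof.
move=> wc wd v.
have H0 : \sum_h w h * (\sum_(a in U v) (a \in iv h)%:R) = 0 :> F2.
  under eq_bigr => h _ do rewrite big_distrr /=.
  by rewrite exchange_big /= big1 // => a _; exact: wc.
rewrite -[RHS]H0 (bigID (mem (x @: E))) /= [X in _ + X]big1 ?addr0.
  rewrite big_imset /=; last exact: x_inj.
  by apply: eq_bigr => e eE; rewrite ends_count.
move=> h hx; have [k|/wd->] := boolP (kept h); last by rewrite mul0r.
case/orP: k => [/existsP[u su]|/existsP[f /andP[fE /eqP fh]]]; last first.
  by rewrite -fh imset_f in hx.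
have /eqP/cards2P[a [b [ab ih]]] := iv2 h.
rewrite (sum_ends _ ih).
have aU : a \in U u by apply: (subsetP su); rewrite ih !inE eqxx.
have bU : b \in U u by apply: (subsetP su); rewrite ih !inE eqxx orbT.
have [<-|uv] := eqVneq u v; first by rewrite aU bU addF2 mulr0.
have -> : (a \in U v) = false by apply/negP => av; case/eqP: uv; exact: Udisj aU av.
have -> : (b \in U v) = false by apply/negP => av; case/eqP: uv; exact: Udisj bU av.
by rewrite addr0 mulr0.
Qed.

Lemma boundaryD w w' v : boundary (fun e => w e + w' e) v = boundary w v + boundary w' v.
Proof. by rewrite /boundary -big_split; apply: eq_bigr => e _; rewrite mulrDl. Qed.

Lemma boundary_sum (I : finType) (P : pred I) (w : I -> HE -> F2) v :
  boundary (fun e => \sum_(i | P i) w i e) v = \sum_(i | P i) boundary (w i) v.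
Proof.
rewrite /boundary exchange_big /=; apply: eq_bigr => e _.
by rewrite big_distrl.
Qed.

Lemma boundary_edge h v : boundary (fun e => (e == h)%:R) v = (v \in iv h)%:R.
Proof.
rewrite /boundary (bigD1 h) //= eqxx mul1r big1 ?addr0 // => e /negbTE->.
by rewrite mul0r.
Qed.

Lemma path_chain v a b : a \in U v -> connect (inside v) a b ->
  exists y : HE -> F2, (forall e, ~~ (iv e \subset U v) -> y e = 0) /\
    forall c, boundary y c = (c == a)%:R + (c == b)%:R.
Proof.
move=> aU /connectP[p pth ->]; elim: p a aU pth => [|c p IH] a aU /=.
  move=> _; exists (fun=> 0); split => // c.
  by rewrite /boundary big1 ?addF2 // => e _; rewrite mul0r.
case/andP=> /existsP[h /and3P[/eqP ih _ cU]] /(IH _ cU)[y [ys yb]].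
exists (fun e => (e == h)%:R + y e); split.
  move=> e eU; rewrite ys // addr0; have [eh|//] := eqVneq e h.
  case/negP: eU; rewrite eh ih; apply/subsetP => d; rewrite !inE.
  by case/orP=> /eqP->.
move=> d; rewrite boundaryD boundary_edge yb ih !inE.
have ac : a != c by have := iv2 h; rewrite ih cards2; case: eqP.
have -> : ((d == a) || (d == c))%:R = (d == a)%:R + (d == c)%:R :> F2.
  by have [->|] := eqVneq d a; rewrite ?(negbTE ac) ?addr0 // add0r.
by rewrite -!addrA; congr (_ + _); rewrite addrA addF2 add0r.
Qed.

(** Join every point of the prescribed boundary to one vertex [a] by a path in the branch set; the
    contributions at [a] cancel because the number of paths is even. *)
Lemma tjoin v (h : HV -> F2) : \sum_(b in U v) h b = 0 ->
  exists y : HE -> F2, (forall e, ~~ (iv e \subset U v) -> y e = 0) /\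
    forall c, boundary y c = (c \in U v)%:R * h c.
Proof.
move=> h0; have [U0|[a aU]] := set_0Vmem (U v).
  exists (fun=> 0); split => // c; rewrite U0 inE mul0r.
  by rewrite /boundary big1 // => e _; rewrite mul0r.
have /fin_all_exists[y yP] : forall b, exists y : HE -> F2, b \in U v ->
    (forall e, ~~ (iv e \subset U v) -> y e = 0) /\
    forall c, boundary y c = (c == a)%:R + (c == b)%:R.
  move=> b; have [bU|] := boolP (b \in U v); last by exists (fun=> 0).
  have [y [ys yb]] := path_chain aU (Uconn aU bU).
  by exists y => _; split.
exists (fun e => \sum_(b in U v) h b * y b e); split.
  by move=> e eU; rewrite big1 // => b bU; case: (yP b bU) => ys _; rewrite ys // mulr0.
move=> c; rewrite boundary_sum.
rewrite (eq_bigr (fun b => h b * (c == a)%:R + h b * (c == b)%:R)); last first.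
  move=> b bU; case: (yP b bU) => _ yb; rewrite -mulrDr -yb /boundary big_distrr /=.
  by apply: eq_bigr => e _; rewrite mulrA.
rewrite big_split /= -big_distrl /= h0 mul0r add0r.
rewrite big_mkcond (bigD1 c) //= eqxx mulr1 big1 ?addr0.
  by case: ifP; rewrite ?mul1r ?mul0r.
by move=> b /negbTE nb; rewrite eq_sym nb mulr0 if_same.
Qed.

(** Copied to the host edges, [z] has a boundary of even size in every branch set, because it is a
    cycle at the contracted vertex; a join inside the branch set repairs it. *)
Lemma lift_cycle (z : {set T} -> F2) :
  (forall v, \sum_(e in E) z e * (v \in e)%:R = 0) ->
  exists w : HE -> F2, [/\ forall v, boundary w v = 0,
    forall e, ~~ kept e -> w e = 0 & forall e, e \in E -> w (x e) = z e].
Proof.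
move=> zc.
pose w0 h : F2 := \sum_(e in E) z e * (h == x e)%:R.
have w0b c : boundary w0 c = \sum_(e in E) z e * (c \in iv (x e))%:R.
  rewrite boundary_sum; apply: eq_bigr => e _; rewrite -boundary_edge /boundary big_distrr.
  by apply: eq_bigr => h _; rewrite /= mulrA.
have /fin_all_exists[Y YP] : forall v, exists y : HE -> F2,
    (forall e, ~~ (iv e \subset U v) -> y e = 0) /\
    forall c, boundary y c = (c \in U v)%:R * boundary w0 c.
  move=> v; apply: tjoin; under eq_bigr => b _ do rewrite w0b.
  rewrite exchange_big /= -[RHS](zc v); apply: eq_bigr => e eE.
  by rewrite -big_distrr /= ends_count.
exists (fun h => w0 h + \sum_v Y v h); split.
- move=> c; rewrite boundaryD boundary_sum.
  rewrite (eq_bigr (fun v => (c \in U v)%:R * boundary w0 c)); last by move=> v _; case: (YP v).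
  rewrite -big_distrl /=.
  have [[v cv]|nc] := altP (@existsP _ (fun v => c \in U v)).
    rewrite (bigD1 v) //= cv big1 ?addr0 ?mul1r ?addF2 // => u uv.
    by case: (boolP (c \in U u)) => // cu; case/eqP: uv; exact: Udisj cu cv.
  have -> : boundary w0 c = 0; last by rewrite mulr0 addr0.
  rewrite w0b big1 // => e eE; have [u [w [a [b [_ -> aU bU]]]]] := xP eE.
  rewrite !inE; case: eqP => [ca|_].
    by case/existsP: nc; exists u; rewrite ca.
  by case: eqP => [cb|_]; [case/existsP: nc; exists w; rewrite cb|rewrite mulr0].
- move=> h; rewrite negb_or => /andP[/existsPn n1 /existsPn n2].
  rewrite /w0 big1 ?add0r; last first.
    move=> e eE; have := n2 e; rewrite eE /= eq_sym => /negbTE->.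
    by rewrite mulr0.
  by rewrite big1 // => v _; case: (YP v) => ys _; rewrite ys // n1.
- move=> e eE; rewrite [X in _ + X]big1 ?addr0; last first.
    by move=> v _; case: (YP v) => ys _; rewrite ys // x_outside.
  rewrite /w0 (bigD1 e) //= eqxx mulr1 big1 ?addr0 // => f /andP[fE fe].
  case: eqP => [/(x_inj eE fE) ef|]; last by rewrite mulr0.
  by rewrite ef eqxx in fe.
Qed.

(** Deleting an edge merges the two faces beside it. The classes of this relation serve as the faces
    of the minor, and [merged_bd] is the boundary of a class modulo 2. *)
Definition merged : rel HF :=
  [rel f f' | [exists e, [&& ~~ kept e, e \in bd f & e \in bd f']]].

Definition merged_bd r h : F2 := \sum_(f | fingraph.root merged f == r) (h \in bd f)%:R.

Definition merged_cycle r := [set e in E | merged_bd r (x e) != 0].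

Lemma merged_sym : connect_sym merged.
Proof.
by apply: sym_connect_sym => f f' /=; apply: eq_existsb => e; rewrite [X in _ && X]andbC.
Qed.

Lemma two_faces e : exists f f', f != f' /\ forall h, (e \in bd h) = (h \in [set f; f']).
Proof.
have /eqP/cards2P[f [f' [ff fE]]] := bd2 e; exists f, f'; split => // h.
by rewrite -fE inE.
Qed.

Lemma merged_bd_cycle r v : boundary (merged_bd r) v = 0.
Proof. by rewrite boundary_sum big1 // => f _; exact: bdiv. Qed.

Lemma merged_bd_kept r e : ~~ kept e -> merged_bd r e = 0.
Proof.
move=> ke; have [f [f' [ff fE]]] := two_faces e.
rewrite /merged_bd; under eq_bigr => h _ do rewrite fE.
rewrite sum_pair //.
have -> : fingraph.root merged f = fingraph.root merged f'; last exact: addF2.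
apply/(fingraph.rootP merged_sym)/connect1; apply/existsP; exists e.
by rewrite ke !fE !inE !eqxx orbT.
Qed.

Lemma sum_mul_pair (A : finType) (f : A -> F2) a b : a != b ->
  \sum_c f c * (c \in [set a; b])%:R = f a + f b.
Proof.
move=> ab; rewrite (bigD1 a) //= (bigD1 b) 1?eq_sym //= !inE !eqxx orbT !mulr1 big1 ?addr0 //.
by move=> c /andP[/negbTE ca /negbTE cb]; rewrite !inE ca cb mulr0.
Qed.

Lemma eqF2 (a b : F2) : a + b = 0 -> a = b.
Proof. by move=> ab; rewrite -[RHS]add0r -ab -addrA addF2 addr0. Qed.

Lemma merged_cycle_even r v : ~~ odd #|[set e in merged_cycle r | v \in e]|.
Proof.
apply/negbT/boolF2_inj; rewrite -natF2 -sum1_card natr_sum -[RHS]/(0 : F2).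
rewrite -[RHS](projection_cycle (merged_bd_cycle r) (@merged_bd_kept r) v).
rewrite [RHS](eq_bigr (fun e => if (merged_bd r (x e) != 0) && (v \in e) then 1 else 0 : F2)) => [|e _].
  by rewrite -big_mkcondr /=; apply: eq_bigl => e; rewrite !inE -!andbA.
by rewrite {1}(F2E (merged_bd r (x e))); case: (_ != 0); case: (v \in e); rewrite /= ?mulr0 ?mulr1.
Qed.

(** By Euler's relation and connectedness, the cycles of the host modulo face boundaries have
    dimension at most [2 * g]. This passes to the cycles carried by kept edges ([W]) and to their
    projections ([W *m X]), among which are all cycles of [E]. A sum of faces carried by kept edges
    has coefficients constant on merged classes, so the part coming from faces is generated by the
    sets [C j]. *)
Theorem minor_bound : exists (J : {set HF}) (C : HF -> {set {set T}}),
  [/\ forall j, j \in J -> C j != set0,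
      forall j, C j \subset E,
      forall j v, ~~ odd #|[set e in C j | v \in e]|,
      forall e, #|[set j in J | e \in C j]| <= 2 &
      #|E| + kappa E <= #|T| + 2 * g + #|J|]%N.
Proof.
pose J := [set r | merged_cycle r != set0].
exists J, merged_cycle; split.
- by move=> j; rewrite inE.
- by move=> j; apply/subsetP => e; rewrite inE => /andP[].
- exact: merged_cycle_even.
(* A class whose boundary contains [x e] contains one of the two faces beside [x e]. *)
- move=> e; rewrite -(bd2 (x e)).
  apply: leq_trans (leq_imset_card (fingraph.root merged) _).
  apply: subset_leq_card; apply/subsetP => r; rewrite !inE => /andP[_ /andP[_ nz]].
  have [/existsP[f /andP[/eqP fr xf]]|/existsPn no] :=
    boolP [exists f, (fingraph.root merged f == r) && (x e \in bd f)].
    by apply/imsetP; exists f; rewrite ?inE.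
  case/eqP: nz; rewrite /merged_bd big1 // => f fr.
  by have := no f; rewrite fr /= => /negbTE->.
pose D1 := fmx (fun e v => (v \in iv e)%:R : F2).
pose D2 := fmx (fun f e => (e \in bd f)%:R : F2).
pose Del := fmx (fun e e' => ((e == e') && ~~ kept e)%:R : F2).
pose X := fmx (fun h (e : GE) => (h == x (val e))%:R : F2).
pose W := (kermx D1 :&: kermx Del)%MS.
have memW (w : HE -> F2) : (frow w <= W)%MS <->
    (forall v, boundary w v = 0) /\ (forall e, ~~ kept e -> w e = 0).
  have DE e : \sum_a w a * ((a == e) && ~~ kept a)%:R = w e * (~~ kept e)%:R.
    rewrite (bigD1 e) //= eqxx /= big1 ?addr0 // => a /negbTE->.
    by rewrite mulr0.
  rewrite sub_capmx; split.
    case/andP=> /sub_kermxP + /sub_kermxP; rewrite !frow_mul => /frow0 h1 /frow0 h2.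
    by split=> // e ke; have := h2 e; rewrite DE ke mulr1.
  case=> h1 h2; apply/andP; split; apply/sub_kermxP; rewrite frow_mul; apply/frow0 => // e.
  by rewrite DE; case: (boolP (kept e)) => ke; rewrite ?mulr0 // h2 // mul0r.
have rD1 : (#|HV| <= (\rank D1).+1)%N.
  have -> : D1 = (fmx (fun v e => (v \in iv e)%:R : F2))^T by apply/matrixP => i j; rewrite !mxE.
  rewrite mxrank_tr; apply: rank_kermx_connected => f f0; apply: connV => e u v.
  have /eqP/cards2P[a [b [ab ih]]] := iv2 e.
  have := f0 e; rewrite ih sum_mul_pair // => /eqF2 fab.
  by rewrite !inE => /orP[]/eqP-> /orP[]/eqP->.
have rD2 : (#|HF| <= (\rank D2).+1)%N.
  apply: rank_kermx_connected => h h0; apply: connF => e f f'.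
  have [f1 [f2 [ff fE]]] := two_faces e.
  have := h0 e; under eq_bigr => k _ do rewrite fE.
  by rewrite sum_mul_pair // => /eqF2 hab; rewrite !fE !inE => /orP[]/eqP-> /orP[]/eqP->.
have D2Z : (D2 <= kermx D1)%MS.
  apply/sub_kermxP; rewrite fmxM; apply/matrixP => i j; rewrite !mxE; exact: bdiv.
have WZ : (W <= kermx D1)%MS by exact: capmxSl.
(* Dimension formula inside the cycle space of the host, which has dimension [#|HE| - \rank D1]. *)
have rWB : (\rank W + \rank D2 <= #|HE| - \rank D1 + \rank (W :&: D2)%MS)%N.
  rewrite -mxrank_sum_cap leq_add2r -mxrank_ker; apply: mxrankS.
  by rewrite addsmx_sub WZ D2Z.
have r1 := mxrank_mul_ker W X; have r2 := mxrank_mul_ker (W :&: D2)%MS X.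
(* The projection kills at least as much of [W] as of its subspace, so the codimension cannot
   grow. *)
have r3 : (\rank ((W :&: D2) :&: kermx X)%MS <= \rank (W :&: kermx X)%MS)%N.
  by apply: mxrankS; exact: capmxS (capmxSl _ _) (submx_refl _).
have rJ : (\rank ((W :&: D2)%MS *m X) <= #|J|)%N.
  pose CJ := fmx (fun (j : {j | j \in J}) (e : GE) => merged_bd (val j) (x (val e))).
  have <- : #|{: {j | j \in J}}| = #|J| by rewrite card_sig; apply: eq_card => j; rewrite !inE.
  apply: leq_trans (rank_leq_row CJ); apply: mxrankS; apply: row_sub_all => f /submxP[D fD].
  have uW : (D *m (W :&: D2)%MS <= W :&: D2)%MS by exact: submxMl.
  move: uW; rewrite sub_capmx => /andP[uW /submxP[a uD]].
  rewrite (frowK a) frow_mul in uD; move: uW; rewrite uD => /memW[_ ud].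
  rewrite mulmxA uD frow_mul in fD; move/frow_eq: fD => fD.
  set al := fun f => a 0 (enum_rank f) in uD ud fD.
  (* The combination vanishes on deleted edges, so its coefficients agree on the two faces beside
     each of them, hence on every merged class. *)
  have alc f1 : al f1 = al (fingraph.root merged f1).
    have cl : fingraph.closed merged [pred f | al f == al f1].
      move=> h h' /existsP[e /and3P[ke he he']]; rewrite !inE.
      have := ud e ke; have [k1 [k2 [kk kE]]] := two_faces e.
      under eq_bigr => k _ do rewrite kE.
      rewrite sum_mul_pair // => /eqF2 ab; move: he he'; rewrite !kE !inE.
      by case/orP=> /eqP-> /orP[]/eqP->; rewrite /al ?ab.
    have := closed_connect cl (connect_root merged f1); rewrite !inE eqxx.
    by move/esym/eqP.
  apply/submxP; exists (frow (fun j : {j | j \in J} => al (val j))).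
  rewrite frow_mul; apply/frow_eq => e; rewrite fD.
  rewrite (bigD1 (x (val e))) //= eqxx mulr1 [X in _ + X]big1 ?addr0; last first.
    by move=> h /negbTE->; rewrite mulr0.
  rewrite (eq_bigr (fun i => al i * (x (sval e) \in bd i)%:R)) //.
  rewrite (partition_big (fingraph.root merged) predT) //=.
  rewrite -(big_sub [pred j | j \in J] (fun j => al j * merged_bd j (x (val e)))).
  rewrite [RHS]big_mkcond /=; apply: eq_bigr => r _; rewrite inE.
  have -> : \sum_(i | fingraph.root merged i == r) al i * (x (sval e) \in bd i)%:R
      = al r * merged_bd r (x (val e)).
    by rewrite /merged_bd big_distrr /=; apply: eq_bigr => h /eqP <-; rewrite -alc.
  case: eqP => //= C0.
  suff -> : merged_bd r (x (val e)) = 0 by rewrite mulr0.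
  apply/eqP; have : val e \notin merged_cycle r by rewrite C0 inE.
  by rewrite inE (valP e) /= negbK.
have rG : (#|E| <= \rank (fmx (@graph_inc T E)) + \rank (W *m X))%N.
  have -> : #|E| = #|{: GE}| by rewrite card_sig; apply: eq_card => e; rewrite inE.
  rewrite -leq_subLR -mxrank_ker; apply: mxrankS; apply: row_sub_all => z /sub_kermxP.
  rewrite frow_mul => /frow0 z0.
  pose z' e : F2 := if insub e is Some s then z s else 0.
  have z'E (e : GE) : z' (val e) = z e by rewrite /z' valK.
  have [|w [w1 w2 w3]] := @lift_cycle z'.
    move=> v; rewrite -[RHS](z0 v) big_sub /=; apply: eq_bigr => e _.
    by rewrite -z'E.
  have -> : frow z = frow w *m X.
    rewrite frow_mul; apply/frow_eq => e.
    rewrite (bigD1 (x (val e))) //= eqxx mulr1 big1 ?addr0; last first.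
      by move=> h /negbTE->; rewrite mulr0.
    by rewrite w3 ?(valP e) // -z'E.
  by apply: submxMr; apply/memW.
have rT := rank_graph_inc E2.
have rD1' : (\rank D1 <= #|HE|)%N by exact: rank_leq_row.
move: rD1' rD1 rD2 rWB r1 r2 r3 rJ rG rT euler.
move: (\rank D1) (\rank D2) (\rank W) (\rank (W :&: D2)%MS) (\rank (W *m X))
  (\rank ((W :&: D2)%MS *m X)) (\rank (W :&: kermx X)%MS)
  (\rank ((W :&: D2) :&: kermx X)%MS) (\rank (fmx (@graph_inc T E))).
by clear; lia.
Qed.

End MinorBound.

Local Close Scope ring_scope.

(** * A cubical subdivision of the surface *)

(* Cells of the subdivided line: an even number 2k is the point k, an odd number
   2k + 1 the open interval between k and k + 1. In a profile, o marks the cells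
   inside a union of open intervals and d their end points. *)
Record profile (M : nat) (o d : pred nat) : Prop := Profile {
  pf_M : ~~ odd M;
  pf_M0 : 0 < M;
  pf_odd_d : forall a, odd a -> ~~ d a;
  pf_o_range : forall a, a <= M -> o a -> 0 < a < M;
  pf_d_range : forall a, a <= M -> d a -> 0 < a < M;
  pf_o : forall a, ~~ odd a -> a <= M -> o a -> o a.-1 /\ o a.+1;
  pf_d : forall a, ~~ odd a -> a <= M -> d a -> ~~ o a /\ o a.-1 (+) o a.+1;
  pf_out : forall a, ~~ odd a -> a <= M -> ~~ o a -> ~~ d a -> ~~ o a.-1 /\ ~~ o a.+1;
  pf_close : forall a, odd a -> a <= M -> o a -> (o a.-1 || d a.-1) && (o a.+1 || d a.+1) }.

Section Cubes.
Variables (N g : nat).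
Hypothesis N0 : 0 < N.

(** Doubled coordinates with [N] edges per unit of length, so that the real coordinate [k] becomes
    [2 * N * k]. On the x-axis [ox] marks the open intervals carrying the mouths and [dx] their end
    points; [oy] and [dy] do so on the y-axis; [ex], [ey], [ez] mark the outer faces of the box. *)
Definition xm := 2 * N * (2 * g + 1).
Definition ym := 6 * N.
Definition zm := 2 * N.
Definition ox a := [exists i : 'I_g, 2 * N * (2 * i + 1) < a < 2 * N * (2 * i + 2)].
Definition dx a := [exists i : 'I_g, (a == 2 * N * (2 * i + 1)) || (a == 2 * N * (2 * i + 2))].
Definition oy b := 2 * N < b < 4 * N.
Definition dy b := (b == 2 * N) || (b == 4 * N).
Definition ex a := (a == 0) || (a == xm).
Definition ey b := (b == 0) || (b == ym).
Definition ez c := (c == 0) || (c == zm).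

Lemma mulN_lt u v : 2 * N * u < 2 * N * v -> u < v.
Proof. by rewrite ltn_pmul2l // muln_gt0. Qed.

Lemma mulN_odd u : odd (2 * N * u) = false.
Proof. by rewrite -mulnA oddM. Qed.

Lemma profile_x : profile xm ox dx.
Proof.
split.
- by rewrite /xm mulN_odd.
- by rewrite /xm muln_gt0; lia.
- move=> a oa; apply/negP => /existsP[i /orP[]/eqP aE]; by rewrite aE mulN_odd in oa.
- move=> a _ /existsP[i /andP[h1 h2]]; apply/andP; split; first lia.
  by apply: leq_trans h2 _; rewrite /xm leq_mul2l; have := ltn_ord i; lia.
- move=> a _ /existsP[i /orP[]/eqP->]; rewrite muln_gt0 /xm ltn_pmul2l; have := ltn_ord i; lia.
- move=> a oa _ /existsP[i /andP[h1 h2]].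
  have p1 := mulN_odd (2 * i + 1); have p2 := mulN_odd (2 * i + 2).
  by split; apply/existsP; exists i; lia.
- move=> a oa _ /existsP[i ai]; split.
    apply/negP => /existsP[j /andP[h1 h2]]; case/orP: ai => /eqP aE; rewrite aE in h1 h2;
      have := mulN_lt h1; have := mulN_lt h2; lia.
  have np : forall j : 'I_g, ~~ (2 * N * (2 * j + 1) < (2 * N * (2 * i + 1)).-1 < 2 * N * (2 * j + 2)).
    move=> j; apply/negP => /andP[h1 h2].
    have k1 : 2 * j + 1 < 2 * i + 1 by apply: mulN_lt; lia.
    have : 2 * N * (2 * j + 2) <= 2 * N * (2 * i) by rewrite leq_mul2l; lia.
    lia.
  have nn : forall j : 'I_g, ~~ (2 * N * (2 * j + 1) < (2 * N * (2 * i + 2)).+1 < 2 * N * (2 * j + 2)).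
    move=> j; apply/negP => /andP[h1 h2].
    have k1 : 2 * i + 2 < 2 * j + 2 by apply: mulN_lt; lia.
    have : 2 * N * (2 * i + 3) <= 2 * N * (2 * j + 1) by rewrite leq_mul2l; lia.
    lia.
  have L : 2 * N * (2 * i + 2) = 2 * N * (2 * i + 1) + 2 * N by lia.
  case/orP: ai => /eqP ->.
    have -> : ox (2 * N * (2 * i + 1)).+1 by apply/existsP; exists i; lia.
    by rewrite addbT; apply/existsPn.
  have -> : ox (2 * N * (2 * i + 2)).-1 by apply/existsP; exists i; lia.
  by rewrite addTb; apply/existsPn.
- move=> a oa _ no nd; split; apply/negP => /existsP[i /andP[h1 h2]].
    have n1 : ~~ (2 * N * (2 * i + 1) < a < 2 * N * (2 * i + 2)).
      by apply: contra no => h; apply/existsP; exists i.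
    have n2 : ~~ ((a == 2 * N * (2 * i + 1)) || (a == 2 * N * (2 * i + 2))).
      by apply: contra nd => h; apply/existsP; exists i.
    lia.
  have n1 : ~~ (2 * N * (2 * i + 1) < a < 2 * N * (2 * i + 2)).
    by apply: contra no => h; apply/existsP; exists i.
  have n2 : ~~ ((a == 2 * N * (2 * i + 1)) || (a == 2 * N * (2 * i + 2))).
    by apply: contra nd => h; apply/existsP; exists i.
  lia.
- move=> a oa _ /existsP[i /andP[h1 h2]].
  have H b : 2 * N * (2 * i + 1) <= b <= 2 * N * (2 * i + 2) -> ox b || dx b.
    move=> hb; apply/orP.
    have [->|n1] := eqVneq b (2 * N * (2 * i + 1)).
      by right; apply/existsP; exists i; rewrite eqxx.
    have [->|n2] := eqVneq b (2 * N * (2 * i + 2)).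
      by right; apply/existsP; exists i; rewrite eqxx orbT.
    by left; apply/existsP; exists i; lia.
  by rewrite !H //; lia.
Qed.

Lemma profile_y : profile ym oy dy.
Proof. by split; rewrite /ym /oy /dy; intros; lia. Qed.

(** [hole] is the open square of a mouth. [rim] collects the columns that stand on the surface over
    their full height: the outer walls and the walls of the tubes. *)
Definition hole a b := ox a && oy b.
Definition rim a b := [|| ex a, ey b | [&& ox a || dx a, oy b || dy b & ~~ hole a b]].
Definition surf a b c := (ez c && ~~ hole a b) || rim a b.

Lemma exE a : a <= xm -> ex a -> [/\ ~~ odd a, ~~ ox a & ~~ dx a].
Proof.
move=> ax /orP[]/eqP aE; split; rewrite ?aE ?(pf_M profile_x) //; apply/negP => h.
- by have := pf_o_range profile_x (leq0n _) h.
- by have := pf_d_range profile_x (leq0n _) h.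
- by have := pf_o_range profile_x (leqnn _) h; rewrite ltnn andbF.
- by have := pf_d_range profile_x (leqnn _) h; rewrite ltnn andbF.
Qed.

Lemma eyE b : ey b -> [/\ ~~ odd b, ~~ oy b & ~~ dy b].
Proof. by rewrite /ey /oy /dy /ym => h; split; lia. Qed.

Lemma rim_hole a b : a <= xm -> rim a b -> ~~ hole a b.
Proof.
move=> ax /or3P[/(exE ax)[_ /negbTE h _]|/eyE[_ /negbTE h _]|/and3P[_ _ //]].
  by rewrite /hole h.
by rewrite /hole h andbF.
Qed.

Definition cell := ('I_xm.+1 * 'I_ym.+1 * 'I_zm.+1)%type.
Definition dim (t : cell) := odd t.1.1 + odd t.1.2 + odd t.2.
Definition in_surf (t : cell) := surf t.1.1 t.1.2 t.2.
Definition inc1 (s t : nat) := odd t && ((s == t.+1) || (s.+1 == t)).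
Definition inc (t s : cell) :=
  [|| [&& inc1 s.1.1 t.1.1, s.1.2 == t.1.2 & s.2 == t.2],
      [&& s.1.1 == t.1.1, inc1 s.1.2 t.1.2 & s.2 == t.2] |
      [&& s.1.1 == t.1.1, s.1.2 == t.1.2 & inc1 s.2 t.2]].

(** The mouths are open and the walls closed, so faces of cells of the surface stay on it; this is
    checked for each coordinate separately. *)
Lemma surf_closed (t s : cell) : in_surf t -> inc t s -> in_surf s.
Proof.
have X1 a a' b : a <= xm -> inc1 a' a -> ~~ hole a b -> ~~ hole a' b.
  move=> ax /andP[oa aa]; rewrite /hole; case: (oy b); rewrite ?andbF // !andbT.
  apply: contra => oa'; case/orP: aa => /eqP aE.
    rewrite aE in oa'.
    have lt : a < xm.
      rewrite ltn_neqAle ax andbT; apply: contraTneq oa => ->.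
      exact: (pf_M profile_x).
    by have [] := pf_o profile_x (a := a.+1) _ lt oa'; rewrite /= ?oa.
  have oa'' : ~~ odd a' by rewrite -aE /= in oa.
  have ax' : a' <= xm by apply: leq_trans ax; rewrite -aE.
  by have [_] := pf_o profile_x oa'' ax' oa'; rewrite aE.
have Y1 a b b' : inc1 b' b -> ~~ hole a b -> ~~ hole a b'.
  by rewrite /hole /inc1 /oy; case: (ox a) => //=; lia.
have XR a a' b : a <= xm -> inc1 a' a -> rim a b -> rim a' b.
  move=> ax aa /or3P[/(exE ax)[]|h|/and3P[h1 h2 h3]].
  - by case/andP: aa => ->.
  - by rewrite /rim h orbT.
  have oa : odd a by case/andP: aa.
  have nd : ~~ dx a by exact: (pf_odd_d profile_x).
  rewrite (negbTE nd) orbF in h1.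
  have noy : ~~ oy b by move: h3; rewrite /hole h1.
  rewrite (negbTE noy) /= in h2.
  apply/or3P; apply: Or33; rewrite h2 orbT /= /hole (negbTE noy) andbF andbT.
  by have /andP[k1 k2] := pf_close profile_x oa ax h1; case/andP: aa => _ /orP[]/eqP aE; [rewrite aE|move: k1; rewrite -aE].
have YR a b b' : inc1 b' b -> rim a b -> rim a b'.
  move=> bb /or3P[h|/eyE[]|/and3P[h1 h2 h3]].
  - by rewrite /rim h.
  - by case/andP: bb => ->.
  apply/or3P; apply: Or33; rewrite h1 /=.
  have nox : ~~ ox a.
    by move: h3 h2 bb; rewrite /hole /inc1 /oy /dy; case: (ox a) => //=; lia.
  rewrite /hole (negbTE nox) andbT.
  by move: h2 bb; rewrite /inc1 /oy /dy; lia.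
case: t => [[a b] c]; case: s => [[a' b'] c']; rewrite /in_surf /inc /surf /=.
have ax : a <= xm by rewrite -ltnS.
case/orP=> [/andP[cz ph]|r] /or3P[] /and3P[].
- by move=> aa /eqP bE /eqP cE; rewrite bE cE cz (X1 a).
- by move=> /eqP aE bb /eqP cE; rewrite aE cE cz (Y1 _ b).
- move=> _ _ /andP[oc _]; move: cz oc; rewrite /ez /zm; case/orP=> /eqP->; by rewrite ?oddM.
- by move=> aa /eqP bE /eqP cE; rewrite bE (XR a) // orbT.
- by move=> /eqP aE bb /eqP cE; rewrite aE (YR _ b) // orbT.
- by move=> /eqP -> /eqP -> _; rewrite r orbT.
Qed.

Local Ltac qlia := repeat match goal with
  | H : is_true (surf _ _ _) |- _ => clear H
  | H : is_true (rim _ _) |- _ => clear H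
  | H : is_true (hole _ _) |- _ => clear H
  | H : is_true (~~ hole _ _) |- _ => clear H
  | H : is_true (inc1 _ _) |- _ => clear H
  | H : is_true (ez _) |- _ => clear H
  | H : is_true (ox _) |- _ => clear H
  | H : is_true (~~ ox _) |- _ => clear H
  | H : is_true (dx _) |- _ => clear H
  | H : profile _ _ _ |- _ => clear H
  | H : ?P |- _ => lazymatch type of P with Prop =>
      lazymatch P with forall _ : _, _ => clear H end end end; lia.

Lemma ex_inner a : 0 < a < xm -> ex a = false.
Proof. by rewrite /ex => /andP[a0 am]; rewrite (gtn_eqF a0) (ltn_eqF am). Qed.

Lemma sum_delta n k (F : nat -> nat) : \sum_(i < n) (i == k :> nat) * F i = (k < n) * F k.
Proof.
have [kn|nk] := ltnP k n.
  rewrite (bigD1 (Ordinal kn)) //= eqxx big1 ?addn0 // => i /negbTE.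
  by rewrite -val_eqE /= => ->.
by rewrite big1 // => i _; case: eqP => // ik; move: (ltn_ord i); rewrite ik ltnNge nk.
Qed.

Lemma sum_inc1 M a (F : nat -> nat) : ~~ odd M -> a <= M ->
  \sum_(i < M.+1) inc1 i a * F i = if odd a then F a.-1 + F a.+1 else 0.
Proof.
move=> oM aM; case: ifP => oa; last by rewrite big1 // => i _; rewrite /inc1 oa.
have a0 : 0 < a by case: a oa {aM}.
have lt : a < M by rewrite ltn_neqAle aM andbT; apply: contraTneq oa => ->.
rewrite (eq_bigr (fun i : 'I_M.+1 => (i == a.+1 :> nat) * F i + (i == a.-1 :> nat) * F i)).
  rewrite big_split /= !sum_delta ltnS lt (_ : a.-1 < M.+1); last by lia.
  by rewrite !mul1n addnC.
by move=> i _; rewrite -mulnDl /inc1 oa /=; congr (_ * _); lia.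
Qed.

Lemma sum_coinc1 M a (F : nat -> nat) : ~~ odd M -> a <= M ->
  \sum_(i < M.+1) inc1 a i * F i =
  if odd a then 0 else (0 < a) * F a.-1 + (a < M) * F a.+1.
Proof.
move=> oM aM; case: ifP => oa.
  by rewrite big1 // => i _; rewrite /inc1; case: (boolP (odd i)) => //= oi; lia.
rewrite (eq_bigr (fun i : 'I_M.+1 => (i == a.+1 :> nat) * F i + ((0 < a) && (i == a.-1 :> nat)) * F i)).
  rewrite big_split /= sum_delta ltnS addnC; congr (_ + _).
  case: (posnP a) => a0; first by rewrite big1.
  by rewrite sum_delta /= (_ : a.-1 < M.+1) //; lia.
move=> i _; rewrite -mulnDl /inc1; congr (_ * _).
by case: (boolP (odd i)) => oi /=; lia.
Qed.

Lemma sum_cell (F : cell -> nat) :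
  \sum_(t : cell) F t = \sum_(a < xm.+1) \sum_(b < ym.+1) \sum_(c < zm.+1) F (a, b, c).
Proof.
rewrite pair_bigA /= pair_bigA /=; apply: eq_bigr => -[[a b] c] _ //.
Qed.

(** Leibniz rule for the product of three lines. The disjunction becomes a sum because its cases
    exclude each other. *)
Lemma incE (t s : cell) : inc t s =
  inc1 s.1.1 t.1.1 * ((s.1.2 == t.1.2 :> nat) * (s.2 == t.2 :> nat)) +
  (s.1.1 == t.1.1 :> nat) * (inc1 s.1.2 t.1.2 * (s.2 == t.2 :> nat)) +
  (s.1.1 == t.1.1 :> nat) * ((s.1.2 == t.1.2 :> nat) * inc1 s.2 t.2) :> nat.
Proof.
have ne a b : inc1 a b -> (a == b :> nat) = false by rewrite /inc1; lia.
rewrite /inc -!val_eqE /=.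
case h1: (inc1 _ _); case h2: (inc1 _ _); case h3: (inc1 _ _); rewrite ?(ne _ _ h1) ?(ne _ _ h2) ?(ne _ _ h3) //=;
 by repeat (case: (_ == _)).
Qed.

Lemma odd_xm : ~~ odd xm. Proof. exact: pf_M profile_x. Qed.
Lemma odd_ym : ~~ odd ym. Proof. exact: pf_M profile_y. Qed.
Lemma odd_zm : ~~ odd zm. Proof. by rewrite /zm oddM. Qed.

Lemma bdry_sum (t : cell) (F : nat -> nat -> nat -> nat) (a b c : nat) :
  a = t.1.1 -> b = t.1.2 -> c = t.2 ->
  \sum_s inc t s * F s.1.1 s.1.2 s.2 =
  (if odd a then F a.-1 b c + F a.+1 b c else 0) +
  (if odd b then F a b.-1 c + F a b.+1 c else 0) +
  (if odd c then F a b c.-1 + F a b c.+1 else 0).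
Proof.
move=> aE bE cE.
have ax : a <= xm by rewrite aE -ltnS.
have by_ : b <= ym by rewrite bE -ltnS.
have cz : c <= zm by rewrite cE -ltnS.
under eq_bigr => s _ do rewrite incE 2!mulnDl.
rewrite 2!big_split /=; congr (_ + _ + _); rewrite sum_cell /=.
- rewrite -(@sum_inc1 xm a (fun a' => F a' b c)) ?odd_xm //; apply: eq_bigr => i _.
  rewrite -aE; under eq_bigr => j _.
    under eq_bigr => k _ do rewrite -!mulnA -bE -cE.
    rewrite -!big_distrr /= (@sum_delta _ c (fun k => F i j k)) ltnS cz mul1n mulnCA.
  over.
  by rewrite (@sum_delta _ b (fun j => inc1 i a * F i j c)) ltnS by_ mul1n.
- rewrite -(@sum_inc1 ym b (fun b' => F a b' c)) ?odd_ym //.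
  under eq_bigr => i _.
    under eq_bigr => j _.
      under eq_bigr => k _ do rewrite -!mulnA -aE -bE -cE.
      rewrite -!big_distrr /= (@sum_delta _ c (fun k => F i j k)) ltnS cz mul1n.
    over.
    rewrite -big_distrr /=.
  over.
  by rewrite (@sum_delta _ a (fun i => \sum_(j < ym.+1) inc1 j b * F i j c)) ltnS ax mul1n.
- rewrite -(@sum_inc1 zm c (fun c' => F a b c')) ?odd_zm //.
  under eq_bigr => i _.
    under eq_bigr => j _.
      under eq_bigr => k _ do rewrite -!mulnA -aE -bE -cE.
      rewrite -!big_distrr /=.
    over.
    rewrite -big_distrr /= (@sum_delta _ b (fun j => \sum_(k < zm.+1) inc1 k c * F i j k)) ltnS by_ mul1n.
  over.
  by rewrite (@sum_delta _ a (fun i => \sum_(k < zm.+1) inc1 k c * F i b k)) ltnS ax mul1n.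
Qed.

Lemma cobdry_sum (t : cell) (F : nat -> nat -> nat -> nat) (a b c : nat) :
  a = t.1.1 -> b = t.1.2 -> c = t.2 ->
  \sum_s inc s t * F s.1.1 s.1.2 s.2 =
  (if odd a then 0 else (0 < a) * F a.-1 b c + (a < xm) * F a.+1 b c) +
  (if odd b then 0 else (0 < b) * F a b.-1 c + (b < ym) * F a b.+1 c) +
  (if odd c then 0 else (0 < c) * F a b c.-1 + (c < zm) * F a b c.+1).
Proof.
move=> aE bE cE.
have ax : a <= xm by rewrite aE -ltnS.
have by_ : b <= ym by rewrite bE -ltnS.
have cz : c <= zm by rewrite cE -ltnS.
under eq_bigr => s _ do rewrite incE 2!mulnDl -aE -bE -cE.
under eq_bigr => s _ do rewrite ![a == _]eq_sym ![b == _]eq_sym ![c == _]eq_sym.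
rewrite 2!big_split /=; congr (_ + _ + _); rewrite sum_cell /=.
- rewrite -(@sum_coinc1 xm a (fun a' => F a' b c)) ?odd_xm //; apply: eq_bigr => i _.
  under eq_bigr => j _.
    under eq_bigr => k _ do rewrite -!mulnA.
    rewrite -!big_distrr /= (@sum_delta _ c (fun k => F i j k)) ltnS cz mul1n mulnCA.
  over.
  by rewrite (@sum_delta _ b (fun j => inc1 a i * F i j c)) ltnS by_ mul1n.
- rewrite -(@sum_coinc1 ym b (fun b' => F a b' c)) ?odd_ym //.
  under eq_bigr => i _.
    under eq_bigr => j _.
      under eq_bigr => k _ do rewrite -!mulnA.
      rewrite -!big_distrr /= (@sum_delta _ c (fun k => F i j k)) ltnS cz mul1n.
    over.
    rewrite -big_distrr /=.
  over.
  by rewrite (@sum_delta _ a (fun i => \sum_(j < ym.+1) inc1 b j * F i j c)) ltnS ax mul1n.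
- rewrite -(@sum_coinc1 zm c (fun c' => F a b c')) ?odd_zm //.
  under eq_bigr => i _.
    under eq_bigr => j _.
      under eq_bigr => k _ do rewrite -!mulnA.
      rewrite -!big_distrr /=.
    over.
    rewrite -big_distrr /= (@sum_delta _ b (fun j => \sum_(k < zm.+1) inc1 c k * F i j k)) ltnS by_ mul1n.
  over.
  by rewrite (@sum_delta _ a (fun i => \sum_(k < zm.+1) inc1 c k * F i b k)) ltnS ax mul1n.
Qed.

Lemma inc_dim (t s : cell) : inc t s -> dim t = (dim s).+1.
Proof.
case: t => [[a b] c]; case: s => [[a' b'] c']; rewrite /inc /dim /=.
have h x y : inc1 x y -> odd y /\ ~~ odd x by rewrite /inc1; lia.
by case/or3P=> /and3P[]; [move=> /h[-> /negbTE->] /eqP-> /eqP->|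
  move=> /eqP-> /h[-> /negbTE->] /eqP->|move=> /eqP-> /eqP-> /h[-> /negbTE->]]; lia.
Qed.

Definition kcell k := {t : cell | in_surf t && (dim t == k)}.
Definition bdry k (t : kcell k.+1) : {set kcell k} := [set s | inc (val t) (val s)].

Lemma card_bdry k (t : kcell k.+1) : #|bdry t| = 2 * k.+1.
Proof.
case/andP: (valP t) => ts /eqP td.
rewrite -sum1_card (eq_bigl (fun s : kcell k => inc (val t) (val s))); last by move=> s; rewrite inE.
rewrite -(big_sub_cond [pred s | in_surf s && (dim s == k)] [pred s | inc (val t) s] (fun=> 1%N)) /=.
rewrite (eq_bigl (fun s => inc (val t) s)); last first.
  move=> s /=; rewrite !inE andbC; case: (boolP (inc _ _)) => //= h.
  by rewrite (surf_closed ts h) /=; have := inc_dim h; rewrite td => -[->]; rewrite eqxx.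
rewrite big_mkcond (eq_bigr (fun s => inc (val t) s * 1)) => [|s _]; last by rewrite muln1; case: (inc _ _).
rewrite (@bdry_sum _ (fun _ _ _ => 1) _ _ _ erefl erefl erefl).
by move: td; rewrite /dim; do 3!case: (odd _) => /=; lia.
Qed.

Lemma rim_oo a b : a <= xm -> odd a -> odd b -> rim a b = false.
Proof.
move=> ax oa ob; apply/negP => /or3P[/(exE ax)[]|/eyE[]|]; rewrite ?oa ?ob //.
rewrite (negbTE (pf_odd_d profile_x oa)) (negbTE (pf_odd_d profile_y ob)) !orbF /hole.
by case: (ox a); case: (oy b).
Qed.

Lemma rim_oe a b : a <= xm -> odd a -> rim a b = ey b || (ox a && dy b).
Proof.
move=> ax oa; rewrite /rim (negbTE (pf_odd_d profile_x oa)) orbF /hole.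
have -> : ex a = false by apply/negP => /(exE ax)[]; rewrite oa.
rewrite /=; congr (_ || _); case: (ox a) => //=.
by rewrite /oy /dy; lia.
Qed.

Lemma rim_eo a b : a <= xm -> odd b -> rim a b = ex a || (dx a && oy b).
Proof.
move=> ax ob; rewrite /rim (negbTE (pf_odd_d profile_y ob)) orbF /hole.
have -> : ey b = false by apply/negP => /eyE[]; rewrite ob.
rewrite /=; congr (_ || _); case: (oy b) => /=; rewrite ?andbF ?andbT //.
case: (boolP (odd a)) => oa.
  by rewrite (negbTE (pf_odd_d profile_x oa)) orbF andbN.
case: (boolP (dx a)) => d; last by rewrite orbF andbN.
by have [/negbTE->] := pf_d profile_x oa ax d; rewrite orbT.
Qed.

Lemma ez_odd c : odd c -> ez c = false.
Proof. by rewrite /ez /zm; lia. Qed.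

Lemma face_count_y (o : bool) b : b <= ym -> odd b = false ->
  [|| ~~ (o && oy b), ey b | o && dy b] ->
  (0 < b) * ~~ (o && oy b.-1) + (b < ym) * ~~ (o && oy b.+1) + (ey b || o && dy b) = 2.
Proof. by rewrite /ym /oy /ey /dy /ym; case: o => /=; lia. Qed.

(** The surface has no boundary. The three cases are the edges parallel to the x-, y- and z-axis; in
    each, the neighbouring cells are read off the profiles of the axes. *)
Lemma cobdry_two a b c : a <= xm -> b <= ym -> c <= zm -> surf a b c ->
  odd a + odd b + odd c = 1 ->
  (if odd a then 0 else (0 < a) * surf a.-1 b c + (a < xm) * surf a.+1 b c) +
  (if odd b then 0 else (0 < b) * surf a b.-1 c + (b < ym) * surf a b.+1 c) +
  (if odd c then 0 else (0 < c) * surf a b c.-1 + (c < zm) * surf a b c.+1) = 2.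
Proof.
move=> ax by_ cz.
have pz : ~~ odd c -> if ez c then (0 < c) + (c < zm) = 1 else (0 < c) && (c < zm).
  by move=> _; move: cz; rewrite /ez /zm; case: ifP; lia.
case oa: (odd a); case ob: (odd b); case oc: (odd c) => // sf _; rewrite ?add0n ?addn0.
- rewrite /surf.
  have od c' : odd c' -> ez c' && ~~ hole a b || rim a b = rim a b.
    by move=> h; rewrite ez_odd.
  have zz : (0 < c) * (ez c.-1 && ~~ hole a b || rim a b) + (c < zm) * (ez c.+1 && ~~ hole a b || rim a b)
      = ((0 < c) + (c < zm)) * rim a b.
    rewrite mulnDl; congr (_ + _); last by rewrite od //= oc.
    by case: (posnP c) => // c0; rewrite od //; lia.
  rewrite zz.
  have b1 : 0 < b -> rim a b.-1 = false.
    by move=> b0; apply: rim_oo => //; move: ob; rewrite -{1}(prednK b0) /=; case: (odd b.-1).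
  have b2 : rim a b.+1 = false by apply: rim_oo => //=; rewrite ob.
  have -> : (0 < b) * (ez c && ~~ hole a b.-1 || rim a b.-1) = (0 < b) * (ez c && ~~ hole a b.-1).
    by case: (posnP b) => // b0; rewrite b1 // orbF.
  rewrite b2 orbF.
  have {}pz := pz (negbT oc).
  move: sf; rewrite /surf rim_oe //; case: ifP pz => [_ ->|_ /andP[-> ->]] /=; last first.
    by move=> ->; rewrite !muln0.
  by rewrite mul1n; exact: face_count_y.
- rewrite /surf.
  have od c' : odd c' -> ez c' && ~~ hole a b || rim a b = rim a b.
    by move=> h; rewrite ez_odd.
  have zz : (0 < c) * (ez c.-1 && ~~ hole a b || rim a b) + (c < zm) * (ez c.+1 && ~~ hole a b || rim a b)
      = ((0 < c) + (c < zm)) * rim a b.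
    rewrite mulnDl; congr (_ + _); last by rewrite od //= oc.
    by case: (posnP c) => // c0; rewrite od //; lia.
  rewrite zz.
  have a1 : 0 < a -> rim a.-1 b = false.
    move=> a0; apply: rim_oo => //; first by apply: leq_trans ax; exact: leq_pred.
    by move: oa; rewrite -{1}(prednK a0) /=; case: (odd a.-1).
  have a2 : a < xm -> rim a.+1 b = false by move=> lt; apply: rim_oo => //=; rewrite oa.
  have -> : (0 < a) * (ez c && ~~ hole a.-1 b || rim a.-1 b) = (0 < a) * (ez c && ~~ hole a.-1 b).
    by case: (posnP a) => // a0; rewrite a1 // orbF.
  have -> : (a < xm) * (ez c && ~~ hole a.+1 b || rim a.+1 b) = (a < xm) * (ez c && ~~ hole a.+1 b).
    by case: (boolP (a < xm)) => // lt; rewrite a2 // orbF.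
  have {}pz := pz (negbT oc).
  move: sf; rewrite /surf rim_eo //; case: ifP pz => [_ ->|_ /andP[-> ->]] /=; last first.
    by move=> ->; rewrite !muln0.
  rewrite mul1n /hole.
  have px := profile_x; have M0 := pf_M0 px.
  have na : ~~ odd a by rewrite oa.
  case O: (ox a).
    have [-> ->] := pf_o px na ax O; have ra := pf_o_range px ax O; have /andP[a0 am] := ra.
    rewrite (ex_inner ra).
    have -> : dx a = false by apply/negbTE/negP => d; have [no _] := pf_d px na ax d; rewrite O in no.
    by rewrite a0 am; case: (oy b).
  case D: (dx a).
    have [_] := pf_d px na ax D; have ra := pf_d_range px ax D; have /andP[a0 am] := ra.
    rewrite (ex_inner ra) a0 am.
    by case: (ox a.-1); case: (ox a.+1); case: (oy b).
  have [/negbTE-> /negbTE->] := pf_out px na ax (negbT O) (negbT D).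
  by move=> _; rewrite /= orbF /ex; clear -ax M0; lia.
- have s1 a' b' : surf a' b' c = rim a' b' by rewrite /surf ez_odd.
  rewrite !s1; have r : rim a b by rewrite -s1.
  have px := profile_x; have M0 := pf_M0 px.
  have na : ~~ odd a by rewrite oa.
  have a1 : 0 < a -> rim a.-1 b = ey b || (ox a.-1 && dy b).
    move=> a0; apply: rim_oe; first by apply: leq_trans ax; exact: leq_pred.
    by move: oa; rewrite -{1}(prednK a0) /=; case: (odd a.-1).
  have a2 : a < xm -> rim a.+1 b = ey b || (ox a.+1 && dy b).
    by move=> lt; apply: rim_oe => //=; rewrite oa.
  have b1 : 0 < b -> rim a b.-1 = ex a || (dx a && oy b.-1).
    by move=> b0; apply: rim_eo => //; move: ob; rewrite -{1}(prednK b0) /=; case: (odd b.-1).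
  have b2 : rim a b.+1 = ex a || (dx a && oy b.+1) by apply: rim_eo => //=; rewrite ob.
  have -> : (0 < a) * rim a.-1 b = (0 < a) * (ey b || (ox a.-1 && dy b)).
    by case: (posnP a) => // a0; rewrite a1.
  have -> : (a < xm) * rim a.+1 b = (a < xm) * (ey b || (ox a.+1 && dy b)).
    by case: (boolP (a < xm)) => // lt; rewrite a2.
  have -> : (0 < b) * rim a b.-1 = (0 < b) * (ex a || (dx a && oy b.-1)).
    by case: (posnP b) => // b0; rewrite b1.
  rewrite b2; move: r; rewrite /rim /hole.
  case O: (ox a).
    have [-> ->] := pf_o px na ax O; have ra := pf_o_range px ax O; have /andP[a0 am] := ra.
    rewrite (ex_inner ra).
    have -> : dx a = false.
      by apply/negbTE/negP => d; have [no _] := pf_d px na ax d; rewrite O in no.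
    by rewrite a0 am /=; clear -N0 by_ ob; move: by_; rewrite /oy /dy /ey /ym; lia.
  case D: (dx a).
    have [_] := pf_d px na ax D; have ra := pf_d_range px ax D; have /andP[a0 am] := ra.
    rewrite (ex_inner ra).
    rewrite a0 am; case: (ox a.-1); case: (ox a.+1) => //= _;
      by clear -N0 by_ ob; move: by_; rewrite /oy /dy /ey /ym; lia.
  have [/negbTE-> /negbTE->] := pf_out px na ax (negbT O) (negbT D).
  by clear -N0 by_ ob ax M0; move: by_; rewrite /= !orbF /ex /ey /ym; lia.
Qed.

Lemma card_cobdry (e : kcell 1) : #|[set f : kcell 2 | e \in bdry f]| = 2.
Proof.
case/andP: (valP e) => es /eqP ed.
rewrite -sum1_card (eq_bigl (fun f : kcell 2 => inc (val f) (val e))); last by move=> f; rewrite !inE.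
rewrite -(big_sub_cond [pred s | in_surf s && (dim s == 2)] [pred s | inc s (val e)] (fun=> 1%N)) /=.
rewrite big_mkcond (eq_bigr (fun s => inc s (val e) * surf s.1.1 s.1.2 s.2)); last first.
  move=> s _; rewrite !inE /=; case: (boolP (inc _ _)) => h; rewrite ?andbF // andbT mul1n.
  by have := inc_dim h; rewrite ed => ->; rewrite eqxx andbT /in_surf; case: (surf _ _ _).
rewrite (@cobdry_sum _ (fun a b c => surf a b c) _ _ _ erefl erefl erefl).
by apply: cobdry_two => //; rewrite -ltnS.
Qed.

(** From a square to one of its vertices the two one-dimensional incidences can be taken in either
    order, so the count is even. *)
Lemma bdry_bdry (f : kcell 2) (v : kcell 0) :
  (\sum_e (e \in bdry f)%:R * (v \in bdry e)%:R = 0 :> 'F_2)%R.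
Proof.
case/andP: (valP f) => fs /eqP fd.
have -> : (\sum_(e : kcell 1) (e \in bdry f)%:R * (v \in bdry e)%:R)%R
    = ((\sum_s inc (val f) s * inc s (val v))%:R : 'F_2)%R.
  rewrite natr_sum (eq_bigr (fun e : kcell 1 => (inc (val f) (val e))%:R * (inc (val e) (val v))%:R)%R).
    2: by move=> e _; rewrite !inE.
  rewrite -(big_sub [pred s | in_surf s && (dim s == 1)]
    (fun s => (inc (val f) s)%:R * (inc s (val v))%:R)%R) /=.
  rewrite big_mkcond; apply: eq_bigr => s _; rewrite natrM inE /=.
  case: (boolP (inc (val f) s)) => h; last by rewrite mul0r if_same.
  by rewrite (surf_closed fs h); have := inc_dim h; rewrite fd => -[<-].
rewrite natF2; move: (val v) (val f) fd => {}v {fs}f fd.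
pose F a b c : nat := inc1 v.1.1 a * ((v.1.2 == b :> nat) * (v.2 == c :> nat)) +
  (v.1.1 == a :> nat) * (inc1 v.1.2 b * (v.2 == c :> nat)) +
  (v.1.1 == a :> nat) * ((v.1.2 == b :> nat) * inc1 v.2 c).
rewrite (eq_bigr (fun s : cell => inc f s * F s.1.1 s.1.2 s.2)); last by move=> s _; rewrite (incE s v).
rewrite (@bdry_sum f F _ _ _ erefl erefl erefl).
have ev n x : odd n = false -> inc1 x n = false by rewrite /inc1 => ->.
have od n x : odd n -> (x == n.-1 :> nat) + (x == n.+1 :> nat) = inc1 x n :> nat.
  by rewrite /inc1 => on; lia.
have opr n : odd n -> odd n.-1 = false by lia.
have osu n : odd n -> odd n.+1 = false by lia.
move: fd; rewrite /dim.
case oa: (odd f.1.1); case ob: (odd f.1.2); case oc: (odd f.2) => // _; rewrite /F ?addn0 ?add0n.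
- rewrite !(ev _ _ oc) !(ev _ _ (opr _ oa)) !(ev _ _ (osu _ oa)) !(ev _ _ (opr _ ob)) !(ev _ _ (osu _ ob)).
  rewrite !mul0n !muln0 !addn0 !add0n -mulnDl od // -mulnDr -mulnDl od //.
  by rewrite addnn ?oddM odd_double ?andbF.
- rewrite !(ev _ _ ob) !(ev _ _ (opr _ oa)) !(ev _ _ (osu _ oa)) !(ev _ _ (opr _ oc)) !(ev _ _ (osu _ oc)).
  rewrite !mul0n !muln0 !addn0 !add0n -mulnDl od // -!mulnDr od //.
  by rewrite addnn ?oddM odd_double ?andbF.
- rewrite !(ev _ _ oa) !(ev _ _ (opr _ ob)) !(ev _ _ (osu _ ob)) !(ev _ _ (opr _ oc)) !(ev _ _ (osu _ oc)).
  rewrite !mul0n !muln0 !addn0 !add0n -!mulnDr -!mulnDl od // od //.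
  by rewrite addnn ?oddM odd_double ?andbF.
Qed.

Definition mkc a b c : cell := (inord a, inord b, inord c).

Lemma mkcE a b c : a <= xm -> b <= ym -> c <= zm ->
  [/\ (mkc a b c).1.1 = a :> nat, (mkc a b c).1.2 = b :> nat & (mkc a b c).2 = c :> nat].
Proof. by move=> h1 h2 h3; rewrite /= !inordK. Qed.

Lemma mkc_surf a b c : a <= xm -> b <= ym -> c <= zm -> in_surf (mkc a b c) = surf a b c.
Proof. by move=> h1 h2 h3; rewrite /in_surf; have [-> -> ->] := mkcE h1 h2 h3. Qed.

Lemma mkc_dim a b c : a <= xm -> b <= ym -> c <= zm ->
  dim (mkc a b c) = odd a + odd b + odd c.
Proof. by move=> h1 h2 h3; rewrite /dim; have [-> -> ->] := mkcE h1 h2 h3. Qed.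

Lemma mkcK (t : cell) : mkc t.1.1 t.1.2 t.2 = t.
Proof. by case: t => [[a b] c]; rewrite /mkc /= !inord_val. Qed.

Lemma mkc_inc a b c a' b' c' : a <= xm -> b <= ym -> c <= zm ->
  a' <= xm -> b' <= ym -> c' <= zm ->
  [|| [&& inc1 a' a, b' == b & c' == c], [&& a' == a, inc1 b' b & c' == c] |
      [&& a' == a, b' == b & inc1 c' c]] ->
  inc (mkc a b c) (mkc a' b' c').
Proof.
by move=> h1 h2 h3 h1' h2' h3'; rewrite /inc -!val_eqE /= !inordK.
Qed.

Lemma chain_eq (A : Type) (G : nat -> A) lo k :
  (forall i, i < k -> G (lo + i.*2) = G (lo + i.*2).+2) -> G lo = G (lo + k.*2).
Proof.
elim: k => [|k IH] H; first by rewrite addn0.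
rewrite IH; last by move=> i ik; apply: H; exact: ltnW.
by rewrite H // doubleS !addnS.
Qed.

Lemma chain_to (A : Type) (G : nat -> A) lo hi : lo <= hi -> odd lo = odd hi ->
  (forall i, lo <= i -> i.+2 <= hi -> odd i = odd lo -> G i = G i.+2) -> G lo = G hi.
Proof.
move=> lh oo H; have hiE : hi = lo + ((hi - lo)./2).*2 by lia.
rewrite hiE; apply: chain_eq => i ik; apply: H; lia.
Qed.

Section Connected.

Local Notation F2 := 'F_2.

(** All vertices are joined to one corner. On a horizontal face one walks parallel to the y-axis to
    an outer wall without meeting a mouth, then down the wall and along its foot; from a tube or
    outer wall one first goes down the column. *)
Lemma vertices_connected (h : kcell 0 -> F2) :
  (forall (e : kcell 1) u v, u \in bdry e -> v \in bdry e -> h u = h v) ->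
  forall u v, h u = h v.
Proof.
move=> hE.
pose hh (t : cell) : F2 := if insub t is Some u then h u else 0%R.
have hop e s s' : in_surf e -> dim e = 1 -> inc e s -> inc e s' -> hh s = hh s'.
  move=> es ed i1 i2.
  have pe : in_surf e && (dim e == 1) by rewrite es ed.
  have ps : in_surf s && (dim s == 0) by rewrite (surf_closed es i1); have := inc_dim i1; rewrite ed => -[<-].
  have ps' : in_surf s' && (dim s' == 0) by rewrite (surf_closed es i2); have := inc_dim i2; rewrite ed => -[<-].
  rewrite /hh !insubT; apply: (hE (Sub e pe)); rewrite inE //.
pose G a b c := hh (mkc a b c).
have xh a b c : a.+2 <= xm -> b <= ym -> c <= zm -> ~~ odd a -> ~~ odd b -> ~~ odd c ->
    surf a.+1 b c -> G a b c = G a.+2 b c.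
  move=> h1 h2 h3 oa ob oc sf; apply: (hop (mkc a.+1 b c)); rewrite ?mkc_surf ?mkc_dim //=; try qlia;
    apply: mkc_inc => //; try qlia; rewrite /inc1 /= oa !eqxx /= ?orbT //.
have yh a b c : a <= xm -> b.+2 <= ym -> c <= zm -> ~~ odd a -> ~~ odd b -> ~~ odd c ->
    surf a b.+1 c -> G a b c = G a b.+2 c.
  move=> h1 h2 h3 oa ob oc sf; apply: (hop (mkc a b.+1 c)); rewrite ?mkc_surf ?mkc_dim //=; try qlia;
    apply: mkc_inc => //; try qlia; rewrite /inc1 /= ob !eqxx /= ?orbT //.
have zh a b c : a <= xm -> b <= ym -> c.+2 <= zm -> ~~ odd a -> ~~ odd b -> ~~ odd c ->
    surf a b c.+1 -> G a b c = G a b c.+2.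
  move=> h1 h2 h3 oa ob oc sf; apply: (hop (mkc a b c.+1)); rewrite ?mkc_surf ?mkc_dim //=; try qlia;
    apply: mkc_inc => //; try qlia; rewrite /inc1 /= oc !eqxx /= ?orbT //.
have oy0 := negbTE odd_ym; have ox0 := negbTE odd_xm; have oz0 := negbTE odd_zm.
have down a b c : a <= xm -> b <= ym -> c <= zm -> ~~ odd a -> ~~ odd b -> ~~ odd c ->
    rim a b -> G a b 0 = G a b c.
  move=> h1 h2 h3 oa ob oc r; apply: chain_to => //=; first by rewrite (negbTE oc).
  by move=> i _ ic oi; apply: zh => //; rewrite ?oi //; [qlia|rewrite /surf r orbT].
have base_y b : b = 0 \/ b = ym -> forall a, a <= xm -> ~~ odd a -> G 0 b 0 = G a b 0.
  move=> bE a ax oa.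
  have eb : ey b by rewrite /ey; case: bE => ->; rewrite eqxx ?orbT.
  have bm : b <= ym by case: bE => ->.
  have ob : ~~ odd b by case: (eyE eb).
  apply: (@chain_to _ (fun a => G a b 0)) => //=; first by rewrite (negbTE oa).
  by move=> i _ ic oi; apply: xh => //; rewrite ?oi //; [qlia|rewrite /surf /rim eb !orbT].
have base : G 0 0 0 = G 0 ym 0.
  apply: (@chain_to _ (fun b => G 0 b 0)) => //=.
  by move=> i _ ic oi; apply: yh => //; rewrite ?oi //; rewrite /surf /rim /ex eqxx !orbT.
have reach a b c : a <= xm -> b <= ym -> c <= zm -> ~~ odd a -> ~~ odd b -> ~~ odd c ->
    ez c -> ~~ hole a b -> G 0 0 0 = G a b c.
  move=> h1 h2 h3 oa ob oc ec nh.
  (* [4 * N] is y = 2, the far side of the mouths: from there on the way to y = 3 is free, and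
     before it the way to y = 0 is free for a vertex outside the mouths. *)
  have [hi|lo] := boolP ((4 * N <= b)).
    rewrite base (base_y ym (or_intror erefl) a) // (down a ym c) //; try by rewrite oy0.
      apply/esym; apply: (@chain_to _ (fun b => G a b c)) => //; first by rewrite oy0 (negbTE ob).
      move=> i bi ic oi; apply: yh => //; rewrite ?oi //.
      by rewrite /surf ec /hole /oy (_ : i.+1 < 4 * N = false) ?andbF //; qlia.
    by rewrite /rim /ey eqxx !orbT.
  rewrite (base_y 0 (or_introl erefl) a) // (down a 0 c) //.
    apply: (@chain_to _ (fun b => G a b c)) => //=; first by rewrite (negbTE ob).
    move=> i bi ic oi; apply: yh => //; rewrite ?oi //; first by qlia.
    rewrite /surf ec /=; apply/orP; left; move: nh; rewrite /hole /oy.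
    by case: (ox a) => //=; qlia.
  by rewrite /rim /ey eqxx !orbT.
have all_base (u : kcell 0) : h u = G 0 0 0.
  case/andP: (valP u) => us /eqP ud.
  have <- : hh (val u) = h u by rewrite /hh valK.
  move: (val u) us ud => t; rewrite /in_surf /dim => us ud.
  have oa : ~~ odd t.1.1 by qlia.
  have ob : ~~ odd t.1.2 by qlia.
  have oc : ~~ odd t.2 by qlia.
  have ax : t.1.1 <= xm by rewrite -ltnS.
  have bx : t.1.2 <= ym by rewrite -ltnS.
  have cx : t.2 <= zm by rewrite -ltnS.
  rewrite -(mkcK t) -/(G _ _ _); case/orP: us => [/andP[ec nh]|r].
    exact/esym/reach.
  by rewrite -(down _ _ _ ax bx cx oa ob oc r); apply/esym/reach => //; exact: rim_hole.
by move=> u v; rewrite !all_base.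
Qed.

(** The same walk on squares: horizontal squares are linked by rows and lines, top and bottom
    through the wall y = 0. A vertical square slides down its column and turns the corner onto a
    bottom square outside the mouth. *)
Lemma faces_connected (h : kcell 2 -> F2) :
  (forall (e : kcell 1) f f', e \in bdry f -> e \in bdry f' -> h f = h f') ->
  forall f f', h f = h f'.
Proof.
move=> hE.
pose hh (t : cell) : F2 := if insub t is Some u then h u else 0%R.
have hop e s s' : in_surf s -> in_surf s' -> dim s = 2 -> dim s' = 2 ->
    inc s e -> inc s' e -> hh s = hh s'.
  move=> ss ss' sd sd' i1 i2.
  have ps : in_surf s && (dim s == 2) by rewrite ss sd.
  have ps' : in_surf s' && (dim s' == 2) by rewrite ss' sd'.
  have pe : in_surf e && (dim e == 1).
    by rewrite (surf_closed ss i1); have := inc_dim i1; rewrite sd => -[<-].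
  by rewrite /hh !insubT; apply: (hE (Sub e pe)); rewrite inE.
pose G a b c := hh (mkc a b c).
have xh a b c : a.+2 <= xm -> b <= ym -> c <= zm -> odd a -> odd b -> ~~ odd c ->
    surf a b c -> surf a.+2 b c -> G a b c = G a.+2 b c.
  move=> h1 h2 h3 oa ob oc s1 s2; apply: (hop (mkc a.+1 b c)); rewrite ?mkc_surf ?mkc_dim //=; try qlia;
    apply: mkc_inc => //; try qlia; rewrite /inc1 /= ?oa ?negbK ?oa !eqxx /= ?orbT //.
have yh a b c : a <= xm -> b.+2 <= ym -> c <= zm -> odd a -> odd b -> ~~ odd c ->
    surf a b c -> surf a b.+2 c -> G a b c = G a b.+2 c.
  move=> h1 h2 h3 oa ob oc s1 s2; apply: (hop (mkc a b.+1 c)); rewrite ?mkc_surf ?mkc_dim //=; try qlia;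
    apply: mkc_inc => //; try qlia; rewrite /inc1 /= ?ob ?negbK ?ob !eqxx /= ?orbT //.
have zh a b c : a <= xm -> b <= ym -> c.+2 <= zm -> odd a + odd b = 1 -> odd c ->
    rim a b -> G a b c = G a b c.+2.
  move=> h1 h2 h3 oab oc r; apply: (hop (mkc a b c.+1)); rewrite ?mkc_surf ?mkc_dim //=; try qlia; try (by rewrite /surf r orbT);
    apply: mkc_inc => //; try qlia; rewrite /inc1 /= ?oc ?negbK ?oc !eqxx /= ?orbT //.
have cy a b c b' c' : a <= xm -> b <= ym -> c <= zm -> b' <= ym -> c' <= zm ->
    odd a -> ~~ odd b -> ~~ odd c -> inc1 b b' -> inc1 c c' -> rim a b -> surf a b' c ->
    G a b c' = G a b' c.
  move=> h1 h2 h3 h2' h3' oa ob oc ib ic r sf.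
  have [ob' _] := andP ib; have [oc' _] := andP ic.
  apply: (hop (mkc a b c)); rewrite ?mkc_surf ?mkc_dim //=; try (by qlia).
  + by rewrite /surf r orbT.
  + by apply: mkc_inc => //; rewrite ic !eqxx !orbT.
  + by apply: mkc_inc => //; rewrite ib !eqxx !orbT.
have cx a b c a' c' : a <= xm -> b <= ym -> c <= zm -> a' <= xm -> c' <= zm ->
    ~~ odd a -> odd b -> ~~ odd c -> inc1 a a' -> inc1 c c' -> rim a b -> surf a' b c ->
    G a b c' = G a' b c.
  move=> h1 h2 h3 h1' h3' oa ob oc ia ic r sf.
  have [oa' _] := andP ia; have [oc' _] := andP ic.
  apply: (hop (mkc a b c)); rewrite ?mkc_surf ?mkc_dim //=; try (by qlia).
  + by rewrite /surf r orbT.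
  + by apply: mkc_inc => //; rewrite ic !eqxx !orbT.
  + by apply: mkc_inc => //; rewrite ia !eqxx.
have oy0 := negbTE odd_ym; have ox0 := negbTE odd_xm; have oz0 := negbTE odd_zm.
have xm2 : 2 <= xm by have := pf_M0 profile_x; have := odd_xm; qlia.
have ym6 : 6 <= ym by rewrite /ym; qlia.
have zm2 : 2 <= zm by rewrite /zm; qlia.
have ez0 : ez 0 by []; have ezm : ez zm by rewrite /ez eqxx orbT.
have ox1 : ox 1 = false.
  have [h0 h1 h2] := @exE 0 isT isT.
  by have [_ /negbTE] := pf_out profile_x h0 isT h1 h2.
have row b c : odd b -> ez c -> oy b = false -> b <= ym -> forall a, a <= xm -> odd a -> G 1 b c = G a b c.
  move=> ob ec nb bm a ax oa.
  have sf a' : surf a' b c by rewrite /surf ec /hole nb andbF.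
  have cm : c <= zm by case/orP: ec => /eqP->.
  have oc : ~~ odd c by case/orP: ec => /eqP->; rewrite ?oz0.
  apply: (@chain_to _ (fun a => G a b c)) => //=; first by case: a oa ax.
  by move=> i i1 ia oi; apply: xh => //; qlia.
have horiz a b c : a <= xm -> b <= ym -> odd a -> odd b -> ez c -> ~~ hole a b -> G 1 1 c = G a b c.
  move=> ax bm oa ob ec nh.
  have cm : c <= zm by case/orP: ec => /eqP->.
  have oc : ~~ odd c by case/orP: ec => /eqP->; rewrite ?oz0.
  have [hi|lo] := boolP ((4 * N <= b)).
    have -> : G 1 1 c = G 1 ym.-1 c.
      apply: (@chain_to _ (fun b => G 1 b c)); try qlia.
      by move=> i i1 ib oi; apply: yh => //; try qlia; rewrite /surf ec /hole ox1.
    rewrite (row ym.-1 c _ ec _ _ a) //; try qlia; last by rewrite /oy /ym; qlia.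
    apply/esym; apply: (@chain_to _ (fun b => G a b c)) => //; try qlia.
    by move=> i i1 ib oi; apply: yh => //; try qlia; rewrite /surf ec /hole /oy; case: (ox a) => //=; qlia.
  rewrite (row 1 c _ ec _ _ a) //; try qlia; last by rewrite /oy; qlia.
  apply: (@chain_to _ (fun b => G a b c)); try qlia.
  move=> i i1 ib oi; apply: yh => //; try qlia; rewrite /surf ec; move: nh; rewrite /hole /oy;
    by case: (ox a) => //=; qlia.
have wall : G 1 1 0 = G 1 1 zm.
  have r0 : rim 1 0 by rewrite /rim /ey eqxx !orbT.
  have s1 c : ez c -> surf 1 1 c by move=> ec; rewrite /surf ec /hole ox1.
  rewrite -(cy 1 0 0 1 1) //; try qlia; last exact: s1.
  rewrite -(cy 1 0 zm 1 zm.-1) //; try qlia; try (by rewrite oz0).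
  - by apply: (@chain_to _ (fun c => G 1 0 c)); try qlia; move=> i i1 ic oi; apply: zh => //; qlia.
  - by rewrite /inc1; qlia.
  - exact: s1.
have flat a b c : a <= xm -> b <= ym -> odd a -> odd b -> ez c -> ~~ hole a b -> G 1 1 0 = G a b c.
  move=> ax bm oa ob ec nh; rewrite -(horiz a b c) //.
  by case/orP: ec => /eqP->.
have drop a b c : a <= xm -> b <= ym -> c <= zm -> odd a + odd b = 1 -> odd c -> rim a b ->
    G a b 1 = G a b c.
  move=> h1 h2 h3 oab oc r; apply: (@chain_to _ (fun c => G a b c)) => //; first by case: c oc {h3}.
  by move=> i i1 ic oi; apply: zh => //; qlia.
have all_base (u : kcell 2) : h u = G 1 1 0.
  case/andP: (valP u) => us /eqP ud.
  have <- : hh (val u) = h u by rewrite /hh valK.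
  move: (val u) us ud => t; rewrite /in_surf /dim => us ud.
  have ax : t.1.1 <= xm by rewrite -ltnS.
  have bx : t.1.2 <= ym by rewrite -ltnS.
  have ct : t.2 <= zm by rewrite -ltnS.
  rewrite -(mkcK t) -/(G _ _ _); move: us ud ax bx ct.
  move: (nat_of_ord t.1.1) (nat_of_ord t.1.2) (nat_of_ord t.2) => a b c us ud ax bx ct.
  case oc: (odd c); last first.
    have oa : odd a by qlia.
    have ob : odd b by qlia.
    case/orP: us => [/andP[ec nh]|r]; last by rewrite rim_oo in r.
    exact/esym/flat.
  have r : rim a b by move: us; rewrite /surf ez_odd.
  have oab : odd a + odd b = 1 by qlia.
  rewrite -(drop a b c) //.
  have nh := rim_hole ax r.
  case oa: (odd a).
    have ob : ~~ odd b by qlia.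
    have [b' ib /andP[bm nh']] : exists2 b', inc1 b b' & (b' <= ym) && ~~ hole a b'.
      move: nh; rewrite /hole; case: (ox a) => /= nb; last first.
        case: (posnP b) => b0; [exists b.+1|exists b.-1]; rewrite /inc1 ?andbT; qlia.
      have [lt|ge] := leqP b (2 * N).
        case: (posnP b) => b0; [exists b.+1|exists b.-1]; rewrite /inc1 /oy; qlia.
      by case: (ltnP b ym) => b1; [exists b.+1|exists b.-1]; rewrite /inc1 /oy; move: nb b1 bx; rewrite /oy /ym; qlia.
    rewrite (cy a b 0 b' 1) //; [|by qlia|by rewrite /surf nh'].
    by apply/esym/flat => //; case/andP: ib.
  have ob : odd b by qlia.
  have [a' ia /andP[am nh']] : exists2 a', inc1 a a' & (a' <= xm) && ~~ hole a' b.
    case: (boolP ((a < xm) && ~~ (ox a.+1 && oy b))) => [/andP[lt nn]|nn].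
      by exists a.+1; [rewrite /inc1 /= oa eqxx orbT|rewrite lt].
    have a0 : 0 < a.
      rewrite lt0n; apply/eqP => a00; move: nn; rewrite a00.
      rewrite ox1.
      by rewrite andbT; qlia.
    exists a.-1; first by rewrite /inc1; qlia.
    rewrite (_ : a.-1 <= xm) /=; last qlia.
    move: nn; rewrite negb_and negbK /hole => /orP[ge|/andP[o1 yb]].
      have aE : a = xm by qlia.
      have ee : ex a by rewrite /ex aE eqxx orbT.
      have [na no nd] := exE ax ee.
      by have [/negbTE->] := pf_out profile_x na ax no nd.
    rewrite yb andbT.
    have na : ~~ odd a by rewrite oa.
    have no : ~~ ox a by apply: contraNN nh => o; rewrite /hole o yb.
    case D: (dx a); last by have [] := pf_out profile_x na ax no (negbT D).
    by have [_] := pf_d profile_x na ax D; rewrite o1 addbT.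
  rewrite (cx a b 0 a' 1) //; [|by qlia..|by rewrite /surf nh'].
  by apply/esym/flat => //; case/andP: ia.
by move=> f f'; rewrite !all_base.
Qed.

End Connected.

(** * Euler characteristic of the subdivided surface *)

Section Euler.
Local Open Scope ring_scope.

(** Euler characteristic of a set of cells of the line, with -1 for an open interval. It is additive
    over disjoint sets of cells, which permits inclusion-exclusion. *)
Definition sgn_sum M (p : pred nat) : int := \sum_(a < M.+1) (-1) ^+ a * (p a)%:R.

Lemma sum_sgn k : \sum_(a < k) (-1) ^+ a = (odd k)%:R :> int.
Proof.
elim: k => [|k IH]; first by rewrite big_ord0.
by rewrite big_ord_recr /= IH -signr_odd; case: (odd k).
Qed.

Lemma sgn_sum_lt M k : (k <= M.+1)%N -> sgn_sum M (fun a => (a < k)%N) = (odd k)%:R.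
Proof.
move=> kM; rewrite -sum_sgn (big_ord_widen _ (fun a => (-1) ^+ a) kM) big_mkcond /=.
by apply: eq_bigr => a _; case: ifP => _; rewrite ?mulr1 ?mulr0.
Qed.

Lemma sgn_sum_eq M k : (k <= M)%N -> sgn_sum M (eq_op^~ k) = (-1) ^+ k.
Proof.
move=> kM; rewrite /sgn_sum (bigD1 (Ordinal (kM : k < M.+1)%N)) //= eqxx mulr1 big1 ?addr0 // => a.
by rewrite -val_eqE /= => /negbTE->; rewrite mulr0.
Qed.

Lemma sgn_sumT M : ~~ odd M -> sgn_sum M predT = 1.
Proof.
move=> oM; rewrite /sgn_sum (eq_bigr (fun a : 'I_M.+1 => (-1) ^+ a)) => [|a _]; last by rewrite mulr1.
by rewrite sum_sgn /= oM.
Qed.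

Lemma sgn_sum_split M (p q r : pred nat) : (forall a, (a <= M)%N -> (p a + q a)%N = r a :> nat) ->
  sgn_sum M p + sgn_sum M q = sgn_sum M r.
Proof.
move=> H; rewrite /sgn_sum -big_split /=; apply: eq_bigr => a _.
by rewrite -mulrDr -natrD H // -ltnS.
Qed.

Lemma sgn_sum_exists M n (p : 'I_n -> pred nat) :
  (forall a i j, p i a -> p j a -> i = j) ->
  sgn_sum M (fun a => [exists i, p i a]) = \sum_i sgn_sum M (p i).
Proof.
move=> u; rewrite /sgn_sum exchange_big /=; apply: eq_bigr => a _.
rewrite -big_distrr /=; congr (_ * _).
case: existsP => [[i pi]|no]; last first.
  by rewrite big1 // => i _; case: (boolP (p i a)) => // pi; case: no; exists i.
rewrite (bigD1 i) //= pi big1 ?addr0 // => j ji.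
by case: (boolP (p j a)) => // pj; rewrite (u _ _ _ pi pj) eqxx in ji.
Qed.

Lemma sgn_sum_ends M : ~~ odd M -> (0 < M)%N -> sgn_sum M (fun a => (a == 0%N) || (a == M)) = 2.
Proof.
move=> oM M0; rewrite -(@sgn_sum_split M (eq_op^~ 0%N) (eq_op^~ M)).
  by rewrite !sgn_sum_eq // -[(-1) ^+ M]signr_odd (negbTE oM).
by move=> a aM; lia.
Qed.

Lemma sgn_sum_interval M lo hi : (lo < hi)%N -> (hi <= M)%N -> ~~ odd lo -> ~~ odd hi ->
  sgn_sum M (fun a => (lo < a < hi)%N) = -1.
Proof.
move=> lh hM ol oh.
have : sgn_sum M (fun a => (a < lo.+1)%N) + sgn_sum M (fun a => (lo < a < hi)%N)
    = sgn_sum M (fun a => (a < hi)%N).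
  by apply: sgn_sum_split => a aM; lia.
rewrite !sgn_sum_lt /=; [|lia|lia].
by rewrite ol (negbTE oh) => /eqP; rewrite addrC addr_eq0 => /eqP.
Qed.

Lemma sum_oy : sgn_sum ym oy = -1.
Proof. by apply: sgn_sum_interval; rewrite /ym ?oddM //; lia. Qed.

Lemma sum_dy : sgn_sum ym dy = 2.
Proof.
rewrite /dy -(@sgn_sum_split ym (eq_op^~ (2 * N)%N) (eq_op^~ (4 * N)%N)).
  by rewrite !sgn_sum_eq ?/ym; [rewrite -signr_odd -[X in _ + X]signr_odd !oddM|lia|lia].
by move=> a aM; lia.
Qed.

Lemma sum_ox : sgn_sum xm ox = - g%:R.
Proof.
rewrite /ox sgn_sum_exists.
  rewrite (eq_bigr (fun=> -1)) ?sumr_const ?card_ord ?mulNrn // => i _.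
  apply: sgn_sum_interval; rewrite ?mulN_odd ?ltn_pmul2l ?muln_gt0 //.
  - by rewrite ltn_add2l.
  - by rewrite /xm leq_mul2l; have := ltn_ord i; lia.
move=> a i j /andP[h1 h2] /andP[h3 h4]; apply/val_inj => /=.
by have := mulN_lt (ltn_trans h1 h4); have := mulN_lt (ltn_trans h3 h2); lia.
Qed.

Lemma sum_dx : sgn_sum xm dx = (2 * g)%:R.
Proof.
rewrite /dx sgn_sum_exists.
  rewrite (eq_bigr (fun=> 2)) ?sumr_const ?card_ord.
    by rewrite mulrnA.
  move=> i _; rewrite -(@sgn_sum_split xm (eq_op^~ (2 * N * (2 * i + 1))%N) (eq_op^~ (2 * N * (2 * i + 2))%N)).
    rewrite !sgn_sum_eq; first by rewrite -signr_odd -[X in _ + X]signr_odd !mulN_odd.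
      by rewrite /xm leq_mul2l; have := ltn_ord i; lia.
    by rewrite /xm leq_mul2l; have := ltn_ord i; lia.
  move=> a aM; have : (2 * N * (2 * i + 1) < 2 * N * (2 * i + 2))%N.
    by rewrite ltn_pmul2l ?muln_gt0 // ltn_add2l.
  by lia.
move=> a i j /orP[]/eqP h1 /orP[]/eqP h2; apply/val_inj => /=; move: h2; rewrite h1 => /eqP;
  by rewrite eqn_pmul2l ?muln_gt0 //; lia.
Qed.

Lemma surf_dim (t : cell) : in_surf t -> (dim t <= 2)%N.
Proof.
rewrite /in_surf /dim; case oa: (odd t.1.1); case ob: (odd t.1.2); case oc: (odd t.2) => //.
by rewrite /surf ez_odd // rim_oo // -ltnS.
Qed.

Lemma sum_surf_z (a : 'I_xm.+1) b :
  \sum_(c < zm.+1) (-1) ^+ c * (surf a b c)%:R = 2 * (~~ hole a b)%:R - (rim a b)%:R :> int.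
Proof.
have e2 : sgn_sum zm ez = 2 by apply: sgn_sum_ends; [exact: odd_zm|rewrite /zm; lia].
rewrite (eq_bigr (fun c : 'I_zm.+1 => (-1) ^+ c * (ez c)%:R * (~~ hole a b)%:R
    + ((-1) ^+ c * 1 * (rim a b)%:R - (-1) ^+ c * (ez c)%:R * (rim a b)%:R))).
  rewrite big_split sumrB /= -!big_distrl /=.
  have -> : \sum_(c < zm.+1) (-1) ^+ c * (ez c)%:R = 2 :> int by exact: e2.
  by rewrite sum_sgn /= odd_zm; case: (hole a b); case: (rim a b).
move=> c _; rewrite /surf.
have rh : rim a b -> ~~ hole a b by apply: rim_hole; rewrite -ltnS.
move: ((-1) ^+ c : int) rh => s.
by case: (ez c); case: (hole a b); case: (rim a b) => //= rh; try (by have := rh isT);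
  rewrite ?(mulr0, mulr1, mul0r) ?(subr0, subrr) ?(addr0, add0r).
Qed.

Lemma euler_cells : (#|{: kcell 1%N}| + 2 = #|{: kcell 0%N}| + #|{: kcell 2%N}| + 2 * g)%N.
Proof.
have ck k : #|{: kcell k}|%:R = \sum_(t : cell) (in_surf t && (dim t == k))%:R :> int.
  rewrite card_sig -sum1_card natr_sum big_mkcond /=; apply: eq_bigr => t _.
  by rewrite !inE; case: (_ && _).
suff : #|{: kcell 0%N}|%:R - #|{: kcell 1%N}|%:R + #|{: kcell 2%N}|%:R = 2 - (2 * g)%:R :> int.
  by clear ck; move: #|{: kcell 0%N}| #|{: kcell 1%N}| #|{: kcell 2%N}| => c0 c1 c2; lia.
rewrite !ck -sumrB -big_split /=.
rewrite (eq_bigr (fun t : cell => (-1) ^+ t.1.1 * ((-1) ^+ t.1.2 * ((-1) ^+ t.2 * (in_surf t)%:R)))); last first.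
  move=> t _; rewrite -signr_odd -[(-1) ^+ t.1.2]signr_odd -[(-1) ^+ t.2]signr_odd.
  case: (boolP (in_surf t)) => [/surf_dim|_]; last by rewrite /= !mulr0.
  by rewrite /dim; do 3!case: (odd _).
have -> : \sum_(t : cell) (-1) ^+ t.1.1 * ((-1) ^+ t.1.2 * ((-1) ^+ t.2 * (in_surf t)%:R))
  = \sum_(a < xm.+1) \sum_(b < ym.+1) \sum_(c < zm.+1)
      (-1) ^+ a * ((-1) ^+ b * ((-1) ^+ c * (surf a b c)%:R)) :> int.
  by rewrite pair_bigA /= pair_bigA /=; apply: eq_bigr => -[[a b] c].
(* The alternating sum over a column is twice the indicator of no [hole] minus that of [rim].
   Inclusion-exclusion writes it with products of a function of [a] and one of [b], so that the
   double sums factor. *)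
rewrite (eq_bigr (fun a : 'I_xm.+1 => \sum_(b < ym.+1)
    ((-1) ^+ a * (-1) ^+ b * 2
     - ((-1) ^+ a * (ox a)%:R) * ((-1) ^+ b * (oy b)%:R)
     - ((-1) ^+ a * (ex a)%:R) * ((-1) ^+ b * 1)
     - ((-1) ^+ a * 1) * ((-1) ^+ b * (ey b)%:R)
     + ((-1) ^+ a * (ex a)%:R) * ((-1) ^+ b * (ey b)%:R)
     - ((-1) ^+ a * ((ox a)%:R + (dx a)%:R)) * ((-1) ^+ b * ((oy b)%:R + (dy b)%:R))))); last first.
  move=> a _; apply: eq_bigr => b _.
  rewrite -big_distrr /= -big_distrr /= sum_surf_z.
  have ax : (a <= xm)%N by rewrite -ltnS.
  have xd : ox a -> dx a = false.
    move=> o; apply/negbTE/negP => d; have [oa|oa] := boolP (odd a).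
      by have := pf_odd_d profile_x oa; rewrite d.
    by have [no _] := pf_d profile_x oa ax d; rewrite o in no.
  have ye : ey b -> oy b = false /\ dy b = false by case/eyE=> _ /negbTE-> /negbTE->.
  have xe : ex a -> ox a = false /\ dx a = false by case/(exE ax)=> _ /negbTE-> /negbTE->.
  have yd : oy b -> dy b = false by rewrite /oy /dy; lia.
  rewrite /rim /hole; move: xd ye xe yd; move: ((-1) ^+ a : int) ((-1) ^+ b : int) => A B.
  case: (ox a); case: (dx a); case: (ex a); case: (oy b); case: (dy b); case: (ey b) => /= xd ye xe yd;
    try (by have := xd isT); try (by have := yd isT); try (by case: (xe isT)); try (by case: (ye isT));
    by rewrite ?mulr0 ?mulr1 ?addr0 ?add0r ?mul0r; lia.
under eq_bigr => a _ do rewrite !big_split /= !sumrN.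
rewrite !big_split /= !sumrN.
have P (p : 'I_xm.+1 -> int) (q : 'I_ym.+1 -> int) :
    \sum_a \sum_b p a * q b = (\sum_a p a) * (\sum_b q b) by rewrite big_distrlr.
rewrite !P.
have -> : \sum_(a < xm.+1) \sum_(b < ym.+1) (-1) ^+ a * (-1) ^+ b * 2 = 2 :> int.
  under eq_bigr => a _ do rewrite -big_distrl /= -big_distrr /=.
  by rewrite -big_distrl /= -big_distrl /= !sum_sgn /= (negbTE odd_xm) (negbTE odd_ym).
rewrite -!/(sgn_sum _ _) -/(sgn_sum xm ox) -/(sgn_sum ym oy) -/(sgn_sum xm ex) -/(sgn_sum ym ey)
  -/(sgn_sum xm predT) -/(sgn_sum ym predT).
have -> : \sum_(a < xm.+1) (-1) ^+ a * ((ox a)%:R + (dx a)%:R) = - g%:R + (2 * g)%:R :> int.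
  by rewrite -sum_ox -sum_dx -big_split /=; apply: eq_bigr => a _; rewrite mulrDr.
have -> : \sum_(b < ym.+1) (-1) ^+ b * ((oy b)%:R + (dy b)%:R) = -1 + 2 :> int.
  transitivity (sgn_sum ym oy + sgn_sum ym dy); last by rewrite sum_oy sum_dy.
  by rewrite -big_split /=; apply: eq_bigr => a _; rewrite mulrDr.
rewrite sum_ox sum_oy !sgn_sumT ?odd_xm ?odd_ym // !sgn_sum_ends ?odd_xm ?odd_ym ?(pf_M0 profile_x) ?(pf_M0 profile_y) //.
by lia.
Qed.

End Euler.

End Cubes.

(** * Branch sets *)

Lemma connect_exit (V : finType) (r : rel V) (P : pred V) a b :
  connect r a b -> P a -> ~~ P b -> exists c d, [/\ r c d, P c & ~~ P d].
Proof.
case/connectP=> p; elim: p a => [|c p IH] a /=; first by move=> _ -> ->.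
case/andP=> rac rp lp Pa Pb; have [Pc|Pc] := boolP (P c); first exact: IH rp lp Pc Pb.
by exists a, c.
Qed.

Lemma connect_homo (V : finType) (r r' : rel V) (P : pred V) a b :
  (forall x y, P x -> r x y -> P y /\ r' x y) -> P a -> connect r a b -> connect r' a b.
Proof.
move=> H + /connectP[p]; elim: p a => [|c p IH] a /= Pa; first by move=> _ ->.
case/andP=> rac rp lp; have [Pc r'ac] := H _ _ Pa rac.
exact: connect_trans (connect1 r'ac) (IH _ Pc rp lp).
Qed.

Section BranchSets.
Variables (HV HE : finType) (iv : HE -> {set HV}).

Definition link (A : {set HV}) : rel HV :=
  [rel a b | [exists h, [&& iv h == [set a; b], a \in A & b \in A]]].

Definition linked (A : {set HV}) := forall a b, a \in A -> b \in A -> connect (link A) a b.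

Lemma link_sym A : symmetric (link A).
Proof.
by move=> a b; apply/existsP/existsP => -[h /and3P[i1 i2 i3]]; exists h; rewrite i2 i3 !andbT setUC.
Qed.

Lemma link_csym A : connect_sym (link A).
Proof. by apply: sym_connect_sym; exact: link_sym. Qed.

Lemma connect_linkS (A B : {set HV}) a b :
  A \subset B -> connect (link A) a b -> connect (link B) a b.
Proof.
move=> AB; apply: connect_sub => c d /existsP[h /and3P[i1 i2 i3]].
by apply: connect1; apply/existsP; exists h; rewrite i1 !(subsetP AB).
Qed.

Variables (T : finType) (E : {set {set T}}) (tl hd : {set T} -> T).
(** [K v] stands for what the mesh sees of the arcs close to the vertex [v], and [M e] for what it
    sees of the middle of [e]. A middle may overlap the sets of both its ends, so it is not yet a
    host edge between disjoint branch sets. *)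
Variables (K : T -> {set HV}) (M : {set T} -> {set HV}) (h0 : HE).
Hypothesis ends : forall e, e \in E -> e = [set tl e; hd e] /\ tl e != hd e.
Hypothesis Klinked : forall v, linked (K v).
Hypothesis Mlinked : forall e, e \in E -> linked (M e).
Hypothesis Kdisj : forall u v a, a \in K u -> a \in K v -> u = v.
Hypothesis Mdisj : forall e f a, e \in E -> f \in E -> a \in M e -> a \in M f -> e = f.
Hypothesis MKdisj : forall e v a, e \in E -> a \in M e -> a \in K v -> v \in e.
Hypothesis MKmeet : forall e v, e \in E -> v \in e -> exists a, a \in M e /\ a \in K v.

(** The part of the middle that hangs on the tail outside the set of the head. It joins the branch
    set of the tail; what then represents [e] is a host edge by which the connected middle enters
    [K (hd e)]. *)
Definition tail_part e : {set HV} :=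
  [set c | [exists a, [&& a \in K (tl e), a \in M e & connect (link (M e :\: K (hd e))) a c]]].

Lemma tail_partP e c : e \in E -> c \in tail_part e -> c \in M e :\: K (hd e).
Proof.
move=> eE; rewrite inE => /existsP[a /and3P[aK aM ac]].
have [_ th] := ends eE.
have aD : a \in M e :\: K (hd e).
  by rewrite inE aM andbT; apply/negP => /(Kdisj aK) /eqP; rewrite (negbTE th).
have [//|cD] := boolP (c \in M e :\: K (hd e)).
have [x [y [/existsP[h /and3P[_ _ yD]] _]]] := connect_exit (P := mem (M e :\: K (hd e))) ac aD cD.
by rewrite /= yD.
Qed.

Lemma tail_part_step e c d : c \in tail_part e -> link (M e :\: K (hd e)) c d -> d \in tail_part e.
Proof.
rewrite !inE => /existsP[a /and3P[aK aM ac]] cd; apply/existsP; exists a.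
by rewrite aK aM (connect_trans ac (connect1 cd)).
Qed.

Lemma tail_part_exit e : e \in E ->
  exists h c b, [/\ iv h = [set c; b], c \in tail_part e & b \in K (hd e)].
Proof.
move=> eE; have [ee th] := ends eE.
have [|a [aM aK]] := MKmeet (v := tl e) eE; first by rewrite {2}ee !inE eqxx.
have [|b [bM bK]] := MKmeet (v := hd e) eE; first by rewrite {2}ee !inE eqxx orbT.
have aC : a \in tail_part e by rewrite inE; apply/existsP; exists a; rewrite aK aM connect0.
have bC : b \notin tail_part e.
  by apply/negP => /(tail_partP eE); rewrite inE bK.
have [c [d [/existsP[h /and3P[/eqP ih cM dM]] cC dC]]] :=
  connect_exit (P := mem (tail_part e)) (Mlinked eE aM bM) aC bC.
exists h, c, d; split=> //; have [//|dK] := boolP (d \in K (hd e)).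
case/negP: dC; apply: (@tail_part_step _ c d cC).
by apply/existsP; exists h; rewrite ih eqxx (tail_partP eE cC) inE dK dM.
Qed.

Definition branch v : {set HV} := K v :|: \bigcup_(e in E | tl e == v) tail_part e.

Lemma branch_linked v : linked (branch v).
Proof.
have KB : K v \subset branch v by exact: subsetUl.
have toK a : a \in branch v -> exists2 k, k \in K v & connect (link (branch v)) a k.
  rewrite inE => /orP[aK|]; first by exists a.
  case/bigcupP=> e /andP[eE /eqP te] ac; have := ac.
  rewrite inE => /existsP[k /and3P[kK kM kc]]; exists k; first by rewrite -te.
  rewrite link_csym; apply: (@connect_linkS (tail_part e)).
    by apply: subset_trans (subsetUr _ _); apply: bigcup_sup; rewrite eE te eqxx.
  apply: (connect_homo (P := mem (tail_part e)) _ _ kc).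
    move=> x y /= xC xy; have yC := tail_part_step xC xy; split=> //.
    by case/existsP: xy => h /and3P[ih _ _]; apply/existsP; exists h; rewrite ih xC yC.
  by rewrite /= inE; apply/existsP; exists k; rewrite kK kM connect0.
move=> a b /toK[k kK ak] /toK[l lK bl].
apply: connect_trans ak _; rewrite link_csym; apply: connect_trans bl _.
exact: connect_linkS KB (Klinked lK kK).
Qed.

Lemma branch_disj u v a : a \in branch u -> a \in branch v -> u = v.
Proof.
have KC w e : e \in E -> a \in K w -> a \in tail_part e -> tl e = w.
  move=> eE aK /(tail_partP eE); rewrite inE => /andP[nK aM].
  have := MKdisj eE aM aK; have [ee _] := ends eE; rewrite {1}ee !inE => /orP[]/eqP // wh.
  by rewrite -wh aK in nK.
rewrite !inE => /orP[aK|/bigcupP[e /andP[eE /eqP<-] ae]]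
  /orP[aK'|/bigcupP[f /andP[fE /eqP<-] af]].
- exact: Kdisj aK aK'.
- by rewrite (KC _ _ fE aK af).
- by rewrite (KC _ _ eE aK' ae).
move: (tail_partP eE ae) (tail_partP fE af); rewrite !inE => /andP[_ aM] /andP[_ aM'].
by rewrite (Mdisj eE fE aM aM').
Qed.

Lemma branch_sets : exists (U : T -> {set HV}) (x : {set T} -> HE),
  [/\ forall u v a, a \in U u -> a \in U v -> u = v,
      forall v, linked (U v) &
      forall e, e \in E -> exists u v a b,
        [/\ e = [set u; v], iv (x e) = [set a; b], a \in U u & b \in U v]].
Proof.
pose good e h := [exists c in tail_part e, exists b in K (hd e), iv h == [set c; b]].
exists branch, (fun e => odflt h0 [pick h | good e h]); split.
- exact: branch_disj.
- exact: branch_linked.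
move=> e eE; case: pickP => [h /existsP[c /andP[cC /existsP[b /andP[bK /eqP ih]]]]|no] /=; last first.
  have [h [c [b [ih cC bK]]]] := tail_part_exit eE.
  have := no h; suff -> : good e h by [].
  by apply/existsP; exists c; rewrite cC; apply/existsP; exists b; rewrite bK ih eqxx.
exists (tl e), (hd e), c, b; split=> //; first by case: (ends eE).
  by rewrite inE; apply/orP; right; apply/bigcupP; exists e; rewrite ?eE ?eqxx.
by rewrite inE bK.
Qed.

End BranchSets.

(** * Vertices of a closed cell *)

Section Cells.
Variables (N g : nat).
Hypothesis N0 : 0 < N.

Definition face1 s t := (s == t) || inc1 s t.

Lemma face1xx s : face1 s s.
Proof. by rewrite /face1 eqxx. Qed.

Lemma face1_le M s t : ~~ odd M -> t <= M -> face1 s t -> s <= M.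
Proof. by rewrite /face1 /inc1; lia. Qed.

Lemma surf_face a b c a' b' c' : a <= xm N g -> b <= ym N -> c <= zm N ->
  surf N g a b c -> face1 a' a -> face1 b' b -> face1 c' c -> surf N g a' b' c'.
Proof.
move=> ha hb hc s fa fb fc.
have ha' : a' <= xm N g by apply: face1_le fa => //; exact: odd_xm.
have hb' : b' <= ym N by apply: face1_le fb => //; exact: odd_ym.
have hc' : c' <= zm N by apply: face1_le fc => //; exact: odd_zm.
have s1 : surf N g a' b c.
  case/orP: fa => [/eqP->//|fa]; rewrite -mkc_surf //.
  by apply: (surf_closed N0 (t := mkc N g a b c)); rewrite ?mkc_surf // mkc_inc // fa !eqxx.
have s2 : surf N g a' b' c.
  case/orP: fb => [/eqP->//|fb]; rewrite -mkc_surf //.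
  by apply: (surf_closed N0 (t := mkc N g a' b c)); rewrite ?mkc_surf // mkc_inc // fb !eqxx ?orbT.
case/orP: fc => [/eqP->//|fc]; rewrite -mkc_surf //.
by apply: (surf_closed N0 (t := mkc N g a' b' c)); rewrite ?mkc_surf // mkc_inc // fc !eqxx ?orbT.
Qed.

Lemma edge_cell : kcell N g 1.
Proof.
apply: (exist (fun t : cell N g => in_surf t && (dim t == 1)) (mkc N g 1 0 0)); rewrite mkc_surf ?mkc_dim //; rewrite /surf /rim /ey ?eqxx ?orbT //.
all: rewrite /xm; lia.
Qed.

Lemma face_vertex a b c a' b' c' : a <= xm N g -> b <= ym N -> c <= zm N -> surf N g a b c ->
  face1 a' a -> face1 b' b -> face1 c' c -> ~~ odd a' -> ~~ odd b' -> ~~ odd c' ->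
  exists v : kcell N g 0,
    [/\ (val v).1.1 = a' :> nat, (val v).1.2 = b' :> nat & (val v).2 = c' :> nat].
Proof.
move=> ha hb hc s fa fb fc oa ob oc.
have ha' : a' <= xm N g by apply: face1_le fa => //; exact: odd_xm.
have hb' : b' <= ym N by apply: face1_le fb => //; exact: odd_ym.
have hc' : c' <= zm N by apply: face1_le fc => //; exact: odd_zm.
have hv : in_surf (mkc N g a' b' c') && (dim (mkc N g a' b' c') == 0).
  rewrite mkc_surf // mkc_dim // (surf_face ha hb hc s) //=.
  by rewrite (negbTE oa) (negbTE ob) (negbTE oc).
have [e1 e2 e3] := mkcE ha' hb' hc'.
by exists (exist (fun t : cell N g => in_surf t && (dim t == 0)) _ hv); rewrite /= e1 e2 e3.
Qed.

(** Pass from one vertex to the other by changing one coordinate at a time; each change runs along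
    an edge of the closed cell. *)
Lemma closed_cell_linked a b c (A : {set kcell N g 0}) :
  a <= xm N g -> b <= ym N -> c <= zm N -> surf N g a b c ->
  (forall v : kcell N g 0, v \in A <->
     [/\ face1 (val v).1.1 a, face1 (val v).1.2 b & face1 (val v).2 c]) ->
  linked (@bdry N g 0) A.
Proof.
move=> ha hb hc s AP.
have step (t : cell N g) (u v : kcell N g 0) : u \in A -> v \in A -> in_surf t -> dim t = 1 ->
    inc t (val u) -> inc t (val v) -> u != v -> link (@bdry N g 0) A u v.
  move=> uA vA ts td tu tv uv; have ht : in_surf t && (dim t == 1) by rewrite ts td.
  apply/existsP; exists (exist (fun t : cell N g => in_surf t && (dim t == 1)) t ht); rewrite uA vA !andbT eq_sym eqEcard cards2 uv card_bdry //=.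
  by rewrite andbT; apply/subsetP => w; rewrite !inE => /orP[]/eqP->.
have even (v : kcell N g 0) : [/\ ~~ odd (val v).1.1, ~~ odd (val v).1.2 & ~~ odd (val v).2].
  by have := valP v => /andP[_]; rewrite /dim; do 3!case: (odd _).
have mk a' b' c' : face1 a' a -> face1 b' b -> face1 c' c -> ~~ odd a' -> ~~ odd b' -> ~~ odd c' ->
    exists v : kcell N g 0, [/\ v \in A, (val v).1.1 = a' :> nat, (val v).1.2 = b' :> nat & (val v).2 = c' :> nat].
  move=> fa fb fc oa ob oc.
  have [v [e1 e2 e3]] := face_vertex ha hb hc s fa fb fc oa ob oc.
  by exists v; split=> //; apply/AP; rewrite e1 e2 e3.
have two M s' t' : face1 s' M -> face1 t' M -> ~~ odd s' -> ~~ odd t' -> s' != t' ->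
   [/\ odd M, inc1 s' M & inc1 t' M] by rewrite /face1 /inc1 => f1 f2 o1 o2 st; split; lia.
have stepx (u v : kcell N g 0) : u \in A -> v \in A -> (val u).1.2 = (val v).1.2 :> nat -> (val u).2 = (val v).2 :> nat ->
    connect (link (@bdry N g 0) A) u v.
  move=> uA vA e2 e3; have [->//|uv] := eqVneq u v; apply: connect1.
  have /AP[fa fb fc] := uA; have /AP[fa' fb' fc'] := vA.
  have [o1 o2 o3] := even u; have [o1' o2' o3'] := even v.
  have n1 : (val u).1.1 != (val v).1.1 :> nat.
    apply: contra uv => /eqP e1; apply/eqP/val_inj.
    by rewrite -(mkcK (val u)) -(mkcK (val v)) e1 e2 e3.
  have [oa i1 i2] := two _ _ _ fa fa' o1 o1' n1.
  have sf : surf N g a (val u).1.2 (val u).2 by exact: (surf_face ha hb hc s (face1xx _) fb fc).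
  apply: (step (mkc N g a (val u).1.2 (val u).2)) => //.
  - by rewrite (mkc_surf ha (leq_ord _) (leq_ord _)).
  - by rewrite (mkc_dim ha (leq_ord _) (leq_ord _)) oa (negbTE o2) (negbTE o3).
  - have := mkc_inc ha (leq_ord _) (leq_ord _) (leq_ord (val u).1.1) (leq_ord (val u).1.2) (leq_ord (val u).2); rewrite mkcK; apply.
    by rewrite i1 !eqxx ?orbT.
  - have := mkc_inc ha (leq_ord _) (leq_ord _) (leq_ord (val v).1.1) (leq_ord (val v).1.2) (leq_ord (val v).2); rewrite mkcK; apply.
    by rewrite i2 -e2 -e3 !eqxx ?orbT.
have stepy (u v : kcell N g 0) : u \in A -> v \in A -> (val u).1.1 = (val v).1.1 :> nat -> (val u).2 = (val v).2 :> nat ->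
    connect (link (@bdry N g 0) A) u v.
  move=> uA vA e2 e3; have [->//|uv] := eqVneq u v; apply: connect1.
  have /AP[fa fb fc] := uA; have /AP[fa' fb' fc'] := vA.
  have [o1 o2 o3] := even u; have [o1' o2' o3'] := even v.
  have n1 : (val u).1.2 != (val v).1.2 :> nat.
    apply: contra uv => /eqP e1; apply/eqP/val_inj.
    by rewrite -(mkcK (val u)) -(mkcK (val v)) e1 e2 e3.
  have [oa i1 i2] := two _ _ _ fb fb' o2 o2' n1.
  have sf : surf N g (val u).1.1 b (val u).2 by exact: (surf_face ha hb hc s fa (face1xx _) fc).
  apply: (step (mkc N g (val u).1.1 b (val u).2)) => //.
  - by rewrite (mkc_surf (leq_ord _) hb (leq_ord _)).
  - by rewrite (mkc_dim (leq_ord _) hb (leq_ord _)) (negbTE o1) oa (negbTE o3).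
  - have := mkc_inc (leq_ord _) hb (leq_ord _) (leq_ord (val u).1.1) (leq_ord (val u).1.2) (leq_ord (val u).2); rewrite mkcK; apply.
    by rewrite i1 !eqxx ?orbT.
  - have := mkc_inc (leq_ord _) hb (leq_ord _) (leq_ord (val v).1.1) (leq_ord (val v).1.2) (leq_ord (val v).2); rewrite mkcK; apply.
    by rewrite i2 -e2 -e3 !eqxx ?orbT.
have stepz (u v : kcell N g 0) : u \in A -> v \in A -> (val u).1.1 = (val v).1.1 :> nat -> (val u).1.2 = (val v).1.2 :> nat ->
    connect (link (@bdry N g 0) A) u v.
  move=> uA vA e2 e3; have [->//|uv] := eqVneq u v; apply: connect1.
  have /AP[fa fb fc] := uA; have /AP[fa' fb' fc'] := vA.
  have [o1 o2 o3] := even u; have [o1' o2' o3'] := even v.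
  have n1 : (val u).2 != (val v).2 :> nat.
    apply: contra uv => /eqP e1; apply/eqP/val_inj.
    by rewrite -(mkcK (val u)) -(mkcK (val v)) e1 e2 e3.
  have [oa i1 i2] := two _ _ _ fc fc' o3 o3' n1.
  have sf : surf N g (val u).1.1 (val u).1.2 c by exact: (surf_face ha hb hc s fa fb (face1xx _)).
  apply: (step (mkc N g (val u).1.1 (val u).1.2 c)) => //.
  - by rewrite (mkc_surf (leq_ord _) (leq_ord _) hc).
  - by rewrite (mkc_dim (leq_ord _) (leq_ord _) hc) (negbTE o1) (negbTE o2) oa.
  - have := mkc_inc (leq_ord _) (leq_ord _) hc (leq_ord (val u).1.1) (leq_ord (val u).1.2) (leq_ord (val u).2); rewrite mkcK; apply.
    by rewrite i1 !eqxx ?orbT.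
  - have := mkc_inc (leq_ord _) (leq_ord _) hc (leq_ord (val v).1.1) (leq_ord (val v).1.2) (leq_ord (val v).2); rewrite mkcK; apply.
    by rewrite i2 -e2 -e3 !eqxx ?orbT.
move=> u v uA vA; have /AP[fa fb fc] := uA; have /AP[fa' fb' fc'] := vA.
have [o1 o2 o3] := even u; have [o1' o2' o3'] := even v.
have [w [wA w1 w2 w3]] := mk _ _ _ fa' fb fc o1' o2 o3.
have [y [yA y1 y2 y3]] := mk _ _ _ fa' fb' fc o1' o2' o3.
apply: connect_trans (stepx u w uA wA _ _) _ => //.
apply: connect_trans (stepy w y wA yA _ _) (stepz y v yA vA _ _) => //.
by rewrite w1. by rewrite w3.
Qed.

End Cells.

(** * Counting forests *)

(** Number of forests on [s] labelled vertices whose trees each contain exactly one of [k] given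
    roots. Removing a root makes roots of its [i] children, chosen among the [s - k] other
    vertices. *)
Fixpoint forests s k : nat :=
  match s, k with
  | 0, 0 => 1
  | s'.+1, k'.+1 => \sum_(i < (s' - k').+1) 'C(s' - k', i) * forests s' (k' + i)
  | _, _ => 0
  end.

(** The binomial theorem together with its version weighted by [i]; it is the inductive step of
    Cayley's formula with denominators cleared. *)
Lemma sum_bin_shift p k s :
  s.+1 * \sum_(i < p.+1) 'C(p, i) * ((k + i) * s ^ (p - i)) = s.+1 ^ p * (k * s.+1 + p).
Proof.
have binS q : \sum_(i < q.+1) 'C(q, i) * s ^ (q - i) = s.+1 ^ q.
  by rewrite -[s.+1]addn1 expnDn; apply: eq_bigr => i _; rewrite exp1n muln1.
have sumI : s.+1 * \sum_(i < p.+1) 'C(p, i) * (i * s ^ (p - i)) = s.+1 ^ p * p.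
  case: p => [|p]; first by rewrite big_ord_recl big_ord0 muln0 !muln0.
  rewrite big_ord_recl /= !muln0 add0n expnS -binS -mulnA; congr (_ * _).
  rewrite big_distrl /=; apply: eq_bigr => i _.
  by rewrite /bump leq0n add1n subSS !mulnA [X in X * _ = _]mulnC -mul_bin_diag [in RHS]mulnC mulnA.
rewrite (eq_bigr (fun i : 'I_p.+1 => k * ('C(p, i) * s ^ (p - i)) + 'C(p, i) * (i * s ^ (p - i)))).
  by rewrite big_split /= -big_distrr /= binS mulnDr sumI mulnDr; lia.
by move=> i _; rewrite mulnDl mulnDr; congr (_ + _); rewrite mulnCA.
Qed.

(** Cayley's formula k s^(s-k-1), multiplied by [s] because the exponent would be -1 for [k = s]. *)
Lemma forestsE s k : k <= s -> forests s k * s = k * s ^ (s - k).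
Proof.
elim: s k => [|s IH] [|k] //= ks.
have [s0|s0] := posnP s.
  have k0 : k = 0 by lia.
  by rewrite s0 k0 big_ord_recl big_ord0.
rewrite subSS; have [p sp] : exists p, s = k + p by exists (s - k); lia.
have pE : s - k = p by lia.
rewrite pE; have e := sum_bin_shift p k s.
rewrite (eq_bigr (fun i : 'I_p.+1 => s * ('C(p, i) * forests s (k + i)))) in e; last first.
  move=> i _; have ip : i <= p by rewrite -ltnS.
  rewrite [RHS]mulnCA [s * forests _ _]mulnC IH; last by lia.
  by congr (_ * (_ * _ ^ _)); lia.
rewrite -big_distrr /= in e; set F := \sum_(i < _) _ in e *.
have kE : k * s.+1 + p = s * k.+1 by rewrite sp; nia.
apply/eqP; rewrite -(eqn_pmul2l s0); apply/eqP.
by rewrite [F * _]mulnC mulnCA e kE mulnCA [s.+1 ^ p * _]mulnC.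
Qed.

Lemma mul_bin_trinom p j i : i <= j -> j <= p ->
  'C(p, j) * 'C(j, i) = 'C(p, i) * 'C(p - i, j - i).
Proof.
move=> ij jp.
have e1 := bin_fact jp; have e2 := bin_fact ij; have e3 := bin_fact (leq_trans ij jp).
have e4 : 'C(p - i, j - i) * ((j - i)`! * (p - j)`!) = (p - i)`!.
  by rewrite -(bin_fact (leq_sub2r i jp)); congr (_ * (_ * _`!)); lia.
have f0 : 0 < (j`! * (p - j)`!) * (i`! * (j - i)`!) by rewrite !muln_gt0 !fact_gt0.
apply/eqP; rewrite -(eqn_pmul2r f0); apply/eqP.
move: e1 e2 e3 e4; set a := 'C(p, j); set b := 'C(j, i); set c := 'C(p, i); set d := 'C(_, _).
move: (j`!) (i`!) ((p - j)`!) ((j - i)`!) ((p - i)`!) (p`!) => J I PJ JI PI P e1 e2 e3 e4.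
transitivity ((a * (J * PJ)) * (b * (I * JI))); first by lia.
rewrite e1 e2 -e3 -e4; lia.
Qed.

(* A forest with k + l roots splits into the trees of the first k roots and
   those of the last l. *)
Lemma forests_split p k l :
  \sum_(j < p.+1) 'C(p, j) * (forests (k + j) k * forests (l + (p - j)) l) =
  forests (k + l + p) (k + l).
Proof.
move: {2}(k + p) (leqnn (k + p)) => q.
have base p' : \sum_(j < p'.+1) 'C(p', j) * (forests (0 + j) 0 * forests (l + (p' - j)) l) =
    forests (0 + l + p') (0 + l).
  by rewrite big_ord_recl /= bin0 !add0n subn0 !mul1n big1 ?addn0 // => i _; rewrite mul0n muln0.
elim: q k p => [|q IH] [|k] p kq //.
(* Expand by the children of one root of the first group. Trinomial revision then allows the [i]
   children to be chosen among all [p] vertices before the rest is divided between the two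
   groups. *)
have E1 j : forests (k.+1 + j) k.+1 = \sum_(i < j.+1) 'C(j, i) * forests (k + i + (j - i)) (k + i).
  rewrite addSn /= addnC addnK; apply: eq_bigr => i _.
  by congr (_ * forests _ _); have := ltn_ord i; lia.
rewrite (eq_bigr (fun j : 'I_p.+1 => 'C(p, j) * ((\sum_(i < j.+1) 'C(j, i) *
    forests (k + i + (j - i)) (k + i)) * forests (l + (p - j)) l))) => [|j _]; last by rewrite E1.
have -> : forests (k.+1 + l + p) (k.+1 + l) = \sum_(i < p.+1) 'C(p, i) * forests (k + l + p) (k + l + i).
  by rewrite !addSn /= addKn.
transitivity (\sum_(i < p.+1) 'C(p, i) *
   \sum_(j < (p - i).+1) 'C(p - i, j) * (forests (k + i + j) (k + i) * forests (l + (p - i - j)) l)).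
  transitivity (\sum_(j < p.+1) \sum_(i < p.+1 | i <= j)
      'C(p, i) * ('C(p - i, j - i) * (forests (k + i + (j - i)) (k + i) * forests (l + (p - j)) l))).
    apply: eq_bigr => j _; have jp : j <= p by rewrite -ltnS.
    rewrite big_distrl /= big_distrr /=.
    rewrite (big_ord_widen_cond p.+1 xpredT (fun i => 'C(p, j) * ('C(j, i) * forests (k + i + (j - i)) (k + i) * forests (l + (p - j)) l))) //.
    apply: eq_big => [i|i ij]; first by rewrite ltnS.
    by rewrite !mulnA mul_bin_trinom // -ltnS.
  rewrite (exchange_big_dep xpredT) //=; apply: eq_bigr => i _; have ip : i <= p by rewrite -ltnS.
  rewrite -big_distrr /=; congr (_ * _).
  rewrite -(big_mkord (fun j => i <= j) (fun j => 'C(p - i, j - i) * (forests (k + i + (j - i)) (k + i) * forests (l + (p - j)) l))).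
  rewrite (big_cat_nat (leq0n i) (leqW ip)) /= big_nat_cond big1 => [|j]; last by case/andP; lia.
  rewrite add0n -{1}[nat_of_ord i]add0n big_addn.
  have -> : p.+1 - i = (p - i).+1 by lia.
  rewrite big_mkord; apply: eq_big => [j|j _]; first by rewrite leq_addl.
  by rewrite addnK; congr (_ * (_ * forests _ _)); lia.
apply: eq_bigr => i _; have ip : i <= p by rewrite -ltnS.
rewrite (IH (k + i) (p - i)); last by lia.
by congr (_ * forests _ _); lia.
Qed.

(** * Rooted forests as sets of edges *)

Section ForestSets.
Variable T : finType.
Implicit Types (S A B X : {set T}) (F : {set {set T}}) (a b u v : T).

Definition pairs S : {set {set T}} := [set e : {set T} | (e \subset S) && (#|e| == 2)].
Definition stable F X := [forall u, forall v, (u \in X) && ([set u; v] \in F) ==> (v \in X)].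
Definition spans F A S :=
  [forall X : {set T}, [&& A \subset X, X \subset S & stable F X] ==> (X == S)].
(** Acyclicity is replaced by a count: edges that reach all of [S] from [A] and number [#|S| - #|A|]
    form a forest with one vertex of [A] in each tree. *)
Definition forest_set S A : {set {set {set T}}} :=
  [set F : {set {set T}} | [&& F \subset pairs S, spans F A S & #|F| + #|A| == #|S|]].
Definition nbr F a := [set b | [set a; b] \in F].
Definition star a B : {set {set T}} := [set [set a; b] | b in B].
Definition off F a := [set e in F | a \notin e].

Lemma stableP F X : reflect (forall u v, u \in X -> [set u; v] \in F -> v \in X) (stable F X).
Proof.
apply: (iffP forallP) => [H u v uX uv|H u].
  by have /forallP/(_ v)/implyP := H u; apply; rewrite uX.
by apply/forallP => v; apply/implyP => /andP[]; exact: H.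
Qed.

Lemma spansP F A S :
  reflect (forall X, A \subset X -> X \subset S -> stable F X -> X = S) (spans F A S).
Proof.
apply: (iffP forallP) => [H X h1 h2 h3|H X].
  by have /implyP/(_ _)/eqP := H X; apply; rewrite h1 h2.
by apply/implyP => /and3P[h1 h2 h3]; apply/eqP; exact: H.
Qed.

Lemma pair_mem S u v : ([set u; v] \in pairs S) = [&& u \in S, v \in S & u != v].
Proof. by rewrite inE subUset !sub1set cards2; case: (u != v); rewrite ?andbT ?andbF. Qed.

Lemma pair_eqr a b c : [set a; b] = [set a; c] -> b = c.
Proof.
move=> e; have : b \in [set a; c] by rewrite -e !inE eqxx orbT.
have : c \in [set a; b] by rewrite e !inE eqxx orbT.
by rewrite !inE => /orP[]/eqP-> // /orP[]/eqP.
Qed.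

Lemma edge_at F S a e : F \subset pairs S -> e \in F -> a \in e -> exists2 b, b \in nbr F a & e = [set a; b].
Proof.
move=> FS eF ae; have := subsetP FS e eF; rewrite inE => /andP[_ /cards2P[u [v [uv ee]]]].
move: ae; rewrite ee !inE => /orP[]/eqP->; first by exists v => //; rewrite inE -ee.
by exists u; rewrite ?inE 1?setUC // -ee.
Qed.

Lemma off_star F S a : F \subset pairs S -> F = off F a :|: star a (nbr F a).
Proof.
move=> FS; apply/setP => e; rewrite !inE.
have [ae|ae] := boolP (a \in e); last first.
  rewrite andbT orbC; case: imsetP => // -[b _ ee].
  by rewrite ee !inE eqxx in ae.
rewrite andbF /=; apply/idP/imsetP => [eF|[b + ->]]; last by rewrite inE.
by have [b ba ->] := edge_at FS eF ae; exists b.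
Qed.

Lemma star_a a B e : e \in star a B -> a \in e.
Proof. by case/imsetP=> b _ ->; rewrite !inE eqxx. Qed.

Lemma card_star a B : #|star a B| = #|B|.
Proof. by rewrite card_imset // => b c /pair_eqr. Qed.

Lemma card_off_star F S a : F \subset pairs S -> #|F| = #|off F a| + #|nbr F a|.
Proof.
move=> FS; rewrite {1}(off_star a FS) cardsU card_star.
suff -> : off F a :&: star a (nbr F a) = set0 by rewrite cards0 subn0.
by apply/setP => e; rewrite !inE; apply/negP => /andP[/andP[_ ae] /star_a]; rewrite (negbTE ae).
Qed.

Lemma nbr_sub F S a : F \subset pairs S -> nbr F a \subset S :\ a.
Proof.
move=> FS; apply/subsetP => b; rewrite inE => /(subsetP FS); rewrite pair_mem !inE eq_sym.
by case/and3P=> _ -> ->.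
Qed.

Lemma off_sub F S a : F \subset pairs S -> off F a \subset pairs (S :\ a).
Proof.
move=> FS; apply/subsetP => e; rewrite inE => /andP[/(subsetP FS)].
by rewrite !inE subsetD1 => /andP[-> ->] ->.
Qed.

Lemma spans_off F S A a : F \subset pairs S -> a \in A -> A \subset S -> spans F A S ->
  spans (off F a) (A :\ a :|: nbr F a) (S :\ a).
Proof.
move=> FS aA AS /spansP sp; apply/spansP => X; rewrite subUset => /andP[AX NX] XS /stableP st.
have aX : a \notin X by apply/negP => /(subsetP XS); rewrite !inE eqxx.
rewrite -(sp (a |: X)) ?setU1K //.
- by rewrite -(setD1K aA) setUS.
- by rewrite subUset sub1set (subsetP AS) // (subset_trans XS) // subD1set.
apply/stableP => u v; rewrite !inE; have [->|ua] := eqVneq u a; have [->//|va] := eqVneq v a => /=.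
  by move=> _ uv; apply: (subsetP NX); rewrite inE.
by move=> uX uv; apply: st uX _; rewrite !inE uv negb_or ![a == _]eq_sym ua va.
Qed.

Lemma spans_star F S A B a : F \subset pairs (S :\ a) -> a \in A -> A \subset S -> B \subset S :\ a ->
  spans F (A :\ a :|: B) (S :\ a) -> spans (F :|: star a B) A S.
Proof.
move=> FS aA AS BS /spansP sp; apply/spansP => X AX XS /stableP st.
have aX := subsetP AX _ aA.
have := sp (X :\ a); rewrite subUset setSD //= setSD // => /(_ _ isT) e.
rewrite -(setD1K aX) e ?setD1K ?(subsetP AS) //.
  apply/subsetP => b bB; have := subsetP BS b bB; rewrite !inE => /andP[-> _] /=.
  by apply: st aX _; rewrite inE; apply/orP; right; apply/imsetP; exists b.
apply/stableP => u v; rewrite !inE => /andP[ua uX] uv.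
have := subsetP FS _ uv; rewrite pair_mem !inE => /and3P[_ /andP[va _] _]; rewrite va.
by apply: st uX _; rewrite inE uv.
Qed.

Lemma spans_set0 F S : F \subset pairs S -> spans F set0 S -> S = set0.
Proof.
move=> FS /spansP sp; rewrite -(sp set0) ?sub0set //.
by apply/stableP => u v; rewrite inE.
Qed.

(** Delete a root and make its neighbours roots: the loss in edges is at least the gain in new
    roots. *)
Lemma spans_card F S A : A \subset S -> F \subset pairs S -> spans F A S -> #|S| <= #|F| + #|A|.
Proof.
have [n] := ubnP #|S|; elim: n S A F => // n IH S A F Sn AS FS sp.
have [A0|[a aA]] := set_0Vmem A.
  by rewrite A0 in sp; rewrite (spans_set0 FS sp) cards0.
have aS := subsetP AS _ aA.
have c1 := cardsD1 a S; have c2 := cardsD1 a A; rewrite aS in c1; rewrite aA in c2.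
have sub : A :\ a :|: nbr F a \subset S :\ a by rewrite subUset setSD //= nbr_sub.
have lt : #|S :\ a| < n by lia.
have := IH _ _ _ lt sub (off_sub a FS) (spans_off FS aA AS sp).
by have := card_off_star a FS; rewrite cardsU; lia.
Qed.

(** If a neighbour of [a] were a root already, deleting [a] would leave too few edges and roots for
    [spans_card]. *)
Lemma forest_nbr S A F a : A \subset S -> a \in A -> F \in forest_set S A -> nbr F a \subset S :\: A.
Proof.
move=> AS aA; rewrite inE => /and3P[FS sp /eqP cF].
have aS := subsetP AS _ aA.
have sub : A :\ a :|: nbr F a \subset S :\ a by rewrite subUset setSD //= nbr_sub.
have := spans_card sub (off_sub a FS) (spans_off FS aA AS sp).
have := cardsD1 a S; have := cardsD1 a A; rewrite aS aA.
have := card_off_star a FS; rewrite cardsU => c0 c1 c2.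
have le : #|(A :\ a) :&: nbr F a| <= #|A :\ a| by rewrite subset_leq_card // subsetIl.
move=> c3; have : #|(A :\ a) :&: nbr F a| = 0 by lia.
move/eqP; rewrite cards_eq0 => /eqP dis; apply/subsetP => b bn.
have := subsetP (nbr_sub a FS) b bn; rewrite !inE => /andP[ba ->]; rewrite andbT.
by apply/negP => bA; move/setP/(_ b): dis; rewrite inE bn !inE ba bA.
Qed.

(** Bijective form of the recursion for [forests]: delete the root [a] and promote its children [B],
    or put the star of [a] back. *)
Lemma forest_fiber S A B a : A \subset S -> a \in A -> B \subset S :\: A ->
  [set F in forest_set S A | nbr F a == B] =
  [set F :|: star a B | F in forest_set (S :\ a) (A :\ a :|: B)].
Proof.
move=> AS aA BSA; have aS := subsetP AS _ aA.
have BS : B \subset S :\ a.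
  by apply/subsetP => b /(subsetP BSA); rewrite !inE => /andP[bA ->]; rewrite andbT; apply: contraNneq bA => ->.
have c1 := cardsD1 a S; have c2 := cardsD1 a A; rewrite aS in c1; rewrite aA in c2.
have cAB : #|A :\ a :|: B| = #|A :\ a| + #|B|.
  rewrite cardsU; suff -> : (A :\ a) :&: B = set0 by rewrite cards0 subn0.
  apply/setP => b; rewrite !inE; apply/negP => /andP[/andP[_ bA] /(subsetP BSA)].
  by rewrite !inE bA.
apply/setP => F; apply/idP/imsetP.
  rewrite 2!inE => /andP[/and3P[FS sp /eqP cF] /eqP nB]; exists (off F a); last by rewrite -nB -(off_star a FS).
  rewrite inE (off_sub a FS) -nB (spans_off FS aA AS sp) nB cAB /=.
  have c3 := card_off_star a FS; rewrite nB in c3.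
  apply/eqP; move: c1 c2 c3 cF.
  move: #|off F a| #|F| #|A| #|S| #|A :\ a| #|S :\ a| #|B| => o f x y x' y' b.
  by rewrite !add1n; lia.
case=> F' F'f ->; rewrite inE in F'f; case/and3P: F'f => FS sp /eqP cF.
have off' : off (F' :|: star a B) a = F'.
  apply/setP => e; rewrite !inE; have [eF|eF] := boolP (e \in F') => /=.
    by have := subsetP FS e eF; rewrite inE subsetD1 => /andP[/andP[_ ->]].
  by apply/negP => /andP[/star_a ->].
have nb : nbr (F' :|: star a B) a = B.
  apply/setP => b; rewrite !inE; have -> : [set a; b] \in F' = false.
    by apply/negP => /(subsetP FS); rewrite pair_mem !inE eqxx.
  by apply/imsetP/idP => [[c cB /pair_eqr ->]|bB] //; exists b.
have FS' : F' :|: star a B \subset pairs S.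
  rewrite subUset; apply/andP; split; apply/subsetP => e.
    by move/(subsetP FS); rewrite !inE subsetD1 => /andP[/andP[-> _] ->].
  case/imsetP=> b /(subsetP BS); rewrite !inE => /andP[ba bS] ->.
  by have := pair_mem S a b; rewrite inE aS bS [a == b]eq_sym ba => ->.
rewrite 2!inE FS' nb eqxx andbT (spans_star FS aA AS BS sp) /=; apply/eqP.
have := card_off_star a FS'; rewrite off' nb => c3; move: c1 c2 c3 cF; rewrite cAB.
move: #|F'| #|F' :|: star a B| #|A| #|S| #|A :\ a| #|S :\ a| #|B| => o f x y x' y' b.
by rewrite !add1n; lia.
Qed.

Lemma card_forest_rec S A a : A \subset S -> a \in A ->
  #|forest_set S A| = \sum_(B in powerset (S :\: A)) #|forest_set (S :\ a) (A :\ a :|: B)|.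
Proof.
move=> AS aA; rewrite -sum1_card (partition_big (fun F => nbr F a) (mem (powerset (S :\: A)))) /=.
  apply: eq_bigr => B; rewrite powersetE => BS.
  rewrite sum1dep_card forest_fiber // card_in_imset // => F F'.
  rewrite !inE => /and3P[FS _ _] /and3P[FS' _ _] e; apply/setP => f.
  have := congr1 (fun G : {set {set T}} => (f \in G) && (a \notin f)) e; rewrite !inE.
  have nost : (f \in star a B) && (a \notin f) = false by apply/negP => /andP[/star_a ->].
  rewrite !andb_orl nost !orbF.
  have inS (G : {set {set T}}) : G \subset pairs (S :\ a) -> (f \in G) && (a \notin f) = (f \in G).
    move=> GS; apply: andb_idr => /(subsetP GS); rewrite inE subsetD1 => /andP[/andP[_ ->]].
    by [].
  by rewrite !inS.
by move=> F FA; rewrite powersetE (forest_nbr AS).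
Qed.

Lemma sum_powerset_card S (f : nat -> nat) :
  \sum_(B in powerset S) f #|B| = \sum_(i < #|S|.+1) 'C(#|S|, i) * f i.
Proof.
have bnd B : B \in powerset S -> #|B| < #|S|.+1 by rewrite powersetE ltnS => /subset_leq_card.
rewrite (partition_big (fun B : {set T} => inord #|B| : 'I_#|S|.+1) xpredT) //=; apply: eq_bigr => i _.
rewrite -cards_draws -sum1dep_card big_distrl /=; apply: eq_big => [B|B /andP[BS /eqP <-]].
  rewrite powersetE; apply: andb_id2l => BS; rewrite -val_eqE /= inordK //.
  by apply: bnd; rewrite powersetE.
by rewrite mul1n inordK //; exact: bnd.
Qed.

Theorem card_forest_set S A : A \subset S -> #|forest_set S A| = forests #|S| #|A|.
Proof.
move: {2}#|S| (erefl #|S|) => n; elim: n S A => [|n IH] S A cS AS.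
  move/eqP: (cS); rewrite cards_eq0 => /eqP S0; move: AS; rewrite S0 subset0 => /eqP->.
  rewrite !cards0 /= -(cards1 (set0 : {set {set T}})); apply: eq_card => F; rewrite !inE.
  have p0 : pairs set0 = set0.
    by apply/setP => e; rewrite !inE subset0; apply/negP => /andP[/eqP->]; rewrite cards0.
  rewrite p0 subset0 !cards0; have [->|//] := eqVneq F set0.
  rewrite cards0 /= andbT; apply/spansP => X _; rewrite subset0 => /eqP-> //.
have [A0|[a aA]] := set_0Vmem A.
  rewrite A0 cards0 cS /=; apply/eqP; rewrite cards_eq0; apply/eqP/setP => F.
  rewrite !inE; apply/negP => /and3P[FS /(spans_set0 FS) S0 _].
  by rewrite S0 cards0 in cS.
have aS := subsetP AS _ aA.
have c1 := cardsD1 a S; have c2 := cardsD1 a A; rewrite aS in c1; rewrite aA in c2.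
have cSA : #|S :\: A| = #|S| - #|A| by rewrite cardsD (setIidPr AS).
have cSa : #|S :\ a| = n by lia.
rewrite (card_forest_rec AS aA).
rewrite (eq_bigr (fun B => forests n (#|A :\ a| + #|B|))) => [|B]; last first.
  rewrite powersetE => BSA; rewrite IH //.
    rewrite cSa cardsU; suff -> : (A :\ a) :&: B = set0 by rewrite cards0 subn0.
    apply/setP => b; rewrite !inE; apply/negP => /andP[/andP[_ bA] /(subsetP BSA)].
    by rewrite !inE bA.
  rewrite subUset setSD //=; apply/subsetP => b /(subsetP BSA); rewrite !inE => /andP[bA ->].
  by rewrite andbT; apply: contraNneq bA => ->.
rewrite (sum_powerset_card _ (fun i => forests n (#|A :\ a| + i))) cSA cS c2 add1n /= subSS.
by [].
Qed.

End ForestSets.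

Arguments forests : simpl never.

(** * Components of a graph *)

Section GraphComponents.
Variable T : finType.
Implicit Types (E F U : {set {set T}}) (S : {set T}) (r u v w : T).

(** All pairs with an end in [S]. Whether [S] is a tree component depends on [E] only through its
    trace on this set, which makes the event countable. *)
Definition touching S : {set {set T}} := pairs [set: T] :\: pairs (~: S).
Definition component E v := [set w | connect (adj E) v w].
Definition comps E := [set component E v | v in T].
(** A forest on [S] with a single root is a spanning tree, and taking all edges that touch [S]
    excludes edges leaving [S]. *)
Definition tree_comp E S :=
  if [pick r in S] is Some r then E :&: touching S \in forest_set S [set r] else false.
Definition tree_comps E s := [set S : {set T} | (#|S| == s) && tree_comp E S].
(* Sets of at most K edges with no more vertices than edges; their number is
   bounded on average. *)
Definition dense_sets K E : {set {set {set T}}} :=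
  [set U : {set {set T}} | [&& U \subset E, 0 < #|U| <= K & #|cover U| <= #|U|]].

Lemma mem_component E v : v \in component E v.
Proof. by rewrite inE connect0. Qed.

Lemma comp_eq E v w : w \in component E v -> component E w = component E v.
Proof.
rewrite inE => vw; apply/setP => x; rewrite !inE.
by rewrite (same_connect (@adj_connect_sym _ E) vw).
Qed.

Lemma comps_eq E S v : S \in comps E -> v \in S -> S = component E v.
Proof. by case/imsetP=> w _ -> /comp_eq. Qed.

Lemma card_comps E : #|comps E| = kappa E.
Proof.
have -> : comps E = [set component E r | r in [set r | roots (adj E) r]].
  apply/setP => S; apply/imsetP/imsetP => [[v _ ->]|[r _ ->]]; last by exists r.
  exists (fingraph.root (adj E) v); first by rewrite inE roots_root //; exact: adj_connect_sym.
  by apply/esym/comp_eq; rewrite inE connect_root.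
rewrite card_in_imset // => r r'; rewrite !inE => /eqP rr /eqP rr' e.
have : connect (adj E) r r' by have := mem_component E r'; rewrite -e inE.
by move/(fingraph.rootP (@adj_connect_sym _ E)); rewrite rr rr'.
Qed.

Lemma touching_mem S u v : ([set u; v] \in touching S) = (u != v) && ((u \in S) || (v \in S)).
Proof. by rewrite inE !pair_mem !inE !andTb; case: (u \in S); case: (v \in S); case: (u != v). Qed.

Lemma touching_sub S : pairs S \subset touching S.
Proof.
apply/subsetP => e; rewrite !inE subsetT => /andP[eS /eqP ce]; rewrite ce eqxx andbT /= andbT.
have /card_gt0P[x xe] : 0 < #|e| by rewrite ce.
by apply/negP => /subsetP/(_ x xe); rewrite inE (subsetP eS).
Qed.

Lemma tree_compP E S : tree_comp E S -> exists2 r, r \in S & E :&: touching S \in forest_set S [set r].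
Proof. by rewrite /tree_comp; case: pickP => // r rS F; exists r. Qed.

Section Graph.
Variable E : {set {set T}}.
Hypothesis EP : E \subset pairs [set: T].

Lemma comp_closed S u v : S \in comps E -> u \in S -> [set u; v] \in E -> v \in S.
Proof. by move=> SE uS uv; rewrite (comps_eq SE uS) inE connect1. Qed.

Lemma comp_edges S : S \in comps E -> E :&: touching S \subset pairs S.
Proof.
move=> SE; apply/subsetP => e; rewrite inE => /andP[eE].
have := subsetP EP e eE; rewrite inE => /andP[_ /cards2P[u [v [uv ee]]]].
rewrite ee in eE *; rewrite touching_mem pair_mem uv andbT /= => /orP[uS|vS].
  by rewrite uS (comp_closed SE uS eE).
by rewrite vS (comp_closed SE vS) // setUC.
Qed.

Lemma comp_spans S r : S \in comps E -> r \in S -> spans (E :&: touching S) [set r] S.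
Proof.
move=> SE rS; apply/spansP => X; rewrite sub1set => rX XS /stableP st.
apply/eqP; rewrite eqEsubset XS /=; apply/subsetP => w; rewrite (comps_eq SE rS) inE.
case/connectP=> p; elim: p r rS rX => [|x p IH] r rS rX /=; first by move=> _ ->.
case/andP=> rx px lx; have {}rx : [set r; x] \in E := rx; have xS := comp_closed SE rS rx.
apply: IH px lx => //; apply: st rX _; rewrite inE rx touching_mem rS andbT.
by have := subsetP EP _ rx; rewrite pair_mem => /and3P[].
Qed.

(** A connected graph on [S] has at least [#|S| - 1] edges, and equality characterises trees. *)
Lemma comp_dichotomy S : S \in comps E -> tree_comp E S \/ #|S| <= #|E :&: touching S|.
Proof.
move=> SE; rewrite /tree_comp; case: pickP => [r rS|no]; last first.
  by right; rewrite (_ : S = set0) ?cards0 //; apply/setP => x; rewrite inE no.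
have sp := comp_spans SE rS; have FS := comp_edges SE.
have := spans_card _ FS sp; rewrite sub1set rS => /(_ isT); rewrite cards1 => le.
have [e|ne] := eqVneq (#|E :&: touching S| + 1) #|S|.
  by left; rewrite inE FS sp cards1 e eqxx.
by right; lia.
Qed.

Lemma tree_comp_comps S : tree_comp E S -> S \in comps E.
Proof.
case/tree_compP=> r rS; rewrite inE => /and3P[FS /spansP sp _].
have cl u v : u \in S -> [set u; v] \in E -> v \in S.
  move=> uS uv; have : [set u; v] \in pairs S.
    apply: (subsetP FS); rewrite inE uv touching_mem uS andbT.
    by have := subsetP EP _ uv; rewrite pair_mem => /and3P[].
  by rewrite pair_mem => /and3P[].
suff -> : S = component E r by apply/imsetP; exists r.
apply/eqP; rewrite eqEsubset; apply/andP; split.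
  apply/setIidPl; apply: sp; rewrite ?subsetIl //.
    by rewrite sub1set inE rS mem_component.
  apply/stableP => u v; rewrite !inE => /andP[uS ru] /andP[uv _].
  by rewrite (cl u v) // (connect_trans ru (connect1 uv)).
apply/subsetP => w; rewrite inE => /connectP[p].
elim: p {sp} r rS => [|x p IH] r rS /=; first by move=> _ ->.
by case/andP=> rx px lx; apply: IH px lx; exact: cl rx.
Qed.

Lemma comps_disjoint S S' : S \in comps E -> S' \in comps E -> S != S' -> [disjoint S & S'].
Proof.
move=> SE SE' ne; apply/pred0P => v /=; apply/negP => /andP[vS vS'].
by rewrite (comps_eq SE vS) (comps_eq SE' vS') eqxx in ne.
Qed.

Lemma sum_tree_comps R :
  \sum_(s < R.+1) #|tree_comps E s| = #|[set S : {set T} | (#|S| <= R) && tree_comp E S]|.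
Proof.
rewrite -[RHS]sum1_card (partition_big (fun S : {set T} => inord #|S| : 'I_R.+1) xpredT) //=.
apply: eq_bigr => s _; rewrite sum1dep_card; apply: eq_card => S; rewrite !inE.
rewrite [RHS]andbC andbA; congr (_ && _).
have [SR|SR] := leqP #|S| R; first by rewrite andbT -val_eqE /= inordK.
by rewrite andbF; apply/negP => /eqP e; have := ltn_ord s; lia.
Qed.

Lemma kappa_ge R : \sum_(s < R.+1) #|tree_comps E s| <= kappa E.
Proof.
rewrite sum_tree_comps -card_comps; apply: subset_leq_card; apply/subsetP => S.
by rewrite inE => /andP[_ /tree_comp_comps].
Qed.

Lemma comps_trivIset : trivIset (comps E).
Proof. by apply/trivIsetP => S S' SE SE'; exact: comps_disjoint. Qed.

Lemma card_pairs S : #|pairs S| = 'C(#|S|, 2).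
Proof. exact: cards_draws. Qed.

(** A component is a small tree, a small non-tree or large. Small non-trees have at least as many
    edges as vertices and pairwise different edge sets of size at most [R ^ 2], so they inject into
    the dense sets; components with more than [R] vertices number at most [#|T| / R]. *)
Lemma kappa_le R :
  kappa E * R <= (\sum_(s < R.+1) #|tree_comps E s| + #|dense_sets (R ^ 2) E|) * R + #|T|.
Proof.
rewrite -card_comps sum_tree_comps.
set TS := [set S : {set T} | _ & _]; pose big := [set S in comps E | R < #|S|].
pose den := [set S in comps E | (#|S| <= R) && (#|S| <= #|E :&: touching S|)].
have cov : comps E \subset (TS :|: den) :|: big.
  apply/subsetP => S SE; rewrite !inE SE /= ltnNge.
  by have [SR|SR] := leqP #|S| R; rewrite ?orbT //= orbF; case: (comp_dichotomy SE) => ->; rewrite ?orbT.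
have nz S : S \in comps E -> 0 < #|S|.
  by case/imsetP=> v _ ->; apply/card_gt0P; exists v; exact: mem_component.
have cb : #|big| * R <= #|T|.
  apply: (@leq_trans (\sum_(S in comps E) #|S|)).
    rewrite -sum_nat_const [X in _ <= X](bigID (mem big)) /=; apply: leq_trans (leq_addr _ _).
    rewrite [X in _ <= X](eq_bigl (mem big)) => [|S]; last first.
      by rewrite /= andb_idl // inE => /andP[].
    by apply: leq_sum => S; rewrite inE => /andP[_ /ltnW].
  by rewrite (eqP comps_trivIset) max_card.
have cd : #|den| <= #|dense_sets (R ^ 2) E|.
  rewrite -(@card_in_imset _ _ (fun S => E :&: touching S) (mem den)).
    apply: subset_leq_card; apply/subsetP => U /imsetP[S]; rewrite inE => /and3P[SE SR le] ->.
    rewrite inE subsetIl (leq_trans (nz _ SE) le) /=; apply/andP; split.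
      apply: leq_trans (subset_leq_card (comp_edges SE)) _; rewrite card_pairs.
      apply: leq_trans (_ : #|S| ^ 2 <= _); last by rewrite leq_exp2r.
      rewrite bin2 -mulnn -divn2; apply: leq_trans (leq_div _ _) _.
      by rewrite leq_mul2l leq_pred orbT.
    apply: leq_trans le; apply: subset_leq_card; apply/bigcupsP => e /(subsetP (comp_edges SE)).
    by rewrite inE => /andP[].
  move=> S S'; rewrite !inE => /and3P[SE SR le] /and3P[SE' SR' le'] /= e.
  have [e0 he] : exists e0, e0 \in E :&: touching S by apply/card_gt0P; exact: leq_trans (nz _ SE) le.
  have h1 := subsetP (comp_edges SE) _ he; have h2 : e0 \in pairs S'.
    by apply: (subsetP (comp_edges SE')); rewrite -e.
  move: h1 h2; rewrite !inE => /andP[s1 /eqP c2] /andP[s2 _].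
  have /card_gt0P[x xe] : 0 < #|e0| by rewrite c2.
  by rewrite (comps_eq SE (subsetP s1 _ xe)) (comps_eq SE' (subsetP s2 _ xe)).
have {}cov : #|comps E| <= #|TS| + #|den| + #|big|.
  apply: leq_trans (subset_leq_card cov) _; rewrite cardsU; apply: leq_trans (leq_subr _ _) _.
  by rewrite leq_add2r cardsU leq_subr.
apply: leq_trans (leq_mul cov (leqnn R)) _; rewrite mulnDl leq_add // leq_mul2r leq_add2l cd.
by rewrite orbT.
Qed.

(** A covered vertex has positive even degree, hence degree at least 2; then sum the degrees. *)
Lemma even_cover U : U \subset E -> (forall v, ~~ odd #|[set e in U | v \in e]|) -> #|cover U| <= #|U|.
Proof.
move=> UE ev; suff : 2 * #|cover U| <= 2 * #|U| by rewrite leq_mul2l.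
have -> : 2 * #|U| = \sum_(v : T) #|[set e in U | v \in e]|.
  transitivity (\sum_(e in U) #|e|).
    rewrite mulnC -sum_nat_const; apply: eq_bigr => e /(subsetP UE)/(subsetP EP).
    by rewrite inE => /andP[_ /eqP].
  transitivity (\sum_(e in U) \sum_(v : T) (v \in e)).
    by apply: eq_bigr => e _; rewrite -sum1_card big_mkcond; apply: eq_bigr => v _; case: (v \in e).
  rewrite exchange_big; apply: eq_bigr => v _.
  rewrite -sum1_card [LHS]big_mkcond [RHS]big_mkcond; apply: eq_bigr => e _.
  by rewrite !inE; case: (e \in U); case: (v \in e).
rewrite mulnC -sum_nat_const [X in _ <= X](bigID (mem (cover U))) /=; apply: leq_trans (leq_addr _ _).
apply: leq_sum => v /bigcupP[e eU ve]; have := ev v.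
have : 0 < #|[set e in U | v \in e]| by apply/card_gt0P; exists e; rewrite inE eU.
by move: #|_| => k; lia.
Qed.

(* A family of cycles covering no edge more than twice has few long members by
   double counting; the short ones are dense sets. *)
Lemma card_even_family (I : finType) (J : {set I}) (C : I -> {set {set T}}) K :
  (forall j, j \in J -> C j != set0) -> (forall j, C j \subset E) ->
  (forall j v, ~~ odd #|[set e in C j | v \in e]|) ->
  (forall e, #|[set j in J | e \in C j]| <= 2) ->
  #|J| * K <= 2 * #|dense_sets K E| * K + 2 * #|E|.
Proof.
move=> nz CE ev two.
pose Js := [set j in J | #|C j| <= K]; pose Jb := [set j in J | K < #|C j|].
have cJ : #|J| <= #|Js| + #|Jb|.
  rewrite -(cardsID [set j | #|C j| <= K] J) leq_add // subset_leq_card //;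
    by apply/subsetP => j; rewrite !inE ?ltnNge andbC.
have cb : #|Jb| * K <= 2 * #|E|.
  apply: (@leq_trans (\sum_(j in J) #|C j|)).
    rewrite -sum_nat_const [X in _ <= X](bigID (mem Jb)) /=; apply: leq_trans (leq_addr _ _).
    rewrite [X in _ <= X](eq_bigl (mem Jb)) => [|j]; last by rewrite /= andb_idl // inE => /andP[].
    by apply: leq_sum => j; rewrite inE => /andP[_ /ltnW].
  have -> : \sum_(j in J) #|C j| = \sum_(e in E) #|[set j in J | e \in C j]|.
    transitivity (\sum_(j in J) \sum_(e in E) (e \in C j)).
      apply: eq_bigr => j _; rewrite -sum1_card (bigID (mem E)) /= addnC big1 ?add0n.
        rewrite (eq_bigl (fun e => (e \in E) && (e \in C j))) => [|e]; last by rewrite andbC.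
        by rewrite -big_mkcondr; apply: eq_bigr => e; case: (e \in C j).
      by move=> e /andP[/(subsetP (CE j)) ->].
    rewrite exchange_big; apply: eq_bigr => e _.
    rewrite -sum1_card [LHS]big_mkcond [RHS]big_mkcond; apply: eq_bigr => j _.
    by rewrite !inE; case: (j \in J); case: (e \in C j).
  by rewrite mulnC -sum_nat_const; apply: leq_sum.
have cs : #|Js| <= 2 * #|dense_sets K E|.
  rewrite -sum1_card (partition_big C (mem (dense_sets K E))) /=.
    rewrite mulnC -sum_nat_const; apply: leq_sum => U; rewrite inE => /and3P[_ /andP[/card_gt0P[e eU] _] _].
    apply: leq_trans (two e); rewrite sum1dep_card; apply: subset_leq_card; apply/subsetP => j.
    by rewrite !inE => /andP[/andP[-> _] /eqP->].
  move=> j; rewrite !inE => /andP[jJ ->]; rewrite CE card_gt0 nz //=.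
  exact: even_cover (CE j) (ev j).
by apply: leq_trans (leq_mul cJ (leqnn K)) _; nia.
Qed.

End Graph.

End GraphComponents.

(** * Counting graphs with a given number of edges *)

Section Counting.

(** With the trace on [D] fixed, the other [m - #|F|] elements are free in [P :\: D]. Both the tree
    counts and the dense set counts rest on this. *)
Lemma card_fixed_trace (X : finType) (P D F : {set X}) m : F \subset D -> D \subset P -> #|F| <= m ->
  #|[set E : {set X} | [&& E \subset P, #|E| == m & E :&: D == F]]| = 'C(#|P| - #|D|, m - #|F|).
Proof.
move=> FD DP Fm; rewrite -(setIidPr DP) -cardsD (setIidPr DP) -cards_draws.
have dis (A : {set X}) : A \subset P :\: D -> F :&: A = set0.
  move=> AP; apply/setP => x; rewrite !inE; apply/negP => /andP[/(subsetP FD) xD /(subsetP AP)].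
  by rewrite inE xD.
set dr := [set A : {set X} | A \subset P :\: D & _]; rewrite -(@card_in_imset _ _ (fun A => F :|: A) (mem dr)); last first.
  move=> A B; rewrite !inE => /andP[AP _] /andP[BP _] e.
  have k (C : {set X}) : C \subset P :\: D -> (F :|: C) :\: D = C.
    move=> CP; apply/setP => x; rewrite !inE; have [xC|xC] /= := boolP (x \in C).
      by have := subsetP CP x xC; rewrite inE => /andP[-> _]; rewrite orbT.
    by rewrite orbF andbC; apply/negP => /andP[/(subsetP FD) ->].
  by rewrite -(k A AP) e k.
apply: eq_card => E; rewrite inE; apply/and3P/imsetP => [[EP /eqP cE /eqP EF]|[A + ->]].
  exists (E :\: D); last by rewrite -EF setID.
  by rewrite inE setSD //= cardsD EF cE.
rewrite inE => /andP[AP /eqP cA]; split.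
- rewrite subUset (subset_trans FD DP) (subset_trans AP) // subsetDl //.
- by rewrite cardsU dis // cards0 subn0 cA subnKC.
apply/eqP/setP => x; rewrite !inE; have [xD|xD] := boolP (x \in D); rewrite ?andbT ?andbF.
  rewrite orbC; case xA: (x \in A) => //; have := subsetP AP x xA; by rewrite inE xD.
by apply/esym/negP => /(subsetP FD); rewrite (negbTE xD).
Qed.

Variable T : finType.
Local Notation n := #|T|.
Implicit Types (E F U : {set {set T}}) (S : {set T}).

Definition edge_sets m : {set {set {set T}}} :=
  [set E : {set {set T}} | (E \subset pairs [set: T]) && (#|E| == m)].

Lemma card_edge_sets m : #|edge_sets m| = 'C('C(n, 2), m).
Proof. by rewrite cards_draws card_pairs cardsT. Qed.

Lemma card_touching S : 'C(n, 2) - #|touching S| = 'C(n - #|S|, 2).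
Proof.
have sub : pairs (~: S) \subset pairs [set: T].
  by apply/subsetP => e; rewrite !inE subsetT => /andP[].
rewrite cardsD (setIidPr sub) !card_pairs cardsT cardsCs setCK subKn //.
by apply: leq_bin2l; exact: leq_subr.
Qed.

Lemma card_trace_touching S F m : F \subset touching S -> #|F| <= m ->
  #|[set E in edge_sets m | E :&: touching S == F]| = 'C('C(n - #|S|, 2), m - #|F|).
Proof.
move=> FS Fm; rewrite -card_touching -[in RHS]cardsT -card_pairs -(card_fixed_trace FS) //.
  by apply: eq_card => E; rewrite !inE -andbA.
exact: subsetDl.
Qed.

Lemma forest_setE S r F : F \in forest_set S [set r] -> F \subset touching S /\ #|F|.+1 = #|S|.
Proof.
rewrite inE => /and3P[FS _ /eqP <-]; rewrite cards1 addn1; split=> //.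
exact: subset_trans FS (touching_sub S).
Qed.

Lemma card_tree_comp S m s : #|S| = s.+1 -> s <= m ->
  #|[set E in edge_sets m | tree_comp E S]| = forests s.+1 1 * 'C('C(n - s.+1, 2), m - s).
Proof.
move=> cS sm; rewrite /tree_comp; case: pickP => [r rS|no]; last first.
  by move: cS; rewrite (_ : S = set0) ?cards0 //; apply/setP => x; rewrite inE no.
rewrite -sum1_card (partition_big (fun E => E :&: touching S) (mem (forest_set S [set r]))) /=; last first.
  by move=> E; rewrite !inE => /andP[].
have <- : #|forest_set S [set r]| = forests s.+1 1 by rewrite card_forest_set ?sub1set // cS cards1.
rewrite -sum_nat_const; apply: eq_bigr => F FF.
have [FD cF] := forest_setE FF; have Fs : #|F| = s by lia.
have := @card_trace_touching S F m FD; rewrite Fs cS => /(_ sm) <-.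
rewrite sum1dep_card; apply: eq_card => E.
rewrite inE [in LHS]inE [in RHS]inE; have [->|_] := eqVneq (E :&: touching S) F; last by rewrite !andbF.
by rewrite FF !andbT.
Qed.

Lemma sum_card_tree_comps m s : s <= m ->
  \sum_(E in edge_sets m) #|tree_comps E s.+1| =
  'C(n, s.+1) * (forests s.+1 1 * 'C('C(n - s.+1, 2), m - s)).
Proof.
move=> sm; transitivity (\sum_(E in edge_sets m) \sum_(S : {set T} | #|S| == s.+1) tree_comp E S).
  by apply: eq_bigr => E _; rewrite -sum1dep_card big_mkcondr; apply: eq_bigr => S _; case: (tree_comp E S).
rewrite exchange_big /= (eq_bigr (fun=> forests s.+1 1 * 'C('C(n - s.+1, 2), m - s))).
  by rewrite sum_nat_const -card_draws; congr (_ * _); apply: eq_card => S; rewrite inE.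
move=> S /eqP cS; rewrite -(card_tree_comp cS sm) -sum1dep_card big_mkcondr.
by apply: eq_bigr => E _; case: (tree_comp E S).
Qed.

Lemma touchingU S S' : touching (S :|: S') = touching S :|: touching S'.
Proof.
apply/setP => e; rewrite !inE subsetT setCU subsetI; case: (#|e| == 2); rewrite ?andbF //= !andbT.
by rewrite negb_and.
Qed.

Lemma card_two_trees S S' m s : #|S| = s.+1 -> #|S'| = s.+1 -> [disjoint S & S'] -> 2 * s <= m ->
  #|[set E in edge_sets m | tree_comp E S && tree_comp E S']| <=
  forests s.+1 1 ^ 2 * 'C('C(n - 2 * s.+1, 2), m - 2 * s).
Proof.
move=> cS cS' dis sm; have cU : #|S :|: S'| = 2 * s.+1.
  by rewrite cardsU (disjoint_setI0 dis) cards0 cS cS'; lia.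
rewrite /tree_comp; case: pickP => [r rS|no]; last first.
  by move: cS; rewrite (_ : S = set0) ?cards0 //; apply/setP => x; rewrite inE no.
case: pickP => [r' rS'|no]; last first.
  by move: cS'; rewrite (_ : S' = set0) ?cards0 //; apply/setP => x; rewrite inE no.
pose FF := setX (forest_set S [set r]) (forest_set S' [set r']).
rewrite -sum1_card (partition_big (fun E => (E :&: touching S, E :&: touching S')) (mem FF)) /=; last first.
  by move=> E; rewrite !inE => /andP[_].
have cFF : #|FF| = forests s.+1 1 ^ 2.
  by rewrite cardsX !card_forest_set ?sub1set // cS cS' !cards1.
rewrite -cFF -sum_nat_const; apply: leq_sum => -[F F']; rewrite inE /= => /andP[FF1 FF2].
have [FD cF] := forest_setE FF1; have [FD' cF'] := forest_setE FF2.
have disF : F :&: F' = set0.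
  apply/setP => e; rewrite [RHS]inE; apply/negP; rewrite inE => /andP[eF eF'].
  move: FF1 FF2; rewrite !inE => /and3P[/subsetP/(_ e eF) + _ _] /and3P[/subsetP/(_ e eF') + _ _].
  rewrite !inE => /andP[es /eqP ce] /andP[es' _].
  have /card_gt0P[x xe] : 0 < #|e| by rewrite ce.
  by have := disjointFr dis (subsetP es x xe); rewrite (subsetP es' x xe).
have cFU : #|F :|: F'| = 2 * s by rewrite cardsU disF cards0; lia.
have FUD : F :|: F' \subset touching (S :|: S') by rewrite touchingU setUSS.
rewrite -cU -cFU -(card_trace_touching FUD) ?cFU // sum1dep_card; apply: subset_leq_card.
apply/subsetP => E; rewrite !inE => /andP[/andP[-> _] /eqP[e1 e2]] /=.
by rewrite touchingU setIUr e1 e2.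
Qed.

(** Two tree components of one graph are equal or disjoint: equal pairs give the first moment,
    disjoint pairs the second term. *)
Lemma sum_card_tree_comps_sqr m s : 2 * s <= m ->
  \sum_(E in edge_sets m) #|tree_comps E s.+1| ^ 2 <=
  \sum_(E in edge_sets m) #|tree_comps E s.+1| +
  'C(n, s.+1) ^ 2 * (forests s.+1 1 ^ 2 * 'C('C(n - 2 * s.+1, 2), m - 2 * s)).
Proof.
move=> sm.
pose Q (p : {set T} * {set T}) := [&& #|p.1| == s.+1, #|p.2| == s.+1 & [disjoint p.1 & p.2]].
apply: (@leq_trans (\sum_(E in edge_sets m) (#|tree_comps E s.+1| +
    \sum_(p | Q p) (tree_comp E p.1 && tree_comp E p.2)))).
  apply: leq_sum => E; rewrite inE => /andP[EP _].
  rewrite -mulnn -cardsX.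
  pose Dg := [set (S, S) | S in tree_comps E s.+1].
  pose Od := [set p | Q p && (tree_comp E p.1 && tree_comp E p.2)].
  have -> : \sum_(p | Q p) (tree_comp E p.1 && tree_comp E p.2) = #|Od|.
    by rewrite -sum1dep_card [RHS]big_mkcondr; apply: eq_bigr => p _; case: (_ && _).
  rewrite -(@card_imset _ _ (fun S : {set T} => (S, S)) (mem (tree_comps E s.+1))); last by move=> S S' [].
  apply: leq_trans (_ : #|Dg :|: Od| <= _); last by rewrite cardsU leq_subr.
  apply: subset_leq_card; apply/subsetP => -[S S']; rewrite inE /= => /andP[hS hS'].
  rewrite inE; have [<-|ne] := eqVneq S S'; first by rewrite imset_f.
  apply/orP; right; move: hS hS'; rewrite !inE /Q /= => /andP[-> t] /andP[-> t'].
  by rewrite t t' (comps_disjoint (tree_comp_comps EP t) (tree_comp_comps EP t') ne).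
rewrite big_split /= leq_add2l exchange_big /=.
apply: (@leq_trans (\sum_(p | Q p) forests s.+1 1 ^ 2 * 'C('C(n - 2 * s.+1, 2), m - 2 * s))).
  apply: leq_sum => -[S S'] /and3P[/= /eqP cS /eqP cS' dis].
  apply: leq_trans (card_two_trees cS cS' dis sm).
  by rewrite -sum1dep_card [X in _ <= X]big_mkcondr; apply: leq_sum => E _; case: (_ && _).
rewrite sum_nat_const leq_mul2r; apply/orP; right.
rewrite -mulnn -card_draws -cardsX; apply: subset_leq_card; apply/subsetP => -[S S'].
by rewrite !inE => /and3P[/= -> -> _].
Qed.

(** Such a set is determined by a list of [k] vertices, with repetitions, exhausting its cover, and
    by the pairs of positions that are edges. The power of [n] does not exceed the number of edges,
    which keeps the mean number of dense sets bounded. *)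
Lemma card_dense_shape k : 0 < k ->
  #|[set U : {set {set T}} | (#|U| == k) && (U \subset pairs [set: T]) && (#|cover U| <= k)]|
    <= n ^ k * 2 ^ (k * k).
Proof.
move=> k0.
pose img (fD : {ffun 'I_k -> T} * {set 'I_k * 'I_k}) :=
  [set [set fD.1 ij.1; fD.1 ij.2] | ij in fD.2].
have -> : n ^ k * 2 ^ (k * k) = #|[set: {ffun 'I_k -> T} * {set 'I_k * 'I_k}]|.
  have c2 : #|{: {set 'I_k * 'I_k}}| = 2 ^ (k * k).
    by rewrite -cardsT -powersetT card_powerset cardsT card_prod !card_ord.
  by rewrite cardsT card_prod card_ffun card_ord c2.
apply: leq_trans (leq_imset_card img _); apply: subset_leq_card; apply/subsetP => U.
rewrite inE => /andP[/andP[/eqP cU UP] cov].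
have [e0 e0U] : exists e0, e0 \in U by apply/card_gt0P; rewrite cU.
have : e0 \in pairs [set: T] by exact: (subsetP UP).
rewrite inE => /andP[_ /cards2P[x0 _]].
pose f := [ffun i : 'I_k => nth x0 (enum (cover U)) i].
pose D := [set ij : 'I_k * 'I_k | [set f ij.1; f ij.2] \in U].
have fP v : v \in cover U -> exists i, v = f i.
  move=> vU; have lt : index v (enum (cover U)) < k.
    by apply: leq_trans cov; rewrite cardE index_mem mem_enum.
  by exists (Ordinal lt); rewrite ffunE /= nth_index // mem_enum.
apply/imsetP; exists (f, D) => //; apply/setP => e; apply/idP/imsetP => [eU|[ij + ->]]; last by rewrite inE.
have := subsetP UP e eU; rewrite inE => /andP[_ /cards2P[u [v [uv ee]]]].
have [i ui] : exists i, u = f i by apply: fP; apply/bigcupP; exists e => //; rewrite ee !inE eqxx.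
have [j vj] : exists j, v = f j by apply: fP; apply/bigcupP; exists e => //; rewrite ee !inE eqxx orbT.
by exists (i, j); rewrite ?inE /= -ui -vj -?ee.
Qed.

Lemma sum_card_dense_sets m K : K <= m ->
  \sum_(E in edge_sets m) #|dense_sets K E| <=
  \sum_(k < K) n ^ k.+1 * 2 ^ (k.+1 * k.+1) * 'C('C(n, 2) - k.+1, m - k.+1).
Proof.
move=> Km.
pose dn U := [&& U \subset pairs [set: T], 0 < #|U| <= K & #|cover U| <= #|U|].
apply: (@leq_trans (\sum_(U | dn U) #|[set E in edge_sets m | U \subset E]|)).
  rewrite (eq_bigr (fun E => \sum_(U | dn U) (U \subset E))).
    rewrite exchange_big /=; apply: leq_sum => U _.
    by rewrite -sum1dep_card [X in _ <= X]big_mkcondr; apply: leq_sum => E _; case: (_ \subset _).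
  move=> E; rewrite inE => /andP[EP _]; rewrite -sum1_card [RHS]big_mkcond [LHS]big_mkcond /=.
  apply: eq_bigr => U _; rewrite inE /dn; have [UE|_] := boolP (U \subset E); rewrite /= ?if_same //.
  by rewrite (subset_trans UE EP).
have bnd U : dn U -> #|U|.-1 < K by case/and3P=> _ /andP[h1 h2] _; lia.
have [K0|K0] := posnP K.
  by rewrite big_pred0 // => U; apply/negP => /bnd; rewrite K0.
case: K K0 Km @dn bnd => // K _ Km dn bnd.
rewrite (partition_big (fun U => inord #|U|.-1 : 'I_K.+1) xpredT) //=; apply: leq_sum => k _.
have cU U : dn U && (inord #|U|.-1 == k) -> #|U| = k.+1.
  by case/andP=> dU /eqP <-; rewrite inordK ?bnd //; case/and3P: dU => _ /andP[h1 _] _; rewrite prednK.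
apply: (@leq_trans (\sum_(U | dn U && (inord #|U|.-1 == k)) 'C('C(n, 2) - k.+1, m - k.+1))).
  apply: leq_sum => U dU; have /andP[/and3P[UP _ _] _] := dU.
  have km : #|U| <= m by rewrite (cU _ dU); have := ltn_ord k; lia.
  rewrite -(cU _ dU) -[n]cardsT -card_pairs -(card_fixed_trace (subxx U) UP km).
  apply: subset_leq_card; apply/subsetP => E; rewrite !inE => /andP[/andP[-> ->]] /setIidPr ->.
  by rewrite eqxx.
rewrite sum_nat_const leq_mul2r; apply/orP; right.
apply: leq_trans (card_dense_shape (ltn0Sn k)); apply: subset_leq_card; apply/subsetP => U dU.
have := cU _ dU; move: dU => /andP[/and3P[h1 h2 h3] _] h4.
by rewrite inE h4 eqxx h1 -h4 h3.
Qed.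

End Counting.

From mathcomp Require Import all_classical all_reals all_analysis.
From mathcomp Require Import ring lra.
Import numFieldNormedType.Exports.
Local Open Scope classical_set_scope.
Local Open Scope ring_scope.

(** * Drawing a graph by sweeping the surface *)

Section Arcs.
Variables (R : realType) (T : topologicalType).
Implicit Types (K : set T) (P Q : T).

(** The parametrisation is continuous on the whole line, which spares subspace topologies when arcs
    are composed. Only the image [K] is recorded, so arcs are reversed and concatenated as sets. *)
Definition is_arc K P Q := exists g : R -> T,
  [/\ continuous g, {in `[0, 1] &, injective g}, g 0 = P, g 1 = Q &
      K = [set g t | t in `[0, 1]]].

Lemma arc_image (a b : R) (h : R -> T) : a < b -> continuous h ->
  {in `[a, b] &, injective h} -> is_arc [set h t | t in `[a, b]] (h a) (h b).
Proof.
move=> ab ch ih; exists (fun t => h (a + t * (b - a))).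
have ba0 : 0 < b - a by rewrite subr_gt0.
have inab t : t \in `[0, 1] -> a + t * (b - a) \in `[a, b].
  rewrite !in_itv /= => /andP[t0 t1]; apply/andP; split.
    by rewrite lerDl mulr_ge0 // ltW.
  by rewrite -lerBrDl ler_piMl // ltW.
split.
- move=> t; apply: continuous_comp; last exact: ch.
  by apply: cvgD; [exact: cvg_cst|apply: cvgMl; exact: cvg_id].
- move=> s t /inab s1 /inab t1 /(ih _ _ s1 t1) /addrI /mulIf; apply.
  by rewrite gt_eqF.
- by rewrite mul0r addr0.
- by rewrite mul1r addrC subrK.
- apply/seteqP; split => _ [t tab <-].
    exists ((t - a) / (b - a)); last by rewrite divfK ?gt_eqF// addrC subrK.
    move: tab; rewrite /= !in_itv /= => /andP[at_ tb].
    apply/andP; split; first by rewrite divr_ge0 // subr_ge0 // ltW.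
    by rewrite ler_pdivrMr// mul1r; lra.
  by exists (a + t * (b - a)) => //; apply: inab.
Qed.

Lemma arc_sym K P Q : is_arc K P Q -> is_arc K Q P.
Proof.
case=> g [cg ig g0 g1 ->]; exists (fun t => g (1 - t)).
have I t : t \in `[0, 1] -> 1 - t \in (`[0, 1] : interval R).
  by rewrite !in_itv /= => /andP[? ?]; apply/andP; split; lra.
split.
- move=> t; apply: continuous_comp; last exact: cg.
  by apply: cvgB; [exact: cvg_cst|exact: cvg_id].
- by move=> s t /I s1 /I t1 /(ig _ _ s1 t1) /addrI /oppr_inj.
- by rewrite subr0.
- by rewrite subrr.
- apply/seteqP; split => _ [t tI <-]; exists (1 - t); rewrite ?subKr //; exact: I.
Qed.

Lemma arc_ends K P Q : is_arc K P Q -> K P /\ K Q.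
Proof.
case=> g [_ _ <- <- ->].
by split; [exists 0|exists 1] => //=; rewrite in_itv /= lexx ler01.
Qed.

Lemma arc_cat K1 K2 P Q S : is_arc K1 P Q -> is_arc K2 Q S ->
  K1 `&` K2 `<=` [set Q] -> is_arc (K1 `|` K2) P S.
Proof.
case=> g [cg ig g0 g1 ->] [h [ch ih h0 h1 ->]] sub.
pose k (t : R) := if t <= 2^-1 then g (2 * t) else h (2 * t - 1).
have ckg : continuous (fun t : R => g (2 * t)).
  move=> t; apply: continuous_comp; last exact: cg.
  by apply: cvgMr; exact: cvg_id.
have ckh : continuous (fun t : R => h (2 * t - 1)).
  move=> t; apply: continuous_comp; last exact: ch.
  by apply: cvgB; [apply: cvgMr; exact: cvg_id|exact: cvg_cst].
have Ig t : t \in `[0, 1] -> t <= 2^-1 -> 2 * t \in (`[0, 1] : interval R).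
  by rewrite !in_itv /= => /andP[? ?] ?; apply/andP; split; lra.
have Ih t : t \in `[0, 1] -> 2^-1 < t -> 2 * t - 1 \in (`[0, 1] : interval R).
  by rewrite !in_itv /= => /andP[? ?] ?; apply/andP; split; lra.
have cross s t : s \in `[0, 1] -> t \in `[0, 1] -> s <= 2^-1 -> 2^-1 < t ->
    g (2 * s) <> h (2 * t - 1).
  move=> s1 t1 s2 t2 E.
  have : (g @` `[0, 1] `&` h @` `[0, 1]) (g (2 * s)).
    split; first by exists (2 * s) => //; apply: Ig.
    by exists (2 * t - 1); [apply: Ih|rewrite E].
  move=> /sub /=; rewrite E -h0 => /ih; rewrite Ih // => /(_ erefl).
  rewrite in_itv /= lexx ler01 => /(_ erefl) F.
  have : t = 2^-1 by lra.
  by move=> tE; rewrite tE ltxx in t2.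
exists k; split.
- apply/continuous_subspace_setT.
  have -> : [set: R] = [set x | x <= 2^-1] `|` [set x | 2^-1 <= x].
    by apply/seteqP; split => // x _ /=; apply/orP; exact: le_total.
  apply: withinU_continuous; [exact: closed_le|exact: closed_ge|..].
  + apply: (@subspace_eq_continuous _ _ _ (fun t : R => g (2 * t))).
      by move=> t; rewrite inE /= => t2; rewrite /from_subspace /k t2.
    exact: continuous_subspaceT.
  + apply: (@subspace_eq_continuous _ _ _ (fun t : R => h (2 * t - 1))).
      move=> t; rewrite inE /= => t2; rewrite /from_subspace /k; case: ifP => // t3.
      have -> : t = 2^-1 by apply/le_anti; rewrite t2 t3.
      by rewrite mulfV // subrr h0 g1.
    exact: continuous_subspaceT.
- move=> s t s1 t1; rewrite /k.
  case: (leP s 2^-1) => s2; case: (leP t 2^-1) => t2.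
  + by move/(ig _ _ (Ig _ s1 s2) (Ig _ t1 t2)) => /mulfI; apply.
  + by move/(cross _ _ s1 t1 s2 t2).
  + by move/esym/(cross _ _ t1 s1 t2 s2).
  + by move/(ih _ _ (Ih _ s1 s2) (Ih _ t1 t2)) => ?; lra.
- by rewrite /k ifT ?mulr0 // invr_ge0.
- rewrite /k ifF; last by apply/negbTE; rewrite -ltNge; lra.
  by rewrite mulr1 -h1; congr h; lra.
- apply/seteqP; split => p.
    case=> -[t t1 <-]; move: (t1); rewrite /= in_itv /= => /andP[ta tb].
      exists (t / 2); first by rewrite /= in_itv /=; apply/andP; split; lra.
      by rewrite /k ifT; [congr g; lra|lra].
    have [->|tn0] := eqVneq t 0.
      exists 2^-1; first by rewrite /= in_itv /=; apply/andP; split; lra.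
      by rewrite /k lexx mulfV // g1 h0.
    exists ((t + 1) / 2); first by rewrite /= in_itv /=; apply/andP; split; lra.
    have t0 : 0 < t by rewrite lt_def tn0.
    rewrite /k ifF; first by congr h; lra.
    by apply/negbTE; rewrite -ltNge; lra.
  case=> t t1 <-; rewrite /k; case: (leP t 2^-1) => t2.
    by left; exists (2 * t) => //; exact: Ig.
  by right; exists (2 * t - 1) => //; exact: Ih.
Qed.

End Arcs.

Lemma continuous_triple (R : realType) (f g h : R -> R) :
  continuous f -> continuous g -> continuous h ->
  continuous (fun t => (f t, g t, h t)).
Proof.
move=> cf cg ch t.
apply: (@cvg_pair _ _ _ _ (nbhs (f t, g t)) (nbhs (h t))); last exact: ch.
by apply: (@cvg_pair _ _ _ _ (nbhs (f t)) (nbhs (g t))); [exact: cf|exact: cg].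
Qed.

Lemma finite_gap (R : realType) (a : R) (s : seq R) :
  exists2 d : R, 0 < d & forall x, x \in s -> a < x -> a + d < x.
Proof.
elim: s => [|y s [d d0 IH]]; first by exists 1.
have [ay|ya] := ltP a y; last first.
  by exists d => // x; rewrite inE => /orP[/eqP->|/IH//]; rewrite ltNge ya.
exists (Num.min d ((y - a) / 2)); first by rewrite lt_min d0 /=; lra.
move=> x; rewrite inE => /orP[/eqP-> _|/IH H /H].
  have : Num.min d ((y - a) / 2) <= (y - a) / 2 by rewrite ge_min lexx orbT.
  lra.
have : Num.min d ((y - a) / 2) <= d by rewrite ge_min lexx.
lra.
Qed.

(** * Cross-sections of the box *)

Section Strip.
Variable R : realType.
Implicit Types x th : R.

(* The perimeter of the cross-section x = const of the box, cut open along the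
   edge y = 0, z = 1 and parametrised by th in [0, 8]: top face for
   th <= 3, wall y = 3 for 3 <= th <= 4, bottom face for 4 <= th <= 7, wall
   y = 0 for th >= 7. *)
Definition strip_y th : R := Num.max 0 (Num.min th (Num.min 3 (7 - th))).
Definition strip_z th : R := Num.max 0 (Num.min 1 (Num.max (4 - th) (th - 7))).
Definition strip x th : R * R * R := (x, strip_y th, strip_z th).

Lemma strip_cases th : 0 <= th <= 8 ->
  [\/ [/\ th <= 3, strip_y th = th & strip_z th = 1],
      [/\ 3 <= th <= 4, strip_y th = 3 & strip_z th = 4 - th],
      [/\ 4 <= th <= 7, strip_y th = 7 - th & strip_z th = 0] |
      [/\ 7 <= th, strip_y th = 0 & strip_z th = th - 7]].
Proof.
move=> /andP[t0 t8]; rewrite /strip_y /strip_z.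
have [t3|t3] := leP th 3; [|have [t4|t4] := leP th 4; [|have [t7|t7] := leP th 7]].
- apply: Or41; split => //.
    rewrite (_ : Num.min 3 (7 - th) = 3); last by apply/min_idPl; lra.
    by rewrite (min_idPl t3); apply/max_idPr.
  rewrite (_ : Num.max (4 - th) (th - 7) = 4 - th); last by apply/max_idPl; lra.
  by rewrite (_ : Num.min 1 _ = 1); [apply/max_idPr; lra|apply/min_idPl; lra].
- apply: Or42; split; first by apply/andP; split; lra.
    rewrite (_ : Num.min 3 (7 - th) = 3); last by apply/min_idPl; lra.
    by rewrite (_ : Num.min th 3 = 3); [apply/max_idPr; lra|apply/min_idPr; lra].
  rewrite (_ : Num.max (4 - th) (th - 7) = 4 - th); last by apply/max_idPl; lra.
  by rewrite (_ : Num.min 1 _ = 4 - th); [apply/max_idPr; lra|apply/min_idPr; lra].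
- apply: Or43; split; first by apply/andP; split; lra.
    rewrite (_ : Num.min 3 (7 - th) = 7 - th); last by apply/min_idPr; lra.
    by rewrite (_ : Num.min th _ = 7 - th); [apply/max_idPr; lra|apply/min_idPr; lra].
  apply/max_idPl; rewrite ge_min; apply/orP; right.
  by rewrite ge_max; apply/andP; split; lra.
- apply: Or44; split; first lra.
    apply/max_idPl; rewrite ge_min; apply/orP; right.
    by rewrite ge_min; apply/orP; right; lra.
  rewrite (_ : Num.max (4 - th) (th - 7) = th - 7); last by apply/max_idPr; lra.
  by rewrite (_ : Num.min 1 _ = th - 7); [apply/max_idPr; lra|apply/min_idPr; lra].
Qed.

Lemma strip_inj x x' th th' : 0 < th < 8 -> 0 < th' < 8 ->
  strip x th = strip x' th' -> x = x' /\ th = th'.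
Proof.
move=> /andP[a b] /andP[c d] [-> ey ez]; split => //.
have h1 : 0 <= th <= 8 by apply/andP; split; lra.
have h2 : 0 <= th' <= 8 by apply/andP; split; lra.
case: (strip_cases h1) => -[e1 y1 z1]; case: (strip_cases h2) => -[e2 y2 z2];
  rewrite y1 z1 y2 z2 in ey ez; try (move/andP: e1 => [? ?]);
  try (move/andP: e2 => [? ?]); lra.
Qed.

Lemma continuous_strip (f g : R -> R) : continuous f -> continuous g ->
  continuous (fun t => strip (f t) (g t)).
Proof.
move=> cf cg.
have cB c : continuous (fun t => c - g t).
  by move=> t; apply: cvgB; [exact: cvg_cst|exact: cg].
have cB' c : continuous (fun t => g t - c).
  by move=> t; apply: cvgB; [exact: cg|exact: cvg_cst].
have cc (c : R) : continuous (fun _ : R => c) by move=> t; exact: cvg_cst.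
have cmax (u v : R -> R) : continuous u -> continuous v ->
    continuous (fun t => Num.max (u t) (v t)).
  by move=> cu cv t; apply: continuous_max; [exact: cu|exact: cv].
have cmin (u v : R -> R) : continuous u -> continuous v ->
    continuous (fun t => Num.min (u t) (v t)).
  by move=> cu cv t; apply: continuous_min; [exact: cu|exact: cv].
apply: continuous_triple => //; rewrite /strip_y /strip_z.
  exact: (cmax _ _ (cc 0) (cmin _ _ cg (cmin _ _ (cc 3) (cB 7)))).
exact: (cmax _ _ (cc 0) (cmin _ _ (cc 1) (cmax _ _ (cB 4) (cB' 7)))).
Qed.

Lemma strip_box (g : nat) x th : 0 <= x <= (2 * g + 1)%:R -> 0 <= th <= 8 ->
  box_sphere g (strip x th).
Proof.
move=> xg t8; rewrite /box_sphere /strip /=.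
move: (t8) => /andP[? ?].
case: (strip_cases t8) => -[e1 -> ->]; split => //; try (move/andP: e1 => [? ?]);
  try (by apply/andP; split; lra).
- by apply: Or33; right.
- by apply: Or32; right.
- by apply: Or33; left.
- by apply: Or32; left.
Qed.

Lemma strip_surface_between (g i : nat) x th : (i <= g)%N ->
  (2 * i)%:R <= x <= (2 * i + 1)%:R -> 0 < th < 8 ->
  sphere_with_handles g (strip x th).
Proof.
move=> ig /andP[x1 x2] /andP[t0 t8]; left; split.
  apply: strip_box; apply/andP; split; try lra.
    by apply: le_trans x1; rewrite ler0n.
  by apply: le_trans x2 _; rewrite ler_nat leq_add2r leq_mul2l.
case=> j _ [/andP[x3 x4] _ _].
have := lt_le_trans x3 x2; have := le_lt_trans x1 x4.
rewrite !ltr_nat !ltn_add2r => A B.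
move: A; rewrite (_ : (2 * j + 2 = 2 * j.+1)%N); last by rewrite mulnS addnC.
by rewrite ltn_pmul2l// in B *; rewrite ltn_pmul2l// ltnS leqNgt B.
Qed.

(** The mouths occupy the heights between 1 and 2 on the top face and, since y = 7 - th there,
    between 5 and 6 on the bottom face. *)
Lemma strip_surface_off (g : nat) x th : 0 <= x <= (2 * g + 1)%:R -> 0 < th < 8 ->
  ~~ (1 < th < 2) -> ~~ (5 < th < 6) -> sphere_with_handles g (strip x th).
Proof.
move=> xg /andP[t0 t8] n1 n2; left; split.
  by apply: strip_box => //; apply/andP; split; lra.
case=> j _ [_ /andP[y1 y2] zz].
have h1 : 0 <= th <= 8 by apply/andP; split; lra.
case: (strip_cases h1) => -[e1 ey ez]; rewrite ey ?ez in y1 y2 zz.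
- by rewrite y1 y2 in n1.
- lra.
- by move/negP: n2; apply; apply/andP; split; lra.
- lra.
Qed.

(** The left wall of the tube, along which the drawings are routed. *)
Lemma tube_surface (g i : nat) (y z : R) : (i < g)%N -> 1 <= y <= 2 -> 0 <= z <= 1 ->
  sphere_with_handles g ((2 * i + 1)%:R, y, z).
Proof.
move=> ig y1 z1; right; exists i => //; split => //.
  by rewrite lexx ler_nat leq_add2l.
by left; left.
Qed.

End Strip.

(** * Drawings built section by section *)

Section Slabs.
Variables (R : realType) (n : nat) (S : set (R * R * R)).
Implicit Types (x : R) (U : {set 'I_n}) (e f : {set 'I_n}) (L : {set {set 'I_n}}).
Implicit Types (th : {set 'I_n} -> 'I_n -> R) (pos : 'I_n -> R * R * R).
Implicit Types (u v w : 'I_n) (K : {set 'I_n} -> set (R * R * R)).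

Definition end_pt x U th pos e v := if v \in U then pos v else strip x (th e v).

(* A drawing, to the right of the section x, of the edges in L: an end of an
   edge at a vertex v of U is drawn at pos v, the other ends arrive at the
   points of the section given by th. *)
Record right_drawing x U L th pos K : Prop := RightDrawing {
  rd_pos : forall v, v \in U -> S (pos v) /\ x < (pos v).1.1;
  rd_inj : {in U &, injective pos};
  rd_arc : forall e u v, e \in L -> u != v -> e = [set u; v]%SET ->
    is_arc R (K e) (end_pt x U th pos e u) (end_pt x U th pos e v);
  rd_sub : forall e p, e \in L -> K e p -> S p /\ x <= p.1.1;
  rd_port : forall e p, e \in L -> K e p -> p.1.1 = x ->
    exists v, [/\ v \in e, v \notin U & p = strip x (th e v)];
  rd_vtx : forall e v, e \in L -> v \in U -> K e (pos v) -> v \in e;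
  rd_disj : forall e f p, e \in L -> f \in L -> e != f -> K e p -> K f p ->
    exists v, [/\ v \in U, v \in e, v \in f & p = pos v] }.

Definition drawable x U L th := exists pos K, right_drawing x U L th pos K.

(** One step of the sweep. Vertices of [U] outside [U'] are placed between the two sections, edges
    of [L] outside [L'] are completed there by [K], and [M e v] carries the strand of a continuing
    edge towards its end [v], from a port or from a vertex placed here, on to the next section. *)
Record slab x0 x1 U U' L L' th th' pos K (M : {set 'I_n} -> 'I_n -> set (R * R * R))
    : Prop := Slab {
  sl_U : U' \subset U;
  sl_L : L' \subset L;
  sl_pos : forall v, v \in U -> v \notin U' -> S (pos v) /\ x0 < (pos v).1.1 < x1;
  sl_inj : {in [set v in U | v \notin U']%SET &, injective pos};
  sl_arc : forall e v, e \in L' -> v \in e -> v \notin U' ->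
    is_arc R (M e v) (end_pt x0 U th pos e v) (strip x1 (th' e v));
  sl_sub : forall e v p, e \in L' -> v \in e -> v \notin U' -> M e v p ->
    S p /\ x0 <= p.1.1 <= x1;
  sl_left : forall e v p, e \in L' -> v \in e -> v \notin U' -> M e v p ->
    p.1.1 = x0 -> v \notin U /\ p = strip x0 (th e v);
  sl_right : forall e v p, e \in L' -> v \in e -> v \notin U' -> M e v p ->
    p.1.1 = x1 -> p = strip x1 (th' e v);
  sl_disj : forall e v f w p, e \in L' -> v \in e -> v \notin U' ->
    f \in L' -> w \in f -> w \notin U' -> (e, v) != (f, w) ->
    M e v p -> M f w p -> [/\ v = w, v \in U & p = pos v];
  sl_vtx : forall e v w, e \in L' -> v \in e -> v \notin U' -> w \in U ->
    w \notin U' -> M e v (pos w) -> v = w;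
  sl_ends : forall e v, e \in L -> e \notin L' -> v \in e -> v \notin U';
  sl_karc : forall e u v, e \in L -> e \notin L' -> u != v -> e = [set u; v]%SET ->
    is_arc R (K e) (end_pt x0 U th pos e u) (end_pt x0 U th pos e v);
  sl_ksub : forall e p, e \in L -> e \notin L' -> K e p -> S p /\ x0 <= p.1.1 < x1;
  sl_kleft : forall e p, e \in L -> e \notin L' -> K e p -> p.1.1 = x0 ->
    exists v, [/\ v \in e, v \notin U & p = strip x0 (th e v)];
  sl_kvtx : forall e w, e \in L -> e \notin L' -> w \in U -> w \notin U' ->
    K e (pos w) -> w \in e;
  sl_kk : forall e f p, e \in L -> e \notin L' -> f \in L -> f \notin L' ->
    e != f -> K e p -> K f p ->
    exists v, [/\ v \in U, v \in e, v \in f & p = pos v];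
  sl_km : forall e f w p, e \in L -> e \notin L' -> f \in L' -> w \in f ->
    w \notin U' -> K e p -> M f w p -> [/\ w \in U, w \in e & p = pos w] }.

(** A continuing edge is the union of its drawing on the right and at most two strands in the slab.
    These meet only on the section [x1], where the ports of both sides are the same points. *)
Lemma drawable_slab x0 x1 U U' L L' th th' pos0 K0 M : x0 < x1 ->
  slab x0 x1 U U' L L' th th' pos0 K0 M ->
  drawable x1 U' L' th' -> drawable x0 U L th.
Proof.
move=> x01 sl [pos' [K' rd]].
pose pos v := if v \in U' then pos' v else pos0 v.
pose K e := if e \in L' then
  K' e `|` [set p | exists v, [/\ v \in e, v \notin U' & M e v p]] else K0 e.
have LU v : v \in U' -> v \in U by move/(fintype.subsetP (sl_U sl)).
have LL e : e \in L' -> e \in L by move/(fintype.subsetP (sl_L sl)).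
have posU v : v \in U' -> pos v = pos' v by rewrite /pos => ->.
have posN v : v \notin U' -> pos v = pos0 v by rewrite /pos => /negbTE->.
have x1pos v : v \in U' -> x1 < (pos v).1.1.
  by move=> vU; rewrite posU //; case: (rd_pos rd vU).
have posx1 v : v \in U -> v \notin U' -> x0 < (pos v).1.1 < x1.
  by move=> vU vU'; rewrite posN //; case: (sl_pos sl vU vU').
have ptN e v : v \notin U' -> end_pt x0 U th pos0 e v = end_pt x0 U th pos e v.
  by move=> vU'; rewrite /end_pt posN.
have KM e v p : e \in L' -> v \in e -> v \notin U' -> K' e p -> M e v p ->
    p = strip x1 (th' e v).
  move=> eL ve vU kp mp; apply: (sl_right sl) (mp) _ => //.
  have [_ a] := rd_sub rd eL kp; have [_ /andP[_ b]] := sl_sub sl eL ve vU mp.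
  by apply/le_anti; rewrite a b.
have KM2 e f w p : e \in L' -> f \in L' -> e != f -> w \in f -> w \notin U' ->
    K' e p -> M f w p -> False.
  move=> eL fL ef wf wU kp mp.
  have [_ a] := rd_sub rd eL kp; have [_ /andP[_ b]] := sl_sub sl fL wf wU mp.
  have E : p.1.1 = x1 by apply/le_anti; rewrite a b.
  have [v [ve vU pE]] := rd_port rd eL kp E.
  have mv : M e v p by rewrite pE; exact: (arc_ends (sl_arc sl eL ve vU)).2.
  have [|vw vU1 pE2] := sl_disj sl eL ve vU fL wf wU _ mv mp.
    by apply: contra ef => /eqP[->].
  by have := posx1 _ vU1 vU; rewrite posN // -pE2 E ltxx andbF.
have M0 e v w p : e \in L' -> v \in e -> v \notin U' -> w \in U' -> M e v p ->
    p <> pos w.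
  move=> eL ve vU wU mp pE; have [_ /andP[_]] := sl_sub sl eL ve vU mp.
  by rewrite pE leNgt x1pos.
have K0' e w : e \in L' -> w \in U -> w \notin U' -> ~ K' e (pos w).
  move=> eL wU wU' /(rd_sub rd eL)[_]; case/andP: (posx1 _ wU wU') => _ a.
  by rewrite leNgt a.
exists pos, K; split.
- move=> v vU; have [vU'|vU'] := boolP (v \in U').
    rewrite posU //; have [? ?] := rd_pos rd vU'; split => //.
    exact: lt_trans x01 _.
  by rewrite posN //; have [? /andP[? ?]] := sl_pos sl vU vU'; split.
- move=> v w vU wU; have [vU'|vU'] := boolP (v \in U');
    have [wU'|wU'] := boolP (w \in U') => E.
  + by apply: (rd_inj rd) => //; rewrite -!posU.
  + by have := posx1 _ wU wU'; rewrite -E => /andP[_]; rewrite ltNge (ltW (x1pos _ vU')).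
  + by have := posx1 _ vU vU'; rewrite E => /andP[_]; rewrite ltNge (ltW (x1pos _ wU')).
  + by apply: (sl_inj sl); rewrite ?inE ?vU ?wU //; rewrite -!posN.
- move=> e u v eL uv eE; rewrite /K; case: ifP => eL'; last first.
    have eN : e \notin L' by rewrite eL'.
    have ue : u \in e by rewrite eE !inE eqxx.
    have ve : v \in e by rewrite eE !inE eqxx orbT.
    rewrite -!ptN ?(sl_ends sl eL eN) //; exact: (sl_karc sl).
  have ue : u \in e by rewrite eE !inE eqxx.
  have ve : v \in e by rewrite eE !inE eqxx orbT.
  have A := rd_arc rd eL' uv eE.
  have MM p : M e u p -> M e v p -> u \notin U' -> v \notin U' -> False.
    move=> mu mv uU vU.
    have [|uv'] := sl_disj sl eL' ue uU eL' ve vU _ mu mv; last by rewrite uv' eqxx in uv.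
    by apply: contra uv => /eqP[->].
  have [uU|uU] := boolP (u \in U'); have [vU|vU] := boolP (v \in U').
  + rewrite (_ : _ `|` _ = K' e).
      by move: A; rewrite /end_pt uU vU !LU // !posU.
    apply/seteqP; split => [p [//|[w []]]|p kp]; last by left.
    by rewrite eE !inE => /orP[]/eqP->; rewrite ?uU ?vU.
  + rewrite (_ : _ `|` _ = K' e `|` M e v).
      rewrite (_ : end_pt x0 U th pos e u = end_pt x1 U' th' pos' e u); last first.
        by rewrite /end_pt uU LU // posU.
      apply: arc_cat A _ _.
        by rewrite /end_pt (negbTE vU) -/(end_pt _ _ _ _ _ _) -ptN //; apply: arc_sym; exact: (sl_arc sl).
      by move=> p [kp mp] /=; rewrite /end_pt (negbTE vU); exact: KM.
    apply/seteqP; split => [p [|[w []]]|p [kp|mp]]; [by left| |by left|by right; exists v].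
    by rewrite eE !inE => /orP[]/eqP-> // wU mp; [rewrite uU in wU|right].
  + rewrite (_ : _ `|` _ = M e u `|` K' e).
      rewrite (_ : end_pt x0 U th pos e v = end_pt x1 U' th' pos' e v); last first.
        by rewrite /end_pt vU LU // posU.
      apply: arc_cat A _.
        by rewrite /end_pt (negbTE uU) -/(end_pt _ _ _ _ _ _) -ptN //; exact: (sl_arc sl).
      by move=> p [mp kp] /=; rewrite /end_pt (negbTE uU); exact: KM.
    apply/seteqP; split => [p [|[w []]]|p [mp|kp]]; [by right| |by right; exists u|by left].
    by rewrite eE !inE => /orP[]/eqP-> // wU mp; [left|rewrite vU in wU].
  + rewrite (_ : _ `|` _ = (M e u `|` K' e) `|` M e v).
      have Au : is_arc R (M e u `|` K' e) (end_pt x0 U th pos e u) (end_pt x1 U' th' pos' e v).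
        apply: arc_cat A _.
          by rewrite /end_pt (negbTE uU) -/(end_pt _ _ _ _ _ _) -ptN //; exact: (sl_arc sl).
        by move=> p [mp kp] /=; rewrite /end_pt (negbTE uU); exact: KM.
      apply: arc_cat Au _ _.
        by rewrite /end_pt (negbTE vU) -/(end_pt _ _ _ _ _ _) -ptN //; apply: arc_sym; exact: (sl_arc sl).
      move=> p [[mu|kp] mv] /=; first by case: (MM p).
      by rewrite /end_pt (negbTE vU); exact: KM.
    apply/seteqP; split => [p [|[w []]]|p [[mp|kp]|mp]].
    * by move=> ?; left; right.
    * by rewrite eE !inE => /orP[]/eqP-> // wU mp; [left; left|right].
    * by right; exists u.
    * by left.
    * by right; exists v.
- move=> e p eL; rewrite /K; case: ifP => eL'.
    case=> [/(rd_sub rd eL')[? ?]|[v [ve vU /(sl_sub sl eL' ve vU)[? /andP[]//]]]].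
    by split => //; apply: le_trans (ltW x01) _.
  by move/(sl_ksub sl eL (negbT eL')) => [? /andP[]].
- move=> e p eL; rewrite /K; case: ifP => eL' kp px; last first.
    exact: (sl_kleft sl eL (negbT eL')).
  case: kp => [/(rd_sub rd eL')[_]|[v [ve vU /(sl_left sl eL' ve vU)/(_ px)[? ?]]]].
    by rewrite px leNgt x01.
  by exists v.
- move=> e v eL vU; rewrite /K; case: ifP => eL'; last first.
    have [vU'|vU'] := boolP (v \in U').
      by move/(sl_ksub sl eL (negbT eL')) => [_ /andP[_]]; rewrite ltNge (ltW (x1pos _ vU')).
    by rewrite posN //; exact: (sl_kvtx sl eL (negbT eL')).
  case=> [kp|[w [we wU mp]]]; have [vU'|vU'] := boolP (v \in U').
  + by apply: (rd_vtx rd eL' vU'); rewrite -posU.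
  + by case: (K0' e v eL' vU vU').
  + by case: (M0 _ _ _ _ eL' we wU vU' mp).
  + by rewrite posN // in mp; rewrite -(sl_vtx sl eL' we wU vU vU' mp).
- have K0K' e f p : e \in L -> e \notin L' -> f \in L' -> K0 e p -> K' f p -> False.
    move=> eL eL' fL kp kp'; have [_ /andP[_ a]] := sl_ksub sl eL eL' kp.
    by have [_] := rd_sub rd fL kp'; rewrite leNgt a.
  have new e v p : e \in L' -> v \in e -> v \notin U' -> M e v p -> forall f, f \in L' ->
      e != f -> K f p -> exists v, [/\ v \in U, v \in e, v \in f & p = pos v].
    move=> eL ve vU mp f fL ef; rewrite /K fL => -[kp|[w [wf wU mp']]].
      by case: (KM2 f e v p) => //; rewrite eq_sym.
    have [|vw vU1 pE] := sl_disj sl eL ve vU fL wf wU _ mp mp'.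
      by apply: contra ef => /eqP[->].
    by exists v; split => //; [rewrite vw|rewrite posN].
  have fin e f p : e \in L -> e \notin L' -> f \in L' -> K0 e p -> K f p ->
      exists v, [/\ v \in U, v \in e, v \in f & p = pos v].
    move=> eL eL' fL kp; rewrite /K fL => -[kp'|[w [wf wU mp]]].
      by case: (K0K' e f p).
    have [wU1 we pE] := sl_km sl eL eL' fL wf wU kp mp.
    by exists w; split => //; rewrite posN.
  move=> e f p eL fL ef.
  have [eL'|eL'] := boolP (e \in L'); have [fL'|fL'] := boolP (f \in L').
  + rewrite {1}/K eL' => -[kp|[v [ve vU mp]]] kf; last exact: new mp _ fL' ef kf.
    move: (kf); rewrite /K fL' => -[kp'|[w [wf wU mp]]].
      have [v [vU ve vf pE]] := rd_disj rd eL' fL' ef kp kp'.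
      by exists v; rewrite LU // posU.
    by case: (KM2 e f w p).
  + rewrite {2}/K (negbTE fL') => ke kf.
    by have [v [? ? ? ?]] := fin f e p fL fL' eL' kf ke; exists v.
  + by rewrite {1}/K (negbTE eL') => ke kf; exact: fin eL eL' fL' ke kf.
  + rewrite /K (negbTE eL') (negbTE fL') => ke kf.
    have [v [vU ve vf pE]] := sl_kk sl eL eL' fL fL' ef ke kf.
    by exists v; rewrite posN // (sl_ends sl eL eL').
Qed.

End Slabs.

Lemma set2_eq (T : finType) (u v u' v' : T) : u' != v' ->
  [set u; v]%SET = [set u'; v']%SET -> (u = u' /\ v = v') \/ (u = v' /\ v = u').
Proof.
move=> n E.
have hu : u \in [set u'; v']%SET by rewrite -E !inE eqxx.
have hv : v \in [set u'; v']%SET by rewrite -E !inE eqxx orbT.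
have hu' : u' \in [set u; v]%SET by rewrite E !inE eqxx.
have hv' : v' \in [set u; v]%SET by rewrite E !inE eqxx orbT.
move: hu hv hu' hv'; rewrite !inE.
move=> /orP[/eqP->|/eqP->] /orP[/eqP->|/eqP->]; [|by left|by right|].
  by move=> _ /orP[]/eqP e; rewrite e eqxx in n.
by move=> /orP[]/eqP e; rewrite e eqxx in n.
Qed.

(** * Moves that need no handle *)

Section FreeSlabs.
Variables (R : realType) (n g : nat).
Implicit Types (x : R) (U : {set 'I_n}) (e f : {set 'I_n}) (L : {set {set 'I_n}}).
Implicit Types (th : {set 'I_n} -> 'I_n -> R) (u v w : 'I_n).
Local Notation S := (@sphere_with_handles R g).

(** A dangling end: [v] has been placed to the left, so the section cuts the strand of [e] leading
    to it. *)
Definition is_port U L e v := [&& e \in L, v \in e & v \notin U].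

Definition ports_ok U L th :=
  (forall e v, is_port U L e v -> 0 < th e v < 8) /\
  (forall e v f w, is_port U L e v -> is_port U L f w -> th e v = th f w ->
     (e, v) = (f, w)).

Lemma is_portP U L e v : e \in L -> v \in e -> v \notin U -> is_port U L e v.
Proof. by rewrite /is_port => -> -> ->. Qed.

Definition seg x0 x1 (a b : R) : set (R * R * R) :=
  [set strip x (a + (b - a) * ((x - x0) / (x1 - x0))) | x in `[x0, x1]].

Lemma seg_arc x0 x1 a b : x0 < x1 -> is_arc R (seg x0 x1 a b) (strip x0 a) (strip x1 b).
Proof.
move=> x01; have x01' : x1 - x0 != 0 by rewrite subr_eq0 gt_eqF.
pose h x := strip x (a + (b - a) * ((x - x0) / (x1 - x0))).
have -> : strip x0 a = h x0 by rewrite /h subrr mul0r mulr0 addr0.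
have -> : strip x1 b = h x1 by rewrite /h divff // mulr1 addrC subrK.
apply: arc_image => //; last by move=> s t _ _ [].
apply: continuous_strip; first by move=> x; exact: cvg_id.
move=> x; apply: cvgD; first exact: cvg_cst.
apply: cvgMr; apply: cvgMl; apply: cvgB; [exact: cvg_id|exact: cvg_cst].
Qed.

Lemma seg_pt x0 x1 a b p : x0 < x1 -> 0 < a < 8 -> 0 < b < 8 -> seg x0 x1 a b p ->
  exists x (l : R), [/\ x0 <= x <= x1, 0 <= l <= 1, x = x0 + l * (x1 - x0),
    0 < a + (b - a) * l < 8 & p = strip x (a + (b - a) * l)].
Proof.
move=> x01 /andP[a0 a8] /andP[b0 b8] [x + <-]; rewrite /= in_itv /= => /andP[x0x xx1].
have x10 : 0 < x1 - x0 by rewrite subr_gt0.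
set l := (x - x0) / (x1 - x0).
have l0 : 0 <= l by rewrite divr_ge0 // ?subr_ge0 // ltW.
have l1 : l <= 1 by rewrite ler_pdivrMr // mul1r lerD2r.
exists x, l; split => //.
- by rewrite x0x.
- by rewrite l0.
- by rewrite /l divfK ?gt_eqF // addrC subrK.
- clearbody l; have [lh|lh] := leP l 2^-1; apply/andP; split; nra.
Qed.

Lemma seg_disj x0 x1 a b a' b' p : x0 < x1 -> 0 < a < 8 -> 0 < b < 8 ->
  0 < a' < 8 -> 0 < b' < 8 -> a < a' -> b < b' ->
  seg x0 x1 a b p -> seg x0 x1 a' b' p -> False.
Proof.
move=> x01 a8 b8 a8' b8' aa bb /(seg_pt x01 a8 b8) [x [l [? l1 xE t8 ->]]].
move=> /(seg_pt x01 a8' b8') [x' [l' [? l1' xE' t8' /(strip_inj t8 t8')[xx tt]]]].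
have ll : l = l'.
  move: xx; rewrite xE xE' => /addrI /mulIf; apply.
  by rewrite subr_eq0 gt_eqF.
by rewrite -ll in tt; move/andP: l1 => [? ?]; have [lh|lh] := leP l 2^-1; nra.
Qed.

(** Straight strands in strip coordinates do not cross if the order of their ends is the same on
    both sections. *)
Lemma drawable_reposition i x0 x1 U L th th' : (i <= g)%N ->
  (2 * i)%:R <= x0 -> x0 < x1 -> x1 <= (2 * i + 1)%:R ->
  ports_ok U L th -> (forall e v, is_port U L e v -> 0 < th' e v < 8) ->
  (forall e v f w, is_port U L e v -> is_port U L f w -> th e v < th f w ->
     th' e v < th' f w) ->
  drawable S x1 U L th' -> drawable S x0 U L th.
Proof.
move=> ig ix x01 xi [ok1 ok2] ok' mono.
have X0 x : x0 <= x <= x1 -> (2 * i)%:R <= x <= (2 * i + 1)%:R.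
  by move=> /andP[? ?]; apply/andP; split; lra.
apply: (@drawable_slab _ _ _ _ _ _ _ _ _ _ _ (fun=> (0, 0, 0)) (fun=> set0)
  (fun e v => seg x0 x1 (th e v) (th' e v))) => //.
split=> //; try (intros; exfalso; match goal with
  H : is_true (?x \in ?A), H' : is_true (?x \notin ?A) |- _ => by rewrite H in H' end).
- by move=> v w; rewrite !inE => /andP[-> ].
- by move=> e v eL ve vU; rewrite /end_pt (negbTE vU); exact: seg_arc.
- move=> e v p eL ve vU; have P := is_portP eL ve vU.
  move=> /(seg_pt x01 (ok1 _ _ P) (ok' _ _ P)) [x [l [xx _ _ t8 ->]]].
  by split => //; apply: strip_surface_between ig (X0 _ xx) t8.
- move=> e v p eL ve vU; have P := is_portP eL ve vU.
  move=> /(seg_pt x01 (ok1 _ _ P) (ok' _ _ P)) [x [l [xx _ xE t8 ->]]] /= x0E.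
  split => //; have -> : l = 0 by nra.
  by rewrite x0E mulr0 addr0.
- move=> e v p eL ve vU; have P := is_portP eL ve vU.
  move=> /(seg_pt x01 (ok1 _ _ P) (ok' _ _ P)) [x [l [xx _ xE t8 ->]]] /= x1E.
  have -> : l = 1 by nra.
  by rewrite x1E mulr1 addrC subrK.
- move=> e v f w p eL ve vU fL wf wU ne mp mp'.
  have P := is_portP eL ve vU; have P' := is_portP fL wf wU.
  have [lt|lt|E] := ltgtP (th e v) (th f w).
  + by case: (seg_disj x01 _ _ _ _ lt (mono _ _ _ _ P P' lt) mp mp'); auto.
  + by case: (seg_disj x01 _ _ _ _ lt (mono _ _ _ _ P' P lt) mp' mp); auto.
  + by rewrite (ok2 _ _ _ _ P P' E) eqxx in ne.
Qed.

(** Two neighbouring ports of one edge are joined by a parabola that leaves the section and returns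
    to it, while all other strands run straight. *)
Lemma drawable_cap i x0 x1 L th e0 u0 v0 : (i <= g)%N ->
  (2 * i)%:R <= x0 -> x0 < x1 -> x1 <= (2 * i + 1)%:R ->
  ports_ok finset.set0 L th -> e0 \in L -> e0 = [set u0; v0]%SET ->
  th e0 u0 < th e0 v0 ->
  (forall e v, e \in L -> v \in e -> ~~ (th e0 u0 < th e v < th e0 v0)) ->
  drawable S x1 finset.set0 (L :\ e0)%SET th -> drawable S x0 finset.set0 L th.
Proof.
move=> ig ix x01 xi [ok1 ok2] eL0 e0E ab gap.
set a := th e0 u0 in ab gap; set b := th e0 v0 in ab gap.
have pt e v : e \in L -> v \in e -> is_port finset.set0 L e v.
  by move=> eL ve; rewrite /is_port eL ve inE.
have /ok1/andP[a0 a8] : is_port finset.set0 L e0 u0.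
  by apply: pt => //; rewrite e0E !inE eqxx.
have /ok1/andP[b0 b8] : is_port finset.set0 L e0 v0.
  by apply: pt => //; rewrite e0E !inE eqxx orbT.
rewrite -/a -/b in a0 a8 b0 b8.
have X0 x : x0 <= x <= x1 -> (2 * i)%:R <= x <= (2 * i + 1)%:R.
  by move=> /andP[? ?]; apply/andP; split; lra.
(* The ports lie in an interval of length 8, so (t - a)(b - t) is at most 64; dividing by 65 keeps
   the parabola strictly left of [x1]. *)
pose c := (x1 - x0) / 65.
have c0 : 0 < c by rewrite divr_gt0 // subr_gt0.
pose h t := strip (x0 + c * ((t - a) * (b - t))) t.
have K8 t : t \in `[a, b] -> [/\ 0 < t < 8 & x0 <= x0 + c * ((t - a) * (b - t)) < x1].
  rewrite in_itv /= => /andP[at_ tb]; split; first by apply/andP; split; lra.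
  have q0 : 0 <= (t - a) * (b - t) by rewrite mulr_ge0 // subr_ge0.
  have q1 : (t - a) * (b - t) <= 64 by nra.
  have cE : c * 65 = x1 - x0 by rewrite /c divfK.
  by apply/andP; split; nra.
have DL e : e \in L -> e \notin (L :\ e0)%SET -> e = e0.
  by rewrite !inE => -> ; rewrite andbT negbK => /eqP.
have LD e : e \in (L :\ e0)%SET -> e \in L /\ e != e0 by rewrite !inE => /andP[].
have th_h e v t : e \in (L :\ e0)%SET -> v \in e -> t \in `[a, b] -> th e v = t -> False.
  move=> /LD[eL ne] ve; rewrite in_itv /= => /andP[at_ tb] E.
  have ue0 : u0 \in e0 by rewrite e0E !inE eqxx.
  have ve0 : v0 \in e0 by rewrite e0E !inE eqxx orbT.
  have := gap _ _ eL ve; rewrite E.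
  have [ta|ta|ta] := ltgtP a t; last first.
  - have := ok2 _ _ _ _ (pt _ _ eL ve) (pt _ _ eL0 ue0); rewrite E -ta => /(_ erefl)[ee].
    by rewrite ee eqxx in ne.
  - by rewrite leNgt ta in at_.
  have [tb'|tb'|tb'] := ltgtP t b => // _.
  - by rewrite leNgt tb' in tb.
  - have := ok2 _ _ _ _ (pt _ _ eL ve) (pt _ _ eL0 ve0); rewrite E tb' => /(_ erefl)[ee].
    by rewrite ee eqxx in ne.
apply: (@drawable_slab _ _ _ _ _ _ _ _ _ _ _ (fun=> (0, 0, 0)) (fun=> [set h t | t in `[a, b]])
  (fun e v => seg x0 x1 (th e v) (th e v))) => //.
have hx e v p : e \in (L :\ e0)%SET -> v \in e -> seg x0 x1 (th e v) (th e v) p ->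
    exists2 x, x0 <= x <= x1 & p = strip x (th e v).
  move=> /LD[eL _] ve; have P := pt _ _ eL ve.
  move=> /(seg_pt x01 (ok1 _ _ P) (ok1 _ _ P)) [x [l [xx _ xE _ ->]]].
  by exists x => //; rewrite subrr mul0r addr0.
split=> //; try (intros; exfalso; match goal with
  H : is_true (_ \in _) |- _ => by rewrite inE in H end).
- exact: finset.subsetDl.
- by move=> v w; rewrite !inE.
- by move=> e v eL ve _; rewrite /end_pt inE; exact: seg_arc.
- move=> e v p eL ve _ /(hx _ _ _ eL ve)[x xx ->]; split => //.
  by apply: strip_surface_between ig (X0 _ xx) _; apply: ok1; apply: pt => //; case: (LD _ eL).
- by move=> e v p eL ve _ /(hx _ _ _ eL ve)[x xx ->] /= ->; rewrite inE.
- by move=> e v p eL ve _ /(hx _ _ _ eL ve)[x xx ->] /= ->.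
- move=> e v f w p eL ve _ fL wf _ ne /(hx _ _ _ eL ve)[x xx ->] /(hx _ _ _ fL wf)[x' xx'].
  have [eL1 _] := LD _ eL; have [fL1 _] := LD _ fL.
  have P := pt _ _ eL1 ve; have P' := pt _ _ fL1 wf.
  case/(strip_inj (ok1 _ _ P) (ok1 _ _ P')) => _ /(ok2 _ _ _ _ P P') E.
  by rewrite E eqxx in ne.
- by move=> e v _ _ _; rewrite inE.
- move=> e u v eL eN uv eE; have ee := DL _ eL eN.
  have A : is_arc R [set h t | t in `[a, b]] (strip x0 a) (strip x0 b).
    have -> : strip x0 a = h a by rewrite /h subrr mul0r mulr0 addr0.
    have -> : strip x0 b = h b by rewrite /h subrr !mulr0 addr0.
    apply: arc_image => //.
      apply: continuous_strip; last by move=> t; exact: cvg_id.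
      move=> t; apply: cvgD; first exact: cvg_cst.
      apply: cvgMr; apply: cvgM; apply: cvgB; exact: cvg_cst || exact: cvg_id.
    by move=> s t /K8[s8 _] /K8[t8 _] /(strip_inj s8 t8)[].
  rewrite /end_pt !inE; move: eE; rewrite ee e0E => /(set2_eq uv)[][<- <-].
    by rewrite -e0E.
  by rewrite -e0E; apply: arc_sym.
- move=> e p eL eN [t /K8[t8 xt] <-]; split => //.
  by apply: strip_surface_between ig (X0 _ _) t8; move/andP: xt => [-> /ltW].
- move=> e p eL eN [t tab <-] /= E; have ee := DL _ eL eN.
  have : (t - a) * (b - t) = 0 by nra.
  move/eqP; rewrite mulf_eq0 !subr_eq0 => /orP[]/eqP tE.
    exists u0; rewrite inE ee; split=> //; first by rewrite e0E !inE eqxx.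
    by rewrite /h E tE.
  exists v0; rewrite inE ee; split=> //; first by rewrite e0E !inE eqxx orbT.
  by rewrite /h E -tE.
- by move=> e f p eL eN fL fN; rewrite (DL _ eL eN) (DL _ fL fN) eqxx.
- move=> e f w p eL eN fL wf _ [t tab <-] /(hx _ _ _ fL wf)[x xx].
  have [fL1 _] := LD _ fL; have [t8 _] := K8 _ tab.
  case/(strip_inj t8 (ok1 _ _ (pt _ _ fL1 wf))) => _ /esym.
  by move/(th_h _ _ _ fL wf tab).
Qed.

(** The vertex is put at height [t0]. An edge that arrives there ends, at most one since ports have
    distinct heights; the other edges at [v0] leave as a fan into the free interval of length [d]
    above [t0]. *)
Lemma drawable_vertex i x0 x1 U L L' th v0 t0 d : (i <= g)%N ->
  (2 * i)%:R <= x0 -> x0 < x1 -> x1 <= (2 * i + 1)%:R ->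
  ports_ok U L th -> v0 \in U -> 0 < t0 -> 0 < d -> t0 + d < 8 -> L' \subset L ->
  (forall e, e \in L -> e \notin L' ->
     exists u, [/\ u \notin U, e = [set u; v0]%SET & th e u = t0]) ->
  (forall e v, is_port U L' e v -> ~~ (t0 <= th e v <= t0 + d)) ->
  exists th', ports_ok (U :\ v0)%SET L' th' /\
    (drawable S x1 (U :\ v0)%SET L' th' -> drawable S x0 U L th).
Proof.
move=> ig ix x01 xi [ok1 ok2] vU0 t00 d0 t0d sLL fin gap.
(* Distinct offsets in ]0, d[ for the strands of the fan, taken from the rank of the edge. *)
pose eta e : R := d * ((enum_rank e).+1%:R / (#|{set 'I_n}|.+1)%:R).
have eta_gt0 e : 0 < eta e by rewrite mulr_gt0 // divr_gt0 ?ltr0n.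
have eta_lt e : eta e < d.
  by rewrite -[ltRHS]mulr1 ltr_pM2l // ltr_pdivrMr ?ltr0n // mul1r ltr_nat ltnS ltn_ord.
have eta_inj : injective eta.
  move=> e f /(mulfI (lt0r_neq0 d0)) /mulIf; rewrite invr_eq0 pnatr_eq0 => /(_ isT).
  by move/eqP; rewrite eqr_nat eqSS => /eqP/val_inj/enum_rank_inj.
clearbody eta.
pose th' e v := if v == v0 then t0 + eta e else th e v.
have L'L e : e \in L' -> e \in L by move/(fintype.subsetP sLL).
have port_old e v : is_port (U :\ v0)%SET L' e v -> v != v0 -> is_port U L' e v.
  by rewrite /is_port !inE => /and3P[-> ->] /=; case: eqP.
have portL e v : is_port U L' e v -> is_port U L e v.
  by rewrite /is_port => /and3P[/L'L -> -> ->].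
have ok' : ports_ok (U :\ v0)%SET L' th'.
  split=> [e v P|e v f w P Q]; rewrite /th'.
    case: ifPn => [_|vn]; last exact: ok1 (portL _ _ (port_old _ _ P vn)).
    by have := eta_gt0 e; have := eta_lt e => ? ?; apply/andP; split; lra.
  case: ifPn => [/eqP->|vn]; case: ifPn => [/eqP->|wn].
  - by move/addrI/eta_inj ->.
  - move=> E; have /negP[] := gap _ _ (port_old _ _ Q wn); rewrite -E.
    by have := eta_gt0 e; have := eta_lt e => ? ?; apply/andP; split; lra.
  - move=> E; have /negP[] := gap _ _ (port_old _ _ P vn); rewrite E.
    by have := eta_gt0 f; have := eta_lt f => ? ?; apply/andP; split; lra.
  - exact: ok2 (portL _ _ (port_old _ _ P vn)) (portL _ _ (port_old _ _ Q wn)).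
exists th'; split => //.
have X0 x : x0 <= x <= x1 -> (2 * i)%:R <= x <= (2 * i + 1)%:R.
  by move=> /andP[? ?]; apply/andP; split; lra.
(* The vertex lies halfway, the arriving edge to its left and the fan to its right. *)
pose xm := (x0 + x1) / 2.
have x0m : x0 < xm by rewrite /xm; lra.
have xm1 : xm < x1 by rewrite /xm; lra.
clearbody xm.
have t8 : 0 < t0 < 8 by apply/andP; split; lra.
pose M e v := if v == v0 then seg xm x1 t0 (t0 + eta e) else seg x0 x1 (th e v) (th e v).
have te8 e : 0 < t0 + eta e < 8.
  by have := eta_gt0 e; have := eta_lt e => ? ?; apply/andP; split; lra.
have Mnew e p : M e v0 p -> exists x (l : R), [/\ xm <= x <= x1, 0 <= l <= 1,
    x = xm + l * (x1 - xm) & p = strip x (t0 + eta e * l)].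
  rewrite /M eqxx => /(seg_pt xm1 t8 (te8 e)) [x [l [? ? ? _ ->]]].
  by exists x, l; split => //; congr strip; ring.
have Mold e v p : is_port U L' e v -> v != v0 -> M e v p ->
    exists2 x, x0 <= x <= x1 & p = strip x (th e v).
  move=> P vn; rewrite /M (negbTE vn).
  have T := ok1 _ _ (portL _ _ P).
  move=> /(seg_pt x01 T T) [x [l [xx _ xE _ ->]]].
  by exists x => //; rewrite subrr mul0r addr0.
have notU' v : v \notin (U :\ v0)%SET -> v != v0 -> v \notin U.
  by rewrite !inE; case: eqP.
have inU v : v \in U -> v \notin (U :\ v0)%SET -> v = v0.
  by rewrite !inE => ->; rewrite andbT negbK => /eqP.
have K0 e p : seg x0 xm t0 t0 p -> exists2 x, x0 <= x <= xm & p = strip x t0.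
  move=> /(seg_pt x0m t8 t8) [x [l [xx _ _ _ ->]]].
  by exists x => //; rewrite subrr mul0r addr0.
have off_old e v x l f : is_port U L' e v -> 0 <= l <= 1 -> th e v <> t0 + eta f * l.
  move=> P /andP[l0 l1] E; have /negP[] := gap _ _ P; rewrite E.
  by have := eta_gt0 f; have := eta_lt f => ? ?; apply/andP; split; nra.
have l8 l e : 0 <= l <= 1 -> 0 < t0 + eta e * l < 8.
  by move=> /andP[l0 l1]; have := eta_gt0 e; have := eta_lt e => ? ?; apply/andP; split; nra.
apply: (@drawable_slab _ _ _ _ _ _ _ _ _ _ _ (fun=> strip xm t0)
  (fun=> seg x0 xm t0 t0) M) => //.
split=> //.
- exact: finset.subsetDl.
- move=> v vU vU'; split; last by rewrite /= x0m.
  by apply: strip_surface_between ig (X0 _ _) t8; apply/andP; split; lra.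
- by move=> v w; rewrite !inE => /andP[vU +] /andP[wU +]; rewrite vU wU !andbT !negbK => /eqP-> /eqP->.
- move=> e v eL ve vU; rewrite /M /th' /end_pt; case: ifPn => [/eqP->|vn].
    by rewrite vU0; exact: seg_arc.
  by rewrite (negbTE (notU' _ vU vn)); exact: seg_arc.
- move=> e v p eL ve vU; have [->|vn] := eqVneq v v0.
    move=> /Mnew [x [l [xx ll _ ->]]]; split; last by move/andP: xx => [? ?] /=; apply/andP; split; lra.
    by apply: strip_surface_between ig (X0 _ _) (l8 _ _ ll); move/andP: xx => [? ?]; apply/andP; split; lra.
  have P := is_portP eL ve (notU' _ vU vn).
  move=> /(Mold _ _ _ P vn)[x xx ->]; split => //.
  exact: strip_surface_between ig (X0 _ xx) (ok1 _ _ (portL _ _ P)).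
- move=> e v p eL ve vU; have [->|vn] := eqVneq v v0.
    by move=> /Mnew [x [l [/andP[xx _] ll _ ->]]] /= E; exfalso; lra.
  have P := is_portP eL ve (notU' _ vU vn).
  by move=> /(Mold _ _ _ P vn)[x xx ->] /= ->; split; rewrite ?notU'.
- move=> e v p eL ve vU; rewrite /th'; have [->|vn] := eqVneq v v0.
    move=> /Mnew [x [l [/andP[xx _] ll xE ->]]] /= E.
    have -> : l = 1 by nra.
    by rewrite E mulr1.
  have P := is_portP eL ve (notU' _ vU vn).
  by move=> /(Mold _ _ _ P vn)[x xx ->] /= ->.
- move=> e v f w p eL ve vU fL wf wU ne.
  have [ev|vn] := eqVneq v v0; have [ew|wn] := eqVneq w v0.
  + subst v w => /Mnew [x [l [? ll xE ->]]] /Mnew [x' [l' [? ll' xE']]].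
    case/(strip_inj (l8 _ _ ll) (l8 _ _ ll')) => xx tt.
    have ll1 : l = l' by nra.
    have /mulIf : eta e * l = eta f * l by rewrite {2}ll1; apply: (addrI t0).
    have [l0 _|l0 /(_ isT)/eta_inj ef] := eqVneq l 0.
      by split => //; rewrite xE l0 mul0r mulr0 !addr0.
    by rewrite ef eqxx in ne.
  + subst v => /Mnew [x [l [? ll xE ->]]].
    have P := is_portP fL wf (notU' _ wU wn).
    move=> /(Mold _ _ _ P wn)[x' xx'] /(strip_inj (l8 _ _ ll) (ok1 _ _ (portL _ _ P)))[_].
    by move/esym/(off_old _ _ 0 _ _ P ll).
  + subst w => mp /Mnew [x [l [? ll xE pE]]]; move: mp; rewrite {}pE.
    have P := is_portP eL ve (notU' _ vU vn).
    move=> /(Mold _ _ _ P vn)[x' xx'] /(strip_inj (l8 _ _ ll) (ok1 _ _ (portL _ _ P)))[_].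
    by move/esym/(off_old _ _ 0 _ _ P ll).
  + have P := is_portP eL ve (notU' _ vU vn); have Q := is_portP fL wf (notU' _ wU wn).
    move=> /(Mold _ _ _ P vn)[x xx ->] /(Mold _ _ _ Q wn)[x' xx'].
    case/(strip_inj (ok1 _ _ (portL _ _ P)) (ok1 _ _ (portL _ _ Q))) => _.
    by move/(ok2 _ _ _ _ (portL _ _ P) (portL _ _ Q)) => E; rewrite E eqxx in ne.
- move=> e v w eL ve vU wU wU'; rewrite (inU _ wU wU').
  have [//|vn] := eqVneq v v0.
  have P := is_portP eL ve (notU' _ vU vn).
  move=> /(Mold _ _ _ P vn)[x xx] /(strip_inj t8 (ok1 _ _ (portL _ _ P)))[_ E].
  have := gap _ _ P; rewrite -E lexx /= => /negP[]; lra.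
- move=> e v eL eN ve; have [u [uU eE _]] := fin _ eL eN.
  move: ve; rewrite eE !inE => /orP[]/eqP->; last by rewrite eqxx.
  by rewrite (negbTE uU) andbF.
- move=> e u v eL eN uv eE; have [u' [uU' eE' tE]] := fin _ eL eN.
  have A : is_arc R (seg x0 xm t0 t0) (strip x0 (th e u')) (strip xm t0).
    by rewrite tE; exact: seg_arc.
  move: eE; rewrite {1}eE' => /(set2_eq uv)[][<- <-]; rewrite /end_pt vU0 (negbTE uU') //.
  exact: arc_sym.
- move=> e p eL eN /(K0 e) [x xx ->]; split; last by move/andP: xx => [? ?] /=; apply/andP; split; lra.
  by apply: strip_surface_between ig (X0 _ _) t8; move/andP: xx => [? ?]; apply/andP; split; lra.
- move=> e p eL eN /(K0 e) [x xx ->] /= ->; have [u' [uU' eE' tE]] := fin _ eL eN.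
  by exists u'; rewrite uU' tE eE' !inE eqxx.
- move=> e w eL eN wU wU' _; have [u' [uU' eE' tE]] := fin _ eL eN.
  by rewrite (inU _ wU wU') eE' !inE eqxx orbT.
- move=> e f p eL eN fL fN ef _ _.
  have [u [uU eE tE]] := fin _ eL eN; have [w [wU fE wE]] := fin _ fL fN.
  have P1 : is_port U L e u by apply: is_portP => //; rewrite eE !inE eqxx.
  have P2 : is_port U L f w by apply: is_portP => //; rewrite fE !inE eqxx.
  have [E _] := ok2 _ _ _ _ P1 P2 (etrans tE (esym wE)).
  by rewrite E eqxx in ef.
- move=> e f w p eL eN fL wf wU /(K0 e)[x /andP[xx0 xxm] ->].
  have [u [uU eE tE]] := fin _ eL eN.
  have [ew|wn] := eqVneq w v0.
    subst w => /Mnew [x' [l [/andP[xm' _] ll xE]]] /(strip_inj t8 (l8 _ _ ll))[xx _].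
    have -> : x = xm by apply/le_anti; rewrite xxm xx xm'.
    by rewrite vU0 eE !inE eqxx orbT.
  have Q := is_portP fL wf (notU' _ wU wn).
  move=> /(Mold _ _ _ Q wn)[x' xx'] /(strip_inj t8 (ok1 _ _ (portL _ _ Q)))[_ E].
  have := gap _ _ Q; rewrite -E lexx /= => /negP[]; lra.
Qed.

End FreeSlabs.

(** * Routing strands around one handle *)

Section Gadget.
Variable R : realType.
Implicit Types s c r x t th z : R.

Lemma strip_top x t : 0 <= t <= 3 -> strip x t = (x, t, 1).
Proof.
move=> /andP[? ?]; have h : 0 <= t <= 8 by apply/andP; split; lra.
rewrite /strip; case: (strip_cases h) => -[e -> ->] //; try (move/andP: e => [? ?]).
- by congr (_, _, _); lra.
- by congr (_, _, _); lra.
- by congr (_, _, _); lra.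
Qed.

Lemma strip_bot x t : 4 <= t <= 7 -> strip x t = (x, 7 - t, 0).
Proof.
move=> /andP[? ?]; have h : 0 <= t <= 8 by apply/andP; split; lra.
rewrite /strip; case: (strip_cases h) => -[e -> ->] //; try (move/andP: e => [? ?]);
  by congr (_, _, _); lra.
Qed.

Lemma tube_not_strip x x' y z t : 1 < y < 2 -> 0 < z < 1 -> 0 < t < 8 ->
  (x, y, z) <> strip x' t.
Proof.
move=> /andP[? ?] /andP[? ?] /andP[? ?] [_ yE zE].
have h : 0 <= t <= 8 by apply/andP; split; lra.
by case: (strip_cases h) => -[e ey ez]; rewrite ey in yE; rewrite ez in zE; lra.
Qed.

Definition hline x0 x1 s : set (R * R * R) := [set strip x s | x in `[x0, x1]].

Lemma hline_arc x0 x1 s : x0 < x1 -> is_arc R (hline x0 x1 s) (strip x0 s) (strip x1 s).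
Proof.
move=> x01; apply: (@arc_image _ _ _ _ (fun x => strip x s)) => //; last by move=> ? ? _ _ [].
by apply: continuous_strip => x; [exact: cvg_id|exact: cvg_cst].
Qed.

Definition tube_line x y : set (R * R * R) := [set (x, y, z) | z in `[0, 1]].

Lemma tube_line_arc x y : is_arc R (tube_line x y) (x, y, 0) (x, y, 1).
Proof.
apply: (@arc_image _ _ _ _ (fun z => (x, y, z))) => //; last by move=> ? ? _ _ [].
by apply: continuous_triple => z; [exact: cvg_cst|exact: cvg_cst|exact: cvg_id].
Qed.

(** A parabola around a corner of the bottom mouth, on the left of the tube wall. It is used with
    [r < 1 / 2], and the divisor 5 then keeps it to the right of [b + 9 / 10]. *)
Definition turn b c r : set (R * R * R) :=
  [set strip (b + 1 - (r ^+ 2 - t ^+ 2) / 5) (c + t) | t in `[- r, r]].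

Lemma turn_arc b c r : 0 < r -> 0 < c - r -> c + r < 8 ->
  is_arc R (turn b c r) (strip (b + 1) (c - r)) (strip (b + 1) (c + r)).
Proof.
move=> r0 c0 c8; pose h t := strip (b + 1 - (r ^+ 2 - t ^+ 2) / 5) (c + t).
have -> : strip (b + 1) (c - r) = h (- r).
  by rewrite /h sqrrN subrr mul0r subr0.
have -> : strip (b + 1) (c + r) = h r by rewrite /h subrr mul0r subr0.
apply: arc_image; first lra.
  apply: continuous_strip => t; last by apply: cvgD; [exact: cvg_cst|exact: cvg_id].
  apply: cvgB; first exact: cvg_cst.
  apply: cvgMl; apply: cvgB; first exact: cvg_cst.
  exact: exprn_continuous.
move=> s t; rewrite !in_itv /= => /andP[? ?] /andP[? ?].
by case/strip_inj; [apply/andP; split; lra|apply/andP; split; lra|move=> _ /addrI].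
Qed.

(* A strand at height s enters the mouth on the top face, leaves it on the
   bottom face at height 7 - s, and turns back around the corner at height c of
   that mouth, to continue at height 2 c - 7 + s. *)
Definition bend b c r s s' : set (R * R * R) :=
  hline (b + 9 / 10) (b + 1) s `|` tube_line (b + 1) s `|` turn b c r
    `|` hline (b + 1) (b + 5 / 2) s'.

(** The part of a bent strand visible in the strip, relative to [b]; what is left out is the open
    segment inside the tube. *)
Definition trace_bend c r s s' x th :=
  [\/ th = s /\ 9 / 10 <= x <= 1,
      exists t, [/\ - r <= t <= r, x = 1 - (r ^+ 2 - t ^+ 2) / 5 & th = c + t] |
      th = s' /\ 1 <= x <= 5 / 2].

Lemma bendP b c r s s' p : 1 < s < 2 -> 0 < r -> 4 < c - r -> c + r < 7 ->
  7 - s = c - r \/ 7 - s = c + r -> bend b c r s s' p ->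
  (exists x th, trace_bend c r s s' x th /\ p = strip (b + x) th) \/
  (exists2 z, 0 < z < 1 & p = (b + 1, s, z)).
Proof.
move=> /andP[s1 s2] r0 c0 c8 sc [[[]|]|].
- case=> x + <-; rewrite /= in_itv /= => /andP[? ?]; left.
  exists (x - b), s; split; last by congr strip; lra.
  by apply: Or31; split => //; apply/andP; split; lra.
- case=> z + <-; rewrite /= in_itv /= => /andP[z0 z1].
  have [z00|z0'] := eqVneq z 0.
    left; exists 1, (7 - s); split; last first.
      by rewrite strip_bot ?z00; [congr (_, _, _); lra|apply/andP; split; lra].
    apply: Or32; case: sc => E; [exists (- r)|exists r]; (split;
      [by apply/andP; split; lra|rewrite ?sqrrN; lra|lra]).
  have [z11|z1'] := eqVneq z 1.
    left; exists 1, s; split; last first.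
      by rewrite strip_top ?z11 //; apply/andP; split; lra.
    by apply: Or31; split => //; apply/andP; split; lra.
  by right; exists z => //; rewrite !lt_def z0' z0 eq_sym z1' z1.
- case=> t + <-; rewrite /= in_itv /= => tr; left.
  exists (1 - (r ^+ 2 - t ^+ 2) / 5), (c + t); split; last by congr strip; lra.
  by apply: Or32; exists t.
- case=> x + <-; rewrite /= in_itv /= => /andP[? ?]; left.
  exists (x - b), s'; split; last by congr strip; lra.
  by apply: Or33; split => //; apply/andP; split; lra.
Qed.

Lemma bend_arc b c r s s' : 1 < s < 2 -> 0 < r -> 4 < c - r -> c + r < 7 ->
  (7 - s = c - r /\ s' = c + r) \/ (7 - s = c + r /\ s' = c - r) ->
  is_arc R (bend b c r s s') (strip (b + 9 / 10) s) (strip (b + 5 / 2) s').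
Proof.
move=> /andP[s1 s2] r0 c0 c8 sc.
have A1 : is_arc R (hline (b + 9 / 10) (b + 1) s) (strip (b + 9 / 10) s) (strip (b + 1) s).
  by apply: hline_arc; lra.
have A2 : is_arc R (tube_line (b + 1) s) (strip (b + 1) s) (strip (b + 1) (7 - s)).
  rewrite strip_top; last by apply/andP; split; lra.
  rewrite strip_bot; last by apply/andP; split; lra.
  by rewrite subKr; apply: arc_sym; exact: tube_line_arc.
have A3 : is_arc R (turn b c r) (strip (b + 1) (7 - s)) (strip (b + 1) s').
  case: sc => -[-> ->]; last apply: arc_sym; apply: turn_arc; lra.
have A4 : is_arc R (hline (b + 1) (b + 5 / 2) s') (strip (b + 1) s') (strip (b + 5 / 2) s').
  by apply: hline_arc; lra.
have s8 : 0 < s < 8 by apply/andP; split; lra.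
have s8' : 0 < s' < 8 by apply/andP; split; case: sc => -[? ?]; lra.
apply: arc_cat A4 _.
  apply: arc_cat A3 _.
    apply: arc_cat A1 A2 _ => p [[x + <-] [z + E]]; rewrite /= !in_itv /= => ? ?.
    move: E; rewrite strip_top; last by apply/andP; split; lra.
    by case=> <- _; rewrite strip_top //; apply/andP; split; lra.
  move=> p [[[x + <-]|[z + <-]] [t + E]]; rewrite /= !in_itv /= => /andP[? ?] /andP[? ?].
    have t8 : 0 < c + t < 8 by apply/andP; split; lra.
    by case: (strip_inj t8 s8 E) => _ ?; exfalso; case: sc => -[? ?]; lra.
  move: E; rewrite strip_bot; last by apply/andP; split; lra.
  case=> ex ey <-; rewrite strip_bot; last by apply/andP; split; lra.
  by congr (_, _, _); lra.
move=> p [[[[x + <-]|[z + <-]]|[t + <-]] [x' + E]]; rewrite /= !in_itv /= => /andP[? ?] /andP[? ?].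
- by case: (strip_inj s8' s8 E) => _ ?; exfalso; case: sc => -[? ?]; lra.
- move: E; rewrite strip_bot; last by apply/andP; split; case: sc => -[? ?]; lra.
  by case=> _ ? _; exfalso; case: sc => -[? ?]; lra.
- have t8 : 0 < c + t < 8 by apply/andP; split; lra.
  case: (strip_inj s8' t8 E) => xE tE; rewrite tE.
  have q0 : 0 <= r ^+ 2 - t ^+ 2 by nra.
  by congr strip; lra.
Qed.

(** Normalised heights. The crossing pair has its ports at 1/10, 29/10 and at 3/2, 11/2. Strands of
    [zoneA] and [zoneB] are trapped by the chord from 1/10 to 29/10, on the two sides of 3/2; they
    escape through the tube and around the corners 6 and 5 of the bottom mouth, to reappear in ]6,
    13/2[ and ]9/2, 5[. Strands of [zoneD] leave these heights free and go straight on. *)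
Definition zoneD s := [\/ 0 < s < 1 / 10, 29 / 10 < s < 9 / 2 | 13 / 2 < s < 8].
Definition zoneA s := 1 < s < 3 / 2.
Definition zoneB s := 3 / 2 < s < 2.
Definition zone s := [\/ zoneD s, zoneA s | zoneB s].

Definition through b s : set (R * R * R) :=
  if s < 1 then hline (b + 9 / 10) (b + 5 / 2) s
  else if s < 3 / 2 then bend b 6 (s - 1) s (5 + s)
  else if s < 2 then bend b 5 (2 - s) s (3 + s)
  else hline (b + 9 / 10) (b + 5 / 2) s.

Definition out_height s :=
  if s < 1 then s else if s < 3 / 2 then 5 + s else if s < 2 then 3 + s else s.

Variant strand_spec b s : set (R * R * R) -> R -> Type :=
| StrandD of zoneD s : strand_spec b s (hline (b + 9 / 10) (b + 5 / 2) s) s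
| StrandA of zoneA s : strand_spec b s (bend b 6 (s - 1) s (5 + s)) (5 + s)
| StrandB of zoneB s : strand_spec b s (bend b 5 (2 - s) s (3 + s)) (3 + s).

Lemma strandP b s : zone s -> strand_spec b s (through b s) (out_height s).
Proof.
move=> zs; rewrite /through /out_height.
have [h1|h1] := ltP s 1; last have [h2|h2] := ltP s (3 / 2); last have [h3|h3] := ltP s 2.
- apply: StrandD; case: zs => // /andP[? ?]; exfalso; lra.
- apply: StrandA; case: zs => [[]||] // /andP[? ?]; exfalso; lra.
- apply: StrandB; case: zs => [[]||] // /andP[? ?]; exfalso; lra.
- apply: StrandD; case: zs => // /andP[? ?]; exfalso; lra.
Qed.

Definition trace s x th := [\/ zoneD s /\ (th = s /\ 9 / 10 <= x <= 5 / 2),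
  zoneA s /\ trace_bend 6 (s - 1) s (5 + s) x th |
  zoneB s /\ trace_bend 5 (2 - s) s (3 + s) x th].

Lemma through_trace b s p : zone s -> through b s p ->
  (exists x th, trace s x th /\ p = strip (b + x) th) \/
  (exists z, [/\ 0 < z < 1, 1 < s < 2 & p = (b + 1, s, z)]).
Proof.
move=> zs; case: (strandP b zs) => zz.
- case=> x + <-; rewrite /= in_itv /= => /andP[? ?]; left; exists (x - b), s.
  split; last by congr strip; lra.
  by apply: Or31; split => //; split => //; apply/andP; split; lra.
- move/andP: (zz) => [? ?]; case/bendP; try lra; try (by apply/andP; split; lra).
    by case=> x [th [tr ->]]; left; exists x, th; split => //; apply: Or32.
  by case=> z z1 ->; right; exists z; split => //; apply/andP; split; lra.
- move/andP: (zz) => [? ?]; case/bendP; try lra; try (by apply/andP; split; lra).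
    by case=> x [th [tr ->]]; left; exists x, th; split => //; apply: Or33.
  by case=> z z1 ->; right; exists z; split => //; apply/andP; split; lra.
Qed.

Lemma through_arc b s : zone s ->
  is_arc R (through b s) (strip (b + 9 / 10) s) (strip (b + 5 / 2) (out_height s)).
Proof.
move=> zs; case: (strandP b zs) => [_|/andP[? ?]|/andP[? ?]].
- by apply: hline_arc; lra.
- by apply: bend_arc; try lra; apply/andP; split; lra.
- by apply: bend_arc; try lra; apply/andP; split; lra.
Qed.

Lemma zone_range s : zone s -> 0 < s < 8 /\ 0 < out_height s < 8.
Proof.
move=> zs; case: (strandP 0 zs) => [[]|/andP[? ?]|/andP[? ?]]; try (move=> /andP[? ?]);
  by split; apply/andP; split; lra.
Qed.

Lemma out_height_inj s s' : zone s -> zone s' -> out_height s = out_height s' -> s = s'.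
Proof.
move=> zs zs'; case: (strandP 0 zs) => [[]|/andP[? ?]|/andP[? ?]];
  try (move=> /andP[? ?]); case: (strandP 0 zs') => [[]|/andP[? ?]|/andP[? ?]];
  try (move=> /andP[? ?]); lra.
Qed.

Lemma out_heightD s : zoneD s -> out_height s = s.
Proof.
move=> zs; case: (strandP 0 (Or31 _ _ zs)) => //; case: zs => /andP[? ?] /andP[? ?]; lra.
Qed.

Lemma out_heightA s : zoneA s -> out_height s = 5 + s.
Proof.
move=> zs; case: (strandP 0 (Or32 _ _ zs)) => //; move: zs => /andP[? ?].
  by case=> /andP[? ?]; lra.
by case/andP=> ? ?; lra.
Qed.

Lemma out_heightB s : zoneB s -> out_height s = 3 + s.
Proof.
move=> zs; case: (strandP 0 (Or33 _ _ zs)) => //; move: zs => /andP[? ?].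
  by case=> /andP[? ?]; lra.
by case/andP=> ? ?; lra.
Qed.

Lemma turn_range r t : 0 < r -> r < 1 / 2 -> - r <= t <= r ->
  9 / 10 < 1 - (r ^+ 2 - t ^+ 2) / 5 <= 1.
Proof. by move=> ? ? /andP[? ?]; apply/andP; split; nra. Qed.

Lemma trace_range s x th : trace s x th -> [/\ 0 < th < 8, 9 / 10 <= x <= 5 / 2,
  x = 9 / 10 -> th = s & x = 5 / 2 -> th = out_height s].
Proof.
case=> -[zz tr].
- case: tr => -> xx; rewrite out_heightD //; split => //.
  by case: zz => /andP[? ?]; apply/andP; split; lra.
- rewrite out_heightA //; move/andP: zz => [? ?].
  case: tr => [[-> /andP[? ?]]|[t [tt -> ->]]|[-> /andP[? ?]]].
  + by split; try (by apply/andP; split; lra); lra.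
  + have /andP[? ?] : 9 / 10 < 1 - ((s - 1) ^+ 2 - t ^+ 2) / 5 <= 1 by apply: turn_range => //; lra.
    by move/andP: tt => [? ?]; split; try (by apply/andP; split; lra); lra.
  + by split; try (by apply/andP; split; lra); lra.
- rewrite out_heightB //; move/andP: zz => [? ?].
  case: tr => [[-> /andP[? ?]]|[t [tt -> ->]]|[-> /andP[? ?]]].
  + by split; try (by apply/andP; split; lra); lra.
  + have /andP[? ?] : 9 / 10 < 1 - ((2 - s) ^+ 2 - t ^+ 2) / 5 <= 1 by apply: turn_range => //; lra.
    by move/andP: tt => [? ?]; split; try (by apply/andP; split; lra); lra.
  + by split; try (by apply/andP; split; lra); lra.
Qed.

(* The three stretches of a bent strand are told apart by their heights. *)
Lemma trace_bend_range s x th :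
  (zoneA s -> trace_bend 6 (s - 1) s (5 + s) x th ->
    (th = s /\ x <= 1) \/ 11 / 2 < th < 13 / 2) /\
  (zoneB s -> trace_bend 5 (2 - s) s (3 + s) x th ->
    (th = s /\ x <= 1) \/ 9 / 2 < th < 11 / 2).
Proof.
split=> /andP[? ?] [[-> /andP[? ?]]|[t [/andP[? ?] _ ->]]|[-> _]];
  by [left|right; apply/andP; split; lra].
Qed.

(** Bends around one corner are nested: on the parabola, x and th determine r^2, so a common point
    forces equal radii. *)
Lemma trace_bend_inj c r r' s1 s2 t1 t2 x th : s1 < 2 -> s2 < 2 -> 4 < c - r -> 4 < c - r' ->
  4 < t1 -> 4 < t2 -> 0 < r -> 0 < r' ->
  (t1 = c + r /\ t2 = c + r') \/ (t1 = c - r /\ t2 = c - r') ->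
  trace_bend c r s1 t1 x th -> trace_bend c r' s2 t2 x th -> s1 = s2 \/ r = r'.
Proof.
move=> h1 h2 h3 h4 h5 h6 r0 r0' tc [[e1 x1]|[t [/andP[a b] e1 e2]]|[e1 /andP[x1 _]]]
  [[e1' x1']|[t' [/andP[a' b'] e1' e2']]|[e1' /andP[x1' _]]].
- by left; rewrite -e1 -e1'.
- by exfalso; lra.
- by exfalso; lra.
- by exfalso; lra.
- right; have ? : t = t' by lra.
  have : r ^+ 2 = r' ^+ 2 by subst t'; lra.
  by move/eqP; rewrite eqrXn2 // ?ltW // => /eqP.
- right; have tE : t = th - c by lra.
  have rt : r ^+ 2 = t ^+ 2 by nra.
  have /eqP : r ^+ 2 = r' ^+ 2.
    by rewrite rt tE e1'; case: tc => -[_ ->]; ring.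
  by rewrite eqrXn2 // ?ltW // => /eqP.
- by exfalso; lra.
- right; have tE : t' = th - c by lra.
  have rt : r' ^+ 2 = t' ^+ 2 by nra.
  have /eqP : r ^+ 2 = r' ^+ 2.
    by rewrite rt tE e1; case: tc => -[-> _]; ring.
  by rewrite eqrXn2 // ?ltW // => /eqP.
- by right; case: tc => -[? ?]; lra.
Qed.

Lemma trace_inj s s' x th : trace s x th -> trace s' x th -> s = s'.
Proof.
have bd t : zoneD t -> [\/ t < 1, 29 / 10 < t < 9 / 2 | 13 / 2 < t].
  by case=> /andP[? ?]; [apply: Or31|apply: Or32|apply: Or33]; try (apply/andP; split); lra.
have D t t' : zoneD t -> th = t -> 1 < t' < 2 ->
    (th = t' /\ x <= 1) \/ 9 / 2 < th < 13 / 2 -> False.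
  move=> /bd zz tE /andP[? ?] [[? _]|/andP[? ?]]; case: zz => [?|/andP[? ?]|?]; lra.
have A12 t : zoneA t -> 1 < t < 2 by move=> /andP[? ?]; apply/andP; split; lra.
have B12 t : zoneB t -> 1 < t < 2 by move=> /andP[? ?]; apply/andP; split; lra.
have wA (P : Prop) : P \/ 11 / 2 < th < 13 / 2 -> P \/ 9 / 2 < th < 13 / 2.
  by case=> [|/andP[? ?]]; [left|right; apply/andP; split; lra].
have wB (P : Prop) : P \/ 9 / 2 < th < 11 / 2 -> P \/ 9 / 2 < th < 13 / 2.
  by case=> [|/andP[? ?]]; [left|right; apply/andP; split; lra].
have AB t t' : zoneA t -> zoneB t' -> (th = t /\ x <= 1) \/ 11 / 2 < th < 13 / 2 ->
    (th = t' /\ x <= 1) \/ 9 / 2 < th < 11 / 2 -> False.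
  move=> /andP[? ?] /andP[? ?] {bd D A12 B12 wA wB}.
  by case=> [[? _]|/andP[? ?]] [[? _]|/andP[? ?]]; lra.
have [A B] := trace_bend_range s x th; have [A' B'] := trace_bend_range s' x th.
case=> -[zz tr] [] [zz' tr'].
- by case: tr tr' => -> _ [].
- by case: (D s s' zz tr.1 (A12 _ zz') (wA _ (A' zz' tr'))).
- by case: (D s s' zz tr.1 (B12 _ zz') (wB _ (B' zz' tr'))).
- by case: (D s' s zz' tr'.1 (A12 _ zz) (wA _ (A zz tr))).
- move: zz zz' => /andP[? ?] /andP[? ?] {bd D A12 B12 wA wB AB A B A' B'}.
  by have [] := @trace_bend_inj 6 (s - 1) (s' - 1) s s' (5 + s) (5 + s') x th; try lra.
- by case: (AB s s' zz zz' (A zz tr) (B' zz' tr')).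
- by case: (D s' s zz' tr'.1 (B12 _ zz) (wB _ (B zz tr))).
- by case: (AB s' s zz' zz (A' zz' tr') (B zz tr)).
- move: zz zz' => /andP[? ?] /andP[? ?] {bd D A12 B12 wA wB AB A B A' B'}.
  by have [] := @trace_bend_inj 5 (2 - s) (2 - s') s s' (3 + s) (3 + s') x th; try lra.
Qed.

(** The first chord of the pair goes around the far side of the top mouth. The factor 3/4 brings the
    parabola beyond x = 2 at the heights 1 to 2 of the mouth and keeps it below x = 5/2. *)
Definition loop_x th := 9 / 10 + 3 / 4 * ((th - 1 / 10) * (29 / 10 - th)).

Definition loop b : set (R * R * R) :=
  [set strip (b + loop_x th) th | th in `[1 / 10, 29 / 10]].

Lemma loop_arc b : is_arc R (loop b) (strip (b + 9 / 10) (1 / 10)) (strip (b + 9 / 10) (29 / 10)).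
Proof.
pose h th := strip (b + loop_x th) th.
have -> : strip (b + 9 / 10) (1 / 10) = h (1 / 10) by rewrite /h /loop_x subrr mul0r mulr0 addr0.
have -> : strip (b + 9 / 10) (29 / 10) = h (29 / 10) by rewrite /h /loop_x subrr !mulr0 addr0.
apply: arc_image; first lra.
  apply: continuous_strip => t; last exact: cvg_id.
  apply: cvgD; first exact: cvg_cst.
  apply: cvgD; first exact: cvg_cst.
  apply: cvgMr; apply: cvgM; apply: cvgB; exact: cvg_cst || exact: cvg_id.
move=> s t; rewrite !in_itv /= => /andP[? ?] /andP[? ?].
by case/strip_inj; [apply/andP; split; lra|apply/andP; split; lra|].
Qed.

Lemma loop_range th : 1 / 10 <= th <= 29 / 10 ->
  [/\ 9 / 10 <= loop_x th < 5 / 2, 1 <= th <= 2 -> 2 < loop_x th &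
      loop_x th = 9 / 10 -> th = 1 / 10 \/ th = 29 / 10].
Proof.
move=> /andP[a b]; rewrite /loop_x.
have q0 : 0 <= (th - 1 / 10) * (29 / 10 - th) by nra.
have q1 : (th - 1 / 10) * (29 / 10 - th) <= 196 / 100.
  by have := sqr_ge0 (th - 3 / 2); rewrite expr2; nra.
split.
- by apply/andP; split; lra.
- move=> /andP[? ?]; have : 171 / 100 <= (th - 1 / 10) * (29 / 10 - th) by nra.
  lra.
- move=> E; have : (th - 1 / 10) * (29 / 10 - th) = 0 by lra.
  by move/eqP; rewrite mulf_eq0 !subr_eq0 => /orP[]/eqP; [left|right].
Qed.

(** The second chord escapes from the loop through the tube: in at height 3/2 on the top, out at 7 -
    3/2 = 11/2 on the bottom. *)
Definition through_tube b : set (R * R * R) :=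
  hline (b + 9 / 10) (b + 1) (3 / 2) `|` tube_line (b + 1) (3 / 2)
    `|` hline (b + 9 / 10) (b + 1) (11 / 2).

Lemma through_tube_arc b :
  is_arc R (through_tube b) (strip (b + 9 / 10) (3 / 2)) (strip (b + 9 / 10) (11 / 2)).
Proof.
have A1 : is_arc R (hline (b + 9 / 10) (b + 1) (3 / 2))
    (strip (b + 9 / 10) (3 / 2)) (strip (b + 1) (3 / 2)) by apply: hline_arc; lra.
have A2 : is_arc R (tube_line (b + 1) (3 / 2)) (strip (b + 1) (3 / 2)) (strip (b + 1) (11 / 2)).
  rewrite strip_top; last by apply/andP; split; lra.
  rewrite strip_bot; last by apply/andP; split; lra.
  by rewrite (_ : 7 - 11 / 2 = 3 / 2); [apply: arc_sym; exact: tube_line_arc|lra].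
have A3 : is_arc R (hline (b + 9 / 10) (b + 1) (11 / 2))
    (strip (b + 1) (11 / 2)) (strip (b + 9 / 10) (11 / 2)).
  by apply: arc_sym; apply: hline_arc; lra.
have B : 0 < (3 / 2 : R) < 8 by apply/andP; split; lra.
have B' : 0 < (11 / 2 : R) < 8 by apply/andP; split; lra.
apply: arc_cat A3 _.
  apply: arc_cat A1 A2 _ => p [[x + <-] [z + E]]; rewrite /= !in_itv /= => ? ?.
  move: E; rewrite strip_top; last by apply/andP; split; lra.
  by case=> <- _; rewrite strip_top //; apply/andP; split; lra.
move=> p [[[x + <-]|[z + <-]] [x' + E]]; rewrite /= !in_itv /= => ? ?.
  by case: (strip_inj B' B E) => _ ?; exfalso; lra.
move: E; rewrite strip_bot; last by apply/andP; split; lra.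
by case=> _ _ <-; rewrite strip_bot; [congr (_, _, _); lra|apply/andP; split; lra].
Qed.

Lemma through_tubeP b p : through_tube b p ->
  (exists x th, [/\ 9 / 10 <= x <= 1, th = 3 / 2 \/ th = 11 / 2 & p = strip (b + x) th]) \/
  (exists2 z, 0 < z < 1 & p = (b + 1, 3 / 2, z)).
Proof.
case=> [[]|] [x + <-]; rewrite /= in_itv /= => /andP[x0 x1].
- left; exists (x - b), (3 / 2); split; [by apply/andP; split; lra|by left|by congr strip; lra].
- have [z00|z0'] := eqVneq x 0.
    left; exists 1, (11 / 2); split; [by apply/andP; split; lra|by right|].
    by rewrite strip_bot ?z00; [congr (_, _, _); lra|apply/andP; split; lra].
  have [z11|z1'] := eqVneq x 1.
    left; exists 1, (3 / 2); split; [by apply/andP; split; lra|by left|].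
    by rewrite strip_top ?z11 //; apply/andP; split; lra.
  by right; exists x => //; rewrite !lt_def z0' x0 eq_sym z1' x1.
- left; exists (x - b), (11 / 2); split; [by apply/andP; split; lra|by right|by congr strip; lra].
Qed.

Lemma trace_off_loop s th : 1 / 10 <= th <= 29 / 10 -> ~ trace s (loop_x th) th.
Proof.
move=> tr; have [_ L _] := loop_range tr; move/andP: tr => [? ?].
have [A B] := trace_bend_range s (loop_x th) th.
case=> -[zz tr].
- by case: tr => ? _; case: zz => /andP[? ?]; lra.
- case: (A zz tr) => [[? ?]|/andP[? ?]]; last lra.
  have : 2 < loop_x th by apply: L; move/andP: zz => [? ?]; apply/andP; split; lra.
  lra.
- case: (B zz tr) => [[? ?]|/andP[? ?]]; last lra.
  have : 2 < loop_x th by apply: L; move/andP: zz => [? ?]; apply/andP; split; lra.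
  lra.
Qed.

Lemma trace_off_tube s x th : th = 3 / 2 \/ th = 11 / 2 -> ~ trace s x th.
Proof.
move=> tE; have [A B] := trace_bend_range s x th.
case=> -[zz tr].
- by case: tr => ? _; case: zz => /andP[? ?]; lra.
- by case: (A zz tr) => [[? ?]|/andP[? ?]]; move/andP: zz => [? ?]; lra.
- by case: (B zz tr) => [[? ?]|/andP[? ?]]; move/andP: zz => [? ?]; lra.
Qed.

End Gadget.

Section Handle.
Variables (R : realType) (n g : nat).
Implicit Types (x : R) (e f : {set 'I_n}) (L : {set {set 'I_n}}).
Implicit Types (th : {set 'I_n} -> 'I_n -> R) (u v w : 'I_n).
Local Notation S := (@sphere_with_handles R g).

Lemma through_surface i (b : R) p : (i < g)%N -> b = (2 * i)%:R ->
  (exists x t, [/\ 0 < t < 8, 9 / 10 <= x <= 5 / 2,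
     ~~ (1 < t < 2) \/ (x <= 1 \/ 2 <= x),
     ~~ (5 < t < 6) \/ (x <= 1 \/ 2 <= x) & p = strip (b + x) t]) \/
  (exists y z : R, [/\ 1 < y < 2, 0 < z < 1 & p = (b + 1, y, z)]) -> S p.
Proof.
move=> ig bE [[x [t [t8 /andP[x0 x1] h1 h2 ->]]]|[y [z [/andP[? ?] /andP[? ?] ->]]]]; last first.
  rewrite (_ : b + 1 = (2 * i + 1)%:R); last by rewrite natrD -bE.
  by apply: tube_surface => //; apply/andP; split; lra.
have i2 : (2 * i + 2)%:R = b + 2 by rewrite natrD -bE.
have i1 : (2 * i + 1)%:R = b + 1 by rewrite natrD -bE.
have i3 : (2 * i.+1 + 1)%:R = b + 3 by rewrite mulnS natrD natrD -bE; lra.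
have side : x <= 1 \/ 2 <= x -> S (strip (b + x) t).
  case=> xx.
    by apply: (@strip_surface_between _ _ i) => //; [exact: ltnW|rewrite i1 -bE; apply/andP; split; lra].
  apply: (@strip_surface_between _ _ i.+1) => //; rewrite i3.
  rewrite (_ : (2 * i.+1)%:R = b + 2); last by rewrite mulnS natrD -bE; lra.
  by apply/andP; split; lra.
case: h1 => // h1; case: h2 => // h2; apply: strip_surface_off => //.
have b0 : 0 <= b by rewrite bE ler0n.
apply/andP; split; first lra.
apply: (@le_trans _ _ (b + 3)); first lra.
by rewrite -i3 ler_nat leq_add2r leq_mul2l.
Qed.

Lemma through_sub (i : nat) (b : R) (s : R) p : (i < g)%N -> b = (2 * i)%:R -> zone s -> through b s p -> S p /\ b + 9 / 10 <= p.1.1 <= b + 5 / 2.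
Proof.
move=> ig bE.
move=> zs /(through_trace zs)[[x [t [tr ->]]]|[z [z1 s1 ->]]].
  have [t8 xx _ _] := trace_range tr.
  split; last by move/andP: xx => [? ?] /=; apply/andP; split; lra.
  apply: (through_surface ig bE); left; exists x, t; split => //.
    case: tr => -[zz1 tr].
    + left; case: tr => -> _; apply/negP => /andP[? ?].
      by case: zz1 => /andP[? ?]; lra.
    + have [A _] := trace_bend_range s x t.
      case: (A zz1 tr) => [[_ ?]|/andP[? ?]]; first by right; left.
      by left; apply/negP => /andP[? ?]; lra.
    + have [_ B] := trace_bend_range s x t.
      case: (B zz1 tr) => [[_ ?]|/andP[? ?]]; first by right; left.
      by left; apply/negP => /andP[? ?]; lra.
  case: tr => -[zz1 tr].
  + left; case: tr => -> _; apply/negP => /andP[? ?].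
    by case: zz1 => /andP[? ?]; lra.
  + move/andP: zz1 => [? ?]; case: tr => [[-> _]|[r [rr -> _]]|[-> _]].
    * by left; apply/negP => /andP[? ?]; lra.
    * have /andP[_ ?] : 9 / 10 < 1 - ((s - 1) ^+ 2 - r ^+ 2) / 5 <= 1 by apply: turn_range => //; lra.
      by right; left.
    * by left; apply/negP => /andP[? ?]; lra.
  + move/andP: zz1 => [? ?]; case: tr => [[-> _]|[r [rr -> _]]|[-> _]].
    * by left; apply/negP => /andP[? ?]; lra.
    * have /andP[_ ?] : 9 / 10 < 1 - ((2 - s) ^+ 2 - r ^+ 2) / 5 <= 1 by apply: turn_range => //; lra.
      by right; left.
    * by left; apply/negP => /andP[? ?]; lra.
split; first by apply: (through_surface ig bE); right; exists s, z.
by apply/andP; split => /=; lra.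
Qed.

Lemma loop_sub (i : nat) (b : R) p : (i < g)%N -> b = (2 * i)%:R -> loop b p -> S p /\ b + 9 / 10 <= p.1.1 < b + 5 / 2.
Proof.
move=> ig bE.
case=> t + <-; rewrite /= in_itv /= => tt; have [/andP[? ?] L2 _] := loop_range tt.
split; last by apply/andP; split; lra.
move/andP: tt => [? ?]; apply: (through_surface ig bE); left.
exists (loop_x t), t; split => //; try (by apply/andP; split; lra).
  have [/andP[? ?]|] := boolP (1 < t < 2); last by left.
  by right; right; apply/ltW/L2; apply/andP; split; lra.
by left; apply/negP => /andP[? ?]; lra.
Qed.

Lemma through_tube_sub (i : nat) (b : R) p : (i < g)%N -> b = (2 * i)%:R -> through_tube b p -> S p /\ b + 9 / 10 <= p.1.1 < b + 5 / 2.
Proof.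
move=> ig bE.
move=> /through_tubeP[[x [t [/andP[? ?] tE ->]]]|[z z1 ->]].
  split; last by apply/andP; split => /=; lra.
  apply: (through_surface ig bE); left; exists x, t; split => //.
  - by apply/andP; split; case: tE => ->; lra.
  - by apply/andP; split; lra.
  - by right; left.
  - by right; left.
split; last by apply/andP; split => /=; lra.
apply: (through_surface ig bE); right; exists (3 / 2), z; split => //.
by apply/andP; split; lra.
Qed.

Lemma trace_range8 (s x t : R) : trace s x t -> 0 < t < 8.
Proof. by move=> /trace_range[]. Qed.

Lemma loop_range8 (t : R) : t \in `[1 / 10, 29 / 10] -> 0 < t < 8.
Proof. by rewrite in_itv /= => /andP[? ?]; apply/andP; split; lra. Qed.

Lemma tube_range8 (t : R) : t = 3 / 2 \/ t = 11 / 2 -> 0 < t < 8.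
Proof. by case=> ->; apply/andP; split; lra. Qed.

Lemma through_loop_disj (b : R) (s : R) p : zone s -> through b s p -> loop b p -> False.
Proof.
move=> zs /(through_trace zs)[[x [t [tr ->]]]|[z [z1 s1 ->]]] [t' /[dup] tt _].
  case/(strip_inj (loop_range8 tt) (trace_range8 tr)) => /addrI xE tE; subst.
  by move: tr; apply: trace_off_loop; rewrite /= in_itv in tt.
by move/esym; apply: tube_not_strip => //; exact: loop_range8.
Qed.

Lemma through_tube_disj (b : R) (s : R) p : zone s -> through b s p -> through_tube b p -> False.
Proof.
move=> zs /(through_trace zs)[[x [t [tr ->]]]|[z [z1 s1 ->]]] /through_tubeP.
  case=> [[x' [t' [_ /[dup] t8 tE]]]|[z z1]].
    move/(strip_inj (trace_range8 tr) (tube_range8 t8)) => [_ tt]; subst t'.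
    exact: trace_off_tube tE tr.
  by move/esym; apply: tube_not_strip (trace_range8 tr) => //; apply/andP; split; lra.
case=> [[x' [t' [_ /tube_range8 t8]]]|[z' _ [sE _]]]; first exact: tube_not_strip.
by case: zs => [[]||] /andP[? ?]; lra.
Qed.

Lemma loop_tube_disj (b : R) p : loop b p -> through_tube b p -> False.
Proof.
case=> t + <-; rewrite /= in_itv /= => tt /through_tubeP.
have [_ L2 _] := loop_range tt; have t8 : 0 < t < 8 by apply: loop_range8; rewrite in_itv.
move/andP: tt => [? ?].
case=> [[x' [t' [/andP[? ?] /[dup] /tube_range8 t8' tE]]]|[z' z1]].
  case/(strip_inj t8 t8') => /addrI xE ?; subst t'.
  have : 2 < loop_x t by apply: L2; apply/andP; split; case: tE; lra.
  lra.
by move/esym; apply: tube_not_strip => //; apply/andP; split; lra.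
Qed.

Lemma drawable_handle i L th e0 f0 u0 v0 s0 t0 : (i < g)%N ->
  ports_ok finset.set0 L th -> e0 \in L -> f0 \in L -> e0 != f0 ->
  e0 = [set u0; v0]%SET -> f0 = [set s0; t0]%SET ->
  th e0 u0 = 1 / 10 -> th e0 v0 = 29 / 10 -> th f0 s0 = 3 / 2 -> th f0 t0 = 11 / 2 ->
  (forall e v, e \in (L :\ e0 :\ f0)%SET -> v \in e -> zone (th e v)) ->
  exists th', ports_ok finset.set0 (L :\ e0 :\ f0)%SET th' /\
   (drawable S ((2 * i)%:R + 5 / 2) finset.set0 (L :\ e0 :\ f0)%SET th' ->
    drawable S ((2 * i)%:R + 9 / 10) finset.set0 L th).
Proof.
move=> ig [ok1 ok2] eL0 fL0 ef eE fE u0E v0E s0E t0E zz.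
set L' := (L :\ e0 :\ f0)%SET in zz *; set b := (2 * i)%:R.
have L'L e : e \in L' -> [/\ e \in L, e != e0 & e != f0].
  by rewrite !inE => /and3P[? ? ?].
have DL e : e \in L -> e \notin L' -> e = e0 \/ e = f0.
  rewrite !inE => ->; rewrite andbT negb_and !negbK => /orP[]/eqP; auto.
have pt e v : e \in L -> v \in e -> is_port finset.set0 L e v.
  by move=> eL ve; rewrite /is_port eL ve inE.
exists (fun e v => out_height (th e v)); split.
  split=> [e v|e v f w] /and3P[eL ve _]; first by case: (zone_range (zz _ _ eL ve)).
  move=> /and3P[fL wf _] /(out_height_inj (zz _ _ eL ve) (zz _ _ fL wf)).
  by apply: ok2; apply: pt => //; [case: (L'L _ eL)|case: (L'L _ fL)].
pose M e v := through b (th e v).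
pose K e := if e == e0 then loop b else through_tube b.
have b9 : b + 1 <> b + 9 / 10 by lra.
have b52 : b + 1 <> b + 5 / 2 by lra.
apply: (@drawable_slab _ _ _ _ _ _ _ _ _ _ _ (fun=> (0, 0, 0)) K M); first lra.
split=> //; try (intros; exfalso; match goal with
  H : is_true (_ \in _) |- _ => by rewrite inE in H end).
- by apply/fintype.subsetP => e /L'L[].
- by move=> v w; rewrite !inE.
- by move=> e v eL ve _; rewrite /end_pt inE; apply: through_arc; exact: zz.
- by move=> e v p eL ve _; apply: (through_sub ig erefl); exact: zz.
- move=> e v p eL ve _ mp px; rewrite inE; split => //.
  have [[x [t [tr pE]]]|[z [_ _ pE]]] := through_trace (zz _ _ eL ve) mp; last first.
    by move: px; rewrite pE /= => /b9.
  have [_ _ E _] := trace_range tr; move: px; rewrite pE /= => /addrI xE.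
  by rewrite xE E.
- move=> e v p eL ve _ mp px.
  have [[x [t [tr pE]]]|[z [_ _ pE]]] := through_trace (zz _ _ eL ve) mp; last first.
    by move: px; rewrite pE /= => /b52.
  have [_ _ _ E] := trace_range tr; move: px; rewrite pE /= => /addrI xE.
  by rewrite xE E.
- move=> e v f w p eL ve _ fL wf _ ne mp mp'; exfalso.
  have P : is_port finset.set0 L e v by apply: pt => //; case: (L'L _ eL).
  have Q : is_port finset.set0 L f w by apply: pt => //; case: (L'L _ fL).
  suff E : th e v = th f w by rewrite (ok2 _ _ _ _ P Q E) eqxx in ne.
  have [[x [t [tr pE]]]|[z [z1 s1 pE]]] := through_trace (zz _ _ eL ve) mp;
    have [[x' [t' [tr' pE']]]|[z' [z1' s1' pE']]] := through_trace (zz _ _ fL wf) mp'.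
  + move: pE; rewrite pE' => /(strip_inj (trace_range8 tr') (trace_range8 tr))[/addrI xE tE].
    by subst x' t'; exact: trace_inj tr tr'.
  + by exfalso; apply: (@tube_not_strip _ (b + 1) (b + x) (th f w) z' t) => //; [exact: trace_range8 tr|rewrite -pE].
  + by exfalso; apply: (@tube_not_strip _ (b + 1) (b + x') (th e v) z t') => //; [exact: trace_range8 tr'|rewrite -pE].
  + by move: pE; rewrite pE' => -[].
- by move=> e v _ _ _; rewrite inE.
- move=> e u v eL eN uv; rewrite /end_pt !inE.
  case: (DL _ eL eN) => ->; rewrite /K.
    rewrite eqxx eE => /(set2_eq uv)[][<- <-]; rewrite -eE u0E v0E; first exact: loop_arc.
    by apply: arc_sym; exact: loop_arc.
  rewrite eq_sym (negbTE ef) fE => /(set2_eq uv)[][<- <-]; rewrite -fE s0E t0E.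
    exact: through_tube_arc.
  by apply: arc_sym; exact: through_tube_arc.
- by move=> e p eL eN; rewrite /K; case: ifP => _; [exact: (loop_sub ig erefl)|exact: (through_tube_sub ig erefl)].
- move=> e p eL eN; case: (DL _ eL eN) => ->; rewrite /K.
    rewrite eqxx => -[t tt <-] /= /addrI; rewrite /= in_itv in tt.
    have [_ _ E] := loop_range tt => /E [tE|tE].
      exists u0; rewrite inE u0E {1}eE !inE eqxx; split=> //.
      by congr strip => //; rewrite /loop_x tE; lra.
    exists v0; rewrite inE v0E {1}eE !inE eqxx orbT; split=> //.
    by congr strip => //; rewrite /loop_x tE; lra.
  rewrite eq_sym (negbTE ef) => /through_tubeP[[x [t [_ tE ->]]]|[z _ ->]] /=; last by move/b9.
  move=> /addrI ->; case: tE => ->.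
    by exists s0; rewrite inE s0E {1}fE !inE eqxx.
  by exists t0; rewrite inE t0E {1}fE !inE eqxx orbT.
- move=> e f p eL eN fL fN; case: (DL _ eL eN) => ->; case: (DL _ fL fN) => ->.
  + by rewrite eqxx.
  + by rewrite /K eqxx [f0 == e0]eq_sym (negbTE ef) => _ k q; case: (loop_tube_disj k q).
  + by rewrite /K eqxx [f0 == e0]eq_sym (negbTE ef) => _ q k; case: (loop_tube_disj k q).
  + by rewrite eqxx.
- move=> e f w p eL eN fL wf _ kp mp; exfalso; move: kp; rewrite /K.
  by case: ifP => _ kp; [apply: (@through_loop_disj b (th f w) p)|apply: (@through_tube_disj b (th f w) p)] => //; exact: zz.
Qed.

End Handle.

(** * Normalising the heights of a crossing pair *)

Section Crossing.
Variable R : realType.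
Implicit Types (s l h : R) (f : R -> R).

Definition increasing_into l h (lo hi : R) f :=
  (forall s, l < s < h -> lo < f s < hi) /\
  (forall s s', l < s -> s < s' -> s' < h -> f s < f s').

Definition lin l h (lo hi : R) s := lo + (hi - lo) * ((s - l) / (h - l)).

Lemma lin_increasing l h lo hi : l < h -> lo < hi ->
  increasing_into l h lo hi (lin l h lo hi).
Proof.
move=> lh lohi; have d0 : 0 < h - l by rewrite subr_gt0.
have D0 : 0 < hi - lo by rewrite subr_gt0.
split=> [s /andP[ls sh]|s s' ls ss sh]; rewrite /lin.
  rewrite ltrDl mulr_gt0 ?divr_gt0 ?subr_gt0 //= -ltrBrDl gtr_pMr //.
  by rewrite ltr_pdivrMr // mul1r ltrD2r.
by rewrite ltrD2l ltr_pM2l // ltr_pM2r ?invr_gt0 // ltrD2r.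
Qed.

Definition glue (a : R) f (v : R) (f' : R -> R) s :=
  if s < a then f s else if s == a then v else f' s.

Lemma glue_increasing l a h lo1 hi1 lo2 hi2 v f f' : l < a -> a < h ->
  increasing_into l a lo1 hi1 f -> increasing_into a h lo2 hi2 f' ->
  lo1 < hi1 -> lo2 < hi2 -> hi1 <= v -> v <= lo2 ->
  increasing_into l h lo1 hi2 (glue a f v f').
Proof.
move=> la ah [b1 m1] [b2 m2] h1 h2 hv vl; split=> [s /andP[ls sh]|s s' ls ss sh]; rewrite /glue.
  case: (ltgtP s a) => sa.
  - have /andP[? ?] : lo1 < f s < hi1 by apply: b1; rewrite ls.
    by apply/andP; split; lra.
  - have /andP[? ?] : lo2 < f' s < hi2 by apply: b2; rewrite sa.
    by apply/andP; split; lra.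
  - by apply/andP; split; lra.
case: (ltgtP s a) => sa; case: (ltgtP s' a) => sa' //.
- exact: m1.
- have /andP[? ?] : lo1 < f s < hi1 by apply: b1; rewrite ls.
  have /andP[? ?] : lo2 < f' s' < hi2 by apply: b2; rewrite sa'.
  lra.
- have /andP[? ?] : lo1 < f s < hi1 by apply: b1; rewrite ls.
  lra.
- lra.
- exact: m2.
- lra.
- lra.
- have /andP[? ?] : lo2 < f' s' < hi2 by apply: b2; rewrite sa'.
  lra.
- lra.
Qed.

(** Four interleaved ports are sent to the heights of the crossing pair and the intervals around
    them into the zones. The map jumps over the heights outside the zones; since only the order of
    ports has to be preserved, continuity is not asked for. *)
Definition normal_height a b c d : R -> R :=
  glue a (lin 0 a 0 (1 / 10)) (1 / 10)
  (glue b (lin a b 1 (3 / 2)) (3 / 2)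
  (glue c (lin b c (3 / 2) 2) (29 / 10)
  (glue d (lin c d (29 / 10) (9 / 2)) (11 / 2) (lin d 8 (13 / 2) 8)))).

Lemma normal_height_increasing a b c d : 0 < a -> a < b -> b < c -> c < d -> d < 8 ->
  increasing_into 0 8 0 8 (normal_height a b c d).
Proof.
move=> a0 ab bc cd d8.
have H4 : increasing_into c 8 (29 / 10) 8
    (glue d (lin c d (29 / 10) (9 / 2)) (11 / 2) (lin d 8 (13 / 2) 8)).
  by apply: (@glue_increasing _ _ _ _ (9 / 2) (13 / 2)) => //; try lra; apply: lin_increasing; lra.
have H3 : increasing_into b 8 (3 / 2) 8 (glue c (lin b c (3 / 2) 2) (29 / 10)
    (glue d (lin c d (29 / 10) (9 / 2)) (11 / 2) (lin d 8 (13 / 2) 8))).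
  apply: (@glue_increasing _ _ _ _ 2 (29 / 10)) H4 _ _ _ _ => //; try lra.
  by apply: lin_increasing; lra.
have H2 : increasing_into a 8 1 8 (glue b (lin a b 1 (3 / 2)) (3 / 2) (glue c (lin b c (3 / 2) 2) (29 / 10)
    (glue d (lin c d (29 / 10) (9 / 2)) (11 / 2) (lin d 8 (13 / 2) 8)))).
  apply: (@glue_increasing _ _ _ _ (3 / 2) (3 / 2)) H3 _ _ _ _ => //; try lra.
  by apply: lin_increasing; lra.
apply: (@glue_increasing _ _ _ _ (1 / 10) 1) H2 _ _ _ _ => //; try lra.
by apply: lin_increasing; lra.
Qed.

Lemma normal_heightE a b c d : a < b -> b < c -> c < d ->
  [/\ normal_height a b c d a = 1 / 10, normal_height a b c d b = 3 / 2,
      normal_height a b c d c = 29 / 10 & normal_height a b c d d = 11 / 2].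
Proof.
move=> ab bc cd; rewrite /normal_height /glue; split.
- by rewrite ltxx eqxx.
- by case: (ltgtP b a) => [|_|]; [lra|rewrite ltxx eqxx|lra].
- case: (ltgtP c a) => [|_|]; [lra| |lra].
  by case: (ltgtP c b) => [|_|]; [lra|rewrite ltxx eqxx|lra].
- case: (ltgtP d a) => [|_|]; [lra| |lra].
  case: (ltgtP d b) => [|_|]; [lra| |lra].
  by case: (ltgtP d c) => [|_|]; [lra|rewrite ltxx eqxx|lra].
Qed.

Lemma normal_height_zone a b c d s : 0 < s < 8 -> 0 < a -> a < b -> b < c -> c < d -> d < 8 ->
  s != a -> s != b -> s != c -> s != d -> zone (normal_height a b c d s).
Proof.
move=> /andP[s0 s8] a0 ab bc cd d8 na nb nc nd; rewrite /normal_height /glue.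
rewrite (negbTE na) (negbTE nb) (negbTE nc) (negbTE nd).
have [sa|sa] := ltP s a.
  apply: Or31; apply: Or31.
  by have [B _] := @lin_increasing 0 a 0 (1 / 10) a0 ltac:(lra); apply: B; rewrite s0.
have {na}sa : a < s by rewrite lt_def na.
have [sb|sb] := ltP s b.
  apply: Or32.
  by have [B _] := @lin_increasing a b 1 (3 / 2) ab ltac:(lra); apply: B; rewrite sa.
have {nb}sb : b < s by rewrite lt_def nb.
have [sc|sc] := ltP s c.
  apply: Or33.
  by have [B _] := @lin_increasing b c (3 / 2) 2 bc ltac:(lra); apply: B; rewrite sb.
have {nc}sc : c < s by rewrite lt_def nc.
have [sd|sd] := ltP s d.
  apply: Or31; apply: Or32.
  by have [B _] := @lin_increasing c d (29 / 10) (9 / 2) cd ltac:(lra); apply: B; rewrite sc.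
have {nd}sd : d < s by rewrite lt_def nd.
apply: Or31; apply: Or33.
by have [B _] := @lin_increasing d 8 (13 / 2) 8 d8 ltac:(lra); apply: B; rewrite sd.
Qed.

End Crossing.

Section Chords.
Variables (R : realType) (n g : nat).
Implicit Types (x : R) (e f : {set 'I_n}) (L : {set {set 'I_n}}).
Implicit Types (th : {set 'I_n} -> 'I_n -> R) (u v w : 'I_n).
Local Notation S := (@sphere_with_handles R g).

Lemma drawable_cross i x0 L th e0 f0 u0 v0 s0 t0 : (i < g)%N ->
  (2 * i)%:R <= x0 < (2 * i)%:R + 9 / 10 ->
  ports_ok finset.set0 L th -> e0 \in L -> f0 \in L -> e0 != f0 ->
  e0 = [set u0; v0]%SET -> f0 = [set s0; t0]%SET ->
  th e0 u0 < th f0 s0 -> th f0 s0 < th e0 v0 -> th e0 v0 < th f0 t0 ->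
  exists th', ports_ok finset.set0 (L :\ e0 :\ f0)%SET th' /\
   (drawable S ((2 * i)%:R + 5 / 2) finset.set0 (L :\ e0 :\ f0)%SET th' ->
    drawable S x0 finset.set0 L th).
Proof.
move=> ig /andP[x0i xi] ok eL fL ef eE fE ab bc cd; have [ok1 ok2] := ok.
have pt e v : e \in L -> v \in e -> is_port finset.set0 L e v.
  by move=> ? ve; rewrite /is_port ve inE andbT.
have ue : u0 \in e0 by rewrite eE !inE eqxx.
have ve : v0 \in e0 by rewrite eE !inE eqxx orbT.
have sf : s0 \in f0 by rewrite fE !inE eqxx.
have tf : t0 \in f0 by rewrite fE !inE eqxx orbT.
have /andP[a0 _] := ok1 _ _ (pt _ _ eL ue).
have /andP[_ d8] := ok1 _ _ (pt _ _ fL tf).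
pose h := normal_height (th e0 u0) (th f0 s0) (th e0 v0) (th f0 t0).
have [hb hm] := normal_height_increasing a0 ab bc cd d8.
have [ha1 hb1 hc1 hd1] := normal_heightE ab bc cd.
pose th1 e v := h (th e v).
have mono e v f w : is_port finset.set0 L e v -> is_port finset.set0 L f w ->
    th e v < th f w -> th1 e v < th1 f w.
  by move=> /ok1/andP[? _] /ok1/andP[_ ?] ?; apply: hm.
have ok' : ports_ok finset.set0 L th1.
  split=> [e v /ok1/hb //|e v f w P Q E].
  have [lt|lt|] := ltgtP (th e v) (th f w); last exact: ok2.
    by have := mono _ _ _ _ P Q lt; rewrite E ltxx.
  by have := mono _ _ _ _ Q P lt; rewrite E ltxx.
have [|th' [okt imp]] := @drawable_handle R n g i L th1 e0 f0 u0 v0 s0 t0 ig ok' eL fL ef eE fE ha1 hc1 hb1 hd1.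
  move=> e v; rewrite !inE => /and3P[nf ne eL1] ve1; have P := pt _ _ eL1 ve1.
  apply: normal_height_zone => //; first exact: ok1.
  - by apply/eqP => /(ok2 _ _ _ _ P (pt _ _ eL ue))[E]; rewrite E eqxx in ne.
  - by apply/eqP => /(ok2 _ _ _ _ P (pt _ _ fL sf))[E]; rewrite E eqxx in nf.
  - by apply/eqP => /(ok2 _ _ _ _ P (pt _ _ eL ve))[E]; rewrite E eqxx in ne.
  - by apply/eqP => /(ok2 _ _ _ _ P (pt _ _ fL tf))[E]; rewrite E eqxx in nf.
exists th'; split => // /imp.
apply: (@drawable_reposition _ _ _ i) => //; first exact: ltnW.
  by rewrite natrD; lra.
by case: ok'.
Qed.

Lemma drawable_empty x th : drawable S x finset.set0 finset.set0 th.
Proof.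
exists (fun=> (0, 0, 0)), (fun=> set0); split; try (by move=> u v; rewrite inE);
  intros; exfalso; match goal with H : is_true (_ \in _) |- _ => by rewrite inE in H end.
Qed.

(** Take a chord of least span. If some port lies between its ends, the chord of that port has its
    other end outside by minimality, so the two cross and the next handle disposes of both;
    otherwise the chord is capped. The [+ 1] accounts for a last chord, which has nothing to
    cross. *)
Lemma drawable_chords k i x0 L th : (#|L| <= k)%N -> (forall e, e \in L -> #|e| = 2%N) ->
  (i <= g)%N -> (#|L| <= 2 * (g - i) + 1)%N ->
  (2 * i)%:R <= x0 < (2 * i)%:R + 9 / 10 ->
  ports_ok finset.set0 L th -> drawable S x0 finset.set0 L th.
Proof.
elim: k i x0 L th => [|k IH] i x0 L th Lk L2 ig Lg xi ok.
  have -> : L = finset.set0 by apply: cards0_eq; apply/eqP; rewrite -leqn0.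
  exact: drawable_empty.
have [->|[e1 eL1]] := finset.set_0Vmem L; first exact: drawable_empty.
have [ok1 ok2] := ok.
have pt e v : e \in L -> v \in e -> is_port finset.set0 L e v.
  by move=> ? ve; rewrite /is_port ve inE andbT.
pose P (q : {set 'I_n} * 'I_n * 'I_n) := let: (e, u, v) := q in
  [&& e \in L, u \in e, v \in e & th e u < th e v].
have ends e u v : e \in L -> u \in e -> v \in e -> u != v -> e = [set u; v]%SET.
  move=> eL ue ve uv; apply/esym/eqP; rewrite eqEcard L2 // cards2 uv andbT.
  by apply/fintype.subsetP => w; rewrite !inE => /orP[]/eqP->.
have [q0 Pq0] : exists q, P q.
  have /eqP/cards2P[u [v [uv eE]]] := L2 _ eL1.
  have ue : u \in e1 by rewrite eE !inE eqxx.
  have ve : v \in e1 by rewrite eE !inE eqxx orbT.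
  have [lt|lt|E] := ltgtP (th e1 u) (th e1 v).
  - by exists (e1, u, v); rewrite /P eL1 ue ve lt.
  - by exists (e1, v, u); rewrite /P eL1 ue ve lt.
  - by have [] := ok2 _ _ _ _ (pt _ _ eL1 ue) (pt _ _ eL1 ve) E => E'; rewrite E' eqxx in uv.
have [[[e u] v] /and4P[eL ue ve ab] min] :=
  arg_minP (fun q : {set 'I_n} * 'I_n * 'I_n => th q.1.1 q.2 - th q.1.1 q.1.2) Pq0.
have uv : u != v by apply: contraTneq ab => ->; rewrite ltxx.
have eE := ends _ _ _ eL ue ve uv.
have drop_le e' f' : (#|(L :\ e' :\ f')%SET| <= #|(L :\ e')%SET|)%N.
  by apply: subset_leq_card; exact: finset.subsetDl.
have cross e' f' u' v' s' t' : e' \in L -> f' \in L -> e' != f' -> e' = [set u'; v']%SET ->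
    f' = [set s'; t']%SET -> th e' u' < th f' s' -> th f' s' < th e' v' ->
    th e' v' < th f' t' -> drawable S x0 finset.set0 L th.
  move=> eL' fL' ef' eE' fE' h1 h2 h3.
  have c1 : (#|L| = (#|(L :\ e' :\ f')%SET|).+2)%N.
    by rewrite (cardsD1 e') eL' (cardsD1 f' (L :\ e')%SET) !inE eq_sym ef' fL'.
  have ig' : (i < g)%N.
    rewrite ltn_neqAle ig andbT; apply: contraTneq Lg => ->.
    by rewrite subnn c1.
  have [th' [okt]] := drawable_cross ig' xi ok eL' fL' ef' eE' fE' h1 h2 h3.
  apply; apply: (IH i.+1) => //.
  - by rewrite -ltnS; apply: leq_trans Lk; rewrite c1.
  - by move=> e2; rewrite !inE => /and3P[_ _]; exact: L2.
  - move: Lg; rewrite c1 -(subnSK ig') mulnS !addSn add0n !ltnS.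
    by rewrite addn1.
  - rewrite mulnS natrD; apply/andP; split; lra.
have [/existsP[[f w] /= /and3P[fL wf /andP[aw wb]]]|nin] := boolP [exists q : {set 'I_n} * 'I_n,
    [&& q.1 \in L, q.2 \in q.1 & th e u < th q.1 q.2 < th e v]].
  have ef : e != f.
    apply: contraTneq wf => fe; move: aw wb; rewrite -fe eE !inE.
    by move=> aw wb; apply/negP => /orP[]/eqP wE; rewrite wE ltxx in aw wb.
  have [w' [wf' ww']] : exists w', w' \in f /\ w != w'.
    have /eqP/cards2P[a [b [ab' fE]]] := L2 _ fL.
    move: wf; rewrite fE !inE => /orP[]/eqP->.
      by exists b; rewrite !inE eqxx orbT.
    by exists a; split; [rewrite !inE eqxx|rewrite eq_sym].
  have fE := ends _ _ _ fL wf wf' ww'.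
  have fE' : f = [set w'; w]%SET by rewrite fE finset.setUC.
  have [lt|lt|E] := ltgtP (th f w') (th e u).
  - by apply: (cross f e w' w u v) => //; rewrite eq_sym.
  - have [lt'|lt'|E'] := ltgtP (th f w') (th e v).
    + exfalso; have [l|l|E2] := ltgtP (th f w) (th f w').
      * have := min (f, w, w'); rewrite /P fL wf wf' l => /(_ isT) /=.
        by rewrite leNgt => /negP; apply; clear -lt lt' l aw wb; lra.
      * have := min (f, w', w); rewrite /P fL wf wf' l => /(_ isT) /=.
        by rewrite leNgt => /negP; apply; clear -lt lt' l aw wb; lra.
      * have [E3] := ok2 _ _ _ _ (pt _ _ fL wf) (pt _ _ fL wf') E2.
        by rewrite E3 eqxx in ww'.
    + by apply: (cross e f u v w w').
    + have [E3] := ok2 _ _ _ _ (pt _ _ fL wf') (pt _ _ eL ve) E'.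
      by rewrite E3 eqxx in ef.
  - have [E3] := ok2 _ _ _ _ (pt _ _ fL wf') (pt _ _ eL ue) E.
    by rewrite E3 eqxx in ef.
move/andP: (xi) => [x1 x2].
apply: (@drawable_cap _ _ _ i x0 ((x0 + (2 * i)%:R + 9 / 10) / 2) L th e u v) => //.
- by clear -x1 x2; lra.
- by rewrite natrD; clear -x1 x2; lra.
- move=> f w fL wf; apply: contra nin => lt; apply/existsP; exists (f, w).
  by rewrite /= fL wf.
have c1 : (#|L| = (#|(L :\ e)%SET|).+1)%N by rewrite (cardsD1 e) eL.
apply: (IH i) => //.
- by rewrite -ltnS -c1.
- by move=> e2; rewrite !inE => /andP[_]; exact: L2.
- by apply: leq_trans Lg; rewrite c1.
- by apply/andP; split; clear -x1 x2; lra.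
split=> [f w|f w f' w'] /and3P[]; rewrite !inE => /andP[_ fL] wf _; first exact: ok1 (pt _ _ fL wf).
move=> /and3P[]; rewrite !inE => /andP[_ fL'] wf' _.
exact: ok2 (pt _ _ fL wf) (pt _ _ fL' wf').
Qed.

End Chords.

(** The components, counted by their roots, none of whose vertices has been placed yet. *)
Definition inner_comps (T : finType) (E : {set {set T}}) (U : {set T}) :=
  [set r | roots (adj E) r && [forall v, connect (adj E) r v ==> (v \in U)]]%SET.

(** * Spanning forest and chords *)

Section Embedding.
Variables (R : realType) (n g : nat) (E : {set {set 'I_n}}).
Hypothesis E2 : forall e, e \in E -> #|e| = 2%N.
Implicit Types (x : R) (U : {set 'I_n}) (e f : {set 'I_n}) (L : {set {set 'I_n}}).
Implicit Types (th : {set 'I_n} -> 'I_n -> R) (u v w : 'I_n).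
Local Notation S := (@sphere_with_handles R g).

Lemma port_gap U L th (a : R) : a < 8 ->
  exists d, [/\ 0 < d, a + d < 8 & forall e v, is_port U L e v -> ~~ (a < th e v <= a + d)].
Proof.
move=> a8.
have [d d0 gap] := finite_gap a (8 :: [seq th q.1 q.2 | q : {set 'I_n} * 'I_n]).
exists d; split => //; first by apply: gap => //; rewrite inE eqxx.
move=> e v P; apply/negP => /andP[ae]; apply/negP; rewrite -ltNge.
by apply: gap ae; rewrite inE; apply/orP; right; apply/mapP; exists (e, v) => //; rewrite mem_enum.
Qed.

(** As long as [U] is not empty, either a vertex is placed at the port of a dangling edge, which
    completes this edge, or no such edge exists and a vertex starts a new component. In both cases
    the left side of the budget drops with [#|U|]. What remains at the end are the chords, at most
    [2 * g + 1]. *)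
Lemma drawable_all k U L x0 th : (#|U| <= k)%N -> L \subset E ->
  (forall e v, e \in E -> v \in e -> v \in U -> e \in L) ->
  (#|L| + #|inner_comps E U| <= #|U| + 2 * g + 1)%N ->
  0 <= x0 < 9 / 10 -> ports_ok U L th -> drawable S x0 U L th.
Proof.
elim: k U L x0 th => [|k IH] U L x0 th Uk LE live bud xx ok.
  have U0 : U = finset.set0 by apply: cards0_eq; apply/eqP; rewrite -leqn0.
  subst U; apply: (@drawable_chords _ _ _ #|L| 0) => //.
  - by move=> e /(fintype.subsetP LE)/E2.
  - move: bud; rewrite cards0 subn0 add0n; apply: leq_trans; exact: leq_addr.
  - by rewrite muln0 add0r.
have [U0|[w0 wU0]] := finset.set_0Vmem U.
  by apply: IH => //; rewrite U0 cards0.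
move/andP: (xx) => [x00 x09].
set x1 := (x0 + 9 / 10) / 2.
have x01 : x0 < x1 by rewrite /x1; lra.
have x19 : x1 < 9 / 10 by rewrite /x1; lra.
have x11 : x1 <= (2 * 0 + 1)%:R by rewrite muln0 add0n; lra.
have xx1 : 0 <= x1 < 9 / 10 by rewrite x19 andbT; lra.
have cardU v : v \in U -> #|U| = #|(U :\ v)%SET|.+1 by move=> vU; rewrite (cardsD1 v) vU.
have [ok1 ok2] := ok.
have sub_inner v : inner_comps E (U :\ v)%SET \subset inner_comps E U.
  apply/fintype.subsetP => r; rewrite !inE => /andP[-> /forallP A] /=.
  by apply/forallP => w; apply/implyP => /(implyP (A w)); rewrite !inE => /andP[].
have [/existsP[[[e u] v] /= /and5P[eL ue ve uU vU]]|nin] := boolP [exists q : {set 'I_n} * 'I_n * 'I_n,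
    [&& q.1.1 \in L, q.1.2 \in q.1.1, q.2 \in q.1.1, q.1.2 \notin U & q.2 \in U]].
  have uv : u != v by apply: contraNneq uU => ->.
  have eE : e = [set u; v]%SET.
    apply/esym/eqP; rewrite eqEcard (E2 (fintype.subsetP LE _ eL)) cards2 uv andbT.
    by apply/fintype.subsetP => w; rewrite !inE => /orP[]/eqP->.
  have P0 := is_portP eL ue uU.
  have /andP[t0 t8] := ok1 _ _ P0.
  have [d [d0 td gap]] := port_gap U L th t8.
  have [||th' [okt imp]] := @drawable_vertex R n g 0 x0 x1 U L (L :\ e)%SET th v (th e u) d
      isT x00 x01 x11 ok vU t0 d0 td (finset.subsetDl _ _).
  - move=> f fL; rewrite !inE fL andbT negbK => /eqP->.
    by exists u.
  - move=> f w /and3P[]; rewrite !inE => /andP[fe fL] wf wU.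
    have P := is_portP fL wf wU; rewrite le_eqVlt andb_orl negb_or gap // andbT.
    apply/negP => /andP[/eqP E1 _].
    by have [E3] := ok2 _ _ _ _ P0 P E1; rewrite E3 eqxx in fe.
  apply: imp; apply: IH => //.
  - by rewrite -ltnS -cardU.
  - by apply/fintype.subsetP => f; rewrite !inE => /andP[_ /(fintype.subsetP LE)].
  - move=> f w fE wf; rewrite !inE => /andP[wv wU]; rewrite (live f w) // andbT.
    apply: contraNneq uU => fe; move: wf; rewrite fe eE !inE (negbTE wv) orbF => /eqP <-.
    exact: wU.
  - have := subset_leq_card (sub_inner v) => le1.
    move: bud; rewrite (cardsD1 e L) eL (cardU v vU) add1n !addSn ltnS.
    by apply: leq_trans; rewrite leq_add2l.
(* An arbitrary starting height. The interval from [a + d / 2] to [a + 3 d / 4] lies inside the gap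
   above [a], clear of all ports. *)
pose a : R := 4.
have [d [d0 td gap]] := port_gap U L th (ltac:(rewrite /a; lra) : a < 8).
have [||th' [okt imp]] := @drawable_vertex R n g 0 x0 x1 U L L th w0 (a + d / 2) (d / 4)
    isT x00 x01 x11 ok wU0 (ltac:(rewrite /a; lra)) (ltac:(lra)) (ltac:(lra)) (fintype.subxx _).
- by move=> e ->.
- move=> e v P; apply: contra (gap _ _ P) => /andP[h1 h2].
  by apply/andP; split; lra.
apply: imp; apply: IH => //.
- by rewrite -ltnS -cardU.
- by move=> f w fE wf; rewrite !inE => /andP[_ wU]; exact: live wf wU.
have cl : forall v, connect (adj E) w0 v -> v \in U.
  have step a1 b1 : [set a1; b1]%SET \in E -> a1 \in U -> b1 \in U.
    move=> abE aU; apply: contraNT nin => bU; apply/existsP; exists ([set a1; b1]%SET, b1, a1).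
    by rewrite /= !inE !eqxx bU aU orbT (live _ a1) // !inE eqxx.
  have cU : fingraph.closed (adj E) (mem U).
    move=> u w uw; apply/idP/idP; first exact: step.
    by apply: step; rewrite finset.setUC.
  by move=> v /(closed_connect cU) <-.
have lt : inner_comps E (U :\ w0)%SET \proper inner_comps E U.
  apply/properP; split; first exact: sub_inner.
  exists (fingraph.root (adj E) w0).
    rewrite inE roots_root /=; last exact: adj_connect_sym.
    apply/forallP => v; apply/implyP => c; apply: cl.
    exact: connect_trans (connect_root _ _) c.
  rewrite !inE negb_and; apply/orP; right; apply/forallPn; exists w0.
  by rewrite negb_imply adj_connect_sym connect_root !inE eqxx.
have := proper_card lt; rewrite (cardU w0 wU0) !addSn in bud * => lt1.
by rewrite -ltnS; apply: leq_trans bud; rewrite -addnS leq_add2l.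
Qed.

Lemma embeddable_cycle_rank : (#|E| + kappa E <= n + 2 * g + 1)%N ->
  embeddable E S.
Proof.
move=> bud.
(* All vertices are still to be placed, so there are no ports and the heights 0 are dummies. *)
have [pos [K rd]] : drawable S 0 finset.setT E (fun _ _ => 0).
  apply: (@drawable_all #|[set: 'I_n]%SET|) => //.
  - rewrite cardsT card_ord (leq_trans _ bud) // leq_add2l subset_leq_card //.
    by apply/fintype.subsetP => r; rewrite !inE => /andP[].
  - by rewrite lexx /=; lra.
  - by split=> [e v|e v f w] /and3P[_ _]; rewrite inE.
have inT (v : 'I_n) : v \in finset.setT by rewrite inE.
have A e : exists h : R -> R * R * R, e \in E ->
    [/\ continuous h, {in `[0, 1] &, injective h}, K e = [set h t | t in `[0, 1]] &
      exists u v, [/\ e = [set u; v]%SET, h 0 = pos u & h 1 = pos v]].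
  have [eE|] := boolP (e \in E); last by exists (fun=> (0, 0, 0)).
  have /eqP/cards2P[u [v [uv eUV]]] := E2 eE.
  have [h [ch ih h0 h1 hK]] := rd_arc rd eE uv eUV.
  exists h => _; move: h0 h1; rewrite /end_pt !inT => h0 h1; split => //.
  by exists u, v.
have [q qP] := choice A.
exists pos, q.
have endI e : e \in E -> forall v (t : R), t \in `]0, 1[ -> v \in e -> q e t <> pos v.
  move=> eE v t; rewrite in_itv /= => /andP[t0 t1].
  have [cq iq _ [a [b [eab q0 q1]]]] := qP e eE.
  have ti : t \in `[0, 1] by rewrite in_itv /= !ltW.
  have i0 : (0 : R) \in `[0, 1] by rewrite in_itv /= lexx ler01.
  have i1 : (1 : R) \in `[0, 1] by rewrite in_itv /= lexx ler01.
  rewrite {1}eab !inE => /orP[]/eqP->.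
    by rewrite -q0 => /(iq _ _ ti i0) tE; rewrite tE ltxx in t0.
  by rewrite -q1 => /(iq _ _ ti i1) tE; rewrite tE ltxx in t1.
have inK e (t : R) : e \in E -> t \in `[0, 1] -> K e (q e t).
  by move=> eE tI; have [_ _ -> _] := qP e eE; exists t.
have oc (t : R) : t \in `]0, 1[ -> t \in `[0, 1].
  by rewrite !in_itv /= => /andP[/ltW-> /ltW->].
split.
- split=> [u v|v]; first exact: (rd_inj rd).
  by case: (rd_pos rd (inT v)).
- move=> e eE; have [cq iq Kq eq] := qP e eE; split => //.
  + by apply: continuous_subspaceT.
  + by move=> t tI; case: (rd_sub rd eE (inK _ _ eE tI)).
- move=> e v t eE tI pE; apply: (endI e eE v t tI) => //.
  by apply: (rd_vtx rd eE (inT v)); rewrite -pE; apply: inK => //; exact: oc.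
- move=> e f s t eE fE /eqP ef sI tI pE.
  have Ks : K f (q e s) by rewrite pE; apply: inK fE (oc _ tI).
  have [v [_ ve _ vE]] := rd_disj rd eE fE ef (inK _ _ eE (oc _ sI)) Ks.
  by apply: (endI e eE v s sI ve).
Qed.

End Embedding.

(** * From a drawing to a minor *)

Section CellCoordinate.
Variable R : realType.
Implicit Types (X : R) (a k : nat).

(** The cell of the subdivided line that contains [X], where [X] is already in doubled
    coordinates. *)
Definition coord_cell X a :=
  (~~ odd a /\ X = a%:R) \/ (odd a /\ a%:R - 1 < X < a%:R + 1).

Lemma coord_cell_ex X : 0 <= X -> exists a, coord_cell X a.
Proof.
move=> X0; have /andP[] := truncn_itv X0; set k := Num.trunc X => kX Xk.
have [ok|ok] := boolP (odd k).
  by exists k; right; split=> //; rewrite (lt_le_trans _ kX) ?gtrBl // natr1.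
have [<-|kX'] := eqVneq k%:R X; first by exists k; left.
exists k.+1; right; split=> /=; first by rewrite ok.
by rewrite -natr1 addrK lt_neqAle kX' kX (lt_trans Xk) // -natr1 ltrDl.
Qed.

Lemma coord_cell_lt X a k : coord_cell X a -> ~~ odd k -> (X < k%:R) = (a < k)%N.
Proof.
case=> [[oa ->]|[oa /andP[h1 h2]]] ok; first by rewrite ltr_nat.
have [ak|ka] := ltnP a k.
  by apply: lt_le_trans h2 _; rewrite natr1 ler_nat.
have ka1 : (k.+1 <= a)%N by rewrite ltn_neqAle ka andbT; apply: contraNneq ok => ->.
apply/negbTE; rewrite -leNgt; apply: le_trans (ltW h1).
by rewrite lerBrDr natr1 ler_nat.
Qed.

Lemma coord_cell_gt X a k : coord_cell X a -> ~~ odd k -> (k%:R < X) = (k < a)%N.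
Proof.
case=> [[oa ->]|[oa /andP[h1 h2]]] ok; first by rewrite ltr_nat.
have [ka|ak] := ltnP k a.
  by apply: le_lt_trans h1; rewrite lerBrDr natr1 ler_nat.
have ka1 : (a.+1 <= k)%N by rewrite ltn_neqAle ak andbT; apply: contraNneq ok => <-.
apply/negbTE; rewrite -leNgt; apply: le_trans (ltW h2) _.
by rewrite natr1 ler_nat.
Qed.

(** Having a given vertex on the closed cell of [X] is thus an open condition on [X]. *)
Lemma coord_cell_near X a k : coord_cell X a -> ~~ odd k -> (`|X - k%:R| < 2) = face1 k a.
Proof.
move=> Xa ok; rewrite ltr_norml ltrBDr ltrBDl addrC.
have -> : (k%:R - 2 < X) = (k%:R < X + 2) by rewrite ltrBlDr.
have Xa2 : coord_cell (X + 2) a.+2.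
  rewrite /coord_cell /= negbK -[a.+2]addn2 natrD.
  case: Xa => [[oa ->]|[oa /andP[h1 h2]]]; [left|right]; split=> //; first by rewrite negbK.
  by move: h1 h2; set w := a%:R => h1 h2; apply/andP; split; lra.
rewrite (coord_cell_gt Xa2 ok) -natrD (coord_cell_lt Xa) ?oddD ?addbF //.
have oe : odd a \/ X = a%:R by case: Xa => -[]; [right|left].
have oe2 : odd a \/ ~~ odd a by case: (odd a); [left|right].
by rewrite /face1 /inc1; lia.
Qed.

End CellCoordinate.

(** * Traces of connected sets on the mesh *)

Section Tracing.
Variables (R : realType) (N g : nat).
Hypothesis N0 : (0 < N)%N.
Implicit Types (p q : R * R * R).

Local Notation HV := (kcell N g 0%N).
Local Notation scale x := (2 * N%:R * x : R).

Lemma scaleE k : scale k%:R = (2 * N * k)%N%:R.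
Proof. by rewrite !natrM. Qed.

Lemma scale_lt (x y : R) : (scale x < scale y) = (x < y).
Proof. by rewrite ltr_pM2l // mulr_gt0 // ltr0n. Qed.

Lemma cell_lt x a k : coord_cell (scale x) a -> (x < k%:R) = (a < 2 * N * k)%N.
Proof. by move=> h; rewrite -scale_lt scaleE (coord_cell_lt h) // mulN_odd. Qed.

Lemma cell_gt x a k : coord_cell (scale x) a -> (k%:R < x) = (2 * N * k < a)%N.
Proof. by move=> h; rewrite -scale_lt scaleE (coord_cell_gt h) // mulN_odd. Qed.

Lemma cell_le x a k : coord_cell (scale x) a -> (x <= k%:R) = (a <= 2 * N * k)%N.
Proof. by move=> h; rewrite leNgt (cell_gt _ h) -leqNgt. Qed.

Lemma cell_ge x a k : coord_cell (scale x) a -> (k%:R <= x) = (2 * N * k <= a)%N.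
Proof. by move=> h; rewrite leNgt (cell_lt _ h) -leqNgt. Qed.

Lemma cell_eq x a k : coord_cell (scale x) a -> x = k%:R -> a = (2 * N * k)%N.
Proof.
move=> h e; apply/eqP; rewrite eqn_leq -(cell_le _ h) -(cell_ge _ h) e lexx.
by [].
Qed.

(** Comparisons of a real coordinate with an integer translate exactly into comparisons of cells, so
    the descriptions of the polyhedron and of [surf] correspond clause by clause. *)
Lemma point_cell (x y z : R) : sphere_with_handles g (x, y, z) -> exists a b c,
  [/\ coord_cell (scale x) a, coord_cell (scale y) b & coord_cell (scale z) c] /\
  [/\ (a <= xm N g)%N, (b <= ym N)%N, (c <= zm N)%N & surf N g a b c].
Proof.
move=> Sp.
have [/andP[x0 x1] /andP[y0 y1] /andP[z0 z1]] :
    [/\ (0%N%:R : R) <= x <= (2 * g + 1)%N%:R, (0%N%:R : R) <= y <= 3%N%:R & (0%N%:R : R) <= z <= 1%N%:R].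
  case: Sp => [[[]//]|[i /= ig [/andP[h1 h2] /andP[h3 h4] /andP[h5 h6] _]]].
  split; apply/andP; split=> //.
  - exact: le_trans h1.
  - by apply: le_trans h2 _; rewrite ler_nat; lia.
  - by apply: le_trans h3.
  - by apply: le_trans h4 _; rewrite ler_nat.
have sc0 (w : R) : 0%N%:R <= w -> 0 <= scale w by move=> w0; rewrite mulr_ge0.
have [a ha] := coord_cell_ex (sc0 _ x0); have [b hb] := coord_cell_ex (sc0 _ y0).
have [c hc] := coord_cell_ex (sc0 _ z0).
exists a, b, c; split=> //.
rewrite (cell_le _ ha) in x1; rewrite (cell_le _ hb) in y1; rewrite (cell_le _ hc) in z1.
have yE : ym N = (2 * N * 3)%N by rewrite /ym; lia.
have zE : zm N = (2 * N * 1)%N by rewrite /zm; lia.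
rewrite yE zE; split=> //.
case: Sp => [[box mouths]|[i /= ig [/andP[h1 h2] /andP[h3 h4] /andP[h5 h6] tube]]].
  have nohole : z = 0 \/ z = 1 -> ~~ hole N g a b.
    move=> zz; apply/negP => /andP[/existsP[i /andP[a1 a2]] /andP[b1 b2]].
    apply: mouths; exists i => //=; split=> //.
      by rewrite (cell_gt _ ha) (cell_lt _ ha) a1 a2.
    by rewrite -[1]/(1%N%:R) (cell_gt _ hb) (cell_lt _ hb); lia.
  case: box => _ _ _ [xx|yy|zz]; rewrite /surf /rim.
  - have -> : ex N g a; last by rewrite orbT.
    rewrite /ex; case: xx => [/(cell_eq (k := 0) ha)|/(cell_eq ha)] ->; last by rewrite eqxx orbT.
    by rewrite muln0.
  - have -> : ey N b; last by rewrite !orbT.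
    rewrite /ey; case: yy => [/(cell_eq (k := 0) hb)|/(cell_eq (k := 3) hb)] ->; last by rewrite yE eqxx orbT.
    by rewrite muln0.
  have -> : ez N c; last by rewrite nohole.
  rewrite /ez; case: zz => [/(cell_eq (k := 0) hc)|/(cell_eq (k := 1) hc)] ->; last by rewrite zE eqxx orbT.
  by rewrite muln0.
rewrite (cell_ge _ ha) in h1; rewrite (cell_le _ ha) in h2.
rewrite -[1]/(1%N%:R) (cell_ge _ hb) in h3; rewrite (cell_le _ hb) in h4.
have oda : ox N g a || dx N g a.
  have [e|n1] := eqVneq a (2 * N * (2 * i + 1))%N.
    by apply/orP; right; apply/existsP; exists (Ordinal ig); rewrite /= e eqxx.
  have [e|n2] := eqVneq a (2 * N * (2 * i + 2))%N.
    by apply/orP; right; apply/existsP; exists (Ordinal ig); rewrite /= e eqxx orbT.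
  apply/orP; left; apply/existsP; exists (Ordinal ig) => /=.
  by rewrite !ltn_neqAle h1 h2 n2 eq_sym n1.
have odb : oy N b || dy N b by rewrite /oy /dy; lia.
rewrite /surf /rim oda odb /=; suff -> : ~~ hole N g a b by rewrite !orbT.
apply/negP => /andP[/existsP[j /andP[a1 a2]] /andP[b1 b2]].
case: tube => [[/(cell_eq ha)|/(cell_eq ha)] ae|[/(cell_eq (k := 1) hb)|/(cell_eq (k := 2) hb)] be].
- by rewrite ae in a1 a2; have := mulN_lt N0 a1; have := mulN_lt N0 a2; clear; lia.
- by rewrite ae in a1 a2; have := mulN_lt N0 a1; have := mulN_lt N0 a2; clear; lia.
- by clear -be b1 b2; lia.
- by clear -be b1 b2; lia.
Qed.

(** For [p] on the surface these are the vertices of its closed cell; the form with distances makes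
    the set of points near a given vertex open. *)
Definition near_vertices p : {set HV} :=
  [set v : HV | [&& `|scale p.1.1 - (val v).1.1%:R| < 2, `|scale p.1.2 - (val v).1.2%:R| < 2
             & `|scale p.2 - (val v).2%:R| < 2]]%SET.

Lemma vertex_even (v : HV) : [/\ ~~ odd (val v).1.1, ~~ odd (val v).1.2 & ~~ odd (val v).2].
Proof. by have := valP v => /andP[_]; rewrite /dim; do 3!case: (odd _). Qed.

Lemma near_verticesP p : sphere_with_handles g p -> exists a b c,
  [/\ (a <= xm N g)%N, (b <= ym N)%N, (c <= zm N)%N & surf N g a b c] /\
  forall v : HV, v \in near_vertices p <->
    [/\ face1 (val v).1.1 a, face1 (val v).1.2 b & face1 (val v).2 c].
Proof.
case: p => -[x y] z /point_cell[a [b [c [[ha hb hc] bnd]]]]; exists a, b, c; split=> // v.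
have [ev1 ev2 ev3] := vertex_even v.
rewrite inE /= (coord_cell_near ha) // (coord_cell_near hb) // (coord_cell_near hc) //.
by split=> [/and3P|[-> -> ->]].
Qed.

Lemma near_vertices_linked p : sphere_with_handles g p ->
  linked (@bdry N g 0) (near_vertices p).
Proof. by case/near_verticesP=> a [b [c [[ha hb hc s] P]]]; exact: closed_cell_linked ha hb hc s P. Qed.

Lemma near_vertices_ex p : sphere_with_handles g p -> exists v, v \in near_vertices p.
Proof.
case/near_verticesP=> a [b [c [[ha hb hc s] P]]].
pose f k := if odd k then k.-1 else k.
have f1 k : face1 (f k) k by rewrite /face1 /f /inc1; case: k => [|k] //=; case: ifP => //=; rewrite eqxx ?orbT.
have f2 k : ~~ odd (f k) by rewrite /f; case: k => [|k] //=; case ok: (odd k) => /=; rewrite ok.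
have [v [e1 e2 e3]] := face_vertex N0 ha hb hc s (f1 a) (f1 b) (f1 c) (f2 a) (f2 b) (f2 c).
by exists v; apply/P; rewrite e1 e2 e3.
Qed.

Lemma open_near v : open [set p | v \in near_vertices p].
Proof.
have lin (f : R * R * R -> R) (d : R) : continuous f -> open [set p | `|scale (f p) - d| < 2].
  move=> cf; pose h p : R := `|scale (f p) - d|.
  have ch : continuous h.
    move=> p; apply: cvg_norm; apply: cvgB; last exact: cvg_cst.
    by apply: cvgM; [exact: cvg_cst|exact: cf].
  by apply: (@open_comp _ _ h [set x : R | x < 2]) => [p _|]; [exact: ch|exact: open_lt].
have -> : [set p | v \in near_vertices p] =
   [set p | `|scale p.1.1 - (val v).1.1%:R| < 2] `&`
   ([set p | `|scale p.1.2 - (val v).1.2%:R| < 2] `&` [set p | `|scale p.2 - (val v).2%:R| < 2]).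
  apply/seteqP; split=> p /=; rewrite inE; first by case/and3P.
  by case=> -> [-> ->].
apply: openI; [|apply: openI].
- by apply: (lin (fun p => p.1.1)) => p; apply: (@cvg_comp _ _ _ fst fst); [exact: cvg_fst|exact: cvg_fst].
- by apply: (lin (fun p => p.1.2)) => p; apply: (@cvg_comp _ _ _ fst snd); [exact: cvg_fst|exact: cvg_snd].
- by apply: (lin (fun p => p.2)) => p; exact: cvg_snd.
Qed.

Lemma near_close p q v : v \in near_vertices p -> v \in near_vertices q -> N%:R * `|p - q| < 2.
Proof.
rewrite !inE => /and3P[h1 h2 h3] /and3P[k1 k2 k3].
have NN : 0 < N%:R :> R by rewrite ltr0n.
have one (a b w : R) : `|scale a - w| < 2 -> `|scale b - w| < 2 -> N%:R * `|a - b| < 2.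
  rewrite -[N%:R]ger0_norm // -normrM !ltr_norml mulrBr ger0_norm //.
  by move=> /andP[? ?] /andP[? ?]; apply/andP; split; lra.
rewrite mulrC -ltr_pdivlMr // !prod_normE /= !gt_max !ltr_pdivlMr //.
by rewrite ![`|_| * _]mulrC (one _ _ _ h1 k1) (one _ _ _ h2 k2) (one _ _ _ h3 k3).
Qed.

Definition lattice_trace (X : set (R * R * R)) : {set HV} :=
  [set v : HV | `[< exists2 p, X p & v \in near_vertices p >]]%SET.

Lemma traceP X v : v \in lattice_trace X <-> exists2 p, X p & v \in near_vertices p.
Proof. by rewrite inE; split=> [/asboolP|/asboolP]. Qed.

(** Otherwise the points near a vertex reachable from [a] and those near an unreachable one would
    split [X] into two relatively open sets. They are disjoint because all vertices near one point
    are linked. *)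
Lemma trace_linked X : connected X -> X `<=` sphere_with_handles g ->
  linked (@bdry N g 0) (lattice_trace X).
Proof.
move=> cX XS a b aX bX.
pose r := link (@bdry N g 0) (lattice_trace X).
have sub p u v : X p -> u \in near_vertices p -> v \in near_vertices p -> connect r u v.
  move=> Xp up vp; apply: (connect_linkS (A := near_vertices p)).
    by apply/fintype.subsetP => w wp; apply/traceP; exists p.
  exact: near_vertices_linked (XS _ Xp) _ _ up vp.
pose C1 := \bigcup_(v in [set v | connect r a v]) [set p | v \in near_vertices p].
pose C2 := \bigcup_(v in [set v | ~~ connect r a v]) [set p | v \in near_vertices p].
have XB : X `&` C1 = X.
  apply: cX.
  - by case/traceP: aX => p Xp ap; exists p; split=> //; exists a; rewrite //= connect0.
  - by exists C1 => //; apply: bigcup_open => v _; exact: open_near.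
  - exists (~` C2); first by apply: open_closedC; apply: bigcup_open => v _; exact: open_near.
    apply/seteqP; split=> p [Xp].
      case=> v /= av vp; split=> // -[w /= nw wp].
      by rewrite (connect_trans av (sub _ _ _ Xp vp wp)) in nw.
    move=> nC; split=> //; have [v vp] := near_vertices_ex (XS _ Xp).
    exists v => //=; apply/negP => /negP nv; apply: nC; exists v => //.
case/traceP: bX => q Xq bq; have : (X `&` C1) q by rewrite XB.
by case=> _ [v /= av vq]; exact: connect_trans av (sub _ _ _ Xq vq bq).
Qed.

End Tracing.

Lemma compact_separated (R : realType) (K M : set (R * R * R)) : compact K -> compact M ->
  (forall p, K p -> M p -> False) ->
  exists2 d : R, 0 < d & forall p q, K p -> M q -> d <= `|p - q|.
Proof.
move=> cK cM dis; have [[[p q] [/= Kp Mq]]|no] := pselect ((K `*` M) !=set0); last first.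
  by exists 1 => // p q Kp Mq; exfalso; apply: no; exists (p, q).
pose f (w : (R * R * R) * (R * R * R)) : R := `|w.1 - w.2|.
have cf : continuous f.
  by move=> w; apply: cvg_norm; apply: cvgB; [exact: cvg_fst|exact: cvg_snd].
have [|[u v]] := compact_EVT_min (A := K `*` M) (f := f) _ (compact_setX cK cM) (continuous_subspaceT cf).
  by exists (p, q).
rewrite inE => -[/= Ku Mv] minf; exists `|u - v|.
  rewrite normr_gt0 subr_eq0; apply/eqP => uv; apply: (dis u) => //; by rewrite uv.
by move=> p' q' Kp' Mq'; have := minf (p', q'); apply; rewrite inE.
Qed.

Lemma uniform_bound (R : realType) (I : finType) (P : I -> R -> Prop) :
  (forall i, exists2 d : R, 0 < d & P i d) -> (forall i d d', 0 < d' -> d' <= d -> P i d -> P i d') ->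
  exists2 d : R, 0 < d & forall i, P i d.
Proof.
move=> ex mono; have /choice[f fP] : forall i, exists d : R, 0 < d /\ P i d.
  by move=> i; have [d] := ex i; exists d.
have d0 : 0 < \big[Order.min/1]_i f i by apply: lt_bigmin => // i _; case: (fP i).
exists (\big[Order.min/1]_i f i) => // i; apply: mono (proj2 (fP i)) => //.
exact: bigmin_le.
Qed.

(** * The minor model of a drawing *)

Section DrawingMinor.
Variables (R : realType) (n g : nat) (E : {set {set 'I_n}}).
Variables (pos : 'I_n -> R * R * R) (arc : {set 'I_n} -> R -> R * R * R).
Hypothesis E2 : forall e, e \in E -> #|e| = 2%N.
Hypothesis D : drawing E (sphere_with_handles g) pos arc.
Variables (tl hd : {set 'I_n} -> 'I_n).
Hypothesis endsP : forall e, e \in E -> [/\ e = [set tl e; hd e]%SET, arc e 0 = pos (tl e) & arc e 1 = pos (hd e)].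

Definition endv e (b : bool) := if b then hd e else tl e.

(** Each arc is cut into thirds: [Some b] is the outer third at the end [endv e b] and counts for
    that vertex, [None] is the middle third and counts for the edge. *)
Definition third (o : option bool) : set R :=
  match o with None => `[1/3, 2/3] | Some false => `[0, 1/3] | Some true => `[2/3, 1] end.

Definition piece (i : {set 'I_n} * option bool) := arc i.1 @` third i.2.

Lemma third_sub o : third o `<=` `[0, 1].
Proof. by case: o => [[]|] t /=; rewrite !in_itv /= => /andP[? ?]; apply/andP; split; lra. Qed.

Lemma third_end (b : bool) o : third o b%:R -> o = Some b.
Proof.
by case: b; case: o => [[]|] //=; rewrite in_itv /= => /andP[h1 h2]; exfalso; lra.
Qed.

Lemma arc_meet e f s t : e \in E -> f \in E -> `[0, 1]%classic s -> `[0, 1]%classic t -> arc e s = arc f t ->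
  (e = f /\ s = t) \/ exists b c : bool, [/\ s = b%:R, t = c%:R & endv e b = endv f c].
Proof.
case: D => -[posI posS] arcP arcV arcA eE fE s01 t01 st.
have bd (u : R) : `[0, 1]%classic u -> `]0, 1[%classic u \/ exists b : bool, u = b%:R.
  rewrite /= !in_itv /= => /andP[u0 u1]; have [->|n0] := eqVneq u 0; first by right; exists false.
  have [->|n1] := eqVneq u 1; first by right; exists true.
  by left; rewrite !lt_neqAle u0 u1 n1 eq_sym n0.
have endE h (b : bool) : h \in E -> arc h b%:R = pos (endv h b).
  by case/endsP=> _ a0 a1; case: b.
have [ef|/eqP ef] := eqVneq e f.
  by left; split=> //; rewrite -ef in st; have [_ inj _ _] := arcP e eE; apply: inj st.
have [si|[b sb]] := bd _ s01; have [ti|[c tc]] := bd _ t01.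
- by case: (arcA e f s t eE fE ef si ti).
- by case: (arcV e (endv f c) s eE si); rewrite st tc endE.
- by case: (arcV f (endv e b) t fE ti); rewrite -st sb endE.
by right; exists b, c; split=> //; apply: posI; rewrite -!endE // -sb -tc.
Qed.

(** The pairs of pieces that have to be told apart. A middle third may meet outer thirds at the ends
    of its edge, and outer thirds at a common vertex may meet. *)
Definition conflict (i j : {set 'I_n} * option bool) : bool :=
  match i.2, j.2 with
  | None, None => i.1 != j.1
  | None, Some c => endv j.1 c \notin i.1
  | Some b, None => false
  | Some b, Some c => endv i.1 b != endv j.1 c
  end.

Lemma mem_endv e b : e \in E -> endv e b \in e.
Proof. by move=> eE; have [ee _ _] := endsP eE; rewrite {2}ee !inE; case: b; rewrite eqxx ?orbT. Qed.

Lemma conflict_disjoint i j p : i.1 \in E -> j.1 \in E -> conflict i j -> piece i p -> piece j p -> False.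
Proof.
case: i j => [e o] [f o'] /= eE fE cf [s /= rs <-] [t /= rt st].
have [[fe ts]|[c [b [tc sb ev]]]] := arc_meet fE eE (third_sub rt) (third_sub rs) st.
  move: cf; rewrite /conflict /= fe; subst t f; clear st.
  case: o o' rs rt => [b|] [c|] rs rt /=; rewrite ?eqxx ?mem_endv //.
  case: b c rs rt => [] [] /=; rewrite ?eqxx //.
  - by rewrite !in_itv /= => /andP[? _] /andP[_ ?]; lra.
  - by rewrite !in_itv /= => /andP[_ ?] /andP[? _]; lra.
move: cf; rewrite /conflict /=; subst s t.
by rewrite (third_end rs) (third_end rt) ev eqxx.
Qed.

Lemma compact_piece i : i.1 \in E -> compact (piece i).
Proof.
case: D => _ arcP _ _ /arcP[ca _ _ _]; apply: continuous_compact; last first.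
  by case: (i.2) => [[]|]; exact: segment_compact.
by apply: continuous_subspaceW ca; exact: third_sub.
Qed.

Lemma connected_piece i : i.1 \in E -> connected (piece i).
Proof.
case: D => _ arcP _ _ /arcP[ca _ _ _]; apply: connected_continuous_connected.
  by case: (i.2) => [[]|]; exact: segment_connected.
by apply: continuous_subspaceW ca; exact: third_sub.
Qed.

Lemma piece_sub i : i.1 \in E -> piece i `<=` sphere_with_handles g.
Proof.
case: D => _ arcP _ _ /arcP[_ _ aS _] _ [t rt <-]; apply: aS.
exact: third_sub rt.
Qed.

(** Conflicting pieces are disjoint and compact, hence at distance at least some common [d > 0]. As
    soon as N d is at least 2, no mesh vertex is near both. *)
Lemma fine_mesh : exists2 N, (0 < N)%N & forall i j (v : kcell N g 0%N),
  i.1 \in E -> j.1 \in E -> conflict i j -> v \in lattice_trace N g (piece i) -> v \notin lattice_trace N g (piece j).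
Proof.
pose P (ij : ({set 'I_n} * option bool) * ({set 'I_n} * option bool)) (d : R) :=
  ij.1.1 \in E -> ij.2.1 \in E -> conflict ij.1 ij.2 ->
  forall p q, piece ij.1 p -> piece ij.2 q -> d <= `|p - q|.
have [| |d d0 dP] := @uniform_bound R _ P.
- move=> [i j]; have [/and3P[iE jE cf]|no] := boolP [&& i.1 \in E, j.1 \in E & conflict i j]; last first.
    by exists 1 => // iE jE cf; rewrite iE jE cf in no.
  have [d d0 dP] := compact_separated (compact_piece iE) (compact_piece jE)
    (fun p => conflict_disjoint iE jE cf).
  by exists d => // _ _ _; exact: dP.
- by move=> i d d' _ dd dP iE jE cf p q ip jq; apply: le_trans dd (dP iE jE cf p q ip jq).
have [x2 x2d] : exists N : nat, (0 < N)%N /\ 2 <= N%:R * d.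
  exists (Num.trunc (2 / d)).+1; split=> //; rewrite -ler_pdivrMr //.
  by have /andP[_ /ltW] := truncn_itv (ltW (divr_gt0 (ltr0Sn R 1) d0)).
case: x2d => N0 Nd; exists x2 => // i j v iE jE cf /traceP[p ip vp].
apply/negP => /traceP[q jq vq].
have := near_close N0 vp vq; rewrite ltNge => /negP; apply.
by apply: le_trans Nd _; rewrite ler_pM2l ?ltr0n //; exact: (dP (i, j)).
Qed.

Lemma drawing_minor : exists (N : nat) (U : 'I_n -> {set kcell N g 0%N}) (x : {set 'I_n} -> kcell N g 1%N),
  [/\ (0 < N)%N, forall u v a, a \in U u -> a \in U v -> u = v,
      forall v, linked (@bdry N g 0) (U v) &
      forall e, e \in E -> exists u v a b,
        [/\ e = [set u; v]%SET, bdry (x e) = [set a; b]%SET, a \in U u & b \in U v]].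
Proof.
have [N N0 mesh] := fine_mesh; exists N.
pose own v (eb : {set 'I_n} * bool) := eb.1 \in E /\ endv eb.1 eb.2 = v.
pose star v := \bigcup_(eb in own v) piece (eb.1, Some eb.2).
have in_star v w : w \in lattice_trace N g (star v) -> exists eb, own v eb /\ w \in lattice_trace N g (piece (eb.1, Some eb.2)).
  by case/traceP=> p [eb ob ep] wp; exists eb; split=> //; apply/traceP; exists p.
have [|||||||U [x [U1 U2 U3]]] := @branch_sets _ _ (@bdry N g 0) _ E tl hd
  (fun v => lattice_trace N g (star v)) (fun e => lattice_trace N g (piece (e, None))) (edge_cell g N0).
- move=> e eE; have [ee _ _] := endsP eE; split=> //; have := E2 eE; rewrite {1}ee cards2.
  by case: (_ != _).
- move=> v; apply: trace_linked => //.
    apply: bigcup_connected => [|eb [eE _]]; last exact: connected_piece.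
    exists (pos v) => -[e b] [/= eE <-]; have [_ a0 a1] := endsP eE.
    by case: b; [exists 1|exists 0] => //=; rewrite in_itv /=; apply/andP; split; lra.
  by move=> p [eb [eE _]]; exact: piece_sub.
- by move=> e eE; apply: trace_linked; [exact: N0|exact: connected_piece|exact: piece_sub].
- move=> u v w /in_star[[e b] [[/= eE eu] we]] /in_star[[f c] [[/= fE fv] wf]].
  apply/eqP/negP => /negP uv.
  by have := mesh (e, Some b) (f, Some c) w eE fE; rewrite /conflict /= eu fv uv we wf => /(_ isT isT).
- move=> e f w eE fE we wf; apply/eqP/negP => /negP ef.
  by have := mesh (e, None) (f, None) w eE fE; rewrite /conflict /= ef we wf => /(_ isT isT).
- move=> e v w eE we /in_star[[f c] [[/= fE fv] wf]]; apply/negP => /negP ve.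
  by have := mesh (e, None) (f, Some c) w eE fE; rewrite /conflict /= fv ve we wf => /(_ isT isT).
- move=> e v eE ve; have [ee _ _] := endsP eE.
  have [b bv] : exists b, endv e b = v.
    by move: ve; rewrite {1}ee !inE => /orP[]/eqP->; [exists false|exists true].
  (* The point where the middle third meets the outer third belongs to both pieces. *)
  pose t : R := if b then 2/3 else 1/3.
  have pN : piece (e, None) (arc e t).
    by exists t => //=; rewrite in_itv /= /t; case: (b); apply/andP; split; lra.
  have pS : piece (e, Some b) (arc e t).
    by exists t => //=; rewrite /t; case: (b); rewrite /= in_itv /=; apply/andP; split; lra.
  have [w wp] := near_vertices_ex (N := N) (g := g) N0 (@piece_sub (e, None) eE _ pN).
  exists w; split; apply/traceP; exists (arc e t) => //.
  by exists (e, b).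
by exists U, x.
Qed.

End DrawingMinor.

(* Each face of the drawing gives an element of the cycle space, that is a set of
   edges with all degrees even; these sets cover every edge at most twice and
   generate the cycle space up to codimension 2g. *)
Lemma embeddable_even_sets (R : realType) (n g : nat) (E : {set {set 'I_n}}) :
  (forall e, e \in E -> #|e| = 2%N) -> embeddable E (@sphere_with_handles R g) ->
  exists (F : finType) (J : {set F}) (C : F -> {set {set 'I_n}}),
  [/\ forall j, j \in J -> C j != finset.set0,
      forall j, C j \subset E,
      forall j v, ~~ odd #|[set e in C j | v \in e]%SET|,
      forall e, (#|[set j in J | e \in C j]%SET| <= 2)%N &
      (#|E| + kappa E <= n + 2 * g + #|J|)%N].
Proof.
move=> E2 [pos [arc D]].
(* Without an edge there may be no vertex to serve as default end below; the empty family then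
   suffices. *)
have [E0|[e0 e0E]] := set_0Vmem E.
  exists unit, finset.set0, (fun=> finset.set0); split.
  - by move=> j; rewrite inE.
  - by move=> j; rewrite finset.sub0set.
  - by move=> j v; rewrite eq_card0 // => e; rewrite !inE.
  - by move=> e; rewrite eq_card0 // => j; rewrite !inE.
  rewrite E0 !cards0 addn0 add0n; apply: leq_trans (leq_addr _ _).
  by apply: leq_trans (max_card _) _; rewrite card_ord.
have [v0 _] : exists v0, v0 \in e0.
  by apply/finset.set0Pn; rewrite -card_gt0 E2.
have /choice[uv uvP] : forall e, exists uv : 'I_n * 'I_n, e \in E ->
    [/\ e = [set uv.1; uv.2]%SET, arc e 0 = pos uv.1 & arc e 1 = pos uv.2].
  move=> e; have [eE|_] := boolP (e \in E); last by exists (v0, v0).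
  by case: D => _ arcP _ _; have [_ _ _ [u [v uv]]] := arcP e eE; exists (u, v).
have [N [U [x [N0 U1 U2 U3]]]] := @drawing_minor R n g E pos arc E2 D (fst \o uv) (snd \o uv) uvP.
have [||||||J [C P]] := @minor_bound _ _ _ (@bdry N g 0) (@bdry N g 1) g _ _ _ _ _ _ _ E E2 U x U1 U2 U3.
- by move=> e; rewrite card_bdry.
- exact: card_cobdry.
- exact: bdry_bdry.
- exact: vertices_connected.
- exact: faces_connected.
- by rewrite euler_cells.
by exists (kcell N g 2), J, C; rewrite card_ord in P.
Qed.

(** * Asymptotics of binomial coefficients *)

(** The quotient of the binomials has factors (m - i) / (N - i), each at most m / N. It is the
    probability that [k] given edges are present. *)
Lemma bin_dense_bound N m k : (k <= m)%N -> (m <= N)%N ->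
  ('C(N - k, m - k) * N ^ k <= 'C(N, m) * m ^ k)%N.
Proof.
move=> + mN; elim: k => [|k IH] km; first by rewrite !subn0 !expn0.
have {IH} IH := IH (ltnW km).
have kN : (0 < N - k)%N by lia.
have e : ((N - k) * 'C(N - k.+1, m - k.+1) = (m - k) * 'C(N - k, m - k))%N.
  have := mul_bin_diag (N - k) (m - k.+1); rewrite -subnS.
  by have -> : (m - k.+1).+1 = (m - k)%N by lia.
rewrite -(leq_pmul2l kN) !expnS mulnA e.
apply: leq_trans (_ : (m - k) * N * ('C(N, m) * m ^ k) <= _)%N.
  rewrite -!mulnA leq_mul2l; apply/orP; right; rewrite mulnCA leq_mul2l; apply/orP; right.
  by [].
have : ((m - k) * N <= (N - k) * m)%N by nia.
move bE: ((N - k) * m)%N => b; move: ((m - k) * N)%N => a ab.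
have := leq_mul ab (leqnn ('C(N, m) * m ^ k)); rewrite -[X in (_ <= X * _)%N -> _]bE => /leq_trans; apply.
by rewrite -!mulnA leq_mul2l [X in (_ <= X)%N]mulnCA leqnn orbT.
Qed.

Section BinomialRatio.
Variable R : realType.

(** The factors are 1 - d / (M - k). Both estimates come from [1 + x <= expR x], applied for the
    lower one to the inverse of the factor. *)
Lemma bin_ratio_bounds (M d m : nat) : (m + d < M)%N ->
  expR (- (m%:R * d%:R / (M - m - d)%N%:R)) <= ('C(M - d, m)%:R / 'C(M, m)%:R : R)
    <= expR (- (m%:R * d%:R / M%:R)).
Proof.
move=> mdM; suff : forall k, (k <= m)%N ->
    expR (- (k%:R * d%:R / (M - m - d)%N%:R)) <= ('C(M - d, k)%:R / 'C(M, k)%:R : R)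
    <= expR (- (k%:R * d%:R / M%:R)) by apply.
have M0 : 0 < M%:R :> R by rewrite ltr0n; lia.
have D0 : 0 < (M - m - d)%N%:R :> R by rewrite ltr0n; lia.
elim=> [|k IH] km; first by rewrite !bin0 !mul0r !oppr0 !expR0 divr1 lexx.
have {IH} /andP[lo hi] := IH (ltnW km).
have b0 : 0 < 'C(M, k)%:R :> R by rewrite ltr0n bin_gt0; lia.
have b1 : 0 < 'C(M, k.+1)%:R :> R by rewrite ltr0n bin_gt0; lia.
have Mk : 0 < (M - k)%N%:R :> R by rewrite ltr0n; lia.
have Mdk : 0 < (M - d - k)%N%:R :> R by rewrite ltr0n; lia.
have step (A : nat) : 'C(A, k.+1)%:R = (A - k)%N%:R * 'C(A, k)%:R / k.+1%:R :> R.
  by rewrite -natrM -mul_bin_left natrM mulrAC divff ?mul1r // pnatr_eq0.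
have -> : 'C(M - d, k.+1)%:R / 'C(M, k.+1)%:R =
    ('C(M - d, k)%:R / 'C(M, k)%:R) * ((M - d - k)%N%:R / (M - k)%N%:R) :> R.
  rewrite !step; field.
  by rewrite !gt_eqF //= ltr0n.
have sub : (M - k)%N%:R = (M - d - k)%N%:R + d%:R :> R by rewrite -natrD; congr (_%:R); lia.
have spl (Q : R) : Q != 0 -> - (k.+1%:R * d%:R / Q) = - (k%:R * d%:R / Q) - d%:R / Q.
  by move=> Q0; rewrite -natr1; field.
rewrite !spl ?gt_eqF // !expRD; apply/andP; split; apply: ler_pM => //.
- rewrite expRN -[X in _ <= X]invf_div lef_pV2 ?posrE ?expR_gt0 ?divr_gt0 //.
  rewrite sub mulrDl divff ?gt_eqF //; apply: le_trans (expR_ge1Dx _).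
  by rewrite lerD2l ler_wpM2l // lef_pV2 ?posrE // ler_nat; lia.
- apply: le_trans (_ : 1 + - (d%:R / M%:R) <= _); last exact: expR_ge1Dx.
  have -> : (M - d - k)%N%:R = (M - k)%N%:R - d%:R :> R by rewrite sub addrK.
  rewrite mulrBl divff ?gt_eqF // lerD2l lerN2 ler_wpM2l // lef_pV2 ?posrE // ler_nat leq_subr.
  by [].
Qed.

End BinomialRatio.

Section Asymptotics.
Variable R : realType.
Implicit Types (a b : nat -> nat) (u : nat -> R).

Lemma cvg_subn a b u (x : R) : (forall n, 0 <= u n) ->
  (fun n => (a n)%:R * u n) @ \oo --> x -> (fun n => (b n)%:R * u n) @ \oo --> (0 : R) ->
  (fun n => (a n - b n)%N%:R * u n) @ \oo --> x.
Proof.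
move=> u0 ca cb.
apply: (@squeeze_cvgr _ _ _ _ (fun n => (a n)%:R * u n - (b n)%:R * u n) (fun n => (a n)%:R * u n)) => //.
- near=> n; apply/andP; split; last by rewrite ler_wpM2r // ler_nat leq_subr.
  rewrite -mulrBl ler_wpM2r //.
  have [ba|ab] := leqP (b n) (a n); first by rewrite natrB.
  by apply: le_trans (ler0n _ _); rewrite subr_le0 ler_nat ltnW.
- by rewrite -[x]subr0; apply: cvgB.
Unshelve. all: by end_near. Qed.

Lemma cvg_invn : (fun n => n%:R^-1 : R) @ \oo --> (0 : R).
Proof.
rewrite -(cvg_shiftS (fun n => n%:R^-1 : R)); exact: cvg_harmonic.
Qed.

Lemma cvg_constn k : (fun n => k%:R * n%:R^-1 : R) @ \oo --> (0 : R).
Proof. by rewrite -[0](mulr0 k%:R); apply: cvgM; [exact: cvg_cst|exact: cvg_invn]. Qed.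

Lemma cvg_n : (fun n => n%:R * n%:R^-1 : R) @ \oo --> (1 : R).
Proof.
apply: cvg_near_cst; near=> n.
by rewrite divff // pnatr_eq0 -lt0n; near: n; exact: nbhs_infty_gt.
Unshelve. all: by end_near. Qed.

Lemma cvg_nsub s : (fun n => (n - s)%N%:R * n%:R^-1 : R) @ \oo --> (1 : R).
Proof. by apply: cvg_subn => [n||]; [rewrite invr_ge0|exact: cvg_n|exact: cvg_constn]. Qed.

Lemma cvg_bin2 s : (fun n => 'C(n - s, 2)%:R * (n%:R^-1 * n%:R^-1) : R) @ \oo --> (2^-1 : R).
Proof.
have -> : (fun n => 'C(n - s, 2)%:R * (n%:R^-1 * n%:R^-1) : R) =
    (fun n => 2^-1 * (((n - s)%N%:R * n%:R^-1) * ((n - s.+1)%N%:R * n%:R^-1))).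
  apply/funext => n; have := mul_bin_diag (n - s) 1; rewrite bin1 -subnS => e.
  have -> : 'C(n - s, 2)%:R = 2^-1 * ((n - s)%N%:R * (n - s.+1)%N%:R) :> R.
    by rewrite -natrM e natrM mulKf // pnatr_eq0.
  by ring.
have H : (fun n => 2^-1 * (((n - s)%N%:R * n%:R^-1) * ((n - s.+1)%N%:R * n%:R^-1)) : R) @ \oo -->
    (2^-1 * (1 * 1) : R).
  by apply: cvgM; [exact: cvg_cst|apply: cvgM; exact: cvg_nsub].
by rewrite !mulr1 in H.
Qed.

Lemma cvg_binn s : (fun n => 'C(n, s)%:R * n%:R^-1 ^+ s : R) @ \oo --> ((s`!)%:R^-1 : R).
Proof.
elim: s => [|s IH].
  have -> : (fun n => 'C(n, 0)%:R * n%:R^-1 ^+ 0 : R) = (fun=> 1) by apply/funext => n; rewrite bin0 mulr1.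
  by rewrite fact0 invr1; exact: cvg_cst.
have -> : (fun n => 'C(n, s.+1)%:R * n%:R^-1 ^+ s.+1 : R) =
    (fun n => s.+1%:R^-1 * (((n - s)%N%:R * n%:R^-1) * ('C(n, s)%:R * n%:R^-1 ^+ s))).
  apply/funext => n; have e := mul_bin_left n s.
  have -> : 'C(n, s.+1)%:R = s.+1%:R^-1 * ((n - s)%N%:R * 'C(n, s)%:R) :> R.
    by rewrite -natrM -e natrM mulKf // pnatr_eq0.
  by rewrite exprS; ring.
have -> : (s.+1)`!%:R^-1 = s.+1%:R^-1 * (1 * s`!%:R^-1) :> R by rewrite factS natrM invfM mul1r.
by apply: cvgM; [exact: cvg_cst|apply: cvgM => //; exact: cvg_nsub].
Qed.

Variables (m : nat -> nat) (l : R).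
Hypothesis l0 : 0 < l.
Hypothesis ml : (fun n => (m n)%:R * n%:R^-1) @ \oo --> l.

Lemma near_gt a u (x : R) : (fun n => (a n)%:R * u n) @ \oo --> x -> 0 < x ->
  \forall n \near \oo, (0 < a n)%N.
Proof.
move=> ca x0; near=> n; have h : 0 < (a n)%:R * u n by near: n; exact: (cvgr_gt x ca 0 x0).
by rewrite lt0n; apply/eqP => a0; rewrite a0 mul0r ltxx in h.
Unshelve. all: by end_near. Qed.

Lemma cvg_msub j : (fun n => (m n - j)%N%:R * n%:R^-1 : R) @ \oo --> l.
Proof. by apply: cvg_subn => [n||]; [rewrite invr_ge0|exact: ml|exact: cvg_constn]. Qed.

Lemma near_m_ge k : \forall n \near \oo, (k <= m n)%N.
Proof.
near=> n; rewrite ltnW // -subn_gt0; near: n; exact: (near_gt (cvg_msub k) l0).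
Unshelve. all: by end_near. Qed.

Lemma cvg_quad_linear a (x : R) : (fun n => (a n)%:R * n%:R^-1 : R) @ \oo --> x ->
  (fun n => (a n)%:R * (n%:R^-1 * n%:R^-1) : R) @ \oo --> (0 : R).
Proof.
move=> ca; rewrite -[0](mulr0 x).
have -> : (fun n => (a n)%:R * (n%:R^-1 * n%:R^-1) : R) = (fun n => (a n)%:R * n%:R^-1 * n%:R^-1).
  by apply/funext => n; rewrite mulrA.
by apply: cvgM => //; exact: cvg_invn.
Qed.

Lemma quad_ge0 n : 0 <= n%:R^-1 * n%:R^-1 :> R.
Proof. by rewrite mulr_ge0 ?invr_ge0. Qed.

Lemma cvg_bin2_sub s j :
  (fun n => ('C(n - s, 2) - (m n - j))%N%:R * (n%:R^-1 * n%:R^-1) : R) @ \oo --> (2^-1 : R).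
Proof.
by apply: cvg_subn; [exact: quad_ge0|exact: cvg_bin2|exact: cvg_quad_linear (cvg_msub j)].
Qed.

Lemma near_bin_gt0 s : \forall n \near \oo, (0 < 'C('C(n - s, 2), m n))%N.
Proof.
have h : 0 < 2^-1 :> R by rewrite invr_gt0.
near=> n; rewrite bin_gt0 ltnW // -subn_gt0 -[m n]subn0; near: n.
exact: (near_gt (cvg_bin2_sub s 0) h).
Unshelve. all: by end_near. Qed.

Lemma cvg_div2 (x y : nat -> R) (a : R) : x @ \oo --> a -> y @ \oo --> (2^-1 : R) ->
  (fun n => x n / y n) @ \oo --> 2 * a.
Proof.
move=> cx cy; rewrite mulrC -[2]invrK; by apply: cvgM => //; apply: cvgV.
Qed.

Lemma div_quad (x q z : R) : x != 0 -> z * (x^-1 * x^-1) / (q * (x^-1 * x^-1)) = z / q.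
Proof. by move=> x0; rewrite -mulf_div divff ?mulr1 // mulf_neq0 // invr_eq0. Qed.

(** Isolating one more vertex forbids n - s - 1 pairs out of about n^2 / 2, so the exponent m d / M
    tends to 2 l in both exponential bounds. *)
Lemma cvg_component_step s :
  (fun n => 'C('C(n - s.+1, 2), m n)%:R / 'C('C(n - s, 2), m n)%:R : R) @ \oo --> expR (- (2 * l)).
Proof.
pose M n := 'C(n - s, 2); pose d n := (n - s.+1)%N.
have cD : (fun n => (M n - m n - d n)%N%:R * (n%:R^-1 * n%:R^-1) : R) @ \oo --> (2^-1 : R).
  apply: cvg_subn; first exact: quad_ge0.
    by apply: cvg_subn; [exact: quad_ge0|exact: cvg_bin2|exact: cvg_quad_linear ml].
  exact: cvg_quad_linear (cvg_nsub s.+1).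
have cN : (fun n => (m n)%:R * n%:R^-1 * ((d n)%:R * n%:R^-1) : R) @ \oo --> l.
  by rewrite -[l]mulr1; apply: cvgM => //; exact: cvg_nsub.
have lim1 (Q : nat -> nat) : (fun n => (Q n)%:R * (n%:R^-1 * n%:R^-1) : R) @ \oo --> (2^-1 : R) ->
    (fun n => expR (- ((m n)%:R * (d n)%:R / (Q n)%:R)) : R) @ \oo --> expR (- (2 * l)).
  move=> cQ; apply: (@continuous_cvg _ _ _ _ _ _ expR); first exact: continuous_expR.
  apply: cvgN; apply: cvg_trans (cvg_div2 cN cQ); apply: near_eq_cvg; near=> n.
  have n0 : (n%:R : R) != 0 by rewrite pnatr_eq0 -lt0n; near: n; exact: nbhs_infty_gt.
  have Q0 : ((Q n)%:R : R) != 0.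
    rewrite pnatr_eq0 -lt0n; near: n; apply: (near_gt cQ).
    by rewrite invr_gt0.
  by rewrite mulrACA div_quad.
apply: (squeeze_cvgr _ (lim1 _ cD) (lim1 _ (cvg_bin2 s))).
near=> n.
have pos : (0 < M n - m n - d n)%N.
  by near: n; apply: (near_gt cD); rewrite invr_gt0.
have ns : (s < n)%N by near: n; exact: nbhs_infty_gt.
have -> : 'C(n - s.+1, 2) = (M n - d n)%N.
  rewrite /M /d; have -> : (n - s = (n - s.+1).+1)%N by lia.
  by rewrite [in RHS]binS bin1 addnK.
by apply: bin_ratio_bounds; lia.
Unshelve. all: by end_near. Qed.

(** The quotient is the probability that [j] given edges are the only ones touching [s] given
    vertices. Prescribing one more edge multiplies it by about 2 l / n. *)
Lemma cvg_component_prob s j :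
  (fun n => n%:R ^+ j * ('C('C(n - s, 2), m n - j)%:R / 'C('C(n, 2), m n)%:R) : R) @ \oo -->
  (2 * l) ^+ j * expR (- (2 * l)) ^+ s.
Proof.
elim: j => [|j IH].
  rewrite expr0 mul1r.
  have -> : (fun n => n%:R ^+ 0 * ('C('C(n - s, 2), m n - 0)%:R / 'C('C(n, 2), m n)%:R) : R) =
      (fun n => 'C('C(n - s, 2), m n)%:R / 'C('C(n, 2), m n)%:R).
    by apply/funext => n; rewrite expr0 mul1r subn0.
  elim: s => [|s IH].
    rewrite expr0; apply: cvg_near_cst; near=> n.
    rewrite subn0 divff // pnatr_eq0 -lt0n -[n in 'C(n, 2)]subn0.
    by near: n; exact: (near_bin_gt0 0).
  rewrite exprS; apply: cvg_trans (cvgM (cvg_component_step s) IH); apply: near_eq_cvg; near=> n.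
  rewrite /= mulrA divfK // pnatr_eq0 -lt0n.
  by near: n; exact: near_bin_gt0.
pose f n : R := ((m n - j)%N%:R * n%:R^-1) / (('C(n - s, 2) - (m n - j.+1))%N%:R * (n%:R^-1 * n%:R^-1)).
have cf : f @ \oo --> 2 * l by apply: cvg_div2; [exact: cvg_msub|exact: cvg_bin2_sub].
rewrite exprS -mulrA; apply: cvg_trans (cvgM cf IH); apply: near_eq_cvg; near=> n.
have n0 : (n%:R : R) != 0 by rewrite pnatr_eq0 -lt0n; near: n; exact: nbhs_infty_gt.
have mj : (j < m n)%N by near: n; exact: near_m_ge.
have Q0 : (0 < 'C(n - s, 2) - (m n - j.+1))%N.
  by near: n; apply: (near_gt (cvg_bin2_sub s j.+1)); rewrite invr_gt0.
have := mul_bin_left 'C(n - s, 2) (m n - j.+1); have -> : (m n - j.+1).+1 = (m n - j)%N by lia.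
move=> e; have {}e : (m n - j)%N%:R * 'C('C(n - s, 2), m n - j)%:R =
    ('C(n - s, 2) - (m n - j.+1))%N%:R * 'C('C(n - s, 2), m n - j.+1)%:R :> R by rewrite -!natrM e.
have Q0' : ('C(n - s, 2) - (m n - j.+1))%N%:R != 0 :> R by rewrite pnatr_eq0 -lt0n.
have -> : 'C('C(n - s, 2), m n - j.+1)%:R =
   (m n - j)%N%:R * 'C('C(n - s, 2), m n - j)%:R / ('C(n - s, 2) - (m n - j.+1))%N%:R :> R.
  by rewrite e mulrAC divff ?mul1r.
rewrite /f exprS /=; move: ('C('C(n, 2), m n)%:R^-1) ('C('C(n - s, 2), m n - j)%:R) ((m n - j)%N%:R) => w v z.
move: Q0' n0; move: (('C(n - s, 2) - (m n - j.+1))%N%:R) (n%:R) => q x q0 x0.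
by field; rewrite x0 q0.
Unshelve. all: by end_near. Qed.

Lemma cvg_edge_density : (fun n => n%:R * ((m n)%:R / 'C(n, 2)%:R) : R) @ \oo --> 2 * l.
Proof.
have cb : (fun n => 'C(n, 2)%:R * (n%:R^-1 * n%:R^-1) : R) @ \oo --> (2^-1 : R).
  rewrite (_ : (fun n => _) = (fun n => 'C(n - 0, 2)%:R * (n%:R^-1 * n%:R^-1))); first exact: cvg_bin2.
  by apply/funext => n; rewrite subn0.
apply: cvg_trans (cvg_div2 ml cb); apply: near_eq_cvg; near=> n.
have n0 : (n%:R : R) != 0 by rewrite pnatr_eq0 -lt0n; near: n; exact: nbhs_infty_gt.
have Q0 : ('C(n, 2)%:R : R) != 0.
  by rewrite pnatr_eq0 -lt0n bin_gt0; near: n; exact: nbhs_infty_ge.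
move: ('C(n, 2)%:R) ((m n)%:R) (n%:R) n0 Q0 => q z x x0 q0.
by field; rewrite x0 q0.
Unshelve. all: by end_near. Qed.

End Asymptotics.

(** * Concentration of the number of components *)

Section Moments.
Variables (R : realType) (T : finType) (m : nat).
Local Notation Om := (edge_sets T m).
Implicit Types (f h : {set {set T}} -> R) (Q : pred {set {set T}}).

Definition mean f : R := (\sum_(E in Om) f E) / #|Om|%:R.
Definition freq Q : R := #|[set E in Om | Q E]%SET|%:R / #|Om|%:R.

Lemma mean_le f h : (forall E, E \in Om -> f E <= h E) -> mean f <= mean h.
Proof. by move=> fh; rewrite ler_wpM2r ?invr_ge0 //; exact: ler_sum. Qed.

Lemma meanD f h : mean (fun E => f E + h E) = mean f + mean h.
Proof. by rewrite /mean big_split mulrDl. Qed.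

Lemma meanZ c f : mean (fun E => c * f E) = c * mean f.
Proof. by rewrite /mean -big_distrr /= mulrA. Qed.

Lemma mean_cst c : (0 < #|Om|)%N -> mean (fun=> c) = c.
Proof.
move=> O0; have e : \sum_(E in Om) c = c * #|Om|%:R by rewrite sumr_const mulr_natr.
by rewrite /mean e mulfK // pnatr_eq0 -lt0n.
Qed.

Lemma freqE Q : freq Q = mean (fun E => (Q E)%:R).
Proof.
rewrite /freq /mean -sum1dep_card natr_sum big_mkcondr; congr (_ / _).
by apply: eq_bigr => E _; case: (Q E).
Qed.

Lemma markov_freq f t : (forall E, 0 <= f E) -> 0 < t -> freq (fun E => t <= f E) <= mean f / t.
Proof.
move=> f0 t0; rewrite freqE ler_pdivlMr // mulrC -meanZ; apply: mean_le => E _.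
by case: (leP t (f E)) => h; rewrite ?mulr1 ?mulr0.
Qed.

Lemma freq_le Q Q' : (forall E, E \in Om -> Q E -> Q' E) -> freq Q <= freq Q'.
Proof.
move=> QQ; rewrite !freqE; apply: mean_le => E EO; rewrite ler_nat.
by case: (boolP (Q E)) => // /(QQ _ EO) ->.
Qed.

Lemma freq_or Q Q' : freq (fun E => Q E || Q' E) <= freq Q + freq Q'.
Proof.
rewrite !freqE -meanD; apply: mean_le => E _; rewrite -natrD ler_nat.
by case: (Q E); case: (Q' E).
Qed.

Lemma freq_exists (I : finType) (Q : I -> pred {set {set T}}) :
  freq (fun E => [exists i, Q i E]) <= \sum_i freq (Q i).
Proof.
have -> : \sum_i freq (Q i) = mean (fun E => \sum_i (Q i E)%:R).
  by under eq_bigr do rewrite freqE; rewrite /mean -big_distrl /= exchange_big.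
rewrite freqE; apply: mean_le => E _; case: existsP => [[i Qi]|_]; last exact: sumr_ge0.
by rewrite (bigD1 i) //= Qi lerDl sumr_ge0.
Qed.

End Moments.

Section Concentration.
Variables (R : realType) (m : nat -> nat) (l : R).
Hypothesis l0 : 0 < l.
Hypothesis ml : (fun n => (m n)%:R * n%:R^-1) @ \oo --> l.
Local Notation TC s := (fun E => #|tree_comps E s.+1|%:R : R).

(** Limit of the mean number of tree components with [s.+1] vertices, per vertex of the graph. *)
Definition tree_density s : R :=
  (forests s.+1 1)%:R * ((s.+1)`!)%:R^-1 * ((2 * l) ^+ s * expR (- (2 * l)) ^+ s.+1).

Lemma card_Om n : #|edge_sets 'I_n (m n)| = 'C('C(n, 2), m n).
Proof. by rewrite card_edge_sets card_ord. Qed.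

Lemma near_Om : \forall n \near \oo, (0 < #|edge_sets 'I_n (m n)|)%N.
Proof.
near=> n; rewrite card_Om -[n in 'C(n, 2)]subn0; near: n; exact: (near_bin_gt0 ml 0).
Unshelve. all: by end_near. Qed.

Lemma mean_tree n s : (s <= m n)%N ->
  mean (m n) (TC s : {set {set 'I_n}} -> R) =
  'C(n, s.+1)%:R * ((forests s.+1 1)%:R * ('C('C(n - s.+1, 2), m n - s)%:R / 'C('C(n, 2), m n)%:R)).
Proof.
move=> sm; rewrite /mean card_Om -natr_sum sum_card_tree_comps // card_ord !natrM.
by rewrite !mulrA.
Qed.

Lemma cvg_mean_tree s :
  (fun n => mean (m n) (TC s : {set {set 'I_n}} -> R) * n%:R^-1) @ \oo --> tree_density s.
Proof.
have c1 : (fun n => (forests s.+1 1)%:R * ('C(n, s.+1)%:R * n%:R^-1 ^+ s.+1) *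
   (n%:R ^+ s * ('C('C(n - s.+1, 2), m n - s)%:R / 'C('C(n, 2), m n)%:R)) : R) @ \oo --> tree_density s.
  apply: cvgM; last exact: cvg_component_prob.
  by apply: cvgM; [exact: cvg_cst|exact: cvg_binn].
apply: cvg_trans c1; apply: near_eq_cvg; near=> n; have n0 : (n%:R : R) != 0.
  by rewrite pnatr_eq0 -lt0n; near: n; exact: nbhs_infty_gt.
rewrite /= mean_tree; last by near: n; exact: near_m_ge l0 ml s.
move: (n%:R) n0 ('C(n, s.+1)%:R) ('C('C(n - s.+1, 2), m n - s)%:R / _) => x x0 b q.
have e : x^-1 ^+ s.+1 * x ^+ s = x^-1 by rewrite exprSr mulrAC -exprMn mulVf // expr1n mul1r.
by rewrite -[in RHS]e; ring.
Unshelve. all: by end_near. Qed.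

Lemma mean_tree_sqr n s : (2 * s <= m n)%N ->
  mean (m n) (fun E : {set {set 'I_n}} => (TC s E) ^+ 2) <=
  mean (m n) (TC s : {set {set 'I_n}} -> R) + 'C(n, s.+1)%:R ^+ 2 * ((forests s.+1 1)%:R ^+ 2 *
    ('C('C(n - 2 * s.+1, 2), m n - 2 * s)%:R / 'C('C(n, 2), m n)%:R)).
Proof.
move=> sm; rewrite /mean card_Om !mulrA -mulrDl ler_wpM2r ?invr_ge0 //.
have := @sum_card_tree_comps_sqr 'I_n (m n) s sm; rewrite card_ord; move: (forests s.+1 1) => f.
rewrite -(ler_nat R) natrD !natrM !natr_sum => h; apply: le_trans (le_trans _ h) _.
  by apply: ler_sum => E _; rewrite natrX.
by rewrite !expr2 !mulrA.
Qed.

Lemma cvg_tree_pairs s :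
  (fun n => ('C(n, s.+1)%:R ^+ 2 * ((forests s.+1 1)%:R ^+ 2 *
    ('C('C(n - 2 * s.+1, 2), m n - 2 * s)%:R / 'C('C(n, 2), m n)%:R))) * n%:R^-1 ^+ 2 : R) @ \oo -->
  tree_density s ^+ 2.
Proof.
pose F n : R := ((forests s.+1 1)%:R * ('C(n, s.+1)%:R * n%:R^-1 ^+ s.+1)) *
   ((forests s.+1 1)%:R * ('C(n, s.+1)%:R * n%:R^-1 ^+ s.+1)) *
   (n%:R ^+ (2 * s) * ('C('C(n - 2 * s.+1, 2), m n - 2 * s)%:R / 'C('C(n, 2), m n)%:R)).
have c1 : F @ \oo --> (((forests s.+1 1)%:R * ((s.+1)`!)%:R^-1) * ((forests s.+1 1)%:R * ((s.+1)`!)%:R^-1)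
    * ((2 * l) ^+ (2 * s) * expR (- (2 * l)) ^+ (2 * s.+1)) : R).
  apply: cvgM; last exact: cvg_component_prob.
  by apply: cvgM; apply: cvgM; try exact: cvg_cst; exact: cvg_binn.
have -> : tree_density s ^+ 2 = ((forests s.+1 1)%:R * ((s.+1)`!)%:R^-1) * ((forests s.+1 1)%:R * ((s.+1)`!)%:R^-1)
    * ((2 * l) ^+ (2 * s) * expR (- (2 * l)) ^+ (2 * s.+1)).
  by rewrite /tree_density ![(2 * _)%N]mulnC !exprM !expr2; ring.
apply: cvg_trans c1; apply: near_eq_cvg; near=> n; have n0 : (n%:R : R) != 0.
  by rewrite pnatr_eq0 -lt0n; near: n; exact: nbhs_infty_gt.
rewrite /F; move: (n%:R) n0 ('C(n, s.+1)%:R) ('C('C(n - 2 * s.+1, 2), m n - 2 * s)%:R / _) => x x0 b q.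
have e : x^-1 ^+ s.+1 * x ^+ s = x^-1 by rewrite exprSr mulrAC -exprMn mulVf // expr1n mul1r.
by rewrite -[in RHS]e [(2 * s)%N]mulnC exprM !expr2; ring.
Unshelve. all: by end_near. Qed.

(** Chebyshev's inequality. Divided by n^2, the pairs of distinct components contribute the square
    of the limit mean and the diagonal is of order 1 / n, so the bound [B] tends to 0. *)
Lemma freq_tree s (d : R) : 0 < d ->
  (fun n => freq R (m n) (fun E : {set {set 'I_n}} => d * n%:R <= `|TC s E - tree_density s * n%:R|))
    @ \oo --> (0 : R).
Proof.
move=> d0; set a := tree_density s.
pose M n : R := mean (m n) (TC s : {set {set 'I_n}} -> R) * n%:R^-1.
pose P n : R := ('C(n, s.+1)%:R ^+ 2 * ((forests s.+1 1)%:R ^+ 2 *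
    ('C('C(n - 2 * s.+1, 2), m n - 2 * s)%:R / 'C('C(n, 2), m n)%:R))) * n%:R^-1 ^+ 2.
pose B n : R := (M n * n%:R^-1 + P n + - (2 * a) * M n + a ^+ 2) * (d ^+ 2)^-1.
have cB : B @ \oo --> (0 : R).
  have -> : 0 = (a * 0 + a ^+ 2 + - (2 * a) * a + a ^+ 2) * (d ^+ 2)^-1 :> R by rewrite mulr0; ring.
  apply: cvgM; last exact: cvg_cst.
  apply: cvgD; last exact: cvg_cst.
  apply: cvgD; last by apply: cvgM; [exact: cvg_cst|exact: cvg_mean_tree].
  apply: cvgD; last exact: cvg_tree_pairs.
  by apply: cvgM; [exact: cvg_mean_tree|exact: cvg_invn].
apply: (squeeze_cvgr _ (cvg_cst (0 : R)) cB); near=> n.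
have n0 : 0 < n%:R :> R by rewrite ltr0n; near: n; exact: nbhs_infty_gt.
have O0 : (0 < #|edge_sets 'I_n (m n)|)%N by near: n; exact: near_Om.
have sm : (2 * s <= m n)%N by near: n; exact: near_m_ge l0 ml _.
apply/andP; split; first by rewrite /freq divr_ge0.
have t0 : 0 < (d * n%:R) ^+ 2 by rewrite exprn_gt0 // mulr_gt0.
apply: le_trans (_ : freq R (m n) (fun E : {set {set 'I_n}} => (d * n%:R) ^+ 2 <= (TC s E - a * n%:R) ^+ 2) <= _).
  apply: freq_le => E _ h; rewrite -[X in _ <= X]real_normK ?num_real //.
  by rewrite ler_sqr ?nnegrE // mulr_ge0 // ltW.
apply: le_trans (markov_freq _ _ t0) _; first by move=> E; rewrite sqr_ge0.
have -> : mean (m n) (fun E : {set {set 'I_n}} => (TC s E - a * n%:R) ^+ 2) =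
    mean (m n) (fun E : {set {set 'I_n}} => (TC s E) ^+ 2) + (- (2 * a * n%:R)) * mean (m n) (TC s : {set {set 'I_n}} -> R)
      + (a * n%:R) ^+ 2.
  rewrite -[(a * n%:R) ^+ 2 in RHS](mean_cst _ O0) -meanZ -!meanD; congr (mean _ _); apply/funext => E.
  by ring.
rewrite ler_pdivrMr //; apply: le_trans (lerD (lerD (mean_tree_sqr sm) (lexx _)) (lexx _)) _.
have nn : (n%:R : R) != 0 by rewrite gt_eqF.
have dd : d != 0 by rewrite gt_eqF.
rewrite le_eqVlt; apply/orP; left; apply/eqP; rewrite /B /M /P.
move: (mean _ _) ('C(n, s.+1)%:R) ('C('C(n - 2 * s.+1, 2), m n - 2 * s)%:R / _) (n%:R) nn => mu b q x xx.
by field; rewrite xx dd.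
Unshelve. all: by end_near. Qed.

Lemma cvg_density_sum K (c : nat -> R) :
  (fun n => \sum_(k < K) c k * (n%:R * ((m n)%:R / 'C(n, 2)%:R)) ^+ k.+1 : R) @ \oo -->
  (\sum_(k < K) c k * (2 * l) ^+ k.+1 : R).
Proof.
have pw j : (fun n => (n%:R * ((m n)%:R / 'C(n, 2)%:R)) ^+ j : R) @ \oo --> ((2 * l) ^+ j : R).
  elim: j => [|j IHj]; first by apply: cvg_near_cst; near=> n; rewrite !expr0.
  have -> : (fun n => (n%:R * ((m n)%:R / 'C(n, 2)%:R)) ^+ j.+1 : R) =
     (fun n => (n%:R * ((m n)%:R / 'C(n, 2)%:R)) * (n%:R * ((m n)%:R / 'C(n, 2)%:R)) ^+ j).
    by apply/funext => n; rewrite exprS.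
  by rewrite exprS; apply: cvgM => //; exact: cvg_edge_density.
elim: K => [|K IH].
  by rewrite big_ord0; apply: cvg_near_cst; near=> n; rewrite big_ord0.
rewrite big_ord_recr /=.
have -> : (fun n => \sum_(k < K.+1) c k * (n%:R * ((m n)%:R / 'C(n, 2)%:R)) ^+ k.+1 : R) =
   (fun n => \sum_(k < K) c k * (n%:R * ((m n)%:R / 'C(n, 2)%:R)) ^+ k.+1 +
      c K * (n%:R * ((m n)%:R / 'C(n, 2)%:R)) ^+ K.+1).
  by apply/funext => n; rewrite big_ord_recr.
by apply: cvgD => //; apply: cvgM; [exact: cvg_cst|exact: pw].
Unshelve. all: by end_near. Qed.

(** Markov's inequality: the mean is at most [S n], which converges, while the threshold is linear
    in [n]. *)
Lemma freq_dense K (d : R) : 0 < d ->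
  (fun n => freq R (m n) (fun E : {set {set 'I_n}} => d * n%:R <= #|dense_sets K E|%:R)) @ \oo --> (0 : R).
Proof.
move=> d0.
pose c k : R := (2 ^ (k.+1 * k.+1))%N%:R.
pose S n : R := \sum_(k < K) c k * (n%:R * ((m n)%:R / 'C(n, 2)%:R)) ^+ k.+1.
have cS : S @ \oo --> (\sum_(k < K) c k * (2 * l) ^+ k.+1 : R) by exact: cvg_density_sum.
have cB : (fun n => S n * (n%:R^-1 * d^-1)) @ \oo --> (0 : R).
  have -> : 0 = (\sum_(k < K) c k * (2 * l) ^+ k.+1) * (0 * d^-1) :> R by rewrite mul0r mulr0.
  by apply: cvgM => //; apply: cvgM; [exact: cvg_invn|exact: cvg_cst].
apply: (squeeze_cvgr _ (cvg_cst (0 : R)) cB); near=> n.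
have n0 : 0 < n%:R :> R by rewrite ltr0n; near: n; exact: nbhs_infty_gt.
have O0 : (0 < #|edge_sets 'I_n (m n)|)%N by near: n; exact: near_Om.
have Km : (K <= m n)%N by near: n; exact: near_m_ge l0 ml _.
have N0 : (0 < 'C(n, 2))%N by rewrite bin_gt0; near: n; exact: nbhs_infty_ge.
apply/andP; split; first by rewrite /freq divr_ge0.
apply: le_trans (markov_freq _ _ (mulr_gt0 d0 n0)) _; first by move=> E; exact: ler0n.
rewrite invfM [d^-1 * _]mulrC ler_wpM2r // ?mulr_ge0 ?invr_ge0 ?(ltW d0) //.
have mN : (m n <= 'C(n, 2))%N by rewrite -bin_gt0 -card_Om.
rewrite card_Om in O0.
rewrite /mean card_Om ler_pdivrMr ?ltr0n // -natr_sum.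
have := @sum_card_dense_sets 'I_n (m n) K Km; rewrite card_ord -(ler_nat R) natr_sum => /le_trans; apply.
rewrite /S big_distrl /= natr_sum; apply: ler_sum => k _; have km : (k.+1 <= m n)%N by have := ltn_ord k; lia.
have := bin_dense_bound km mN; rewrite -(ler_nat R) !natrM !natrX => h.
have NN : 0 < 'C(n, 2)%:R ^+ k.+1 :> R by rewrite exprn_gt0 // ltr0n.
rewrite exprMn expr_div_n -/(c k).
have -> : c k * (n%:R ^+ k.+1 * ((m n)%:R ^+ k.+1 / 'C(n, 2)%:R ^+ k.+1)) * 'C('C(n, 2), m n)%:R =
    (n%:R ^+ k.+1 * c k) * ('C('C(n, 2), m n)%:R * (m n)%:R ^+ k.+1 / 'C(n, 2)%:R ^+ k.+1) by ring.
by rewrite /c natrX ler_wpM2l ?mulr_ge0 ?exprn_ge0 // ler_pdivlMr.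
Unshelve. all: by end_near. Qed.

End Concentration.

(** * The tree function *)

Section PowerSeries.
Variable R : realType.
Implicit Types (f : nat -> R) (r x : R).

(** Abel's criterion. Bounded terms at [r] give convergence at smaller radii, and the property
    survives termwise differentiation at any smaller radius. *)
Definition terms_bounded f r := exists C : R, forall n, `|f n| * r ^+ n <= C.

(** Each of the n + 1 powers up to q^n is at least q^n; compare their sum with the geometric
    series. *)
Lemma linear_geometric_le (q : R) n : 0 <= q -> q < 1 -> n.+1%:R * q ^+ n <= (1 - q)^-1.
Proof.
move=> q0 q1; have d0 : 0 < 1 - q by rewrite subr_gt0.
apply: le_trans (_ : \sum_(i < n.+1) q ^+ i <= _).
  rewrite mulr_natl -[X in _ *+ X]card_ord -sumr_const; apply: ler_sum => i _.
  by rewrite ler_wiXn2l // ?ltW // -ltnS.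
rewrite -[X in _ <= X]mul1r ler_pdivlMr // mulrC -opprB mulNr -subrX1 opprB lerBlDr lerDl.
exact: exprn_ge0.
Qed.

Lemma terms_bounded_diffs f r r' : 0 < r' -> r' < r -> terms_bounded f r ->
  terms_bounded (pseries_diffs f) r'.
Proof.
move=> r0 rr [C Cf]; have rp : 0 < r by exact: lt_trans rr.
exists (C * (r^-1 * (1 - r' / r)^-1)) => n; rewrite /pseries_diffs normrM normr_nat.
have -> : n.+1%:R * `|f n.+1| * r' ^+ n =
    (`|f n.+1| * r ^+ n.+1) * (r^-1 * (n.+1%:R * (r' / r) ^+ n)).
  rewrite expr_div_n exprS; field.
  by rewrite expf_neq0 gt_eqF.
apply: ler_pM => //.
- by rewrite mulr_ge0 // exprn_ge0 // ltW.
- by rewrite !mulr_ge0 ?invr_ge0 ?exprn_ge0 ?divr_ge0 ?ltW.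
rewrite ler_pM2l ?invr_gt0 //; apply: linear_geometric_le; first by rewrite divr_ge0 ?ltW.
by rewrite ltr_pdivrMr // mul1r.
Qed.

Lemma cvg_terms_bounded f r x : `|x| < r -> terms_bounded f r -> cvgn (pseries f x).
Proof.
move=> xr [C Cf]; have rp : 0 < r by exact: le_lt_trans xr.
apply: normed_cvg; apply: (@series_le_cvg _ _ (geometric C (`|x| / r))).
- by move=> n; exact: normr_ge0.
- move=> n; rewrite /geometric /= mulr_ge0 ?exprn_ge0 ?divr_ge0 ?(ltW rp) //.
  by apply: le_trans (Cf 0%N); rewrite expr0 mulr1.
- move=> n; rewrite /geometric /= normrM normrX expr_div_n mulrA ler_pdivlMr ?exprn_gt0 //.
  by rewrite mulrAC ler_wpM2r ?exprn_ge0.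
apply: is_cvg_geometric_series; rewrite normrM normr_id normfV (gtr0_norm rp).
by rewrite ltr_pdivrMr // mul1r.
Qed.

Variable rho : R.

Definition analytic f := forall r, 0 < r -> r < rho -> terms_bounded f r.

Lemma analytic_diffs f : analytic f -> analytic (pseries_diffs f).
Proof.
move=> af r r0 rr; apply: (@terms_bounded_diffs _ ((r + rho) / 2)) => //; first by lra.
by apply: af; lra.
Qed.

Lemma analytic_cvg f x : `|x| < rho -> analytic f -> cvgn (pseries f x).
Proof.
move=> xr af; apply: (@cvg_terms_bounded _ ((`|x| + rho) / 2)); first by lra.
by apply: af; have := normr_ge0 x; lra.
Qed.

Lemma analytic_derive f x : `|x| < rho -> analytic f ->
  is_derive x 1 (fun y => limn (pseries f y)) (limn (pseries (pseries_diffs f) x)).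
Proof.
move=> xr af; have x0 := normr_ge0 x.
have K0 : `|(`|x| + rho) / 2| = (`|x| + rho) / 2 by rewrite ger0_norm //; lra.
have Kr : `|(`|x| + rho) / 2| < rho by rewrite K0; lra.
apply: (@pseries_snd_diffs _ _ ((`|x| + rho) / 2)); last by rewrite K0; lra.
- exact: analytic_cvg.
- by apply: analytic_cvg => //; exact: analytic_diffs.
- by apply: analytic_cvg => //; do 2!apply: analytic_diffs.
Qed.

End PowerSeries.

Section TreeFunction.
Variable R : realType.
Implicit Types (x : R).

(** Exponential generating function of labelled trees, with its two derivatives. It has no constant
    term because [forests 0 1] is 0. The tree function is [x * tree_series1 x]. *)
Definition tcoef r : R := (forests r 1)%:R / (r`!)%:R.
Definition rho : R := expR (- 1).
Definition tree_series x : R := limn (pseries tcoef x).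
Definition tree_series1 x : R := limn (pseries (pseries_diffs tcoef) x).
Definition tree_series2 x : R := limn (pseries (pseries_diffs (pseries_diffs tcoef)) x).

Lemma forests1 r : (0 < r)%N -> forests r 1 = (r ^ (r - 2))%N.
Proof.
case: r => // -[|r] _; first by apply/eqP; rewrite -(eqn_pmul2r (ltn0Sn 0)) forestsE.
apply/eqP; rewrite -(eqn_pmul2r (ltn0Sn r.+1)) forestsE // mul1n -expnSr.
by apply/eqP; congr (_ ^ _)%N; lia.
Qed.

Lemma rho_gt0 : 0 < rho. Proof. exact: expR_gt0. Qed.

Lemma tcoef_ge0 r : 0 <= tcoef r. Proof. by rewrite divr_ge0. Qed.

(** n^n / n! is one term of the exponential series of e^n. *)
Lemma tcoef_bounded : terms_bounded tcoef rho.
Proof.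
exists 1 => n; rewrite ger0_norm ?tcoef_ge0 // /rho -expRM_natl mulrN1 expRN.
rewrite ler_pdivrMr ?expR_gt0 // mul1r; case: n => [|n].
  by rewrite /tcoef mul0r expR_ge0.
apply: le_trans (_ : 1 + n.+1%:R ^+ n.+1 / (n.+1)`!%:R <= _); last by exact: expR_ge1Dxn.
apply: le_trans (_ : n.+1%:R ^+ n.+1 / (n.+1)`!%:R <= _); last by rewrite lerDr.
rewrite ler_wpM2r ?invr_ge0 // -natrX ler_nat forests1 // leq_pexp2l //.
by lia.
Qed.

Lemma tcoef_analytic : analytic rho tcoef.
Proof.
move=> r r0 rr; have [C CP] := tcoef_bounded; exists C => n; apply: le_trans (CP n).
by rewrite ler_wpM2l // lerXn2r ?nnegrE ?ltW // rho_gt0.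
Qed.

Lemma F_derive x : `|x| < rho -> is_derive x 1 tree_series (tree_series1 x).
Proof. by move=> xr; apply: analytic_derive xr tcoef_analytic. Qed.

Lemma S_derive x : `|x| < rho -> is_derive x 1 tree_series1 (tree_series2 x).
Proof. by move=> xr; apply: analytic_derive xr (analytic_diffs tcoef_analytic). Qed.

Local Notation a r := (r%:R * tcoef r).

Lemma tcoefS r : a r.+1 = (forests r.+1 1)%:R / (r`!)%:R :> R.
Proof.
rewrite /tcoef factS natrM; field.
by rewrite pnatr_eq0 -lt0n fact_gt0 nat1r pnatr_eq0.
Qed.

(** Coefficients of T^2 = 2 (T - F). A pair of rooted trees is a forest with two given roots, by
    [forests_split], and Cayley's formula compares two roots with one. *)
Lemma tcoef_convolution n : \sum_(i < n.+1) a i * a (n - i)%N = 2 * (a n - tcoef n) :> R.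
Proof.
have b0 : tcoef 0 = 0 :> R by rewrite /tcoef mul0r.
case: n => [|[|p]].
- by rewrite big_ord_recl big_ord0 /= b0 !mul0r; ring.
- by rewrite !big_ord_recl big_ord0 /= !mul0r ; ring.
rewrite big_ord_recl big_ord_recr /= subnn !mul0r mulr0 add0r addr0.
have step (j : 'I_p.+1) : true -> a (bump 0 j) * a (p.+2 - bump 0 j)%N =
    (p`!)%:R^-1 * ('C(p, j) * (forests (1 + j) 1 * forests (1 + (p - j)) 1))%N%:R :> R.
  move=> _; have jp : (j <= p)%N by rewrite -ltnS.
  rewrite /bump add1n !natrM -[in RHS](bin_fact jp) !natrM.
  have -> : (p.+2 - j.+1 = (p - j).+1)%N by lia.
  rewrite !tcoefS !add1n; field.
  by rewrite !pnatr_eq0 -!lt0n !fact_gt0 bin_gt0 jp.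
rewrite (eq_bigr _ step) -big_distrr /= -natr_sum forests_split.
have e2 := @forestsE p.+2 2 isT; have e1 := @forests1 p.+2 isT; rewrite subSS subSS subn0 in e2 e1.
have e3 : (forests p.+2 2)%:R = 2 * (forests p.+2 1)%:R / p.+2%:R :> R.
  apply/eqP; rewrite eq_sym; apply/eqP; rewrite -natrM e1 -e2 natrM mulfK ?pnatr_eq0 //.
have -> : (1 + 1 + p = p.+2)%N by [].
rewrite e3 /tcoef !factS !natrM.
have f0 : (p`!)%:R != 0 :> R by rewrite pnatr_eq0 -lt0n fact_gt0.
have p1 : (p.+1)%:R != 0 :> R by rewrite pnatr_eq0.
have p2 : (p.+2)%:R != 0 :> R by rewrite pnatr_eq0.
have p12 : p.+2%:R = p.+1%:R + 1 :> R by rewrite natr1.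
move: f0 p1 p2; rewrite p12; move: (p`!)%:R (p.+1%:R) ((forests p.+2 1)%:R) => u v w f0 p1 p2.
by field; rewrite f0 p1 p2.
Qed.

Lemma sum_triangle (G : nat -> nat -> R) N :
  \sum_(n < N) \sum_(i < n.+1) G i (n - i)%N = \sum_(i < N) \sum_(j < N - i) G i j.
Proof.
elim: N => [|N IH]; first by rewrite !big_ord0.
rewrite big_ord_recr /= IH.
transitivity (\sum_(i < N.+1) (\sum_(j < N - i) G i j + G i (N - i)%N)).
  by rewrite big_split /=; congr (_ + _); rewrite big_ord_recr /= subnn big_ord0 addr0.
apply: eq_bigr => i _; rewrite subSn; last by rewrite -ltnS.
by rewrite big_ord_recr.
Qed.

Local Notation T x := (x * tree_series1 x).

Lemma sum_T x N : \sum_(i < N.+1) a i * x ^+ i = x * pseries (pseries_diffs tcoef) x N :> R.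
Proof.
rewrite big_ord_recl /= !mul0r add0r /pseries /series /= big_mkord big_distrr /=; apply: eq_bigr => i _.
by rewrite /bump add1n /pseries_diffs exprS; ring.
Qed.

Lemma cvg_sum_T x : `|x| < rho -> (fun N => \sum_(i < N.+1) a i * x ^+ i : R) @ \oo --> T x.
Proof.
move=> xr; have -> : (fun N => \sum_(i < N.+1) a i * x ^+ i : R) = (fun N => x * pseries (pseries_diffs tcoef) x N).
  by apply/funext => N; rewrite sum_T.
apply: cvgM; first exact: cvg_cst.
exact: analytic_cvg xr (analytic_diffs tcoef_analytic).
Qed.

Lemma cvg_sum_F x : `|x| < rho -> (fun N => \sum_(i < N.+1) tcoef i * x ^+ i : R) @ \oo --> tree_series x.
Proof.
move=> xr; have := analytic_cvg xr tcoef_analytic; rewrite -cvg_shiftS.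
by rewrite /pseries /series /=; under eq_fun do rewrite big_mkord.
Qed.

(** Cauchy product of nonnegative terms: the triangular sum up to [N] is at most the square sum,
    which is at most the triangular sum up to [2 * N + 1]. *)
Lemma F_T x : 0 <= x -> x < rho -> tree_series x = T x - T x ^+ 2 / 2.
Proof.
move=> x0 xr; have ax : `|x| < rho by rewrite ger0_norm.
pose u i : R := a i * x ^+ i.
have u0 i : 0 <= u i by rewrite /u !mulr_ge0 ?tcoef_ge0 ?exprn_ge0.
pose A N := \sum_(i < N.+1) u i; pose B N := \sum_(i < N.+1) tcoef i * x ^+ i.
pose P N := \sum_(n < N.+1) \sum_(i < n.+1) u i * u (n - i)%N.
have PE N : P N = 2 * (A N - B N).
  rewrite /P /A /B -sumrB big_distrr /=; apply: eq_bigr => n _.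
  transitivity ((\sum_(i < n.+1) a i * a (n - i)%N) * x ^+ n).
    rewrite big_distrl /=; apply: eq_bigr => i _; rewrite /u mulrACA -exprD subnKC //.
    by rewrite -ltnS.
  by rewrite tcoef_convolution /u; ring.
have cA : A @ \oo --> T x by exact: cvg_sum_T.
have cB : B @ \oo --> tree_series x by exact: cvg_sum_F.
have cP : P @ \oo --> 2 * (T x - tree_series x).
  have -> : P = (fun N => 2 * (A N - B N)) by apply/funext.
  by apply: cvgM; [exact: cvg_cst|exact: cvgB].
have cAA : (fun N => A N * A N) @ \oo --> T x * T x by exact: cvgM.
have up N : P N <= A N * A N.
  rewrite /P (sum_triangle (fun i j => u i * u j)) /A big_distrlr /=; apply: ler_sum => i _.
  rewrite (big_ord_widen _ (fun j => u i * u j) (leq_subr i N.+1)) big_mkcond /=.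
  by apply: ler_sum => j _; case: ifP => // _; rewrite mulr_ge0.
have lo N : A N * A N <= P (N + N)%N.+1.
  rewrite /P (sum_triangle (fun i j => u i * u j)) /A big_distrlr /=.
  have le1 : (N.+1 <= (N + N).+2)%N by lia.
  rewrite (big_ord_widen _ (fun i => \sum_(j < N.+1) u i * u j) le1) big_mkcond /=.
  apply: ler_sum => i _; case: ifP => iN; last by apply: sumr_ge0 => j _; rewrite mulr_ge0.
  have le2 : (N.+1 <= (N + N).+2 - i)%N by lia.
  rewrite (big_ord_widen _ (fun j => u i * u j) le2) big_mkcond /=.
  by apply: ler_sum => j _; case: ifP => // _; rewrite mulr_ge0.
have cP2 : (fun N => P (N + N)%N.+1) @ \oo --> 2 * (T x - tree_series x).
  apply: (@cvg_comp _ _ _ (fun N => (N + N)%N.+1) P) cP.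
  move=> Q [N _ NQ]; exists N => // k /= Nk; apply: NQ => /=; lia.
have h1 : 2 * (T x - tree_series x) <= T x * T x.
  have := ler_cvg_to cP cAA; apply; exact: nearW.
have h2 : T x * T x <= 2 * (T x - tree_series x).
  have := ler_cvg_to cAA cP2; apply; exact: nearW.
have h : T x * T x = 2 * (T x - tree_series x) by apply/eqP; rewrite eq_le h1 h2.
by rewrite expr2 h; field.
Qed.

Lemma T_derive x : `|x| < rho -> is_derive x 1 (fun y => T y) (tree_series1 x + x * tree_series2 x).
Proof.
move=> xr; have dS := S_derive xr.
apply: is_derive_eq (is_deriveM (is_derive_id x 1) dS) _.
by rewrite /GRing.scale /= mulr1 addrC.
Qed.

(** Differentiate F = T - T^2 / 2 and use F' = T / x. *)
Lemma S1E x : 0 < x -> x < rho -> tree_series2 x = tree_series1 x * (tree_series1 x + x * tree_series2 x).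
Proof.
move=> x0 xr; have ax : `|x| < rho by rewrite gtr0_norm.
have dT := T_derive ax.
have d1 : is_derive x 1 (fun y => T y - T y ^+ 2 / 2) ((tree_series1 x + x * tree_series2 x) * (1 - T x)).
  have d2 := is_deriveB dT (is_deriveZ 2^-1 (is_deriveM dT dT)).
  have -> : (fun y => T y - T y ^+ 2 / 2) = (fun y => T y) - 2^-1 \*: ((fun y => T y) * (fun y => T y)).
    by apply/funext => y; rewrite -[RHS]/(T y - 2^-1 * (T y * T y)); field.
  by apply: is_derive_eq d2 _; rewrite /GRing.scale /=; field.
have nearF : \forall y \near x, T y - T y ^+ 2 / 2 = tree_series y.
  near=> y; rewrite F_T //.
    by rewrite ltW //; near: y; exact: lt_nbhsr.
  by near: y; exact: lt_nbhsl.
have d3 := near_eq_is_derive nearF d1.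
have e : tree_series1 x = (tree_series1 x + x * tree_series2 x) * (1 - T x).
  by rewrite -(@derive_val _ _ _ _ _ _ _ d3) (@derive_val _ _ _ _ _ _ _ (F_derive ax)).
have xn : x != 0 by rewrite gt_eqF.
apply: (mulfI xn); move: e; set s := tree_series1 x; set t := tree_series2 x => e.
have : s + x * t - s = x * s * (s + x * t) by rewrite {2}e; ring.
by move=> h; transitivity (s + x * t - s); [ring|rewrite h; ring].
Unshelve. all: by end_near. Qed.

(** By [S1E] the product F' e^(-T) has derivative 0, and at the origin it equals the first
    coefficient, which is 1. *)
Lemma T_exp x : 0 <= x -> x < rho -> T x * expR (- T x) = x.
Proof.
move=> x0 xr; suff e : tree_series1 x * expR (- T x) = 1 by rewrite -mulrA e mulr1.
pose H y : R := tree_series1 y * expR (- T y).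
have dH (y : R) : `|y| < rho -> is_derive y 1 H ((tree_series2 y - tree_series1 y * (tree_series1 y + y * tree_series2 y)) * expR (- T y)).
  move=> yr; have dT := T_derive yr; have dS := S_derive yr.
  have dE : is_derive y 1 (expR \o (fun z => - T z)) (expR (- T y) * - (tree_series1 y + y * tree_series2 y)).
    by apply: is_derive1_comp; exact: is_deriveN.
  apply: is_derive_eq (is_deriveM dS dE) _.
  by rewrite /GRing.scale /=; ring.
have H0 : H 0 = 1.
  rewrite /H mul0r oppr0 expR0 mulr1 /tree_series1; apply/cvg_lim => //; rewrite -cvg_shiftS.
  apply: cvg_near_cst; near=> n.
  rewrite /pseries /series /= big_nat_recl //= expr0 mulr1 big1_seq ?addr0.
    by rewrite /pseries_diffs tcoefS forests1 // fact0 divr1.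
  by move=> i _; rewrite exprS mul0r mulr0.
have [->|xn0] := eqVneq x 0; first exact: H0.
have xp : 0 < x by rewrite lt_neqAle eq_sym xn0.
have [] := @MVT R H (fun=> 0) 0 x xp.
- move=> y; rewrite in_itv /= => /andP[y0 yx]; have yr := lt_trans yx xr.
  apply: is_derive_eq (dH y _) _; first by rewrite gtr0_norm.
  by rewrite {1}(S1E y0 yr) subrr mul0r.
- apply: derivable_within_continuous => y; rewrite in_itv /= => /andP[y0 yx].
  have [] := dH y; last by [].
  by rewrite ger0_norm // (le_lt_trans yx).
by move=> y _ /eqP; rewrite mul0r subr_eq0 H0 => /eqP.
Unshelve. all: by end_near. Qed.

Lemma T_ge0 x : 0 <= x -> x < rho -> 0 <= T x.
Proof.
move=> x0 xr; have := T_exp x0 xr => e.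
by rewrite -(pmulr_lge0 (T x) (expR_gt0 (- T x))) e.
Qed.

(** T is continuous and vanishes at 0. If it took the value 1 at some y, then T e^(-T) = y would
    give y = [rho], outside the open interval. *)
Lemma T_lt1 x : 0 <= x -> x < rho -> T x < 1.
Proof.
move=> x0 xr; rewrite ltNge; apply/negP => T1.
have [] := @IVT R (fun y => T y) 0 x 1 x0.
- apply: derivable_within_continuous => y; rewrite in_itv /= => /andP[y0 yx].
  have [] := @T_derive y; last by [].
  by rewrite ger0_norm // (le_lt_trans yx).
- by rewrite mul0r minEle maxEle (le_trans ler01 T1) ler01.
move=> y; rewrite in_itv /= => /andP[y0 yx] Ty.
have := T_exp y0 (le_lt_trans yx xr); rewrite Ty mul1r => yE.
by have := le_lt_trans yx xr; rewrite -yE ltxx.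
Qed.

End TreeFunction.

(** * The function mu *)

Section Mu.
Variable R : realType.
Implicit Types (l c : R).

Local Notation X l := (2 * l * expR (- (2 * l))).
Local Notation T x := (x * tree_series1 x).

Lemma muE l : mu l = (4 * l ^+ 2)^-1 * tree_series (X l) + 2^-1 * (1 - l^-1).
Proof.
rewrite /mu /tree_series; set f := (fun N : nat => _); suff -> : f = pseries (@tcoef R) (X l) by [].
apply/funext => N; rewrite /f /pseries /series /=; case: N => [|N]; first by rewrite !big_geq.
rewrite [RHS]big_ltn // /tcoef mul0r mul0r add0r; apply: eq_big_nat => r /andP[r0 _].
by rewrite forests1.
Qed.

Lemma X_bounds l : 2^-1 < l -> 0 < X l /\ X l < @rho R.
Proof.
move=> hl; have l0 : 0 < 2 * l by lra.
split; first by rewrite mulr_gt0 // expR_gt0.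
have n0 : 2 * l - 1 != 0 by rewrite gt_eqF // subr_gt0; lra.
have := expR_gt1Dx n0; rewrite addrC subrK => h.
move: (2 * l) h => c h.
by rewrite /rho -(ltr_pM2r (expR_gt0 c)) -mulrA -!expRD addNr expR0 mulr1 [- 1 + c]addrC.
Qed.

Lemma mu_T l : 2^-1 < l ->
  mu l = ((2 * l - 1) ^+ 2 - (1 - T (X l)) ^+ 2) / (2 * (2 * l) ^+ 2).
Proof.
move=> hl; have [x0 xr] := X_bounds hl; rewrite muE F_T ?(ltW x0) //.
have l0 : l != 0 by rewrite gt_eqF //; lra.
by move: (T (X l)) => t; field.
Qed.

Lemma T_X_exp l : 2^-1 < l -> T (X l) * expR (- T (X l)) = 2 * l * expR (- (2 * l)).
Proof. by move=> hl; have [x0 xr] := X_bounds hl; rewrite T_exp // ltW. Qed.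

Lemma mul_exp_homo (s t : R) : s <= t -> t <= 1 -> 0 <= s -> s * expR (- s) <= t * expR (- t).
Proof.
move=> st t1 s0; have t0 := le_trans s0 st.
have -> : - t = - s + - (t - s) by ring.
rewrite expRD mulrCA [s * _]mulrC ler_pM2l ?expR_gt0 //.
apply: le_trans (ler_wpM2l t0 (expR_ge1Dx (- (t - s)))).
by nra.
Qed.

(** The difference of the two sides vanishes at 0 and has derivative y (e^y - e^(-y)). *)
Lemma exp_asym (u : R) : 0 < u -> (1 - u) * expR u < (1 + u) * expR (- u).
Proof.
move=> u0; rewrite -subr_gt0.
pose k y : R := (1 + y) * expR (- y) - (1 - y) * expR y.
have dk (y : R) : is_derive y 1 k (y * (expR y - expR (- y))).
  have dN : is_derive y 1 (expR \o (-%R : R -> R)) (expR (- y) * - 1).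
    by apply: is_derive1_comp; exact: is_deriveNid.
  have d1 := is_deriveM (is_deriveD (is_derive_cst (1 : R) y 1) (is_derive_id y 1)) dN.
  have d2 := is_deriveM (is_deriveB (is_derive_cst (1 : R) y 1) (is_derive_id y 1)) (is_derive_expR y).
  apply: is_derive_eq (is_deriveB d1 d2) _.
  rewrite -[(cst 1 + id) y]/(1 + y) -[(cst 1 - id) y]/(1 - y) -[(expR \o -%R) y]/(expR (- y)).
  by rewrite /GRing.scale /=; ring.
have [] := @MVT R k (fun y => y * (expR y - expR (- y))) 0 u u0.
  by apply: derivable_within_continuous => y _; have [] := dk y.
move=> y; rewrite in_itv /= => /andP[y0 yu]; rewrite {2}/k addr0 subr0 oppr0 subrr subr0 -/(k u) => ->.
by apply: mulr_gt0; [apply: mulr_gt0 => //; rewrite subr_gt0 ltr_expR|]; lra.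
Qed.

(** T and c = 2 l give the same value of s e^(-s) on the two sides of its maximum at s = 1. This
    function decreases more slowly on the right, so T is nearer to 1 than c: for c = 1 + u, having T
    <= 1 - u contradicts [exp_asym]. Positivity of [mu] is equivalent to this. *)
Lemma T_X_gt l : 2^-1 < l -> 2 - 2 * l < T (X l).
Proof.
move=> hl; have [x0 xr] := X_bounds hl; have T0 := T_ge0 (ltW x0) xr.
rewrite ltNge; apply/negP => Tl.
have [u lE] : exists u, 2 * l = 1 + u by exists (2 * l - 1); ring.
have u0 : 0 < u by lra.
have h := exp_asym u0.
have := mul_exp_homo Tl _ T0; rewrite T_X_exp // => /(_ ltac:(lra)).
rewrite lE; have -> : 2 - (1 + u) = 1 - u by ring.
have -> : - (1 + u) = - 1 + - u by ring.
have -> : - (1 - u) = - 1 + u by ring.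
by rewrite !expRD ![_ * (expR (- 1) * _)]mulrCA ler_pM2l ?expR_gt0 // leNgt h.
Qed.

Lemma mu_gt0 l : 2^-1 < l -> 0 < mu l.
Proof.
move=> hl; have [x0 xr] := X_bounds hl; have T1 := T_lt1 (ltW x0) xr; have Tg := T_X_gt hl.
rewrite mu_T // divr_gt0 //; last by rewrite mulr_gt0 // exprn_gt0 //; lra.
by move: (T (X l)) T1 Tg => t T1 Tg; nra.
Qed.

(** Drop the square of 1 - T and bound the denominator below by 1. This gives the limit at 1/2. *)
Lemma mu_le l : 2^-1 < l -> mu l <= (2 * l - 1) ^+ 2.
Proof.
move=> hl; rewrite mu_T // ler_pdivrMr; last by rewrite mulr_gt0 // exprn_gt0 //; lra.
have := sqr_ge0 (1 - T (X l)); move: ((1 - T (X l)) ^+ 2) => t t0.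
have h : 1 <= 2 * (2 * l) ^+ 2 by nra.
have := sqr_ge0 (2 * l - 1); move: ((2 * l - 1) ^+ 2) (2 * (2 * l) ^+ 2) h => a b h a0; nra.
Qed.

Lemma mu_derive l : 2^-1 < l -> is_derive l 1 (@mu R)
  ((2 * l - T (X l)) * (1 - T (X l)) / (4 * l ^+ 3)).
Proof.
move=> hl; have [x0 xr] := X_bounds hl; have l0 : l != 0 by rewrite gt_eqF //; lra.
have ax : `|X l| < @rho R by rewrite gtr0_norm.
have d2 : is_derive l 1 (fun y : R => 2 * y) 2.
  by apply: is_derive_eq (is_deriveZ (2 : R) (is_derive_id l (1 : R))) _; rewrite /GRing.scale /= mulr1.
have dE : is_derive l 1 (expR \o (fun y : R => - (2 * y))) (expR (- (2 * l)) * - 2).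
  by apply: is_derive1_comp; exact: is_deriveN.
have dX : is_derive l 1 (fun y : R => X y) (2 * expR (- (2 * l)) * (1 - 2 * l)).
  by apply: is_derive_eq (is_deriveM d2 dE) _; rewrite /GRing.scale /=; ring.
have dF : is_derive l 1 (@tree_series R \o (fun y : R => X y)) (tree_series1 (X l) * (2 * expR (- (2 * l)) * (1 - 2 * l))).
  by apply: is_derive1_comp; exact: F_derive.
have dV : is_derive l 1 (fun y : R => y^-1) (- l ^- 2).
  by apply: is_derive_eq (is_deriveV l0 (is_derive_id l (1 : R))) _; rewrite /GRing.scale /= mulr1.
have dVV : is_derive l 1 (fun y : R => (4 * y ^+ 2)^-1) (- (2 * l^-1) * (4 * l ^+ 2)^-1).
  have -> : (fun y : R => (4 * y ^+ 2)^-1) = 4^-1 \*: ((fun y : R => y^-1) * (fun y : R => y^-1)).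
    by apply/funext => y; rewrite -[RHS]/(4^-1 * (y^-1 * y^-1)) -invfM -invfM expr2.
  apply: is_derive_eq (is_deriveZ (4^-1 : R) (is_deriveM dV dV)) _.
  by rewrite /GRing.scale /=; field.
have dm := is_deriveD (is_deriveM dVV dF) (is_deriveZ (2^-1 : R) (is_deriveB (is_derive_cst (1 : R) l 1) dV)).
have -> : @mu R = (fun y : R => (4 * y ^+ 2)^-1) * (@tree_series R \o (fun y : R => X y)) +
    2^-1 \*: (cst (1 : R) - (fun y : R => y^-1)) by apply/funext => y; rewrite muE.
apply: is_derive_eq dm _; rewrite /GRing.scale /= F_T ?(ltW x0) //.
(* Trades the exponential for [X l], so that the derivative of the series turns into T. *)
have TE : expR (- (2 * l)) = X l / (2 * l) by rewrite mulrAC divff ?mul1r // mulf_neq0.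
have -> : tree_series1 (X l) * (2 * expR (- (2 * l)) * (1 - 2 * l)) = T (X l) * (1 - 2 * l) / l.
  by rewrite {2}TE; field.
by move: (T (X l)) => t; field.
Qed.

Lemma mu_increasing (l1 l2 : R) : 2^-1 < l1 -> l1 < l2 -> mu l1 < mu l2.
Proof.
move=> h1 h12; rewrite -subr_gt0.
have [] := @MVT R (@mu R) (fun l => (2 * l - T (X l)) * (1 - T (X l)) / (4 * l ^+ 3)) l1 l2 h12.
- by move=> l; rewrite in_itv /= => /andP[h _]; apply: mu_derive; exact: lt_trans h.
- apply: derivable_within_continuous => l; rewrite in_itv /= => /andP[h _].
  by have [] := mu_derive (lt_le_trans h1 h).
move=> l; rewrite in_itv /= => /andP[hl _] ->; have {}hl := lt_trans h1 hl.
have [x0 xr] := X_bounds hl; have T1 := T_lt1 (ltW x0) xr.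
rewrite mulr_gt0 ?subr_gt0 // divr_gt0 //; last by rewrite mulr_gt0 // exprn_gt0 //; lra.
by rewrite mulr_gt0 // subr_gt0 //; apply: lt_trans T1 _; lra.
Qed.

Lemma mu_continuous : {within `](2^-1 : R), +oo[, continuous (@mu R)}.
Proof.
apply: derivable_within_continuous => l; rewrite in_itv /= andbT => hl.
by have [] := mu_derive hl.
Qed.

Lemma mu_cvg_half : mu l @[l --> (2^-1 : R)^'+] --> (0 : R).
Proof.
apply/cvgrPdist_le => e e0; near=> l; have hl : 2^-1 < l by near: l; exact: nbhs_right_gt.
rewrite sub0r normrN gtr0_norm ?mu_gt0 //; apply: le_trans (mu_le hl) _.
have h1 : l < 1 by near: l; apply: nbhs_right_lt; lra.
have h2 : l < 2^-1 + e / 2 by near: l; apply: nbhs_right_lt; rewrite ltrDl divr_gt0.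
by nra.
Unshelve. all: by end_near. Qed.

Lemma mu_cvg_pinfty : mu l @[l --> +oo] --> (2^-1 : R).
Proof.
apply/cvgrPdist_le => e e0; near=> l.
have h1 : 1 <= l by near: l; exact: nbhs_pinfty_ge.
have h2 : (2 * e)^-1 <= l by near: l; apply: nbhs_pinfty_ge; exact: num_real.
have hl : 2^-1 < l by lra.
have [x0 xr] := X_bounds hl; have T1 := T_lt1 (ltW x0) xr; have T0 := T_ge0 (ltW x0) xr.
have l0 : 0 < l by lra.
have e1 : (2 * l)^-1 <= e.
  rewrite invfM ler_pdivrMr // in h2; rewrite -ler_pdivrMl // in h2.
  by rewrite invfM mulrC.
have q0 : 0 < (4 * l ^+ 2)^-1 by rewrite invr_gt0 mulr_gt0 // exprn_gt0.
have q1 : (4 * l ^+ 2)^-1 <= (2 * l)^-1 by rewrite lef_pV2 ?posrE ?mulr_gt0 ?exprn_gt0 //; nra.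
have e2 : 2^-1 * (1 - l^-1) = 2^-1 - (2 * l)^-1 by rewrite invfM; ring.
rewrite muE e2 F_T ?(ltW x0) //; move: (T (X l)) T0 T1 => t T0 T1.
move: (4 * l ^+ 2)^-1 (2 * l)^-1 q0 q1 e1 => p q q0 q1 e1.
have f0 : 0 <= t - t ^+ 2 / 2 by nra.
have f1 : t - t ^+ 2 / 2 <= 1 by nra.
by rewrite ler_norml; apply/andP; split; nra.
Unshelve. all: by end_near. Qed.

End Mu.

(** * The genus of a random graph *)

Section Genus.
Variables (R : realType) (n : nat) (E : {set {set 'I_n}}).
Hypothesis EP : E \subset pairs [set: 'I_n]%SET.

Let E2 e : e \in E -> #|e| = 2%N.
Proof. by move=> /(fintype.subsetP EP); rewrite inE => /andP[_ /eqP]. Qed.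

(** [#|E| + kappa E] handles meet the condition of [embeddable_cycle_rank], so a least number of
    handles exists. *)
Lemma genusP : embeddable E (@sphere_with_handles R (genus R E)) /\
  forall h, embeddable E (@sphere_with_handles R h) -> (genus R E <= h)%N.
Proof.
pose P g := `[< embeddable E (@sphere_with_handles R g) >].
have exP : exists g, P g.
  exists (#|E| + kappa E)%N; apply/asboolP; apply: embeddable_cycle_rank => //; lia.
have [g /asboolP Pg gmin] := ex_minnP exP.
apply: (@xgetPex _ 0%N [set g | embeddable E (@sphere_with_handles R g) /\
  forall h, embeddable E (@sphere_with_handles R h) -> (g <= h)%N]).
by exists g; split=> // h /asboolP; exact: gmin.
Qed.

(** The chord that needs no handle absorbs the remainder when an odd cycle rank is halved. *)
Lemma genus_upper : (2 * genus R E <= #|E| + kappa E - n)%N.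
Proof.
have [_ gmin] := genusP; set t := (#|E| + kappa E - n)%N.
have := gmin t./2; have := odd_double_half t; move: (t./2) => h th.
have hb : (#|E| + kappa E <= n + 2 * h + 1)%N by rewrite /t in th; lia.
by move=> /(_ (embeddable_cycle_rank R E2 hb)); lia.
Qed.

Lemma genus_lower K :
  ((#|E| + kappa E) * K <= (n + 2 * genus R E + 2 * #|dense_sets K E|) * K + 2 * #|E|)%N.
Proof.
have [emb _] := genusP.
have [I [J [C [h1 h2 h3 h4 h5]]]] := embeddable_even_sets E2 emb.
have := @card_even_family _ E EP _ J C K h1 h2 h3 h4.
by move: h5; move: #|J| #|E| (kappa E) #|dense_sets K E| (genus R E) => j e k d g; nia.
Qed.

End Genus.

Lemma graphsE n m : graphs n m = edge_sets 'I_n m.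
Proof.
apply/setP => E; rewrite !inE; congr (_ && _); apply/forallP/fintype.subsetP => [h e eE|h e].
  by rewrite inE finset.subsetT; have := h e; rewrite eE.
by apply/implyP => /h; rewrite inE => /andP[].
Qed.

Lemma tree_comps0 (T : finType) (E : {set {set T}}) : #|tree_comps E 0| = 0%N.
Proof.
apply/eqP; rewrite cards_eq0; apply/eqP/setP => S; rewrite !inE; apply/negP => /andP[/eqP c].
by case/tree_compP=> r rS; move: c => /eqP; rewrite cards_eq0 => /eqP S0; rewrite S0 inE in rS.
Qed.

Lemma sum_tree_density (R : realType) (l : R) N : 0 < l ->
  \sum_(s < N) tree_density l s =
  (\sum_(i < N.+1) tcoef R i * (2 * l * expR (- (2 * l))) ^+ i) / (2 * l).
Proof.
move=> l0; rewrite big_ord_recl /= {1}/tcoef mul0r mul0r add0r big_distrl /=; apply: eq_bigr => s _.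
have c0 : 2 * l != 0 by rewrite gt_eqF // mulr_gt0.
rewrite /tree_density /bump add1n /tcoef [(_ * expR _) ^+ s.+1]exprMn.
move: ((s.+1)`!%:R^-1) ((forests s.+1 1)%:R) (expR _ ^+ _) => a b e.
by rewrite [in RHS]exprS; move: (2 * l) c0 => c c0; move: (c ^+ s) => d; field.
Qed.

(** Real arithmetic of the conclusion: [k] is the number of components, [w] counts the short cycles
    and [q] bounds the long ones. The errors th/6, th/3, th/6, th/6 add up to less than [th]. The
    alternative [g = 0] is the case where the truncated subtraction in [genus_upper] yields 0. *)
Lemma genus_error (R : realType) (n m k A mu l g w q th eps : R) :
  0 < mu -> 2 * mu * l * n = l * n - n + A ->
  (1 + 2 * mu) * `|m - l * n| <= th / 6 -> `|k - A| <= th / 3 -> 2 * w <= th / 6 -> q <= th / 6 ->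
  0 <= m -> m + k <= n + 2 * g + 2 * w + q -> 2 * g <= m + k - n \/ g = 0 ->
  th <= 2 * (eps * (mu * m)) -> `|g - mu * m| <= eps * (mu * m).
Proof.
move=> mu0 muE h1 h2 h3 h4 m0 h5 h6 h7.
have e : 2 * (mu * m) = l * n - n + A + 2 * (mu * (m - l * n)) by rewrite -muE; ring.
have [D DE] : exists D, D = m - l * n by exists (m - l * n).
rewrite -DE in e h1.
have h1' : `|D| + 2 * `|mu * D| <= th / 6.
  by rewrite normrM (gtr0_norm mu0); move: h1; rewrite mulrDl mul1r mulrA.
have M0 : 0 <= mu * m by rewrite mulr_ge0 // ltW.
move: (mu * m) (mu * D) (eps * (mu * m)) e h1' h7 M0 => M N P e h1' h7 M0.
have [a1 a2] := (ler_norm D, ler_norm (- D)); rewrite normrN in a2.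
have [b1 b2] := (ler_norm N, ler_norm (- N)); rewrite normrN in b2.
move: h2; rewrite ler_norml => /andP[c1 c2].
move: `|D| `|N| a1 a2 b1 b2 h1' (normr_ge0 D) (normr_ge0 N) => d' n' a1 a2 b1 b2 h1' d0 n0.
rewrite ler_norml; apply/andP; case: h6 => h6; split; lra.
Qed.

Lemma cvg_sum0 (R : realType) N (u : 'I_N -> nat -> R) :
  (forall s, u s @ \oo --> (0 : R)) -> (fun n => \sum_(s < N) u s n) @ \oo --> (0 : R).
Proof.
elim: N u => [|N IH] u cu.
  by apply: cvg_near_cst; apply: nearW => n; rewrite big_ord0.
have -> : (fun n => \sum_(s < N.+1) u s n) =
    (fun n => \sum_(s < N) u (widen_ord (leqnSn N) s) n + u ord_max n).
  by apply/funext => n; rewrite big_ord_recr.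
have c1 := IH (fun s => u (widen_ord (leqnSn N) s)) (fun s => cu _).
by have := cvgD c1 (cu ord_max); rewrite addr0; exact.
Qed.

Lemma tree_count_error (R : realType) N (X : 'I_N -> R) (a : 'I_N -> R) (n d : R) :
  (forall s, `|X s - a s * n| <= d * n) ->
  `|\sum_(s < N) X s - (\sum_(s < N) a s) * n| <= N%:R * d * n.
Proof.
move=> h; rewrite big_distrl /= -sumrB; apply: le_trans (ler_norm_sum _ _ _) _.
apply: le_trans (ler_sum _ (fun s _ => h s)) _.
by rewrite sumr_const card_ord -mulrA mulr_natl.
Qed.

Lemma kappa_error (R : realType) (k SX W an An nN p q t : R) :
  `|SX - an| <= p -> W <= q -> p + q = t -> `|An - an| <= t -> nN <= t -> 0 <= q ->
  SX <= k -> k <= SX + W + nN -> `|k - An| <= 4 * t.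
Proof.
rewrite !ler_norml => /andP[a1 a2] h1 h2 /andP[b1 b2] h3 h4 h5 h6.
by apply/andP; split; lra.
Qed.

(** The deterministic part: a graph outside the bad events has the right genus. [N] bounds the size
    of the trees counted, [K] the length of the cycles treated as short. *)
Lemma genus_close (R : realType) (n N K : nat) (E : {set {set 'I_n}}) (l eps A a mu th d : R) :
  E \subset pairs [set: 'I_n]%SET -> (0 < N)%N -> (0 < K)%N -> (0 < n)%N -> 0 < l -> 0 < mu -> 0 <= d ->
  2 * mu * l = l - 1 + A -> `|A - a| <= th / 12 -> N%:R^-1 <= th / 12 -> 4 * l * K%:R^-1 <= th / 6 ->
  N%:R * d + d = th / 12 ->
  `|\sum_(s < N) #|tree_comps E s.+1|%:R - a * n%:R| <= N%:R * d * n%:R ->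
  #|dense_sets (N ^ 2) E|%:R <= d * n%:R -> #|dense_sets K E|%:R <= th / 12 * n%:R ->
  (1 + 2 * mu) * `|#|E|%:R - l * n%:R| <= th * n%:R / 6 -> #|E|%:R <= 2 * l * n%:R ->
  th * n%:R <= 2 * (eps * (mu * #|E|%:R)) ->
  `|(genus R E)%:R - mu * #|E|%:R| <= eps * (mu * #|E|%:R).
Proof.
move=> EP N0 K0 n0 l0 mu0 d0 muA NA NV KV dN dev gN gK mn ml2 ml1.
have nR : 0 < n%:R :> R by rewrite ltr0n.
have NR : 0 < N%:R :> R by rewrite ltr0n.
have KR : 0 < K%:R :> R by rewrite ltr0n.
have kl := kappa_ge EP N; have kh := kappa_le EP N.
have gl := genus_lower R EP K; have gu := genus_upper R EP.
have sumE : (\sum_(s < N.+1) #|tree_comps E s| = \sum_(s < N) #|tree_comps E s.+1|)%N.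
  by rewrite big_ord_recl tree_comps0 add0n.
rewrite sumE in kl kh; rewrite card_ord in kh.
rewrite -natr_sum in dev; set SX := (\sum_(s < N) _)%N in kl kh dev.
have klR : SX%:R <= (kappa E)%:R :> R by rewrite ler_nat.
have khR : (kappa E)%:R <= SX%:R + #|dense_sets (N ^ 2) E|%:R + n%:R * N%:R^-1 :> R.
  by rewrite -(ler_pM2r NR) mulrDl divfK ?gt_eqF // -natrD -!natrM -natrD ler_nat.
have kerr : `|(kappa E)%:R - A * n%:R| <= 4 * (th / 12 * n%:R).
  apply: (kappa_error dev gN _ _ _ _ klR khR).
  - by rewrite -mulrDl dN.
  - by rewrite -mulrBl normrM (gtr0_norm nR) ler_pM2r.
  - by rewrite mulrC ler_pM2r.
  - by rewrite mulr_ge0.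
apply: (@genus_error R n%:R #|E|%:R (kappa E)%:R (A * n%:R) mu l (genus R E)%:R
  #|dense_sets K E|%:R (2 * #|E|%:R / K%:R) (th * n%:R) eps) => //.
- by rewrite muA; ring.
- by apply: le_trans kerr _; lra.
- by lra.
- apply: le_trans (_ : 4 * l * K%:R^-1 * n%:R <= _).
    by rewrite [X in _ <= X]mulrAC ler_pM2r ?invr_gt0 //; lra.
  by rewrite -(ler_pM2r nR) in KV; lra.
- by rewrite -(ler_pM2r KR) [X in _ <= X]mulrDl divfK ?gt_eqF // -!natrM -!natrD -!natrM -natrD ler_nat.
have [le|lt] := leqP n (#|E| + kappa E).
  by left; move: gu; rewrite -(ler_nat R) natrB // natrD natrM.
right; move: gu; have -> : (#|E| + kappa E - n = 0)%N by apply/eqP; rewrite subn_eq0 ltnW.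
by rewrite leqn0 muln_eq0 /= => /eqP->.
Qed.

Lemma genus_whp (R : realType) (m : nat -> nat) (l eps : R) : 2^-1 < l -> 0 < eps ->
  (fun n => (m n)%:R * n%:R^-1) @ \oo --> l ->
  whp_gnm R m (fun n E => `|(genus R E)%:R - mu l * (m n)%:R| <= eps * (mu l * (m n)%:R)).
Proof.
move=> hl eps0 ml; have l0 : 0 < l by lra.
have mu0 := mu_gt0 hl.
set x := 2 * l * expR (- (2 * l)).
have [x0 xr] := X_bounds hl.
pose A : R := tree_series x / (2 * l).
(* Twice the genus may err by th n; since m >= l n / 2 eventually, this is at most 2 eps mu m. *)
pose th := eps * mu l * l; have th0 : 0 < th by rewrite !mulr_gt0.
have muA : 2 * mu l * l = l - 1 + A.
  rewrite muE /A -/x; have lz : l != 0 by rewrite gt_eqF.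
  by field.
have cA : (fun N => \sum_(s < N) tree_density l s) @ \oo --> A.
  have -> : (fun N => \sum_(s < N) tree_density l s) = (fun N =>
      (\sum_(i < N.+1) tcoef R i * x ^+ i) * (2 * l)^-1) by apply/funext => N; rewrite sum_tree_density.
  by apply: cvgM; [apply: cvg_sum_F; rewrite gtr0_norm|exact: cvg_cst].
have [N [N0 NA NV]] : exists N : nat, [/\ (0 < N)%N, `|A - \sum_(s < N) tree_density l s| <= th / 12
    & N%:R^-1 <= th / 12].
  have th12 : 0 < th / 12 by rewrite divr_gt0.
  near \oo => N; exists N; split.
  - by near: N; exact: nbhs_infty_gt.
  - by near: N; have /cvgrPdist_le := cA; exact.
  - have : `|0 - N%:R^-1| <= th / 12 by near: N; have /cvgrPdist_le := @cvg_invn R; exact.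
    by rewrite sub0r normrN ger0_norm // invr_ge0.
have [K [K0 KV]] : exists K : nat, (0 < K)%N /\ 4 * l * K%:R^-1 <= th / 6.
  have th12 : 0 < th / 6 / (4 * l) by rewrite !divr_gt0 // mulr_gt0.
  near \oo => K; exists K; split; first by near: K; exact: nbhs_infty_gt.
  have : `|0 - K%:R^-1| <= th / 6 / (4 * l) by near: K; have /cvgrPdist_le := @cvg_invn R; exact.
  by rewrite sub0r normrN ger0_norm ?invr_ge0 // ler_pdivlMr ?mulr_gt0 // mulrC.
(* Chosen so that the [N] tree counts and one dense set count together err by at most th n / 12. *)
pose d := th / (12 * N.+1%:R); have d0 : 0 < d by rewrite divr_gt0 // mulr_gt0.
pose d2 := th / 12; have d20 : 0 < d2 by rewrite divr_gt0.
pose Q1 n (E : {set {set 'I_n}}) :=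
  [exists s : 'I_N, d * n%:R <= `|#|tree_comps E s.+1|%:R - tree_density l s * n%:R|].
pose Q2 n (E : {set {set 'I_n}}) := d * n%:R <= #|dense_sets (N ^ 2) E|%:R :> R.
pose Q3 n (E : {set {set 'I_n}}) := d2 * n%:R <= #|dense_sets K E|%:R :> R.
pose bad n (E : {set {set 'I_n}}) := Q1 n E || (Q2 n E || Q3 n E).
have cbad : (fun n => freq R (m n) (@bad n)) @ \oo --> (0 : R).
  pose B n : R := (\sum_(s < N) freq R (m n) (fun E : {set {set 'I_n}} =>
      d * n%:R <= `|#|tree_comps E s.+1|%:R - tree_density l s * n%:R|)) +
    (freq R (m n) (Q2 n) + freq R (m n) (Q3 n)).
  have cB : B @ \oo --> (0 : R).
    have -> : 0 = 0 + (0 + 0) :> R by rewrite !addr0.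
    apply: cvgD; last by apply: cvgD; [exact: freq_dense l0 ml _ _ d0|exact: freq_dense l0 ml _ _ d20].
    by apply: cvg_sum0 => s; exact: freq_tree l0 ml _ _ d0.
  apply: (squeeze_cvgr _ (cvg_cst (0 : R)) cB); near=> n; apply/andP; split; first by rewrite /freq divr_ge0.
  apply: le_trans (@freq_or R _ (m n) (Q1 n) (fun E => Q2 n E || Q3 n E)) _.
  apply: lerD; first exact: (@freq_exists R _ (m n) _ (fun (s : 'I_N) (E : {set {set 'I_n}}) =>
      d * n%:R <= `|#|tree_comps E s.+1|%:R - tree_density l s * n%:R|)).
  exact: freq_or.
have cgood : (fun n => 1 - freq R (m n) (@bad n)) @ \oo --> (1 : R).
  by rewrite -[X in _ --> X]subr0; apply: cvgB => //; exact: cvg_cst.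
have t0 : 0 < th / 6 / (1 + 2 * mu l) by rewrite !divr_gt0 // addr_gt0 // mulr_gt0.
apply: (squeeze_cvgr _ cgood (cvg_cst (1 : R))); near=> n.
have n0 : 0 < n%:R :> R by rewrite ltr0n; near: n; exact: nbhs_infty_gt.
have Om0 : (0 < #|edge_sets 'I_n (m n)|)%N by near: n; exact: near_Om ml.
have mn : `|(m n)%:R - l * n%:R| <= th / 6 / (1 + 2 * mu l) * n%:R.
  have : `|l - (m n)%:R * n%:R^-1| <= th / 6 / (1 + 2 * mu l).
    by near: n; have /cvgrPdist_le := ml; exact.
  have -> : (m n)%:R - l * n%:R = - ((l - (m n)%:R / n%:R) * n%:R).
    by rewrite mulrBl divfK ?gt_eqF // opprB.
  by rewrite normrN normrM (gtr0_norm n0) ler_pM2r.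
have ml2 : (m n)%:R <= 2 * l * n%:R.
  have : (m n)%:R * n%:R^-1 < 2 * l by near: n; apply: (cvgr_lt l ml); lra.
  by rewrite ltr_pdivrMr // => /ltW.
have ml1 : l / 2 * n%:R <= (m n)%:R.
  have : l / 2 < (m n)%:R * n%:R^-1 by near: n; apply: (cvgr_gt l ml); lra.
  by rewrite ltr_pdivlMr // => /ltW.
rewrite /prob_gnm graphsE -/(freq R (m n) (fun E : {set {set 'I_n}} =>
  `[< `|(genus R E)%:R - mu l * (m n)%:R| <= eps * (mu l * (m n)%:R) >])).
apply/andP; split; last first.
  rewrite ler_pdivrMr ?ltr0n // mul1r ler_nat subset_leq_card //.
  by apply/fintype.subsetP => E; rewrite inE => /andP[].
rewrite lerBlDr -[X in X <= _](@mean_cst R 'I_n (m n) 1 Om0); apply: le_trans (@freq_or R _ (m n) _ _).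
rewrite freqE; apply: mean_le => E EO; rewrite (_ : _ || _ = true) //; apply/orP.
have [bE|good] := boolP (bad n E); [by right|left]; apply/asboolP.
move: EO; rewrite inE => /andP[EP /eqP Em].
move: good; rewrite /bad !negb_or => /andP[/existsPn gT /andP[gN gK]].
rewrite -Em; rewrite -Em in mn ml1 ml2.
apply: (@genus_close R n N K E l eps A (\sum_(s < N) tree_density l s) (mu l) th d) => //.
- by rewrite -(ltr_nat R).
- exact: ltW.
- rewrite /d -natr1; have N1 : N%:R + 1 != 0 :> R by rewrite gt_eqF // ltr_wpDl.
  by field.
- by apply: tree_count_error => s; have := gT s; rewrite -ltNge => /ltW.
- by rewrite ltW // ltNge.
- by rewrite ltW // ltNge.
- have p0 : 0 < 1 + 2 * mu l by rewrite addr_gt0 // mulr_gt0.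
  rewrite mulrC -ler_pdivlMr //; apply: le_trans mn _; rewrite le_eqVlt; apply/orP; left; apply/eqP.
  by field; rewrite gt_eqF.
- rewrite /th; have em := mulr_gt0 eps0 mu0; rewrite -mulrA.
  have -> : 2 * (eps * (mu l * #|E|%:R)) = eps * mu l * (2 * #|E|%:R) by ring.
  by rewrite ler_pM2l //; lra.
Unshelve. all: by end_near. Qed.

Theorem theorem1p2 (R : realType) :
  [/\ forall l : R, 2^-1 < l -> 0 < mu l,
      forall l1 l2 : R, 2^-1 < l1 -> l1 < l2 -> mu l1 < mu l2,
      {within `](2^-1 : R), +oo[, continuous (@mu R)},
      mu l @[l --> (2^-1 : R)^'+] --> (0 : R) &
      mu l @[l --> +oo] --> (2^-1 : R)] /\
  forall (l : R) (m : nat -> nat),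
    2^-1 < l ->
    asymp_equiv (fun n => (m n)%:R) (fun n => l * n%:R) ->
    forall eps : R, 0 < eps ->
      whp_gnm R m (fun n E =>
        `|(genus R E)%:R - mu l * (m n)%:R| <= eps * (mu l * (m n)%:R)).
Proof.
split; first by split; [exact: mu_gt0|exact: mu_increasing|exact: mu_continuous|
  exact: mu_cvg_half|exact: mu_cvg_pinfty].
move=> l m hl ml eps eps0; apply: genus_whp => //.
have l0 : l != 0 by rewrite gt_eqF //; lra.
have -> : (fun n => (m n)%:R * n%:R^-1) = (fun n => l * ((m n)%:R / (l * n%:R))).
  by apply/funext => n; rewrite invfM mulrCA mulVKf.
by rewrite -[X in _ --> X](mulr1 l); apply: cvgM; [exact: cvg_cst|exact: ml].
Qed.
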